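(* Let $X_t\subset\mathbb{P}^{15}$ ($t\neq0,1,\infty$) be the family of curves, $X_1$ and $X_\infty$ its flat limits as $t\to1$ and $t\to\infty$, and $P_{\mathrm{nod},t}$ the linear spaces, all defined in the context. (1) $X_1$ is the union of the limits of the irreducible components in $X_t$ as $t\to1$. It is a graph curve whose dual graph is $G_1$. However, $P_{\mathrm{nod},1}\cap\operatorname{OG}(5,10)\neq X_1$. (2) $X_\infty$ is the union of the limits of the irreducible components in $X_t$ as $t\to\infty$. It is a reducible curve that has nodes and spatial triple points as its singularities. Furthermore, $P_{\mathrm{nod},\infty}\cap\operatorname{OG}(5,10)\neq X_\infty$.
   Context: Work over $\mathbb{C}$. Here $t=[t_0:t_1]\in\mathbb{P}^1$; $t=0$ means $t_0=0$, $t=1$ means $t_0=t_1$, $t=\infty$ means $t_1=0$. Formulas depend on a representative $(t_0,t_1)$; limits as $t\to1$ (resp. $t\to\infty$) are taken with $(t_0,t_1)\to(1,1)$ (resp. $(t_0,t_1)\to(1,0)$), and at $t=1,\infty$ these representatives are used. Curves in $\mathbb{P}^6$. Let $C_t=\bigcup_vC_t^v\subset\mathbb{P}^6$ (coordinates $y_0,\dots,y_6$), $v\in\{0,1,2,34,5,6,7,8,9,10,11\}$, with ideals of components: $0:\langle y_5,y_4,y_3,y_2,y_1\rangle$; $1:\langle y_6,y_5,y_4,y_3,y_2\rangle$; $2:\langle y_6,y_5,y_4,y_3,y_0-y_1\rangle$; $34:\langle t_0y_2y_3-t_1y_2y_4+(-t_0+t_1)y_3y_4,\ y_6,y_5,y_1-y_2+y_4,y_0-y_2+y_3\rangle$;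 $5:\langle y_6,y_3-y_4,y_2-y_4+y_5,y_1,y_0\rangle$; $6:\langle y_4-y_5,y_3-y_5+y_6,y_2,y_1,y_0\rangle$; $7:\langle y_5-y_6,y_3,y_2,y_1,y_0\rangle$; $8:\langle y_4,y_3,y_2,y_1,y_0\rangle$; $9:\langle y_5,y_4,y_2,y_1,y_0+y_3+y_6\rangle$; $10:\langle y_6,y_5,y_3,y_2,y_0\rangle$; $11:\langle y_6,y_4,y_3,y_1,y_0\rangle$. The space of quadrics vanishing on $C_t$ has the basis, satisfying $\sum_{i=0}^4g_ig_{i+5}=0$: $g_0=-t_0y_1y_3+t_1y_0y_4$; $g_1=-(t_0-t_1)y_0y_3-t_1y_2y_3-(t_0-t_1)y_3^2+t_1y_2y_4+(t_0-t_1)y_3y_4-(t_0-t_1)y_3y_6$; $g_2=(t_0-t_1)y_1y_3+t_1y_2y_3-t_1y_2y_4$; $g_3=t_0y_2y_3-t_1y_2y_4-(t_0-t_1)y_3y_4+(t_0-t_1)y_3y_5$; $g_4=-t_1y_0y_2+t_1y_1y_2-t_1y_2y_3+t_1y_2y_4$; $g_5=y_2y_6$; $g_6=y_1y_5$; $g_7=y_0y_5+y_3y_5-y_4y_5+y_4y_6$; $g_8=y_1y_6$; $g_9=y_3y_5-y_4y_5+y_4y_6$ (for $t\ne0,1,\infty$). Spinors. Let $V=\mathbb{C}^{10}$ with basis $e_{-1},\dots,e_{-5},e_1,\dots,e_5$, where $e_{-i}$ corresponds to index $i-1$ and $e_i$ to index $i+4$ in $\{0,\dots,9\}$, with $Q=\sum_{i=1}^5z_{-i}z_i$.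 Let $U_\infty=\operatorname{Span}(e_1,\dots,e_5)$, $S^{+}=\bigwedge^{\mathrm{even}}U_\infty$ with basis $e_I=e_{i_1}\wedge\cdots\wedge e_{i_k}$ ($I=\{i_1<\cdots<i_k\}$, $k$ even; $1=e_\emptyset$) and coordinates $x_I$ on $\mathbb{P}(S^{+})=\mathbb{P}^{15}$ ($x_0=x_\emptyset$). Each $v\in V$ acts on $\bigwedge U_\infty$ by $\varphi_v$, linear in $v$: $\varphi_{e_i}$ is left wedging by $e_i$, $\varphi_{e_{-i}}$ is contraction against $e_i$. The half spinor of a Lagrangian $U\subset V$ with $\dim(U\cap U_\infty)$ even is the unique (up to scalar) nonzero $s_U\in S^{+}$ with $\varphi_u(s_U)=0$ for all $u\in U$. For a smooth point $p\in C_t$, $W_p^\perp$ is the Lagrangian spanned by the rows $(\frac{\partial g_0}{\partial y_i}(p),\dots,\frac{\partial g_9}{\partial y_i}(p))$, $i=0,\dots,6$, and $\rho(p)=[s_{W_p^\perp}]$. For $t\ne0,1,\infty$, $X_t^v=\rho(C_t^v)$ denotes the closure of the image under $\rho$ of the general points of $C_t^v$, and $X_t=\bigcup_vX_t^v$. $X_1$, $X_\infty$ are the flat limits of $X_t$ in $\mathbb{P}^{15}$; limits of components are flat limits of the $X_t^v$. $P_{\mathrm{nod},t}\subset\mathbb{P}^{15}$ is the 6-dimensional linear subspace spanned by $e_{12}+e_{13}$, $e_{24}$, $e_{34}$, $(t_0t_1-t_1^2)\cdot1+(t_0-t_1)e_{15}+t_1e_{23}+t_1e_{25}+t_0e_{35}$,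 $e_{23}+e_{25}+e_{45}$, $e_{1235}$, $e_{1345}$. $\operatorname{OG}(5,10)\subset\mathbb{P}(S^{+})$ is defined by $x_0x_{2345}-x_{23}x_{45}+x_{24}x_{35}-x_{25}x_{34}$, $x_{12}x_{1345}-x_{13}x_{1245}+x_{14}x_{1235}-x_{15}x_{1234}$, $x_0x_{1345}-x_{13}x_{45}+x_{14}x_{35}-x_{15}x_{34}$, $x_{12}x_{2345}-x_{23}x_{1245}+x_{24}x_{1235}-x_{25}x_{1234}$, $x_0x_{1245}-x_{12}x_{45}+x_{14}x_{25}-x_{15}x_{24}$, $x_{13}x_{2345}-x_{23}x_{1345}+x_{34}x_{1235}-x_{35}x_{1234}$, $x_0x_{1235}-x_{12}x_{35}+x_{13}x_{25}-x_{15}x_{23}$, $x_{14}x_{2345}-x_{24}x_{1345}+x_{34}x_{1245}-x_{45}x_{1234}$, $x_0x_{1234}-x_{12}x_{34}+x_{13}x_{24}-x_{14}x_{23}$, $x_{15}x_{2345}-x_{25}x_{1345}+x_{35}x_{1245}-x_{45}x_{1235}$. A graph curve is a nodal curve all of whose irreducible components are rational curves; its dual graph has a vertex for each component and an edge for each node. $G_1$ is the trivalent graph on vertices $0,1,\dots,11$ with edges 0-1, 0-8, 0-9, 1-2, 1-10, 2-4, 2-11, 3-4, 3-9, 3-10, 4-5, 5-6, 5-11, 6-7, 6-9, 7-8, 7-10, 8-11. A spatial triple point is a curve singularity analytically isomorphic to the union of the three coordinate axes in $\mathbb{A}^3$ at the origin. *)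

(* Defs.v *)
From HB Require Import structures.
From mathcomp Require Export all_boot all_order all_algebra.
From mathcomp Require Export reals complex.
From mathcomp.multinomials Require Export mpoly.

Set Implicit Arguments.
Unset Strict Implicit.
Unset Printing Implicit Defensive.

Import GRing.Theory.
Local Open Scope ring_scope.

(* The definitions are meant for an algebraically closed field K; the complex
  numbers are R[i] for R : realType.
  A point of P^(n-1) is a nonzero vector of 'rV[K]_n up to scaling, a subset of
  P^(n-1) is a scaling-invariant set of nonzero vectors (its punctured cone),
  and a closed subscheme of P^(n-1) is given by a homogeneous ideal of
  {mpoly K[n]}, not necessarily saturated, up to [same_subscheme]. *)

Definition pset (K : fieldType) (n : nat) := 'rV[K]_n -> Prop.
Definition polyset (K : fieldType) (n : nat) := {mpoly K[n]} -> Prop.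

Definition same_point (K : fieldType) n (p q : 'rV[K]_n) : Prop :=
  exists2 c : K, c != 0 & q = c *: p.

Definition zeros (K : fieldType) n (I : polyset K n) : pset K n :=
  fun x => x != 0 /\ forall f, I f -> f.@[x 0] = 0.

(* For a scaling-invariant S over an infinite field this is a homogeneous
   ideal. *)
Definition vanishing (K : fieldType) n (S : pset K n) : polyset K n :=
  fun f => forall x, S x -> f.@[x 0] = 0.

Definition zclosure (K : fieldType) n (S : pset K n) : pset K n :=
  zeros (vanishing S).

Definition zclosed (K : fieldType) n (S : pset K n) : Prop :=
  exists2 I : polyset K n, (forall f, I f -> exists d : nat, f \is d.-homog) &
    forall x, S x <-> zeros I x.

Definition reducible (K : fieldType) n (Z : pset K n) : Prop :=
  exists A B : pset K n,
    [/\ zclosed A, zclosed B, forall x, Z x -> A x \/ B x,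
        exists2 x, Z x & ~ A x & exists2 x, Z x & ~ B x].

Definition irreducible (K : fieldType) n (Z : pset K n) : Prop :=
  [/\ zclosed Z, exists x, Z x & ~ reducible Z].

Definition irreducible_component (K : fieldType) n (I : polyset K n)
    (Z : pset K n) : Prop :=
  [/\ irreducible Z, forall x, Z x -> zeros I x &
      forall Z' : pset K n, irreducible Z' -> (forall x, Z x -> Z' x) ->
        (forall x, Z' x -> zeros I x) -> forall x, Z' x -> Z x].

Definition saturation (K : fieldType) n (I : polyset K n) : polyset K n :=
  fun f => exists k : nat, forall m : 'X_{1..n}, mdeg m = k -> I ('X_[m] * f).

Definition same_subscheme (K : fieldType) n (I J : polyset K n) : Prop :=
  forall f, saturation I f <-> saturation J f.

(* The ideal of the scheme-theoretic union of a family of subschemes. *)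
Definition union_ideal (K : fieldType) n (T : Type) (I : T -> polyset K n) :
    polyset K n :=
  fun f => forall v, I v f.

Definition eval_tuple (K : fieldType) m n (F : n.-tuple {mpoly K[m]})
    (u : 'rV[K]_m) : 'rV[K]_n :=
  \row_i (tnth F i).@[u 0].

(* Z, irreducible, is birational to P^1: the forms F and G give rational maps
   P^1 --> Z and Z --> P^1 whose two composites are defined on dense open sets
   and are the identity there. *)
Definition rational_curve (K : fieldType) n (Z : pset K n) : Prop :=
  exists (F : n.-tuple {mpoly K[2]}) (G : 2.-tuple {mpoly K[n]}) (d e : nat),
    [/\ (forall i, tnth F i \is d.-homog) /\ (forall i, tnth G i \is e.-homog),
        forall u, eval_tuple F u != 0 -> Z (eval_tuple F u),
        (exists u, eval_tuple G (eval_tuple F u) != 0) /\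
          (forall u, exists c : K, eval_tuple G (eval_tuple F u) = c *: u) &
        (exists2 z, Z z & eval_tuple F (eval_tuple G z) != 0) /\
          (forall z, Z z -> exists c : K,
             eval_tuple F (eval_tuple G z) = c *: z)].

(* [Y s], for s in the punctured base B, is a family of closed subsets of
  P^(n-1).  [family_ideal B Y] is the ideal, in K[s][x], of the closure in
  A^1 x P^(n-1) of the total space of the family; the flat limit at s0 is the
  fibre of this closure over s0. *)

Definition family_ideal (K : fieldType) n (B : K -> Prop) (Y : K -> pset K n)
    (F : {mpoly {poly K}[n]}) : Prop :=
  forall s, B s -> vanishing (Y s) (map_mpoly (horner_eval s) F).

Definition flat_limit (K : fieldType) n (B : K -> Prop) (Y : K -> pset K n)
    (s0 : K) : polyset K n :=
  fun f => exists2 F, family_ideal B Y F & f = map_mpoly (horner_eval s0) F.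

Definition fps (K : fieldType) (n : nat) := 'X_{1..n} -> K.

Definition fps_of_mpoly (K : fieldType) n (f : {mpoly K[n]}) : fps K n :=
  fun m => f@_m.

Definition fps_add (K : fieldType) n (f g : fps K n) : fps K n :=
  fun m => f m + g m.

Definition fps_sub (K : fieldType) n (f g : fps K n) : fps K n :=
  fun m => f m - g m.

Definition fps_mul (K : fieldType) n (f g : fps K n) : fps K n :=
  fun m => \sum_(k : 'X_{1..n < (mdeg m).+1} | (val k <= m)%MM)
             f (val k) * g (m - val k)%MM.

(* The ideal of K[[x_1, ..., x_n]] generated by a set of polynomials. *)
Definition fps_ideal (K : fieldType) n (I : polyset K n) (f : fps K n) : Prop :=
  exists (r : nat) (a : 'I_r -> fps K n) (b : 'I_r -> {mpoly K[n]}),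
    (forall i, I (b i)) /\
    (forall m, f m = \sum_(i < r) fps_mul (a i) (fps_of_mpoly (b i)) m).

(* The germs at the origin of the subschemes of A^m and A^n with equations I
   and J are analytically isomorphic: phi induces an isomorphism of K-algebras
   K[[x_1, ..., x_m]]/(I) -> K[[y_1, ..., y_n]]/(J). *)
Definition analytically_isomorphic (K : fieldType) m n
    (I : polyset K m) (J : polyset K n) : Prop :=
  exists phi : fps K m -> fps K n,
    [/\ forall f g,
          fps_ideal J (fps_sub (phi (fps_add f g)) (fps_add (phi f) (phi g))),
        forall f g,
          fps_ideal J (fps_sub (phi (fps_mul f g)) (fps_mul (phi f) (phi g))),
        forall c : K,
          fps_ideal J (fps_sub (phi (fps_of_mpoly c%:MP)) (fps_of_mpoly c%:MP)),
        forall f, fps_ideal J (phi f) <-> fps_ideal I f &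
        forall g, exists f, fps_ideal J (fps_sub g (phi f))].

(* For p_j != 0: equations, in the coordinates x - p, of the intersection of
   the affine cone with the hyperplane x_j = p_j; up to a dilation this is the
   affine chart x_j != 0, with p moved to the origin. *)
Definition germ (K : fieldType) n (I : polyset K n) (p : 'rV[K]_n) (j : 'I_n) :
    polyset K n :=
  fun f => (exists2 g, I g &
              f = g \mPo [tuple (p 0 i)%:MP + 'X_i | i < n]) \/ f = 'X_j.

(* Equations of the union of the coordinate axes of A^m. *)
Definition axes (K : fieldType) (m : nat) : polyset K m :=
  fun f => exists i j : 'I_m, i != j /\ f = 'X_i * 'X_j.

Definition axes_point (m : nat) (K : fieldType) n (I : polyset K n)
    (p : 'rV[K]_n) : Prop :=
  zeros I p /\
  exists2 j, p 0 j != 0 & analytically_isomorphic (germ I p j) (@axes K m).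

(* The completed local ring is K[[x]], K[[x, y]]/(xy), and
   K[[x, y, z]]/(xy, xz, yz) respectively.  In particular, a scheme all of whose
   points are of these types is a reduced curve. *)
Definition smooth_point := axes_point 1.
Definition node := axes_point 2.
Definition spatial_triple_point := axes_point 3.

Definition nodal_curve (K : fieldType) n (I : polyset K n) : Prop :=
  forall p, zeros I p -> smooth_point I p \/ node I p.

Definition graph_curve (K : fieldType) n (I : polyset K n) : Prop :=
  nodal_curve I /\ forall Z, irreducible_component I Z -> rational_curve Z.

(* The graph has vertices 'I_V and the list of edges E.  The vertices are in
   bijection with the irreducible components and the edges with the nodes, and
   the edge of a node joins the components through that node. *)
Definition has_dual_graph (K : fieldType) n (I : polyset K n) (V : nat)
    (E : seq (nat * nat)) : Prop :=
  exists (Z : 'I_V -> pset K n) (N : 'I_(size E) -> 'rV[K]_n),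
    [/\ (forall i, irreducible_component I (Z i)) /\
          (forall i j, (forall x, Z i x <-> Z j x) -> i = j),
        forall Z', irreducible_component I Z' ->
          exists i, forall x, Z' x <-> Z i x,
        (forall k, node I (N k)) /\
          (forall k l, same_point (N k) (N l) -> k = l),
        forall p, node I p -> exists k, same_point p (N k) &
        forall k i, Z i (N k) <->
          (i : nat) = (nth (0, 0) E k).1 \/ (i : nat) = (nth (0, 0) E k).2].

(* A parameter is a representative t = (t_0, t_1) of a point of P^1; t.1 is t_0
  and t.2 is t_1. *)

Definition generic (K : fieldType) (t : K * K) : Prop :=
  [/\ t.1 != 0, t.2 != 0 & t.1 != t.2].

Definition y_ (K : fieldType) (k : nat) : {mpoly K[7]} := 'X_(inord k).

Inductive component :=
  v0 | v1 | v2 | v34 | v5 | v6 | v7 | v8 | v9 | v10 | v11.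

Definition C_equations (K : fieldType) (t : K * K) (v : component) :
    seq {mpoly K[7]} :=
  let y := @y_ K in
  match v with
  | v0 => [:: y 5; y 4; y 3; y 2; y 1]
  | v1 => [:: y 6; y 5; y 4; y 3; y 2]
  | v2 => [:: y 6; y 5; y 4; y 3; y 0 - y 1]
  | v34 => [:: t.1 *: (y 2 * y 3) - t.2 *: (y 2 * y 4)
               + (- t.1 + t.2) *: (y 3 * y 4);
               y 6; y 5; y 1 - y 2 + y 4; y 0 - y 2 + y 3]
  | v5 => [:: y 6; y 3 - y 4; y 2 - y 4 + y 5; y 1; y 0]
  | v6 => [:: y 4 - y 5; y 3 - y 5 + y 6; y 2; y 1; y 0]
  | v7 => [:: y 5 - y 6; y 3; y 2; y 1; y 0]
  | v8 => [:: y 4; y 3; y 2; y 1; y 0]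
  | v9 => [:: y 5; y 4; y 2; y 1; y 0 + y 3 + y 6]
  | v10 => [:: y 6; y 5; y 3; y 2; y 0]
  | v11 => [:: y 6; y 4; y 3; y 1; y 0]
  end.

Definition C_comp (K : fieldType) (t : K * K) (v : component) : pset K 7 :=
  zeros (fun f => f \in C_equations t v).

Definition C (K : fieldType) (t : K * K) : pset K 7 :=
  fun y => exists v, C_comp t v y.

Definition quadrics (K : fieldType) (t : K * K) : seq {mpoly K[7]} :=
  let y0 := y_ K 0 in let y1 := y_ K 1 in let y2 := y_ K 2 in
  let y3 := y_ K 3 in let y4 := y_ K 4 in let y5 := y_ K 5 in
  let y6 := y_ K 6 in
  let t0 := t.1 in let t1 := t.2 in
  [:: - t0 *: (y1 * y3) + t1 *: (y0 * y4);
      - (t0 - t1) *: (y0 * y3) - t1 *: (y2 * y3) - (t0 - t1) *: y3 ^+ 2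
      + t1 *: (y2 * y4) + (t0 - t1) *: (y3 * y4) - (t0 - t1) *: (y3 * y6);
      (t0 - t1) *: (y1 * y3) + t1 *: (y2 * y3) - t1 *: (y2 * y4);
      t0 *: (y2 * y3) - t1 *: (y2 * y4) - (t0 - t1) *: (y3 * y4)
      + (t0 - t1) *: (y3 * y5);
      - t1 *: (y0 * y2) + t1 *: (y1 * y2) - t1 *: (y2 * y3) + t1 *: (y2 * y4);
      y2 * y6;
      y1 * y5;
      y0 * y5 + y3 * y5 - y4 * y5 + y4 * y6;
      y1 * y6;
      y3 * y5 - y4 * y5 + y4 * y6].

Definition quadric (K : fieldType) (t : K * K) (k : nat) : {mpoly K[7]} :=
  nth 0 (quadrics t) k.

(* V = K^10 is 'rV[K]_(5 + 5); e_{-i} is the coordinate vector i - 1 of the first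
  summand and e_i the coordinate vector i - 1 of the second one.  Accordingly
  the index set {1, ..., 5} of the e_I is represented by 'I_5, with a shift by
  one.  A form in the exterior algebra of U_oo is given by the coordinates of
  its e_I. *)

Definition exterior (K : fieldType) := {ffun {set 'I_5} -> K}.

Definition wedge_sign (K : fieldType) (i : 'I_5) (I : {set 'I_5}) : K :=
  (-1) ^+ #|[set j in I | j < i]%N|.

Definition wedge (K : fieldType) (i : 'I_5) (s : exterior K) : exterior K :=
  [ffun I : {set 'I_5} => if i \in I then wedge_sign K i I * s (I :\ i) else 0].

Definition contract (K : fieldType) (i : 'I_5) (s : exterior K) : exterior K :=
  [ffun I : {set 'I_5} => if i \in I then 0 else wedge_sign K i I * s (i |: I)].

Definition clifford (K : fieldType) (z : 'rV[K]_(5 + 5)) (s : exterior K) :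
    exterior K :=
  [ffun I : {set 'I_5} => \sum_(i < 5) (z 0 (lshift 5 i) * contract i s I
                           + z 0 (rshift 5 i) * wedge i s I)].

(* s spans the line of half spinors of the row space of W. *)
Definition half_spinor (K : fieldType) m (W : 'M[K]_(m, 5 + 5))
    (s : exterior K) : Prop :=
  [/\ s != 0, forall I : {set 'I_5}, odd #|I| -> s I = 0 &
      forall u : 'rV[K]_(5 + 5), (u <= W)%MS -> clifford u s = 0].

(* The order of the 16 homogeneous coordinates x_I of P^15. *)
Definition even_indices : seq (seq nat) :=
  [:: [::]; [:: 1; 2]; [:: 1; 3]; [:: 1; 4]; [:: 1; 5]; [:: 2; 3]; [:: 2; 4];
      [:: 2; 5]; [:: 3; 4]; [:: 3; 5]; [:: 4; 5]; [:: 1; 2; 3; 4];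
      [:: 1; 2; 3; 5]; [:: 1; 2; 4; 5]; [:: 1; 3; 4; 5]; [:: 2; 3; 4; 5]]%N.

Definition index_set (l : seq nat) : {set 'I_5} := [set i : 'I_5 | i.+1 \in l].

Definition coordinates (K : fieldType) (s : exterior K) : 'rV[K]_16 :=
  \row_k s (index_set (nth [::] even_indices k)).

Definition e_ (K : fieldType) (l : seq nat) : 'rV[K]_16 :=
  delta_mx 0 (inord (index l even_indices)).

Definition x_ (K : fieldType) (l : seq nat) : {mpoly K[16]} :=
  'X_(inord (index l even_indices)).

Definition jacobian (K : fieldType) (t : K * K) (p : 'rV[K]_7) :
    'M[K]_(7, 5 + 5) :=
  \matrix_(i, k) ((quadric t k)^`M(i)).@[p 0].

(* [rho t p x] means that x represents the point rho(p). *)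
Definition rho (K : fieldType) (t : K * K) (p : 'rV[K]_7) : pset K 16 :=
  fun x => exists2 s, half_spinor (jacobian t p) s & x = coordinates s.

Definition X_comp (K : fieldType) (t : K * K) (v : component) : pset K 16 :=
  zclosure (fun x => exists p,
    [/\ C_comp t v p, smooth_point (vanishing (C t)) p & rho t p x]).

Definition X (K : fieldType) (t : K * K) : pset K 16 :=
  fun x => exists v, X_comp t v x.

(* X_t depends on the representative (t_0, t_1), so a limit at t = 1 or oo is
  taken at s = 0 along an arc s |-> (a(s), b(s)) of representatives with
  (a(0), b(0)) = (1, 1) or (1, 0); the arc (1, 1 + s), for instance, uses the
  coordinate t_1/t_0 of P^1.  The result does not depend on the arc: rescaling
  the representative acts on P^15 by a diagonal matrix that tends to 1. *)
Definition limit_X (K : fieldType) (a b : {poly K}) : polyset K 16 :=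
  flat_limit (fun s => generic (a.[s], b.[s])) (fun s => X (a.[s], b.[s])) 0.

Definition limit_X_comp (K : fieldType) (a b : {poly K}) (v : component) :
    polyset K 16 :=
  flat_limit (fun s => generic (a.[s], b.[s]))
    (fun s => X_comp (a.[s], b.[s]) v) 0.

Definition P_nod_basis (K : fieldType) (t : K * K) : 'M[K]_(7, 16) :=
  let e := e_ K in let t0 := t.1 in let t1 := t.2 in
  \matrix_(i < 7) nth 0
    [:: e [:: 1; 2]%N + e [:: 1; 3]%N;
        e [:: 2; 4]%N;
        e [:: 3; 4]%N;
        (t0 * t1 - t1 ^+ 2) *: e [::] + (t0 - t1) *: e [:: 1; 5]%N
        + t1 *: e [:: 2; 3]%N + t1 *: e [:: 2; 5]%N + t0 *: e [:: 3; 5]%N;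
        e [:: 2; 3]%N + e [:: 2; 5]%N + e [:: 4; 5]%N;
        e [:: 1; 2; 3; 5]%N;
        e [:: 1; 3; 4; 5]%N] i.

Definition P_nod (K : fieldType) (t : K * K) : pset K 16 :=
  fun x => x != 0 /\ (x <= P_nod_basis t)%MS.

Definition OG_equations (K : fieldType) : seq {mpoly K[16]} :=
  let x := x_ K in
  let x0 := x [::] in
  let x12 := x [:: 1; 2]%N in let x13 := x [:: 1; 3]%N in
  let x14 := x [:: 1; 4]%N in let x15 := x [:: 1; 5]%N in
  let x23 := x [:: 2; 3]%N in let x24 := x [:: 2; 4]%N in
  let x25 := x [:: 2; 5]%N in let x34 := x [:: 3; 4]%N in
  let x35 := x [:: 3; 5]%N in let x45 := x [:: 4; 5]%N in
  let x1234 := x [:: 1; 2; 3; 4]%N in let x1235 := x [:: 1; 2; 3; 5]%N in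
  let x1245 := x [:: 1; 2; 4; 5]%N in let x1345 := x [:: 1; 3; 4; 5]%N in
  let x2345 := x [:: 2; 3; 4; 5]%N in
  [:: x0 * x2345 - x23 * x45 + x24 * x35 - x25 * x34;
      x12 * x1345 - x13 * x1245 + x14 * x1235 - x15 * x1234;
      x0 * x1345 - x13 * x45 + x14 * x35 - x15 * x34;
      x12 * x2345 - x23 * x1245 + x24 * x1235 - x25 * x1234;
      x0 * x1245 - x12 * x45 + x14 * x25 - x15 * x24;
      x13 * x2345 - x23 * x1345 + x34 * x1235 - x35 * x1234;
      x0 * x1235 - x12 * x35 + x13 * x25 - x15 * x23;
      x14 * x2345 - x24 * x1345 + x34 * x1245 - x45 * x1234;
      x0 * x1234 - x12 * x34 + x13 * x24 - x14 * x23;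
      x15 * x2345 - x25 * x1345 + x35 * x1245 - x45 * x1235].

Definition OG (K : fieldType) : pset K 16 :=
  zeros (fun f => f \in OG_equations K).

Definition G1_edges : seq (nat * nat) :=
  [:: (0, 1); (0, 8); (0, 9); (1, 2); (1, 10); (2, 4); (2, 11); (3, 4); (3, 9);
      (3, 10); (4, 5); (5, 6); (5, 11); (6, 7); (6, 9); (7, 8); (7, 10);
      (8, 11)]%N.

(* Main.v *)
(* On each component of C_t the map rho is linear in a parametrization, so X_t is
   a union of eleven lines and a conic in P_nod, spanned by vectors polynomial in t.
   Glue the components one at a time: each one meets the earlier ones in explicit
   nodes, and a multiple of the product of the linear forms through these nodes
   extends to the ambient space by a form vanishing on the earlier components.
   Hence every form of large degree vanishing on the limits of the components lifts
   to the family, and the flat limit has no other points and is generically and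
   locally reduced. At a point lying on k branches the tangent directions are
   independent, and the projections onto the branches identify the complete local
   ring with that of k coordinate axes. At both limits P_nod meets OG(5,10) in a
   point outside the limit curve. *)
From HB Require Import structures.
From mathcomp Require Import all_classical.
From mathcomp Require Import ring.
Require Import Defs.
Import GRing.Theory Num.Theory.

Set Implicit Arguments.
Unset Strict Implicit.
Unset Printing Implicit Defensive.

Local Open Scope ring_scope.

(** A flat limit is accessible only through forms vanishing on all nearby curves, and its ideal need
    not be saturated. Statements are therefore proved after multiplication by all monomials of one
    degree [N]; these also supply the linear factors consumed when components are glued. Division by
    the parameter s keeps the argument going only if the spanning vectors stay independent at s = 0,
    so those of X_t are rescaled by factors vanishing at infinity. One gluing order serves both
    limits; where disjoint components come together at infinity, a single linear form is made to
    vanish on both. At the limits all data are integral in the basis of P_nod, so independence and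
    incidence are decided by computation in [int]. Uniqueness of the spinor at a point of C_t is
    certified by explicit combinations of the Clifford equations; its existence holds because these
    equations, evaluated at the claimed vector, are combinations of the ten quadrics. *)

Section PowerSeries.
Variables (K : fieldType) (n : nat).
Local Notation fps := (fps K n).
Implicit Types (f g h : fps) (m : 'X_{1..n}) (N : nat).

(** * The ring of formal power series *)

Definition fps_trunc N f : {mpoly K[n]} :=
  \sum_(m : 'X_{1..n < N}) f m *: 'X_[m].

Lemma fps_truncE N f m : (mdeg m < N)%N -> (fps_trunc N f)@_m = f m.
Proof. exact: mcoeff_mpoly. Qed.

(** A coefficient of a product in degree below [N] only involves coefficients of the factors in
    degrees below [N]. This reduces each ring axiom for series to the same axiom for polynomial
    truncations. *)
Lemma mcoeffM_eq_low N (p p' q q' : {mpoly K[n]}) :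
  (forall m, (mdeg m < N)%N -> p@_m = p'@_m) ->
  (forall m, (mdeg m < N)%N -> q@_m = q'@_m) ->
  forall m, (mdeg m < N)%N -> (p * q)@_m = (p' * q')@_m.
Proof.
move=> hp hq m hm; rewrite !mcoeffM; apply: eq_bigr => -[k1 k2] /= _.
by rewrite hp ?hq //; [case: k2|case: k1] => k /= hk; apply: leq_trans hm.
Qed.

Lemma fps_mulE f g m N : (mdeg m < N)%N ->
  fps_mul f g m = (fps_trunc N f * fps_trunc N g)@_m.
Proof.
move=> hm; rewrite mcoeffM /fps_mul.
rewrite -(pair_big_dep xpredT
  (fun k1 k2 : 'X_{1..n < (mdeg m).+1} => m == (k1 + k2)%MM)
  (fun k1 k2 : 'X_{1..n < (mdeg m).+1} =>
     (fps_trunc N f)@_k1 * (fps_trunc N g)@_k2)) /=.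
rewrite big_mkcond /=; apply: eq_bigr => k1 _.
have hk (k : 'X_{1..n < (mdeg m).+1}) : (mdeg k < N)%N.
  by apply: leq_trans hm; case: k.
case: ifPn => [le_km|nle_km].
  have lt_mk : (mdeg (m - k1)%MM < (mdeg m).+1)%N by rewrite ltnS mdegB.
  rewrite (big_pred1 (BMultinom lt_mk)) /= => [|k2].
    by rewrite !fps_truncE // (leq_ltn_trans (mdegB _ _) hm).
  apply/eqP/eqP => [hm'|->]; last by rewrite /= addmC submK.
  by apply/val_inj; rewrite /= {2}hm' addmC addmK.
rewrite big_pred0 // => k2; apply/negP => hm'; case/negP: nle_km.
by apply/mnm_lepP => i; move/eqP/mnmP: hm' => ->; rewrite mnmDE leq_addr.
Qed.

(** A copy of [fps] that carries the ring structure. Since coefficients form an infinite family,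
    equality and choice on it are classical. *)
Definition series := fps.
HB.instance Definition _ := gen_eqMixin series.
HB.instance Definition _ := gen_choiceMixin series.

Definition series_poly (p : {mpoly K[n]}) : series := fps_of_mpoly p.
Definition series_opp (f : series) : series := fun m => - f m.

Lemma seriesP (f g : series) : (forall m, f m = g m) -> f = g.
Proof. by move=> h; apply/funext. Qed.

Lemma series_addA : associative (@fps_add K n : series -> series -> series).
Proof. by move=> f g h; apply: seriesP => m; rewrite /fps_add addrA. Qed.
Lemma series_addC : commutative (@fps_add K n : series -> series -> series).
Proof. by move=> f g; apply: seriesP => m; rewrite /fps_add addrC. Qed.
Lemma series_add0 :
  left_id (series_poly 0) (@fps_add K n : series -> series -> series).
Proof.
by move=> f; apply: seriesP => m; rewrite /fps_add /series_poly /fps_of_mpoly mcoeff0 add0r.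
Qed.
Lemma series_addN :
  left_inverse (series_poly 0) series_opp (@fps_add K n : series -> series -> series).
Proof.
move=> f; apply: seriesP => m.
by rewrite /fps_add /series_opp /series_poly /fps_of_mpoly mcoeff0 addNr.
Qed.
HB.instance Definition _ :=
  GRing.isZmodule.Build series series_addA series_addC series_add0 series_addN.

Lemma sCoefD (f g : series) m : (f + g) m = f m + g m. Proof. by []. Qed.
Lemma sCoefB (f g : series) m : (f - g) m = f m - g m. Proof. by []. Qed.
Lemma sCoef0 m : (0 : series) m = 0. Proof. exact: mcoeff0. Qed.

Lemma trunc_mul N f g m : (mdeg m < N)%N ->
  (fps_trunc N (fps_mul f g))@_m = (fps_trunc N f * fps_trunc N g)@_m.
Proof. by move=> hm; rewrite fps_truncE // (fps_mulE _ _ hm). Qed.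

Lemma trunc_poly N p m : (mdeg m < N)%N -> (fps_trunc N (series_poly p))@_m = p@_m.
Proof. exact: fps_truncE. Qed.

Lemma series_mulA : associative (@fps_mul K n : series -> series -> series).
Proof.
move=> f g h; apply: seriesP => m; pose N := (mdeg m).+1.
rewrite !(@fps_mulE _ _ m N) //.
rewrite (@mcoeffM_eq_low N _ (fps_trunc N f) _ (fps_trunc N g * fps_trunc N h)) //;
  last by move=> k hk; rewrite trunc_mul.
rewrite mulrA; apply/esym/(@mcoeffM_eq_low N) => // k hk.
by rewrite trunc_mul.
Qed.

Lemma series_mulC : commutative (@fps_mul K n : series -> series -> series).
Proof.
move=> f g; apply: seriesP => m.
by rewrite !(@fps_mulE _ _ m (mdeg m).+1) // mulrC.
Qed.

Lemma series_mul1 :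
  left_id (series_poly 1) (@fps_mul K n : series -> series -> series).
Proof.
move=> f; apply: seriesP => m; pose N := (mdeg m).+1.
rewrite (@fps_mulE _ _ m N) // (@mcoeffM_eq_low N _ 1 _ (fps_trunc N f)) //.
  by rewrite mul1r fps_truncE.
by move=> k hk; rewrite trunc_poly.
Qed.

Lemma series_mulDl :
  left_distributive (@fps_mul K n : series -> series -> series) +%R.
Proof.
move=> f g h; apply: seriesP => m; pose N := (mdeg m).+1.
rewrite sCoefD !(@fps_mulE _ _ m N) // -mcoeffD -mulrDl.
apply: (@mcoeffM_eq_low N) => // k hk.
by rewrite mcoeffD !fps_truncE.
Qed.

Lemma series_1neq0 : series_poly 1 != 0.
Proof.
apply/eqP => /(congr1 (fun f : series => f 0%MM)).
by rewrite sCoef0 /series_poly /fps_of_mpoly mcoeff1 eqxx => /eqP; rewrite oner_eq0.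
Qed.

HB.instance Definition _ := GRing.Zmodule_isComNzRing.Build series
  series_mulA series_mulC series_mul1 series_mulDl series_1neq0.

Lemma sCoef_sum I (r : seq I) (P : pred I) (F : I -> series) m :
  (\sum_(i <- r | P i) F i) m = \sum_(i <- r | P i) F i m.
Proof.
elim/big_rec2: _ => [|i y1 y2 _ <-]; first exact: sCoef0.
by rewrite sCoefD.
Qed.

Lemma series_poly_is_additive : additive series_poly.
Proof. by move=> p q; apply: seriesP => m; rewrite /series_poly /fps_of_mpoly mcoeffB. Qed.
HB.instance Definition _ :=
  GRing.isAdditive.Build {mpoly K[n]} series series_poly series_poly_is_additive.
Lemma series_poly_is_multiplicative : multiplicative series_poly.
Proof.
split=> // p q; apply: seriesP => m; pose N := (mdeg m).+1.
rewrite [RHS](@fps_mulE _ _ m N) //; apply: (@mcoeffM_eq_low N) => // k hk;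
by rewrite trunc_poly.
Qed.
HB.instance Definition _ :=
  GRing.isMultiplicative.Build {mpoly K[n]} series series_poly
    series_poly_is_multiplicative.

(** The [N]-th power of the maximal ideal. These powers give the topology in which substitution
    converges and equality can be tested ([series_low_eq]). *)
Definition low N (f : series) := forall m, (mdeg m < N)%N -> f m = 0.

Lemma lowD N f g : low N f -> low N g -> low N (f + g : series).
Proof. by move=> hf hg m hm; rewrite sCoefD hf ?hg ?addr0. Qed.
Lemma lowB N f g : low N f -> low N g -> low N ((f : series) - g).
Proof. by move=> hf hg m hm; rewrite sCoefB hf ?hg ?subr0. Qed.
Lemma low0 N : low N 0. Proof. by move=> m _; apply: sCoef0. Qed.
Lemma low_sum N I (r : seq I) (P : pred I) (F : I -> series) :
  (forall i, P i -> low N (F i)) -> low N (\sum_(i <- r | P i) F i).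
Proof. by move=> h; elim/big_rec: _ => [|i y Pi]; [apply: low0|apply/lowD/h]. Qed.
Lemma lowM N1 N2 f g : low N1 f -> low N2 g -> low (N1 + N2) ((f : series) * g).
Proof.
move=> hf hg m hm; apply: big1 => k hk.
have [hk1|hk1] := ltnP (mdeg (val k)) N1; first by rewrite hf // mul0r.
rewrite (hg (m - val k)%MM) ?mulr0 // -(ltn_add2l (mdeg (val k))) -mdegD.
by rewrite addmC submK // (leq_trans hm) // leq_add2r.
Qed.
Lemma low_le N N' f : (N' <= N)%N -> low N f -> low N' f.
Proof. by move=> le_N hf m hm; apply/hf/(leq_trans hm). Qed.
Lemma lowMl N f g : low N g -> low N ((f : series) * g).
Proof. by move=> hg; apply: (@lowM 0). Qed.
Lemma lowX k f : low 1 f -> low k ((f : series) ^+ k).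
Proof.
move=> hf; elim: k => // k IH; rewrite exprS -add1n; exact: lowM.
Qed.

Lemma low_trunc N f : low N (f - series_poly (fps_trunc N f) : series).
Proof. by move=> m hm; rewrite sCoefB /series_poly /fps_of_mpoly fps_truncE ?subrr. Qed.

Lemma series_low_eq (f g : series) : (forall N, low N (f - g)) -> f = g.
Proof.
move=> h; apply: seriesP => m; apply/eqP; rewrite -subr_eq0.
by rewrite -sCoefB (h (mdeg m).+1).
Qed.

End PowerSeries.

(** * Substitution of power series and Taylor expansion *)

Section Composition.
Variable K : fieldType.

(** Both sums are values at (1, ..., 1) of polynomials with coefficients [F u], and these two
    polynomials have the same coefficients. *)
Lemma sum_bmultinom_eq n (N N' : nat) (F : 'X_{1..n} -> K) : (N <= N')%N ->
  (forall u, (N <= mdeg u)%N -> F u = 0) ->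
  \sum_(u : 'X_{1..n < N}) F u = \sum_(u : 'X_{1..n < N'}) F u.
Proof.
move=> le_N F0.
have E M : \sum_(u : 'X_{1..n < M}) F u
         = (\sum_(u : 'X_{1..n < M}) F u *: 'X_[u] : {mpoly K[n]}).@[fun=> 1].
  rewrite raddf_sum /=; apply: eq_bigr => u _.
  by rewrite mevalZ mevalX big1 ?mulr1 // => i _; rewrite expr1n.
rewrite !E; congr (_.@[_]); apply/mpolyP => m.
have cf M : (mdeg m < M)%N || (N <= mdeg m)%N ->
    (\sum_(u : 'X_{1..n < M}) F u *: 'X_[u] : {mpoly K[n]})@_m = F m.
  have [lt_mM _|le_Mm /= hN] := ltnP (mdeg m) M; first exact: mcoeff_mpoly.
  rewrite F0 // raddf_sum /= big1 // => u _; rewrite mcoeffZ mcoeffX.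
  case: eqP => [um|]; last by rewrite mulr0.
  by rewrite um F0 ?mul0r.
by rewrite !cf //; case: (ltnP (mdeg m) N) => //= h; rewrite ?orbT ?orbF ?(leq_trans h le_N).
Qed.

Lemma sCoefCM n c (f : series K n) m : (series_poly c%:MP * f) m = c * f m.
Proof.
rewrite [LHS](@fps_mulE _ _ _ _ _ (mdeg m).+1) //.
rewrite (@mcoeffM_eq_low _ _ (mdeg m).+1 _ c%:MP _ (fps_trunc (mdeg m).+1 f)) //.
  by rewrite mcoeffCM fps_truncE.
by move=> k hk; rewrite trunc_poly.
Qed.

Lemma sCoefX n (i : 'I_n) m : series_poly ('X_i : {mpoly K[n]}) m = (U_(i)%MM == m)%:R.
Proof. exact: mcoeffX. Qed.

Lemma low_X n (i : 'I_n) : low 1 (series_poly ('X_i : {mpoly K[n]})).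
Proof.
move=> m; rewrite ltnS leqn0 mdeg_eq0 => /eqP ->.
by rewrite sCoefX mnm1_eq0.
Qed.

Section Comp.
Variables (n m : nat) (h : 'I_n -> series K m).
Hypothesis h_low : forall i, low 1 (h i).
Implicit Types (f g : series K n) (p q : {mpoly K[n]}).

(** On polynomials substitution is a ring morphism without any question of convergence; [scomp]
    extends it through truncations. *)
Definition seval p : series K m :=
  mmap (@series_poly K m \o @mpolyC m K) h p.

HB.instance Definition _ := GRing.RMorphism.copy seval
  (mmap (@series_poly K m \o @mpolyC m K) h).

Lemma sevalC c : seval c%:MP = series_poly c%:MP.
Proof. exact: mmapC. Qed.
Lemma sevalXm u : seval 'X_[u] = mmap1 h u.
Proof. exact: mmapX. Qed.
Lemma sevalX i : seval 'X_i = h i.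
Proof. by rewrite sevalXm mmap1U. Qed.

Lemma low_mmap1 u : low (mdeg u) (mmap1 h u).
Proof.
rewrite mdegE /mmap1; elim/big_ind2: _ => [|a b c d ha hb|i _]; first by [].
  exact: lowM.
exact: lowX.
Qed.

Lemma seval_low N p : (forall u, (mdeg u < N)%N -> p@_u = 0) -> low N (seval p).
Proof.
move=> hp; rewrite /seval /mmap big_seq; apply: low_sum => u.
rewrite mcoeff_msupp => hu; apply: lowMl; apply: (low_le _ (@low_mmap1 u)).
by rewrite leqNgt; apply/negP => /hp /eqP; apply/negP.
Qed.

(** As the [h i] have no constant term, a monomial of degree d contributes only in degrees at least
    d. The coefficient at [k] thus needs the terms up to degree [mdeg k], hence the truncation at
    [(mdeg k).+1]. *)
Definition scomp f : series K m := fun k => seval (fps_trunc (mdeg k).+1 f) k.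

Lemma scompE N f k : (mdeg k < N)%N -> scomp f k = seval (fps_trunc N f) k.
Proof.
move=> hk; apply/eqP; rewrite -subr_eq0 /scomp -sCoefB -raddfB.
apply/eqP; apply: (@seval_low (mdeg k).+1) => // u hu.
by rewrite mcoeffB !fps_truncE ?subrr // (leq_trans hu).
Qed.

Lemma scomp_is_additive f g : scomp (f - g) = scomp f - scomp g.
Proof.
apply: seriesP => k; rewrite sCoefB /scomp -sCoefB -raddfB; congr (seval _ k).
apply/mpolyP => u; rewrite mcoeffB; have [hu|hu] := ltnP (mdeg u) (mdeg k).+1.
  by rewrite !fps_truncE.
have E (F : series K n) : (fps_trunc (mdeg k).+1 F)@_u = 0.
  rewrite raddf_sum /= big1 // => v _; rewrite mcoeffZ mcoeffX.
  case: eqP => [vu|]; last by rewrite mulr0.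
  by have := bmdeg v; rewrite vu ltnNge hu.
by rewrite !E subrr.
Qed.

Lemma scomp_low N f : low N f -> low N (scomp f).
Proof.
move=> hf k hk; rewrite (scompE f hk) (@seval_low N) // => u hu.
by rewrite fps_truncE ?hf.
Qed.

Lemma scomp_poly p : scomp (series_poly p) = seval p.
Proof.
apply: seriesP => k; apply/eqP; rewrite -subr_eq0 /scomp -sCoefB -raddfB.
apply/eqP; apply: (@seval_low (mdeg k).+1) => // u hu.
by rewrite mcoeffB !fps_truncE ?subrr.
Qed.

Lemma scompB f g : scomp (f - g) = scomp f - scomp g.
Proof. exact: scomp_is_additive. Qed.
Lemma scomp0 : scomp 0 = 0.
Proof. by rewrite -(subrr 0) scompB subrr. Qed.
Lemma scompN f : scomp (- f) = - scomp f.
Proof. by rewrite -[- f]sub0r scompB scomp0 sub0r. Qed.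
Lemma scompD f g : scomp (f + g) = scomp f + scomp g.
Proof. by rewrite -{1}[g]opprK scompB scompN opprK. Qed.

Lemma scomp_trunc N f : low N (scomp f - seval (fps_trunc N f)).
Proof. by rewrite -scomp_poly -scompB; apply: scomp_low; apply: low_trunc. Qed.

(** Modulo the [N]-th power of the maximal ideal both sides may be computed on the truncations of
    [f] and [g], where substitution is multiplicative; [N] is arbitrary. *)
Lemma scompM f g : scomp (f * g) = scomp f * scomp g.
Proof.
apply: series_low_eq => N.
set P := fps_trunc N f; set Q := fps_trunc N g.
have -> : scomp (f * g) - scomp f * scomp g =
   scomp (f * g - series_poly P * series_poly Q)
   - ((scomp f - seval P) * scomp g + seval P * (scomp g - seval Q)).
  by rewrite scompB -rmorphM scomp_poly rmorphM; ring.
apply: lowB.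
  apply: scomp_low.
  have -> : f * g - series_poly P * series_poly Q =
    g * (f - series_poly P) + series_poly P * (g - series_poly Q) by ring.
  by apply: lowD; apply: lowMl; apply: low_trunc.
apply: lowD; last by apply: lowMl; apply: scomp_trunc.
by rewrite mulrC; apply: lowMl; apply: scomp_trunc.
Qed.

Lemma scompC c : scomp (series_poly c%:MP) = series_poly c%:MP.
Proof. by rewrite scomp_poly sevalC. Qed.
Lemma scomp1 : scomp 1 = 1.
Proof. exact: (scompC 1). Qed.
Lemma scompX i : scomp (series_poly 'X_i) = h i.
Proof. by rewrite scomp_poly sevalX. Qed.
Lemma scomp_sum I (r : seq I) (P : pred I) (F : I -> series K n) :
  scomp (\sum_(i <- r | P i) F i) = \sum_(i <- r | P i) scomp (F i).
Proof. exact: (big_morph _ scompD scomp0). Qed.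
Lemma scomp_exp f k : scomp (f ^+ k) = scomp f ^+ k.
Proof. by elim: k => [|k IH]; rewrite ?scomp1 // !exprS scompM IH. Qed.
Lemma scomp_prod I (r : seq I) (P : pred I) (F : I -> series K n) :
  scomp (\prod_(i <- r | P i) F i) = \prod_(i <- r | P i) scomp (F i).
Proof. exact: (big_morph _ scompM scomp1). Qed.

End Comp.

Lemma eq_scomp n m (h h' : 'I_n -> series K m) : h =1 h' -> scomp h =1 scomp h'.
Proof. by move=> /funext ->. Qed.

Lemma scompA n m k (g : 'I_n -> series K m) (h : 'I_m -> series K k) f :
  (forall i, low 1 (g i)) -> (forall i, low 1 (h i)) ->
  scomp h (scomp g f) = scomp (fun i => scomp h (g i)) f.
Proof.
move=> hg hh; have hgh i : low 1 (scomp h (g i)) by apply: scomp_low => //; apply: hg.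
have Epoly p : scomp h (seval g p) = seval (fun i => scomp h (g i)) p.
  elim/mpolyind: p => [|c u p _ _ IH]; first by rewrite !raddf0 scomp0.
  rewrite !raddfD /= scompD // IH -mul_mpolyC !rmorphM scompM //= !sevalC scompC //.
  by rewrite !sevalXm /mmap1 scomp_prod //; under eq_bigr do rewrite scomp_exp //.
apply: series_low_eq => N; set P := fps_trunc N f.
have -> : scomp h (scomp g f) - scomp (fun i => scomp h (g i)) f =
  scomp h (scomp g f - seval g P)
   - (scomp (fun i => scomp h (g i)) f - seval (fun i => scomp h (g i)) P).
  by rewrite scompB // Epoly; ring.
apply: lowB; last exact: scomp_trunc.
by apply: scomp_low => //; apply: scomp_trunc.
Qed.

Lemma scomp_id n f : scomp (fun i : 'I_n => series_poly 'X_i) f = f.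
Proof.
have hX := @low_X n.
have Epoly p : seval (fun i : 'I_n => series_poly 'X_i) p = series_poly p.
  elim/mpolyind: p => [|c u p _ _ IH]; first by rewrite !raddf0.
  rewrite !raddfD /= IH -mul_mpolyC !rmorphM /= !sevalC sevalXm mpolyXE_id /mmap1.
  by rewrite rmorph_prod /=; under [X in _ = _ * X + _]eq_bigr do rewrite rmorphXn.
apply: series_low_eq => N.
have -> : scomp (fun i : 'I_n => series_poly 'X_i) f - f =
  scomp (fun i : 'I_n => series_poly 'X_i) (f - series_poly (fps_trunc N f))
  - (f - series_poly (fps_trunc N f)).
  by rewrite scompB // scomp_poly // Epoly; ring.
by apply: lowB; first apply: scomp_low => //; apply: low_trunc.
Qed.

Section Taylor.
Variables (n : nat) (h : 'I_n -> series K n).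
Hypothesis h_low : forall i, low 1 (h i).
Local Notation X i := (series_poly ('X_i : {mpoly K[n]})).

(** Telescoping, one variable at a time: X_j X^u' - h_j h^u' = X_j (X^u' - h^u') + (X_j - h_j) h^u'.
    The bound on the order of [D i] is what makes the sum over all monomials converge in
    [taylor]. *)
Lemma monomial_taylor (u : 'X_{1..n}) : exists D : 'I_n -> series K n,
  (forall i, low (mdeg u).-1 (D i)) /\
  series_poly 'X_[u] - mmap1 h u = \sum_i D i * (X i - h i).
Proof.
move: {2}(mdeg u) (erefl (mdeg u)) => d; elim: d u => [|d IH] u.
  move/eqP; rewrite mdeg_eq0 => /eqP ->; exists (fun=> 0); split.
    by move=> i; apply: low0.
  rewrite mpolyX0 mmap11 rmorph1 subrr big1 // => i _; exact: mul0r.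
move=> hu; have [j hj] : exists j, u j != 0%N.
  apply/existsP; rewrite -negb_forall; apply: contraPN hu => /forallP u0.
  by rewrite mdegE big1 // => i _; apply/eqP.
pose u' := (u - U_(j))%MM.
have Eu : u = (U_(j) + u')%MM by rewrite addmC submK // lep1mP.
have hu' : mdeg u' = d by move: hu; rewrite Eu mdegD mdeg1 add1n => -[].
have [D [lowD' ED]] := IH _ hu'.
exists (fun i => X j * D i + (i == j)%:R * mmap1 h u'); split => [i|].
  rewrite hu /=; apply: lowD.
    have := @lowM _ _ 1 (mdeg u').-1 _ _ (@low_X n j) (lowD' i).
    by apply: low_le; rewrite hu'; case: (d).
  by apply: lowMl; rewrite -hu'; apply: low_mmap1.
have Em : mmap1 h u = h j * mmap1 h u'.
  rewrite Eu commr_mmap1_M ?mmap1U // => i x; exact: mulrC.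
rewrite Em {1}Eu mpolyXD rmorphM /=.
under eq_bigr => i _ do rewrite mulrDl -mulrA.
rewrite big_split -mulr_sumr -ED /=.
rewrite (bigD1 j) //= eqxx big1 => [|i /negPf ->]; last by rewrite !mul0r.
rewrite mulr1n; ring.
Qed.

(** The difference is an honest finite combination of the [X i - h i], as [fps_ideal] requires.
    Congruences between coordinates thus become congruences between arbitrary series, with no
    closure argument for ideals. *)
Lemma taylor (f : series K n) : exists a : 'I_n -> series K n,
  f - scomp h f = \sum_i a i * (X i - h i).
Proof.
have [D hD] := choice monomial_taylor.
(* [D u i] starts in degree [mdeg u - 1], so only monomials of degree at most [mdeg k + 1] reach the
   coefficient at [k]. *)
exists (fun i k => \sum_(u : 'X_{1..n < (mdeg k).+2}) f u * D u i k).
apply: seriesP => k; pose N := (mdeg k).+2.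
have hk : (mdeg k < N)%N by rewrite /N.
pose b i : series K n :=
  \sum_(u : 'X_{1..n < N}) series_poly (f u)%:MP * D u i.
have E1 : (f - scomp h f) k =
  (series_poly (fps_trunc N f) - seval h (fps_trunc N f)) k.
  by rewrite !sCoefB (scompE h_low f hk) /series_poly /fps_of_mpoly fps_truncE.
have E2 : series_poly (fps_trunc N f) - seval h (fps_trunc N f)
        = \sum_i b i * (X i - h i).
  rewrite /fps_trunc (raddf_sum (@series_poly K n)) (raddf_sum (seval h)) /= -sumrB.
  under [RHS]eq_bigr => i _ do rewrite /b mulr_suml.
  rewrite exchange_big /=; apply: eq_bigr => u _.
  rewrite -mul_mpolyC !rmorphM /= sevalC sevalXm -mulrBr (proj2 (hD u)) mulr_sumr.
  by apply: eq_bigr => i _; rewrite mulrA.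
rewrite E1 E2 !sCoef_sum; apply: eq_bigr => i _.
apply/eqP; rewrite -subr_eq0 -sCoefB -mulrBl.
apply/eqP; apply: (@lowM _ _ (mdeg k).+1 0 _ _ _ (fun _ => _)) => //; last first.
  by rewrite addn0.
move=> v hv; rewrite sCoefB /b sCoef_sum; apply/eqP; rewrite subr_eq0; apply/eqP.
under eq_bigr => u _ do rewrite sCoefCM.
apply/esym/(@sum_bmultinom_eq n _ _ (fun u => f u * D u i v)) => // u hu.
by rewrite (proj1 (hD u) i) ?mulr0 //; case: (mdeg u) hu.
Qed.

End Taylor.
End Composition.

Lemma sCoef1 (K : fieldType) n m : (1 : series K n) m = (m == 0%MM)%:R.
Proof. exact: mcoeff1. Qed.

Lemma sCoefP (K : fieldType) n (p : {mpoly K[n]}) m : series_poly p m = p@_m.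
Proof. by []. Qed.

Lemma scomp_0 (K : fieldType) n k (f : series K n) :
  scomp (fun=> 0 : series K k) f = series_poly (f 0%MM)%:MP.
Proof.
apply: seriesP => v; rewrite /scomp.
rewrite -(@fps_truncE _ _ (mdeg v).+1 f 0%MM) ?mdeg0 //; congr (_ v).
elim/mpolyind: (fps_trunc _ _) => [|a u p _ _ IH]; first by rewrite mcoeff0 !raddf0.
rewrite mcoeffD mpolyCD !raddfD /= IH; congr (_ + _).
rewrite -mul_mpolyC rmorphM /= sevalC sevalXm mcoeffCM mcoeffX mpolyCM rmorphM /=.
suff -> : mmap1 (fun=> 0 : series K k) u = series_poly (u == 0%MM)%:R%:MP by [].
have [->|u0] := eqVneq u 0%MM; first by rewrite mmap11.
have [j uj] : exists j, u j != 0%N.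
  apply/existsP; rewrite -negb_forall; apply: contraNN u0 => /forallP u0.
  by apply/eqP/mnmP => j; rewrite mnm0E; apply/eqP.
by rewrite /mmap1 (bigD1 j) //= expr0n (negPf uj) mul0r raddf0.
Qed.

(** * Ideals of power series, units, and the coordinate axes *)

Section Ideals.
Variables (K : fieldType) (n : nat) (I : polyset K n).
Implicit Types (f g : series K n).

Lemma fps_idealP f : fps_ideal I f <->
  exists (r : nat) (a : 'I_r -> series K n) (b : 'I_r -> {mpoly K[n]}),
    (forall i, I (b i)) /\ f = \sum_(i < r) a i * series_poly (b i).
Proof.
split=> -[r [a [b [Ib E]]]]; exists r, a, b; split=> //.
  by apply: seriesP => m; rewrite E sCoef_sum.
by move=> m; rewrite E sCoef_sum.
Qed.

Lemma fps_ideal_ind (P : series K n -> Prop) :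
  P 0 -> (forall f g, P f -> P g -> P (f + g)) ->
  (forall a b, I b -> P (a * series_poly b)) ->
  forall f, fps_ideal I f -> P f.
Proof.
move=> P0 PD PM f /fps_idealP[r [a [b [Ib ->]]]].
by elim/big_ind: _ => // i _; apply: PM.
Qed.

Lemma fps_ideal0 : fps_ideal I (0 : series K n).
Proof.
apply/fps_idealP; exists 0, (fun=> 0), (fun=> 0).
by split; [case|rewrite big_ord0].
Qed.

Lemma fps_ideal_gen b : I b -> fps_ideal I (series_poly b).
Proof.
move=> Ib; apply/fps_idealP; exists 1, (fun=> 1), (fun=> b).
by split=> //; rewrite big_ord1 mul1r.
Qed.

Lemma fps_idealD f g : fps_ideal I f -> fps_ideal I g -> fps_ideal I (f + g).
Proof.
move=> /fps_idealP[r [a [b [Ib ->]]]] /fps_idealP[r' [a' [b' [Ib' ->]]]].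
apply/fps_idealP; exists (r + r')%N.
exists (fun i => match split i with inl i => a i | inr i => a' i end).
exists (fun i => match split i with inl i => b i | inr i => b' i end).
split=> [i|]; first by case: (split i).
rewrite big_split_ord /=; congr (_ + _); apply: eq_bigr => i _.
  by rewrite (unsplitK (inl i)).
by rewrite (unsplitK (inr i)).
Qed.

Lemma fps_idealMl g f : fps_ideal I f -> fps_ideal I (g * f).
Proof.
move=> /fps_idealP[r [a [b [Ib ->]]]]; apply/fps_idealP.
exists r, (fun i => g * a i), b; split=> //.
by rewrite mulr_sumr; apply: eq_bigr => i _; rewrite mulrA.
Qed.

Lemma fps_idealN f : fps_ideal I f -> fps_ideal I (- f).
Proof. by rewrite -mulN1r; apply: fps_idealMl. Qed.

Lemma fps_idealB f g : fps_ideal I f -> fps_ideal I g -> fps_ideal I (f - g).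
Proof. by move=> hf hg; apply: fps_idealD => //; apply: fps_idealN. Qed.

Lemma fps_ideal_sum J (r : seq J) (P : pred J) (F : J -> series K n) :
  (forall i, P i -> fps_ideal I (F i)) ->
  fps_ideal I (\sum_(i <- r | P i) F i).
Proof.
move=> h; elim/big_ind: _ => //; [exact: fps_ideal0|exact: fps_idealD].
Qed.

Lemma fps_ideal_congr f g : fps_ideal I (f - g) -> fps_ideal I f <-> fps_ideal I g.
Proof.
move=> h; split=> [hf|hg].
  by rewrite -[g](subKr f); apply: fps_idealB.
by rewrite -[f](subrK g); apply: fps_idealD.
Qed.

End Ideals.

Lemma fps_ideal_morph (K : fieldType) n k (I : polyset K n) (J : polyset K k)
    (h : 'I_n -> series K k) :
  (forall i, low 1 (h i)) ->
  (forall b, I b -> fps_ideal J (scomp h (series_poly b))) ->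
  forall f, fps_ideal I f -> fps_ideal J (scomp h f).
Proof.
move=> h_low hI; apply: fps_ideal_ind => [|f g Pf Pg|a b Ib].
- by rewrite scomp0 //; apply: fps_ideal0.
- by rewrite scompD //; apply: fps_idealD.
by rewrite scompM //; apply/fps_idealMl/hI.
Qed.

Lemma sCoefMX (K : fieldType) n (a : series K n) w k : (a * series_poly 'X_[w]) (w + k)%MM = a k.
Proof.
set N := (mdeg (w + k)%MM).+1.
rewrite [LHS](@fps_mulE _ _ _ _ _ N) //.
rewrite (@mcoeffM_eq_low _ _ N _ (fps_trunc N a) _ 'X_[w]) //.
  by rewrite mcoeffMX fps_truncE // /N mdegD ltnS leq_addl.
by move=> v hv; rewrite trunc_poly.
Qed.

(** The series with all coefficients 1 is 1 + X + X^2 + ... *)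
Lemma series_geom (K : fieldType) : exists2 g : series K 1,
  g * (1 - series_poly 'X_0) = 1 & forall m, g m = 1.
Proof.
exists (fun=> 1) => //; apply: seriesP => m.
rewrite mulrBr mulr1 sCoefB sCoef1.
have [->|m0] := eqVneq m 0%MM.
  rewrite [X in _ - X](@lowM _ _ 0 1 _ _ (fun _ => _) (@low_X K 1 ord0)) ?subr0 //.
  by rewrite mdeg0.
have -> : m = (U_(ord0) + (m - U_(ord0)))%MM.
  rewrite addmC submK // lep1mP; apply: contraNneq m0 => E.
  by apply/eqP/mnmP => i; rewrite ord1 E mnm0E.
by rewrite sCoefMX subrr.
Qed.

(** With [c] the inverse of the constant term and [w = 1 - c f], which has no constant term, the
    inverse is c / (1 - w): substitute [w] in the geometric series. *)
Lemma series_inv (K : fieldType) n (f : series K n) :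
  f 0%MM != 0 -> exists g, g * f = 1.
Proof.
move=> f0; have [geo hgeo _] := series_geom K.
pose c : series K n := series_poly (f 0%MM)^-1%:MP.
pose w : series K n := 1 - c * f.
have w_low : low 1 w.
  move=> m; rewrite ltnS leqn0 mdeg_eq0 => /eqP ->.
  by rewrite /w sCoefB sCoefCM mulVf // sCoef1 eqxx subrr.
exists (scomp (fun=> w) geo * c); rewrite -mulrA.
rewrite -[c * f](subKr 1) -/w -[1 in RHS](@scomp1 _ 1 _ (fun=> w)) // -hgeo.
by rewrite scompM // scompB // scomp1 // scompX.
Qed.

Section Axes.
Variables (K : fieldType) (m : nat).

Lemma sCoefMX0 n (a : series K n) w u : ~~ (w <= u)%MM ->
  (a * series_poly 'X_[w]) u = 0.
Proof.
move=> hwu; rewrite mulrC [LHS]big1 // => k hk.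
rewrite /series_poly /fps_of_mpoly mcoeffX; case: eqP => [E|]; last by rewrite mul0r.
by case/negP: hwu; rewrite E.
Qed.

Definition axis_incl (b i : 'I_m) : series K 1 :=
  if i == b then series_poly 'X_0 else 0.

Lemma axis_incl_low b i : low 1 (axis_incl b i).
Proof. by rewrite /axis_incl; case: ifP => _; [apply: low_X|apply: low0]. Qed.

Lemma scomp_axis_incl b f v :
  scomp (axis_incl b) f v = f (U_(b) *+ (v ord0))%MM.
Proof.
have low1 := @axis_incl_low b.
set u0 := (U_(b) *+ _)%MM.
have hu0 : mdeg u0 = mdeg v.
  by rewrite mdegMn mdeg1 mul1n mdegE big_ord1.
rewrite (scompE low1 f (ltnSn (mdeg v))) -[f u0](@fps_truncE _ _ (mdeg v).+1) ?hu0 //.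
elim/mpolyind: (fps_trunc _ _) => [|c u p _ _ IH]; first by rewrite raddf0 sCoef0 mcoeff0.
rewrite raddfD /= sCoefD IH mcoeffD; congr (_ + _).
rewrite -mul_mpolyC rmorphM /= sevalC sCoefCM sevalXm mcoeffCM mcoeffX; congr (_ * _).
have [hu|] := boolP [forall i, (i != b) ==> (u i == 0%N)].
  have -> : mmap1 (axis_incl b) u = series_poly 'X_0 ^+ u b.
    rewrite /mmap1 (bigD1 b) //= /axis_incl eqxx big1 ?mulr1 // => i ib.
    by move/forallP/(_ i): hu; rewrite ib /= => /eqP ->; rewrite expr0.
  rewrite -rmorphXn /= mpolyXn sCoefP mcoeffX; congr (_%:R).
  congr nat_of_bool; rewrite /u0; apply/eqP/eqP => [<-|E].
    apply/mnmP => i; rewrite !mulmnE !mnm1E eqxx mul1n.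
    have [->|ib] := eqVneq i b; first by rewrite mul1n.
    by move/forallP/(_ i): hu; rewrite ib /= => /eqP ->; rewrite mul0n.
  apply/mnmP => i; rewrite mulmnE mnm1E ord1 eqxx mul1n.
  by rewrite E mulmnE mnm1E eqxx mul1n.
move=> h; have [i {h}] := elimT forallPn h; rewrite negb_imply => /andP[ib ui].
rewrite /mmap1 (bigD1 i) //= /axis_incl (negPf ib) expr0n (negPf ui) mul0r sCoef0.
case: eqP => // E; case/negP: ui.
by rewrite E mulmnE mnm1E [b == i]eq_sym (negPf ib).
Qed.

(** A series restricts to zero on every axis exactly when it has neither a constant term nor pure
    powers. Every other monomial is divisible by a product of two different variables. *)
Lemma axes_idealP (f : series K m) : (0 < m)%N ->
  fps_ideal (@axes K m) f <-> forall b, scomp (axis_incl b) f = 0.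
Proof.
move=> m_gt0; split=> [|f0].
  move=> hf b; move: f hf; apply: fps_ideal_ind => [|f g hf hg|a p].
  - by rewrite scomp0 //; apply: axis_incl_low.
  - by rewrite scompD ?hf ?hg ?addr0 //; apply: axis_incl_low.
  have lowb := @axis_incl_low b.
  case=> i [j [ij ->]]; rewrite scompM // rmorphM /= scompM // !scompX //.
  rewrite /axis_incl; case: eqVneq => [ib|_]; last by rewrite mul0r mulr0.
  by rewrite -ib eq_sym (negPf ij) !mulr0.
have fs (u : 'X_{1..m}) b : (forall i, i != b -> u i = 0%N) -> f u = 0.
  move=> hu; pose v : 'X_{1..1} := [multinom u b | i < 1].
  have := scomp_axis_incl b f v; rewrite f0 sCoef0 mnmE => ->; congr f.
  apply/mnmP => i; rewrite mulmnE mnm1E; case: (eqVneq b i) => [<-|bi].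
    by rewrite mul1n.
  by rewrite mul0n hu // eq_sym.
(* [sel] chooses one pair of variables dividing the monomial, so that each monomial is charged to
   exactly one of the finitely many generators. *)
pose sel (u : 'X_{1..m}) := [pick p : 'I_m * 'I_m |
   [&& p.1 != p.2, u p.1 != 0%N & u p.2 != 0%N]].
pose w (p : 'I_m * 'I_m) : 'X_{1..m} := (U_(p.1) + U_(p.2))%MM.
pose a (p : 'I_m * 'I_m) : series K m :=
  fun k => if sel (w p + k)%MM == Some p then f (w p + k)%MM else 0.
have -> : f = \sum_(p | p.1 != p.2) a p * series_poly 'X_[w p].
  apply: seriesP => u; rewrite sCoef_sum.
  have E p : p.1 != p.2 -> (a p * series_poly 'X_[w p]) u =
      if sel u == Some p then f u else 0.
    move=> p12; have [le_wu|nle_wu] := boolP (w p <= u)%MM.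
      have Eu : u = (w p + (u - w p))%MM by rewrite addmC submK.
      by rewrite Eu sCoefMX.
    rewrite sCoefMX0 //; case: ifP => // /eqP; rewrite /sel.
    case: pickP => // q /and3P[q12 q1 q2] [Eq]; case/negP: nle_wu.
    apply/mnm_lepP => i; rewrite mnmDE !mnm1E -Eq.
    have [E1|i1] := eqVneq q.1 i.
      by rewrite -E1 [q.2 == _]eq_sym (negPf q12) addn0 lt0n.
    by case: eqVneq => [<-|]; rewrite // add0n lt0n.
  rewrite (eq_bigr _ E) {E}; case E : (sel u) => [p|].
    have p12 : p.1 != p.2.
      by move: E; rewrite /sel; case: pickP => // q /and3P[? _ _] [<-].
    rewrite (bigD1 p) //= eqxx big1 ?addr0 // => q /andP[_ qp].
    by case: eqP => // -[] E'; rewrite E' eqxx in qp.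
  rewrite big1 //; move: E; rewrite /sel; case: pickP => // hsel _.
  have [/existsP[b ub]|] := boolP [exists b, u b != 0%N].
    apply: (fs _ b) => i ib; apply/eqP; apply: contraFT (hsel (b, i)) => ui.
    by rewrite /= eq_sym ib ub.
  rewrite negb_exists => /forallP u0; apply: (fs _ (Ordinal m_gt0)) => i _.
  by apply/eqP; move: (u0 i); rewrite negbK.
apply: fps_ideal_sum => p p12; apply: fps_idealMl.
by apply: fps_ideal_gen; exists p.1, p.2; rewrite mpolyXD.
Qed.

End Axes.

Arguments axis_incl {K m} b i.

(** * The completed local ring of a union of independent branches *)

Section LocalBranches.
Variables (K : fieldType) (n m : nat) (S : polyset K n).
Variables (gam : 'I_m -> 'I_n -> series K 1) (c : 'I_m -> 'I_n -> K).
Local Notation X i := (series_poly 'X_i).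
Local Notation l b := (\sum_i c b i *: 'X_i : {mpoly K[n]}).
Hypothesis m_gt0 : (0 < m)%N.
Hypothesis gam_low : forall b i, low 1 (gam b i).
Hypothesis S_gam : forall g b, S g -> scomp (gam b) (series_poly g) = 0.
Hypothesis l_gam : forall b b', scomp (gam b') (series_poly (l b)) =
  if b == b' then X 0 else 0.
Hypothesis S_l : forall b b', b != b' -> fps_ideal S (series_poly (l b * l b')).
Hypothesis S_coord : forall i,
  fps_ideal S (X i - \sum_b scomp (fun=> series_poly (l b)) (gam b i)).

Lemma low_l b : low 1 (series_poly (l b)).
Proof.
rewrite raddf_sum /=; apply: low_sum => i _.
rewrite -mul_mpolyC rmorphM /=; apply: lowMl; apply: low_X.
Qed.

(** Each branch gets its own variable. As no branch has a constant term, restricting this sum to the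
    axis number b leaves the branch [gam b]. *)
Let Gam i : series K m := \sum_b scomp (fun=> X b) (gam b i).

Let Gam_low i : low 1 (Gam i).
Proof.
apply: low_sum => b _; apply: scomp_low => [_|]; first exact: low_X.
exact: gam_low.
Qed.

Let psi (g : series K m) : series K n := scomp (fun b => series_poly (l b)) g.

Let psi_Gam i : psi (Gam i) = \sum_b scomp (fun=> series_poly (l b)) (gam b i).
Proof.
rewrite /psi scomp_sum.
apply: eq_bigr => b _; rewrite scompA => [|_|b']; last 2 first.
- exact: low_X.
- exact: low_l.
by apply: eq_scomp => _; rewrite scompX // => b'; apply: low_l.
Qed.

(** A linear form commutes with the sum over the branches, and by [l_gam] the branch b' contributes
    its variable if b' = b and nothing otherwise. *)
Let Gam_l b : scomp Gam (series_poly (l b)) = X b.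
Proof.
have E (F : 'I_n -> series K 1) (h : 'I_n -> series K m) b' :
  h = (fun i => scomp (fun=> X b') (F i)) -> (forall i, low 1 (F i)) ->
  scomp h (series_poly (l b)) = scomp (fun=> X b') (scomp F (series_poly (l b))).
  by move=> -> F_low; rewrite scompA // => _; apply: low_X.
have lin (k : nat) (h : 'I_n -> series K k) : (forall i, low 1 (h i)) ->
    scomp h (series_poly (l b)) = \sum_i series_poly (c b i)%:MP * h i.
  move=> h_low; rewrite raddf_sum /= scomp_sum //; apply: eq_bigr => i _.
  by rewrite -mul_mpolyC rmorphM /= scompM // scompC // scompX.
rewrite lin // /Gam; under eq_bigr do rewrite mulr_sumr.
rewrite exchange_big /=.
have E' b' : \sum_i series_poly (c b i)%:MP * scomp (fun=> X b') (gam b' i) =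
   scomp (fun=> X b') (if b == b' then X 0 else 0 : series K 1).
  have lowX (i : 'I_1) : low 1 (X b' : series K m) by apply: low_X.
  rewrite -l_gam lin // scomp_sum //; apply: eq_bigr => i _.
  by rewrite scompM // scompC.
under eq_bigr => b' _ do rewrite E'.
rewrite (bigD1 b) //= eqxx scompX => [|_]; last exact: low_X.
by rewrite big1 ?addr0 // => b' bb'; rewrite eq_sym (negPf bb') scomp0.
Qed.

(** [Gam] and [psi], which sends the b-th variable to [l b], are inverse to each other modulo the
    two ideals. One composite is the identity on the nose by [Gam_l]. The other sends X_i to
    something congruent to X_i by [S_coord], and [taylor] extends this to all series. *)
Theorem branches_analytically_isomorphic :
  analytically_isomorphic S (@axes K m).
Proof.
have E0 (f g : series K m) : f = g -> fps_ideal (@axes K m) (fps_sub f g).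
  by move=> ->; rewrite -[fps_sub _ _]/(g - g) subrr; apply: fps_ideal0.
have lowl := low_l.
have axis_Gam b : (fun i => scomp (axis_incl b) (Gam i)) = gam b.
  apply/funext => i; rewrite scomp_sum.
  have E b' : scomp (axis_incl b) (scomp (fun=> X b') (gam b' i)) =
      scomp (fun=> if b' == b then X 0 else 0) (gam b' i).
    rewrite scompA => [|_|j]; last 2 first.
    - exact: low_X.
    - exact: axis_incl_low.
    by apply: eq_scomp => _; rewrite scompX // => j; apply: axis_incl_low.
  rewrite (bigD1 b) //= big1 ?addr0 => [|b' bb']; rewrite E.
    rewrite eqxx -[RHS]scomp_id; apply: eq_scomp => j; by rewrite ord1.
  by rewrite (negPf bb') scomp_0 gam_low ?mdeg0 // !raddf0.
exists (scomp Gam); split.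
- by move=> f g; apply: E0; rewrite -[fps_add f g]/((f : series K n) + g) scompD.
- by move=> f g; apply: E0; rewrite -[fps_mul f g]/((f : series K n) * g) scompM.
- by move=> a; apply: E0; apply: scompC.
(* A series with image in the ideal of the axes: apply [psi], which maps that ideal into [S] by
   [S_l], and use that [psi] after [Gam] is congruent to the identity. *)
- move=> f; split=> [hf|].
    apply/(fps_ideal_congr (g := psi (scomp Gam f))); last first.
      rewrite /psi; apply: fps_ideal_morph hf => // p [b [b' [bb' ->]]].
      by rewrite rmorphM /= scompM // !scompX // -rmorphM; apply: S_l.
    rewrite /psi scompA //.
    have hlow i : low 1 (scomp (fun b => series_poly (l b)) (Gam i)).
      exact: scomp_low.
    have [d ->] := taylor hlow f.
    apply: fps_ideal_sum => i _; apply: fps_idealMl.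
    by rewrite -/(psi _) psi_Gam; apply: S_coord.
  apply: fps_ideal_morph => // p Sp; apply/axes_idealP => // b.
  rewrite scompA // => [|j]; last exact: axis_incl_low.
  by rewrite axis_Gam S_gam.
move=> g; exists (psi g); apply: E0; rewrite /psi scompA //.
rewrite -[LHS]scomp_id; apply: eq_scomp => b; by rewrite Gam_l.
Qed.

End LocalBranches.

(** * Linear forms, and polynomials that vanish as functions *)

Section LinearForms.
Variables (R : comRingType) (n : nat).

Definition lform (c : 'cV[R]_n) : {mpoly R[n]} := \sum_i c i 0 *: 'X_i.

Lemma lform_meval c (x : 'rV[R]_n) : (lform c).@[x 0] = (x *m c) 0 0.
Proof.
rewrite raddf_sum mxE; apply: eq_bigr => i _ /=.
by rewrite mevalZ mevalXU mulrC.
Qed.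

Lemma lform_homog c : lform c \is 1.-homog.
Proof.
by apply: rpred_sum => i _; apply: dhomogZ; rewrite dhomogX /= mdeg1.
Qed.

(** The recentring substitution used in [germ]. *)
Definition shift (p : 'rV[R]_n) (g : {mpoly R[n]}) : {mpoly R[n]} :=
  g \mPo [tuple (p 0 i)%:MP + 'X_i | i < n].

Lemma shift_lform p c : shift p (lform c) = ((p *m c) 0 0)%:MP + lform c.
Proof.
rewrite /shift raddf_sum /= mxE raddf_sum -big_split; apply: eq_bigr => i _ /=.
by rewrite comp_mpolyZ comp_mpolyXU -tnth_nth tnth_mktuple scalerDr -mul_mpolyC -mpolyCM mulrC.
Qed.

Lemma shiftM p : {morph shift p : f g / f * g}.
Proof. by move=> f g; rewrite /shift rmorphM. Qed.

Lemma shift_coef0 p g : (shift p g)@_0%MM = g.@[p 0].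
Proof.
have E h : h@_0%MM = h.@[fun=> 0] :> R.
  elim/mpolyind: h => [|c u h _ _ IH]; first by rewrite mcoeff0 meval0.
  rewrite mcoeffD mevalD IH; congr (_ + _); rewrite mcoeffZ mevalZ mcoeffX mevalX.
  congr (_ * _); have [->|u0] := eqVneq u 0%MM.
    by rewrite big1 // => i _; rewrite mnm0E expr0.
  have [j uj] : exists j, u j != 0%N.
    apply/existsP; rewrite -negb_forall; apply: contraNN u0 => /forallP u0.
    by apply/eqP/mnmP => j; rewrite mnm0E; apply/eqP.
  by rewrite (bigD1 j) //= expr0n (negPf uj) mul0r.
rewrite E /shift comp_mpoly_meval; apply: meval_eq => i.
by rewrite tnth_mktuple mevalD mevalC mevalXU addr0.
Qed.

Lemma comp_mpolyA k l (g : {mpoly R[n]}) (h : n.-tuple {mpoly R[k]})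
    (h' : k.-tuple {mpoly R[l]}) :
  (g \mPo h) \mPo h' = g \mPo [tuple tnth h i \mPo h' | i < n].
Proof.
elim/mpolyind: g => [|c u g _ _ IH]; first by rewrite !comp_mpoly0.
rewrite !comp_mpolyD IH !comp_mpolyZ; congr (_ *: _ + _).
rewrite !comp_mpolyX rmorph_prod; apply: eq_bigr => i _.
by rewrite rmorphXn tnth_mktuple.
Qed.

End LinearForms.

Lemma scomp_mpoly (K : fieldType) n k (h : 'I_n -> {mpoly K[k]}) g :
  (forall i, low 1 (series_poly (h i))) ->
  scomp (fun i => series_poly (h i)) (series_poly g) =
  series_poly (g \mPo [tuple h i | i < n]).
Proof.
move=> h_low; rewrite scomp_poly //.
elim/mpolyind: g => [|c u g _ _ IH]; first by rewrite comp_mpoly0 !raddf0.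
rewrite comp_mpolyD !raddfD /= IH comp_mpolyZ -!mul_mpolyC !rmorphM /= sevalC.
rewrite sevalXm comp_mpolyX /mmap1 rmorph_prod; congr (_ * _ + _).
by apply: eq_bigr => i _; rewrite rmorphXn tnth_mktuple.
Qed.

Lemma low_lform (K : fieldType) n (c : 'cV[K]_n) : low 1 (series_poly (lform c)).
Proof. exact: (@low_l K n 1 (fun _ i => c i 0) ord0). Qed.

Section Vanishing.
Variable K : numFieldType.

Lemma poly_fun_eq0 (p : {poly K}) : (forall x, p.[x] = 0) -> p = 0.
Proof.
move=> h; pose rs : seq K := [seq i%:R | i <- iota 0 (size p)].
apply: (@roots_geq_poly_eq0 _ p rs); last by rewrite size_map size_iota.
  by apply/allP => x _; apply/rootP.
rewrite map_inj_uniq ?iota_uniq // => i j /eqP.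
by rewrite eqr_nat => /eqP.
Qed.

Lemma poly_cofinite_eq0 (e p : {poly K}) : e != 0 ->
  (forall x, e.[x] != 0 -> p.[x] = 0) -> p = 0.
Proof.
move=> e0 h; apply/eqP; have /eqP : e * p = 0.
  apply: poly_fun_eq0 => x; rewrite hornerM.
  by have [->|/h ->] := eqVneq e.[x] 0; rewrite ?mul0r ?mulr0.
by rewrite mulf_eq0 (negPf e0).
Qed.

Lemma mpoly2_fun_eq0 (p : {mpoly K[2]}) : (forall v, p.@[v] = 0) -> p = 0.
Proof.
move=> hp.
pose h (i : 'I_2) : {poly {poly K}} := if i == ord0 then 'X else 'X%:P.
(* [f] reads a polynomial in two variables as a polynomial in X_0 over polynomials in X_1; the case
   of one variable is then used twice. *)
pose f : {mpoly K[2]} -> {poly {poly K}} := mmap (polyC \o polyC) h.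
have fm u : mmap1 h u = 'X^(u ord0) * ('X^(u ord_max))%:P.
  rewrite /mmap1 big_ord_recl big_ord1 (_ : lift ord0 ord0 = ord_max); last exact: val_inj.
  by rewrite /h /= rmorphXn.
have f0 : f p = 0.
  have E x y q : (f q).[x%:P].[y] = q.@[fun i => if i == ord0 then x else y].
    rewrite /f; elim/mpolyind: q => [|c u q _ _ IH]; first by rewrite raddf0 meval0 !horner0.
    rewrite raddfD /= !hornerD IH mevalD mmapZ mmapX fm mevalZ mevalX; congr (_ + _).
    rewrite /= !(hornerM, hornerC, hornerXn) -rmorphXn /= !(hornerM, hornerC, hornerXn).
    by rewrite big_ord_recl big_ord1 (_ : lift ord0 ord0 = ord_max) /= ?mulrA //; apply: val_inj.
  apply/polyP => i; rewrite coef0; apply/polyP => j; rewrite coef0.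
  have Ey y : map_poly (horner_eval y) (f p) = 0.
    apply: poly_fun_eq0 => x; have := E x y p; rewrite hp => <-.
    by rewrite -[x in LHS](hornerC x y) -/(horner_eval y _) horner_map.
  have : (f p)`_i = 0.
    apply: poly_fun_eq0 => y; have /(congr1 (fun q : {poly K} => q`_i)) := Ey y.
    by rewrite coef0 coef_map.
  by move=> ->; rewrite coef0.
apply/mpolyP => w; rewrite mcoeff0.
have -> : p@_w = (f p)`_(w ord0)`_(w ord_max); last by rewrite f0 !coef0.
rewrite /f; elim/mpolyind: p {hp f0} => [|c u q _ _ IH].
  by rewrite mcoeff0 raddf0 !coef0.
rewrite mcoeffD raddfD /= IH !coefD; congr (_ + _).
rewrite mmapZ mmapX fm /= mcoeffZ mcoeffX mulrA coefMC coefCM coefXn.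
case: (eqVneq u w) => [->|uw]; first by rewrite !eqxx !mulr1n !mulr1 coefCM coefXn eqxx mulr1.
case: (eqVneq (w ord0) (u ord0)) => [E0|]; last by rewrite !mulr0 mul0r coef0.
rewrite mulr1n mulr1 coefCM coefXn; case: (eqVneq (w ord_max) (u ord_max)) => [E1|] //.
case/negP: uw; apply/eqP/mnmP => i.
by case: i => -[|[|//]] hi; [rewrite (_ : Ordinal hi = ord0)|rewrite (_ : Ordinal hi = ord_max)];
  rewrite ?E0 ?E1 //; apply: val_inj.
Qed.

Lemma mpoly1_fun_eq0 (p : {mpoly K[1]}) : (forall v, p.@[v] = 0) -> p = 0.
Proof.
move=> hp; pose q := p \mPo [tuple 'X_ord0 : {mpoly K[2]} | i < 1].
have q0 : q = 0 by apply: mpoly2_fun_eq0 => v; rewrite comp_mpoly_meval hp.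
have : q \mPo [tuple 'X_ord0 : {mpoly K[1]} | i < 2] = 0 by rewrite q0 comp_mpoly0.
rewrite comp_mpolyA => <-; rewrite -[LHS]comp_mpoly_id; congr (_ \mPo _).
apply: eq_from_tnth => i; rewrite !tnth_mktuple comp_mpolyXU -tnth_nth tnth_mktuple.
by rewrite ord1.
Qed.

End Vanishing.

(** * From projections of the ambient space to coordinates on the branches *)

Section Branches.
Variables (K : numFieldType) (n : nat).
Implicit Types (Z : pset K n) (p x : 'rV[K]_n) (f g : {mpoly K[n]}).

Definition cone Z := forall x c, c != 0 -> Z x -> Z (c *: x).

(** The polynomial c |-> f(c x) vanishes for c != 0, hence at c = 0. The case is needed because
    [vanishing] speaks of nonzero vectors only, while polynomial parametrizations may take the value
    0. *)
Lemma vanishing_at_0 Z x f : cone Z -> Z x -> vanishing Z f -> f.@[(0 : 'rV[K]_n) 0] = 0.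
Proof.
move=> coneZ Zx vf.
pose q : {poly K} := mmap polyC (fun i => (x 0 i)%:P * 'X) f.
have E c : q.[c] = f.@[(c *: x) 0].
  rewrite /q; elim/mpolyind: (f) => [|a u h _ _ IH]; first by rewrite raddf0 meval0 horner0.
  rewrite raddfD /= hornerD IH mevalD mmapZ mmapX mevalZ mevalX hornerM hornerC.
  congr (_ * _ + _); rewrite /mmap1 horner_prod; apply: eq_bigr => i _.
  by rewrite horner_exp !(hornerM, hornerC, hornerX) mxE mulrC.
have q0 : q = 0.
  apply: (@poly_cofinite_eq0 _ 'X) => [|c]; first by rewrite polyX_eq0.
  by rewrite hornerX => c0; rewrite E vf //; apply: coneZ.
by have := E 0; rewrite q0 horner0 scale0r.
Qed.

Lemma mulmx_col x k (M : 'M[K]_n) : (x *m col k M) 0 0 = (x *m M) 0 k.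
Proof. by rewrite !mxE; apply: eq_bigr => i _; rewrite mxE. Qed.

Definition pull (M : 'M[K]_n) f : {mpoly K[n]} :=
  f \mPo [tuple lform (col k M) | k < n].

Lemma pull_meval M f x : (pull M f).@[x 0] = f.@[(x *m M) 0].
Proof.
rewrite /pull comp_mpoly_meval; apply: meval_eq => k.
by rewrite tnth_mktuple lform_meval mulmx_col.
Qed.

Lemma shift_pull p M f : p *m M = p ->
  shift p (pull M f) = shift p f \mPo [tuple lform (col k M) | k < n].
Proof.
move=> pM; rewrite /shift /pull [LHS]comp_mpolyA [RHS]comp_mpolyA.
apply: (congr1 (fun h : n.-tuple {mpoly K[n]} => f \mPo h)).
apply: eq_from_tnth => k; rewrite !tnth_mktuple.
rewrite -[LHS]/(shift p (lform (col k M))) shift_lform.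
rewrite comp_mpolyD comp_mpolyC comp_mpolyXU -tnth_nth tnth_mktuple; congr (_%:MP + _).
rewrite -{2}pM !mxE; apply: eq_bigr => i _; by rewrite mxE.
Qed.

Lemma shift_lform0 p c : (p *m c) 0 0 = 0 -> shift p (lform c) = lform c.
Proof. by move=> h; rewrite shift_lform h mpolyC0 add0r. Qed.

Lemma scomp_lform k (h : 'I_n -> series K k) (c : 'cV[K]_n) :
  (forall i, low 1 (h i)) ->
  scomp h (series_poly (lform c)) = \sum_i series_poly (c i 0)%:MP * h i.
Proof.
move=> h_low; rewrite /lform raddf_sum /= scomp_sum; apply: eq_bigr => i _.
by rewrite -mul_mpolyC rmorphM /= scompM // scompC // scompX.
Qed.

(** [gam] parametrizes the germ of Z formally in the chart x_j = p_j, and [c] is a linear form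
    through p that restricts to the parameter itself. By the last clause every coordinate is, modulo
    the germ, the series [gam i] in this form, so the form generates the local ring. *)
Definition smooth_branch Z p (j : 'I_n) :=
  exists (gam : 'I_n -> series K 1) (c : 'cV[K]_n),
  [/\ (forall i, low 1 (gam i)) /\ gam j = 0,
      (p *m c) 0 0 = 0,
      forall f, vanishing Z f -> scomp gam (series_poly (shift p f)) = 0,
      scomp gam (series_poly (lform c)) = series_poly 'X_ord0 &
      forall i, fps_ideal (germ (vanishing Z) p j)
        (series_poly 'X_i - scomp (fun=> series_poly (lform c)) (gam i))].

(** A polynomial nonzero at p is a unit in the completed local ring. Equations of components that
    avoid p can therefore be cancelled. *)
Lemma germ_local (I : polyset K n) p j g u :
  I (u * g) -> u.@[p 0] != 0 -> fps_ideal (germ I p j) (series_poly (shift p g)).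
Proof.
move=> Iug up.
have : fps_ideal (germ I p j) (series_poly (shift p (u * g))).
  by apply: fps_ideal_gen; left; exists (u * g).
rewrite shiftM rmorphM /=.
have [v hv] : exists v, v * series_poly (shift p u) = 1.
  by apply: series_inv; rewrite sCoefP shift_coef0.
by move=> /(fps_idealMl v); rewrite mulrA hv mul1r.
Qed.

(** [M b] is the identity on the b-th component and collapses the others to the line of p; its
    existence is the independence of the tangent directions. Pulling the local parameter of [Z b]
    back along [M b] gives a linear form that is the parameter on [Z b] and zero on the other
    components. The condition on column j says that [M b] preserves the chart x_j = p_j. *)
Theorem union_analytically_isomorphic (I : polyset K n) p (j : 'I_n) m
    (Z : 'I_m -> pset K n) (M : 'I_m -> 'M[K]_n) :
  (0 < m)%N -> p 0 j != 0 ->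
  (forall b, cone (Z b)) -> (forall b, Z b p) ->
  (forall b, smooth_branch (Z b) p j) ->
  (forall b x, Z b x -> x *m M b = x) ->
  (forall b b' x, b != b' -> Z b' x -> x *m M b = (x 0 j / p 0 j) *: p) ->
  (forall b i, M b i j = (i == j)%:R) ->
  (forall b f, I f -> vanishing (Z b) f) ->
  (forall f, (forall b, vanishing (Z b) f) ->
     fps_ideal (germ I p j) (series_poly (shift p f))) ->
  analytically_isomorphic (germ I p j) (@axes K m).
Proof.
move=> m_gt0 pj coneZ Zp hsb; have [gam hg] := choice hsb.
have [c hgc] := choice hg => {hsb hg}.
move=> Zid Zproj Mj IZ ZI.
pose S := germ I p j.
have gl b i : low 1 (gam b i) by case: (hgc b) => -[].
pose l b := lform (M b *m c b).
have lE b : l b = pull (M b) (lform (c b)).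
  rewrite /l /pull /lform raddf_sum /=.
  under [RHS]eq_bigr => i _ do
    rewrite comp_mpolyZ comp_mpolyXU -tnth_nth tnth_mktuple /lform scaler_sumr.
  rewrite exchange_big; apply: eq_bigr => i _ /=.
  rewrite mxE scaler_suml; apply: eq_bigr => k _.
  by rewrite mxE scalerA mulrC.
have pM b : p *m M b = p by apply: Zid.
have lp b : (p *m (M b *m c b)) 0 0 = 0.
  by rewrite mulmxA pM; case: (hgc b).
have sl b : shift p (l b) = l b by apply: shift_lform0.
(* On [Z b'] the behaviour of [M b] is a system of linear equations in x, so it passes to the
   parametrization [gam b']. When b != b' the value is a multiple of [gam b' j], which is 0. *)
have Mgam b b' : forall k, \sum_i series_poly (M b i k)%:MP * gam b' i =
    if b == b' then gam b' k else 0.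
  move=> k; pose d : 'cV[K]_n := if b == b' then delta_mx k 0
     else (p 0 k / p 0 j) *: delta_mx j 0.
  have vd : vanishing (Z b') (lform (col k (M b) - d)).
    move=> x Zx; rewrite lform_meval mulmxBr mxE mulmx_col.
    rewrite /d; have [E|bb'] := eqVneq b b'.
      rewrite E Zid // !mxE (bigD1 k) //= !mxE !eqxx mulr1 big1 ?addr0 ?subrr // => i ik.
      by rewrite !mxE (negPf ik) mulr0.
    rewrite (Zproj _ _ _ bb' Zx) !mxE (bigD1 j) //= !mxE !eqxx mulr1 big1 => [|i ij].
      by rewrite addr0; field.
    by rewrite !mxE (negPf ij) !mulr0.
  have [_ _ /(_ _ vd) + _ _] := hgc b'.
  rewrite shift_lform0; last by rewrite -lform_meval; apply: vd.
  rewrite scomp_lform //.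
  under eq_bigr => i _ do rewrite !mxE mpolyCB raddfB /= mulrBl.
  rewrite sumrB => /eqP; rewrite subr_eq0 => /eqP ->.
  rewrite /d; have [E|bb'] := eqVneq b b'.
    rewrite (bigD1 k) //= !mxE !eqxx mpolyC1 rmorph1 mul1r big1 ?addr0 // => i ik.
    by rewrite !mxE (negPf ik) mpolyC0 raddf0 mul0r.
  have gj : gam b' j = 0 by case: (hgc b') => -[].
  rewrite big1 // => i _; rewrite !mxE; have [->|ij] := eqVneq i j.
    by rewrite gj mulr0.
  by rewrite mulr0 mpolyC0 raddf0 mul0r.
have lgam b b' : scomp (gam b') (series_poly (l b)) =
    if b == b' then series_poly 'X_ord0 else 0.
  rewrite scomp_lform //.
  have -> : \sum_i series_poly ((M b *m c b) i 0)%:MP * gam b' i =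
    \sum_k series_poly (c b k 0)%:MP * (if b == b' then gam b' k else 0).
    under [RHS]eq_bigr => k _ do rewrite -Mgam mulr_sumr.
    rewrite exchange_big; apply: eq_bigr => i _ /=.
    rewrite mxE !raddf_sum /= mulr_suml; apply: eq_bigr => k _.
    by rewrite mpolyCM rmorphM /= mulrA [X in X * _]mulrC.
  have [E|_] := eqVneq b b'; last by rewrite big1 // => k _; rewrite mulr0.
  by rewrite -scomp_lform // E; case: (hgc b').
have Sj : fps_ideal S (series_poly 'X_j) by apply: fps_ideal_gen; right.
apply: (@branches_analytically_isomorphic K n m S gam (fun b i => (M b *m c b) i 0)) => //.
- move=> f b [[g Ig ->]|->].
    by case: (hgc b) => _ _ h _ _; apply/h/IZ.
  by rewrite scompX //; case: (hgc b) => -[].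
- move=> b b' bb'; rewrite -[X in fps_ideal S X]/(series_poly (l b * l b')).
  rewrite -(sl b) -(sl b') -shiftM; apply: ZI => b'' x Zx; rewrite mevalM.
  have l0 b1 : b1 != b'' -> (l b1).@[x 0] = 0.
    move=> bb1; rewrite lE pull_meval (Zproj _ _ _ bb1 Zx) lform_meval.
    by rewrite -scalemxAl mxE; case: (hgc b1) => _ -> _ _ _; rewrite mulr0.
  have [E|bb''] := eqVneq b b''; last by rewrite (l0 b) // mul0r.
  by rewrite (l0 b') ?mulr0 // -E eq_sym.
move=> i; rewrite -[X in fps_ideal S X]/(series_poly 'X_i -
   \sum_b scomp (fun=> series_poly (l b)) (gam b i)).
have Mlow b k : low 1 (series_poly (lform (col k (M b)))) by apply: low_lform.
(* The last clause of [smooth_branch] for [Z b], pulled back along [M b]. The pullback maps the germ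
   of [Z b] into [S], because on the other components it only takes values proportional to p. *)
have H1 b : fps_ideal S (series_poly (lform (col i (M b))) -
    scomp (fun=> series_poly (l b)) (gam b i)).
  have [_ _ _ _ /(_ i) hS] := hgc b.
  have := @fps_ideal_morph K n n _ S (fun k => series_poly (lform (col k (M b)))) (Mlow b) _ _ hS.
  rewrite scompB scompX // scompA => [|_|]; last 2 first.
  - exact: low_lform.
  - exact: Mlow.
  have -> : scomp (fun=> scomp (fun k => series_poly (lform (col k (M b))))
      (series_poly (lform (c b)))) (gam b i) = scomp (fun=> series_poly (l b)) (gam b i).
    by apply: eq_scomp => _; rewrite scomp_mpoly // lE.
  apply => f [[g vg ->]|->].
    rewrite scomp_mpoly // -shift_pull //; apply: ZI => b' x Zx.
    rewrite pull_meval; have [E|bb'] := eqVneq b b'.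
      by rewrite Zid; [apply: vg; rewrite E|rewrite E].
    rewrite (Zproj _ _ _ bb' Zx).
    have [->|xj] := eqVneq (x 0 j / p 0 j) 0; last by apply: vg; apply: coneZ.
    by rewrite scale0r; apply: vanishing_at_0 (Zp b) vg.
  rewrite scompX //.
  have -> : lform (col j (M b)) = 'X_j; last by [].
  rewrite /lform (bigD1 j) //= mxE Mj eqxx scale1r big1 ?addr0 // => k kj.
  by rewrite mxE Mj (negPf kj) scale0r.
(* On the union, x - q is the sum over b of x M_b - q, where q = (x_j / p_j) p: all summands but one
   vanish. [d] is the i-th coordinate of this relation. *)
pose d : 'cV[K]_n := delta_mx i 0 - (p 0 i / p 0 j) *: delta_mx j 0
   - \sum_b (col i (M b) - (p 0 i / p 0 j) *: delta_mx j 0).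
have ld e : lform (e : 'cV[K]_n) = \sum_k e k 0 *: 'X_k by [].
have lB e e' : lform (e - e' : 'cV[K]_n) = lform e - lform e'.
  by rewrite !ld -sumrB; apply: eq_bigr => k _; rewrite !mxE scalerBl.
have lZ a e : lform (a *: e : 'cV[K]_n) = a *: lform e.
  by rewrite !ld scaler_sumr; apply: eq_bigr => k _; rewrite mxE scalerA.
have lX k : lform (delta_mx k 0 : 'cV[K]_n) = 'X_k.
  rewrite ld (bigD1 k) //= mxE !eqxx scale1r big1 ?addr0 // => k' kk'.
  by rewrite mxE (negPf kk') scale0r.
have lsum (F : 'I_m -> 'cV[K]_n) : lform (\sum_b F b) = \sum_b lform (F b).
  rewrite ld; under [RHS]eq_bigr => b _ do rewrite ld.
  rewrite exchange_big; apply: eq_bigr => k _ /=.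
  by rewrite summxE scaler_suml.
have meq x k : (lform (delta_mx k 0 : 'cV[K]_n)).@[x 0] = x 0 k.
  by rewrite lX mevalXU.
have vd b : vanishing (Z b) (lform d).
  move=> x Zx; rewrite /d !lB lZ lsum !mevalB mevalZ !meq (raddf_sum (meval (x 0))) /=.
  rewrite (bigD1 b) //= big1 ?addr0 => [|b' bb']; rewrite lB lZ mevalB mevalZ meq.
    rewrite lform_meval mulmx_col Zid //; by rewrite subrr.
  rewrite lform_meval mulmx_col (Zproj _ _ _ bb' Zx) mxE; by field.
have H2 : fps_ideal S (series_poly (lform d)).
  have dp : (p *m d) 0 0 = 0 by rewrite -lform_meval; apply: (vd (Ordinal m_gt0)).
  by rewrite -(shift_lform0 dp); apply: ZI.
have -> : series_poly 'X_i - \sum_b scomp (fun=> series_poly (l b)) (gam b i) =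
  series_poly (lform d) + series_poly (p 0 i / p 0 j)%:MP * series_poly 'X_j
  + \sum_b ((series_poly (lform (col i (M b))) - scomp (fun=> series_poly (l b)) (gam b i))
     - series_poly (p 0 i / p 0 j)%:MP * series_poly 'X_j).
  have Es : \sum_b series_poly (lform (col i (M b) - (p 0 i / p 0 j) *: delta_mx j 0)) =
    \sum_b series_poly (lform (col i (M b)))
    - \sum_(b < m) series_poly (p 0 i / p 0 j)%:MP * series_poly 'X_j.
    rewrite -sumrB; apply: eq_bigr => b _.
    by rewrite lB lZ lX raddfB /= -mul_mpolyC rmorphM.
  rewrite /d lB lB lsum lZ !lX 2!raddfB /= (raddf_sum (@series_poly K n)) /= Es.
  by rewrite -mul_mpolyC rmorphM /= !sumrB; ring.
apply: fps_idealD; first by apply: fps_idealD => //; apply: fps_idealMl.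
by apply: fps_ideal_sum => b _; apply: fps_idealB => //; apply: fps_idealMl.
Qed.

End Branches.

(** * Smooth branches of lines and conics *)

Section LformTheory.
Variables (R : comRingType) (n : nat).
Implicit Types c : 'cV[R]_n.

Lemma lformB c c' : lform (c - c') = lform c - lform c'.
Proof. by rewrite /lform -sumrB; apply: eq_bigr => k _; rewrite !mxE scalerBl. Qed.
Lemma lformZ a c : lform (a *: c) = a *: lform c.
Proof. by rewrite /lform scaler_sumr; apply: eq_bigr => k _; rewrite mxE scalerA. Qed.
Lemma lform_delta i : lform (delta_mx i 0 : 'cV[R]_n) = 'X_i.
Proof.
rewrite /lform (bigD1 i) //= mxE !eqxx scale1r big1 ?addr0 // => k ki.
by rewrite mxE (negPf ki) scale0r.
Qed.
Lemma mulmx_delta (x : 'rV[R]_n) i : (x *m (delta_mx i 0 : 'cV[R]_n)) 0 0 = x 0 i.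
Proof. by rewrite -lform_meval lform_delta mevalXU. Qed.
Lemma evD (x y : 'rV[R]_n) c : ((x + y) *m c) 0 0 = (x *m c) 0 0 + (y *m c) 0 0.
Proof. by rewrite mulmxDl mxE. Qed.
Lemma evN (x : 'rV[R]_n) c : (- x *m c) 0 0 = - (x *m c) 0 0.
Proof. by rewrite mulNmx mxE. Qed.
Lemma evZ a (x : 'rV[R]_n) c : ((a *: x) *m c) 0 0 = a * (x *m c) 0 0.
Proof. by rewrite -scalemxAl mxE. Qed.
Lemma evcB (x : 'rV[R]_n) c c' : (x *m (c - c')) 0 0 = (x *m c) 0 0 - (x *m c') 0 0.
Proof. by rewrite -!lform_meval lformB mevalB. Qed.
Lemma evcZ a (x : 'rV[R]_n) c : (x *m (a *: c)) 0 0 = a * (x *m c) 0 0.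
Proof. by rewrite -!lform_meval lformZ mevalZ. Qed.
Definition evE := (evD, evN, evZ).
End LformTheory.

Lemma seval_comp (K : fieldType) n k m (h : 'I_k -> series K m)
    (t : n.-tuple {mpoly K[k]}) g :
  seval h (g \mPo t) = seval (fun i => seval h (tnth t i)) g.
Proof.
elim/mpolyind: g => [|c u g _ _ IH]; first by rewrite comp_mpoly0 !raddf0.
rewrite comp_mpolyD !raddfD /= IH comp_mpolyZ -!mul_mpolyC !rmorphM /= !sevalC.
rewrite sevalXm comp_mpolyX rmorph_prod; congr (_ * _ + _).
by apply: eq_bigr => i _; rewrite rmorphXn.
Qed.

Section Curves.
Variables (K : numFieldType) (n : nat).
Implicit Types (u v w p x : 'rV[K]_n) (f : 'cV[K]_n).

Definition lineset u v : pset K n :=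
  fun x => x != 0 /\ exists a b, x = a *: u + b *: v.

Definition conicset u v w (al be ga : K) : pset K n :=
  fun x => x != 0 /\ exists a b c,
    x = a *: u + b *: v + c *: w /\ al * a * b + be * a * c + ga * b * c = 0.

Lemma lineset_cone u v : cone (lineset u v).
Proof.
move=> x c c0 [x0 [a [b E]]]; split; first by rewrite scaler_eq0 negb_or c0.
by exists (c * a), (c * b); rewrite E scalerDr !scalerA.
Qed.

Lemma conicset_cone u v w al be ga : cone (conicset u v w al be ga).
Proof.
move=> x k k0 [x0 [a [b [c [E q0]]]]]; split; first by rewrite scaler_eq0 negb_or k0.
exists (k * a), (k * b), (k * c); split; first by rewrite E !scalerDr !scalerA.
by rewrite -(mulr0 (k * k)) -q0; ring.
Qed.

Lemma conicset_swap12 u v w al be ga :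
  conicset u v w al be ga = conicset v u w al ga be.
Proof.
apply/funext => x; apply/propext; split=> -[x0 [a [b [c [E q0]]]]]; split=> //;
  (exists b, a, c; split; last by rewrite -q0; ring); by rewrite E [b *: _ + _]addrC.
Qed.

Lemma conicset_swap13 u v w al be ga :
  conicset u v w al be ga = conicset w v u ga be al.
Proof.
apply/funext => x; apply/propext; split=> -[x0 [a [b [c [E q0]]]]]; split=> //;
  (exists c, b, a; split; last by rewrite -q0; ring);
  by rewrite E [_ + c *: _]addrC [a *: _ + _]addrC addrA.
Qed.

Lemma smooth_branch_line p v j f : p 0 j != 0 ->
  (p *m f) 0 0 = 0 -> (v *m f) 0 0 = 1 -> smooth_branch (lineset p v) p j.
Proof.
(* [v'] is the direction of the line with j-th coordinate 0, so that y |-> p + y v' stays in the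
   chart. *)
move=> pj pf vf; pose v' := v - (v 0 j / p 0 j) *: p.
have v'j : v' 0 j = 0 by rewrite !mxE; field.
have v'f : (v' *m f) 0 0 = 1.
  by rewrite /v' !evE vf pf mulr0 subr0.
pose h i : {mpoly K[1]} := (v' 0 i)%:MP * 'X_ord0.
have h_low i : low 1 (series_poly (h i)).
  by rewrite rmorphM; apply: lowMl; apply: low_X.
exists (fun i => series_poly (h i)), f; split=> //.
- by split=> //; rewrite /h v'j mpolyC0 mul0r raddf0.
- move=> g vg; rewrite scomp_mpoly //.
  suff -> : shift p g \mPo [tuple h i | i < n] = 0 by rewrite raddf0.
  apply: mpoly1_fun_eq0 => y; rewrite comp_mpoly_meval /shift comp_mpoly_meval.
  pose x := p + y ord0 *: v'.
  transitivity (g.@[x 0]).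
    apply: meval_eq => i.
    by rewrite tnth_mktuple mevalD mevalC mevalXU tnth_mktuple /h mevalM mevalC mevalXU !mxE mulrC.
  apply: vg; split.
    apply: contra_neq pj => /(congr1 (fun z : 'rV_n => z 0 j)).
    by rewrite mxE [X in _ + X]mxE v'j mulr0 addr0 mxE.
  exists (1 - y ord0 * (v 0 j / p 0 j)), (y ord0).
  by rewrite /x /v' scalerBr scalerBl scale1r !scalerA addrA addrAC.
- rewrite scomp_lform // /h.
  under eq_bigr => i _ do rewrite rmorphM /= mulrA -rmorphM -mpolyCM /=.
  rewrite -mulr_suml; move: v'f; rewrite mxE => v'f.
  have -> : \sum_i series_poly (f i 0 * v' 0 i)%:MP = 1 :> series K 1; last by rewrite mul1r.
  transitivity (series_poly (\sum_i (f i 0 * v' 0 i))%:MP : series K 1).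
    by rewrite !raddf_sum.
  by under eq_bigr do rewrite mulrC; rewrite v'f.
move=> i; rewrite scomp_mpoly => [|_]; last exact: low_lform.
have -> : h i \mPo [tuple lform f | _ < 1] = v' 0 i *: lform f.
  by rewrite /h rmorphM /= comp_mpolyC comp_mpolyXU -tnth_nth tnth_mktuple mul_mpolyC.
pose d : 'cV[K]_n := delta_mx i 0 - v' 0 i *: f - (p 0 i / p 0 j) *: delta_mx j 0.
have Ed x : (x *m d) 0 0 = x 0 i - v' 0 i * (x *m f) 0 0 - p 0 i / p 0 j * x 0 j.
  by rewrite -lform_meval !lformB !lformZ !lform_delta !mevalB !mevalZ !mevalXU lform_meval.
have -> : series_poly 'X_i - series_poly (v' 0 i *: lform f) =
   series_poly (lform d) + series_poly (p 0 i / p 0 j)%:MP * series_poly 'X_j.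
  rewrite /d !lformB !lformZ !lform_delta !raddfB /= -[(p 0 i / p 0 j) *: _]mul_mpolyC rmorphM /=; ring.
apply: fps_idealD; last first.
  by apply: fps_idealMl; apply: fps_ideal_gen; right.
have pd : (p *m d) 0 0 = 0 by rewrite Ed pf mulr0; field.
rewrite -(shift_lform0 pd); apply: fps_ideal_gen; left; exists (lform d) => // x.
move=> [_ [a [b ->]]]; rewrite lform_meval !evE pd mulr0.
by rewrite Ed vf !mxE; field.
Qed.

(** In the chart the u-coordinate is fixed at p1. If s is the increment of the v-coordinate, the
    equation of the conic gives the w-coordinate p3 + kap s / (1 - del s). Here [M] is the
    derivative of the equation along w. *)
Lemma smooth_branch_conic u v w (al be ga p1 p2 p3 : K) (j : 'I_n) f2 f3 :
  al != 0 -> be != 0 -> ga != 0 -> p1 != 0 ->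
  al * p1 * p2 + be * p1 * p3 + ga * p2 * p3 = 0 ->
  u 0 j != 0 -> v 0 j = 0 -> w 0 j = 0 ->
  (u *m f2) 0 0 = 0 -> (v *m f2) 0 0 = 1 -> (w *m f2) 0 0 = 0 ->
  (u *m f3) 0 0 = 0 -> (v *m f3) 0 0 = 0 -> (w *m f3) 0 0 = 1 ->
  smooth_branch (conicset u v w al be ga) (p1 *: u + p2 *: v + p3 *: w) j.
Proof.
move=> al0 be0 ga0 p10 qp uj vj wj u2 v2 w2 u3 v3 w3.
set p := _ + _ + _; pose M := be * p1 + ga * p2.
(* If [M] were 0, the equation at p would leave al p1 p2 = 0, hence p2 = 0, and then [M] = be p1 is
   not 0. *)
have M0 : M != 0.
  apply/eqP => M0; have /eqP : al * p1 * p2 = 0.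
    by rewrite -qp -[LHS]addr0 -(mul0r p3) -M0 /M; ring.
  rewrite !mulf_eq0 (negPf al0) (negPf p10) /= => /eqP p20.
  by move/eqP: M0; rewrite /M p20 mulr0 addr0 mulf_eq0 (negPf be0) (negPf p10).
pose kap := - (al * p1 + ga * p3) / M; pose del := - ga / M.
have Ekap : kap * M = - (al * p1 + ga * p3) by rewrite /kap divfK.
have Edel : del * M = - ga by rewrite /del divfK.
have pjE : p 0 j = p1 * u 0 j by rewrite !mxE vj wj !mulr0 !addr0.
have piE i : p 0 i = p1 * u 0 i + p2 * v 0 i + p3 * w 0 i by rewrite !mxE.
have pj : p 0 j != 0 by rewrite pjE mulf_neq0.
have pf f : (p *m f) 0 0 = p1 * (u *m f) 0 0 + p2 * (v *m f) 0 0 + p3 * (w *m f) 0 0.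
  by rewrite !evE.
pose f2' := f2 - (p2 / p 0 j) *: delta_mx j 0.
pose f3' := f3 - (p3 / p 0 j) *: delta_mx j 0.
have ef (x : 'rV[K]_n) f a : (x *m (f - a *: delta_mx j 0)) 0 0 = (x *m f) 0 0 - a * x 0 j.
  by rewrite evcB evcZ mulmx_delta.
have cC (c : K) : series_poly c%:MP = series_poly c%:MP :> series K n by [].
pose X0 : series K 1 := series_poly 'X_ord0.
have [geo hgeo _] := series_geom K.
have yl (i : 'I_1) : low 1 (series_poly del%:MP * X0) by apply: lowMl; apply: low_X.
pose G : series K 1 := scomp (fun=> series_poly del%:MP * X0) geo.
have EG : G * (1 - series_poly del%:MP * X0) = 1.
  have := congr1 (scomp (fun=> series_poly del%:MP * X0)) hgeo.
  by rewrite scompM // scompB scomp1 // scompX.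
pose gam i : series K 1 := series_poly (v 0 i)%:MP * X0
   + series_poly (w 0 i * kap)%:MP * (G * X0).
have gl i : low 1 (gam i).
  by apply: lowD; apply: lowMl; [|apply: lowMl]; apply: low_X.
have gamf f : \sum_i series_poly (f i 0)%:MP * gam i =
    series_poly ((v *m f) 0 0)%:MP * X0 + series_poly ((w *m f) 0 0 * kap)%:MP * (G * X0).
  rewrite !mxE mulr_suml !raddf_sum !mulr_suml -big_split; apply: eq_bigr => i _ /=.
  by rewrite /gam !mpolyCM !rmorphM /=; ring.
exists gam, f2'; split.
- by split=> //; rewrite /gam vj wj !mul0r ?mpolyC0 ?raddf0 ?mul0r ?addr0.
- by rewrite ef pf u2 v2 w2 !mulr0 mulr1 add0r addr0; field.
- move=> g vg; rewrite scomp_poly // /shift seval_comp.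
  (* The first variable stands for the inverse of [D]. With denominators cleared, the vanishing is a
     polynomial identity that can be checked pointwise; afterwards the series [G] = 1 / (1 - del s)
     is substituted for that variable. *)
  pose D : {mpoly K[2]} := 1 - del%:MP * 'X_ord_max.
  pose P i : {mpoly K[2]} := 'X_ord0 * ((p 0 i)%:MP * D
      + (v 0 i)%:MP * ('X_ord_max * D) + (w 0 i * kap)%:MP * 'X_ord_max).
  have FP0 : g \mPo [tuple P i | i < n] = 0.
    apply: mpoly2_fun_eq0 => y; rewrite comp_mpoly_meval.
    set c := y ord0; set s := y ord_max; pose d := 1 - del * s.
    pose x := (c * (p1 * d)) *: u + (c * ((p2 + s) * d)) *: v + (c * (p3 * d + kap * s)) *: w.
    have -> : g.@[fun i => (tnth [tuple P i0 | i0 < n] i).@[y]] = g.@[x 0].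
      apply: meval_eq => i; rewrite tnth_mktuple /P /D piE.
      rewrite !(mevalM, mevalD, mevalN, mevalC, mevalXU, meval1) !mxE -/c -/s /d. ring.
    have q0 : al * (p1 * d) * ((p2 + s) * d) + be * (p1 * d) * (p3 * d + kap * s) +
         ga * ((p2 + s) * d) * (p3 * d + kap * s) = 0.
      transitivity (d * (d * (al * p1 * p2 + be * p1 * p3 + ga * p2 * p3)
         + d * s * (al * p1 + ga * p3) + kap * s * (M + ga * s))); first by rewrite /M; ring.
      rewrite qp mulr0 add0r -[al * p1 + _]opprK -Ekap -[ga]opprK -Edel /d; ring.
    have [x0|x0] := eqVneq x 0.
      rewrite x0; have Zp : conicset u v w al be ga p.
        split; last by exists p1, p2, p3.
        by apply: contra_neq pj => ->; rewrite mxE.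
      exact: (vanishing_at_0 (@conicset_cone _ _ _ _ _ _) Zp vg).
    apply: vg; split=> //; do 3 eexists; split; first by [].
    by rewrite -(mulr0 (c * c)) -q0; ring.
  pose h (i : 'I_2) : series K 1 := if i == ord0 then G else X0.
  have := congr1 (seval h) FP0; rewrite seval_comp raddf0 => <-.
  congr (seval _ g); apply/funext => i; rewrite !tnth_mktuple.
  have ED : seval h D = 1 - series_poly del%:MP * X0.
    by rewrite /D rmorphB rmorph1 rmorphM /= sevalC sevalX.
  have hD : seval h D * G = 1 by rewrite ED mulrC.
  have -> : seval h (P i) = G * (series_poly (p 0 i)%:MP * seval h D
      + series_poly (v 0 i)%:MP * (X0 * seval h D) + series_poly (w 0 i * kap)%:MP * X0).
    by rewrite /P rmorphM /= 2!rmorphD /= !rmorphM /= !sevalC !sevalX.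
  rewrite rmorphD /= sevalC sevalX /gam.
  transitivity (series_poly (p 0 i)%:MP * (seval h D * G)
     + series_poly (v 0 i)%:MP * X0 * (seval h D * G) + series_poly (w 0 i * kap)%:MP * (G * X0)).
    by rewrite hD; ring.
  by ring.
- rewrite scomp_lform // gamf !ef v2 w2 vj wj !mulr0 !subr0 mul0r mpolyC0 raddf0 mul0r addr0.
  by rewrite mpolyC1 rmorph1 mul1r.
move=> i; pose l : series K n := series_poly (lform f2').
pose m3 : series K n := series_poly (lform f3').
set I := germ _ _ _.
have ll (k : 'I_1) : low 1 l by apply: low_lform.
pose H := scomp (fun=> l) G.
have EH : H * (1 - series_poly del%:MP * l) = 1.
  have := congr1 (scomp (fun=> l)) EG; rewrite scompM // scompB scomp1 // scompM //.
  by rewrite scompC // scompX.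
have -> : scomp (fun=> l) (gam i) = series_poly (v 0 i)%:MP * l
   + series_poly (w 0 i * kap)%:MP * (H * l).
  by rewrite /gam scompD !scompM // !scompC // !scompX.
have Ij : fps_ideal I (series_poly 'X_j) by apply: fps_ideal_gen; right.
pose d : 'cV[K]_n := delta_mx i 0 - v 0 i *: f2' - w 0 i *: f3' - (p 0 i / p 0 j) *: delta_mx j 0.
have Ed x : (x *m d) 0 0 = x 0 i - v 0 i * ((x *m f2) 0 0 - p2 / p 0 j * x 0 j)
   - w 0 i * ((x *m f3) 0 0 - p3 / p 0 j * x 0 j) - p 0 i / p 0 j * x 0 j.
  rewrite -!ef -lform_meval !lformB !lformZ !lform_delta !mevalB !mevalZ !mevalXU.
  by rewrite !lform_meval.
have ud : (u *m d) 0 0 = 0.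
  by rewrite Ed u2 u3 pjE piE; field; apply/andP.
have vd : (v *m d) 0 0 = 0 by rewrite Ed v2 v3 vj; ring.
have wd : (w *m d) 0 0 = 0 by rewrite Ed w2 w3 wj; ring.
have Id : fps_ideal I (series_poly (lform d)).
  have pd : (p *m d) 0 0 = 0 by rewrite pf ud vd wd !mulr0 !addr0.
  rewrite -(shift_lform0 pd); apply: fps_ideal_gen; left; exists (lform d) => // x.
  move=> [_ [a [b [c [-> _]]]]].
  by rewrite lform_meval !evE ud vd wd !mulr0 !addr0.
pose f1 : 'cV[K]_n := (u 0 j)^-1 *: delta_mx j 0.
pose Q := al *: (lform f1 * lform f2) + be *: (lform f1 * lform f3) + ga *: (lform f2 * lform f3).
have IQ : fps_ideal I (series_poly (shift p Q)).
  apply: fps_ideal_gen; left; exists Q => // x [_ [a [b [c [-> q0]]]]].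
  have ff f : (lform f).@[(a *: u + b *: v + c *: w) 0] =
     a * (u *m f) 0 0 + b * (v *m f) 0 0 + c * (w *m f) 0 0.
    by rewrite lform_meval !evE.
  rewrite /Q !mevalD !mevalZ !mevalM !ff u2 u3 v2 v3 w2 w3.
  have f1E x' : (x' *m f1) 0 0 = x' 0 j / u 0 j.
    by rewrite evcZ mulmx_delta mulrC.
  by rewrite !f1E vj wj divff // -[RHS]q0; ring.
(* The equation of the conic recentred at p, after removal of its value at p and of all multiples of
   X_j, and divided by [M]. *)
have Im : fps_ideal I (m3 * (1 - series_poly del%:MP * l) - series_poly kap%:MP * l).
  pose c (a : K) : series K n := series_poly a%:MP.
  have cD a b : c (a + b) = c a + c b by rewrite /c mpolyCD raddfD.
  have cM a b : c (a * b) = c a * c b by rewrite /c mpolyCM rmorphM.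
  have cN a : c (- a) = - c a by rewrite /c mpolyCN raddfN.
  have c0 : c 0 = 0 by rewrite /c mpolyC0 raddf0.
  have c1 : c 1 = 1 by rewrite /c mpolyC1 rmorph1.
  pose xj : series K n := series_poly 'X_j.
  have slf f a : (p *m f) 0 0 = a -> series_poly (shift p (lform f)) = c a + series_poly (lform f).
    by move=> <-; rewrite shift_lform raddfD.
  have L1 : series_poly (lform f1) = c (u 0 j)^-1 * xj.
    by rewrite /f1 lformZ lform_delta -mul_mpolyC rmorphM.
  have L' f a : series_poly (lform f) = series_poly (lform (f - a *: delta_mx j 0)) + c a * xj.
    by rewrite lformB lformZ lform_delta raddfB /= -[a *: _]mul_mpolyC rmorphM /= subrK.
  have s1 := slf f1 p1; have s2 := slf f2 p2; have s3 := slf f3 p3.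
  rewrite L1 in s1; rewrite (L' f2 (p2 / p 0 j)) -/f2' -/l in s2.
  rewrite (L' f3 (p3 / p 0 j)) -/f3' -/m3 in s3.
  have pf1 : (p *m f1) 0 0 = p1.
    by rewrite evcZ mulmx_delta pjE; field.
  have pf2 : (p *m f2) 0 0 = p2 by rewrite pf u2 v2 w2; ring.
  have pf3 : (p *m f3) 0 0 = p3 by rewrite pf u3 v3 w3; ring.
  have sQ : series_poly (shift p Q) = c al * (series_poly (shift p (lform f1)) * series_poly (shift p (lform f2)))
     + c be * (series_poly (shift p (lform f1)) * series_poly (shift p (lform f3)))
     + c ga * (series_poly (shift p (lform f2)) * series_poly (shift p (lform f3))).
    have sM f f' : series_poly (shift p (lform f * lform f')) =
        series_poly (shift p (lform f)) * series_poly (shift p (lform f')) :> series K n.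
      by rewrite shiftM rmorphM.
    have sZ a g : series_poly (shift p (a *: g)) = c a * series_poly (shift p g) :> series K n.
      by rewrite /shift comp_mpolyZ -mul_mpolyC rmorphM.
    have sD g g' : series_poly (shift p (g + g')) =
        series_poly (shift p g) + series_poly (shift p g') :> series K n.
      by rewrite /shift comp_mpolyD raddfD.
    by rewrite /Q !sD !sZ !sM.
  rewrite sQ (s1 pf1) (s2 pf2) (s3 pf3) in IQ.
  have Eq : c al * c p1 * c p2 + c be * c p1 * c p3 + c ga * c p2 * c p3 = 0.
    by rewrite -!cM -!cD qp.
  have Ek : c kap * c M = - (c al * c p1 + c ga * c p3) by rewrite -!cM -cD -cN -Ekap.
  have Ed' : c del * c M = - c ga by rewrite -cM -cN -Edel.
  have EM : c M = c be * c p1 + c ga * c p2 by rewrite -!cM -cD.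
  have -> : m3 * (1 - series_poly del%:MP * l) - series_poly kap%:MP * l =
     c M^-1 * ((c M * m3 - c del * c M * l * m3 - c kap * c M * l)).
    transitivity (c M^-1 * c M * (m3 * (1 - c del * l) - c kap * l)); last by ring.
    by rewrite -cM mulVf // c1 mul1r.
  apply: fps_idealMl; rewrite Ek Ed' EM.
  set a := c (u 0 j)^-1 in IQ; set a2 := c (p2 / p 0 j) in IQ; set a3 := c (p3 / p 0 j) in IQ.
  rewrite [X in fps_ideal _ X](_ : _ =
    (c al * ((c p1 + a * xj) * (c p2 + (l + a2 * xj)))
     + c be * ((c p1 + a * xj) * (c p3 + (m3 + a3 * xj)))
     + c ga * ((c p2 + (l + a2 * xj)) * (c p3 + (m3 + a3 * xj))))
    - (c al * c p1 * c p2 + c be * c p1 * c p3 + c ga * c p2 * c p3)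
    - (c al * (a * (c p2 + l + a2 * xj) + c p1 * a2) + c be * (a * (c p3 + m3 + a3 * xj) + c p1 * a3)
       + c ga * (a2 * (c p3 + m3 + a3 * xj) + (c p2 + l) * a3)) * xj); last by ring.
  rewrite Eq subr0; apply: fps_idealB => //; exact: fps_idealMl.
have -> : series_poly 'X_i - (series_poly (v 0 i)%:MP * l + series_poly (w 0 i * kap)%:MP * (H * l)) =
  series_poly (lform d) + series_poly (p 0 i / p 0 j)%:MP * series_poly 'X_j
  + (series_poly (w 0 i)%:MP * H) * (m3 * (1 - series_poly del%:MP * l) - series_poly kap%:MP * l).
  have -> : series_poly (lform d) = series_poly 'X_i - series_poly (v 0 i)%:MP * l
     - series_poly (w 0 i)%:MP * m3 - series_poly (p 0 i / p 0 j)%:MP * series_poly 'X_j.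
    rewrite /d !lformB !lformZ !lform_delta !raddfB /= -!mul_mpolyC !rmorphM /=.
    by rewrite /l /m3.
  transitivity (series_poly 'X_i - (series_poly (v 0 i)%:MP * l + series_poly (w 0 i * kap)%:MP * (H * l))
    + series_poly (w 0 i)%:MP * m3 * (H * (1 - series_poly del%:MP * l) - 1)).
    by rewrite EH subrr mulr0 addr0.
  by rewrite !mpolyCM !rmorphM /=; ring.
apply: fps_idealD; last exact: fps_idealMl.
by apply: fps_idealD => //; apply: fps_idealMl.
Qed.

End Curves.

(** * A smooth point is not a node *)

Section NotNode.
Variable K : fieldType.

Lemma mnm1_ord0 (u v : 'X_{1..1}) : mdeg u = mdeg v -> u = v.
Proof.
rewrite !mdegE !big_ord1 => E; apply/mnmP => i; by rewrite ord1.
Qed.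

Lemma series1_low (f : series K 1) : f != 0 -> exists k,
  low k f /\ f (U_(ord0) *+ k)%MM != 0.
Proof.
move=> f0; have : exists k, f (U_(ord0) *+ k)%MM != 0.
  apply/not_existsP => h; case/negP: f0; apply/eqP/seriesP => u.
  have := h (mdeg u); rewrite sCoef0 => /negP; rewrite negbK => /eqP <-.
  by congr f; apply: mnm1_ord0; rewrite mdegMn mdeg1 mul1n.
move=> hex; case: (ex_minnP hex) => k hk kmin; exists k; split=> // u hu.
apply/eqP; apply: contraTT hu => fu; rewrite -leqNgt; apply: kmin.
by rewrite (_ : (_ *+ _)%MM = u) //; apply: mnm1_ord0; rewrite mdegMn mdeg1 mul1n.
Qed.

(** The product of the lowest terms is the lowest term of the product. *)
Lemma series1_mulf_eq0 (f g : series K 1) : f * g = 0 -> f = 0 \/ g = 0.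
Proof.
have [->|f0] := eqVneq f 0; first by left.
have [->|g0] := eqVneq g 0; first by right.
have [k [lk fk]] := series1_low f0; have [l [ll gl]] := series1_low g0.
have rest (h : series K 1) d : low d h ->
    exists2 r, low d.+1 r & h = series_poly (h (U_(ord0) *+ d)%MM *: 'X_[U_(ord0) *+ d]) + r.
  move=> ld; exists (h - series_poly (h (U_(ord0) *+ d)%MM *: 'X_[U_(ord0) *+ d])); last by ring.
  move=> u; rewrite ltnS leq_eqVlt sCoefB sCoefP mcoeffZ mcoeffX => /orP[/eqP ud|ud].
    have -> : u = (U_(ord0) *+ d)%MM by apply: mnm1_ord0; rewrite mdegMn mdeg1 mul1n.
    by rewrite eqxx mulr1 subrr.
  rewrite ld //; case: eqP => [E|]; last by rewrite mulr0 subr0.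
  by move: ud; rewrite -E mdegMn mdeg1 mul1n ltnn.
have [r lr Ef] := rest f k lk; have [s ls Eg] := rest g l ll.
set a := f _ in fk Ef; set b := g _ in gl Eg.
move=> /(congr1 (fun h : series K 1 => h (U_(ord0) *+ (k + l))%MM)).
have -> : f * g = series_poly ((a * b) *: 'X_[U_(ord0) *+ (k + l)]) + (r * g +
   series_poly (a *: 'X_[U_(ord0) *+ k]) * s).
  rewrite {1}Ef mulrDl {1}Eg mulrDr -rmorphM /=.
  have -> : a *: 'X_[U_(ord0) *+ k] * (b *: 'X_[U_(ord0) *+ l]) =
     (a * b) *: 'X_[U_(ord0) *+ (k + l)] :> {mpoly K[1]}.
    rewrite -scalerAl -scalerAr scalerA -mpolyXD; congr (_ *: 'X_[_]).
    by apply: mnm1_ord0; rewrite mdegD !mdegMn mulnDr.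
  by ring.
have hd : (mdeg (U_(@ord0 0) *+ (k + l))%MM < k + l.+1)%N.
  by rewrite mdegMn mdeg1 mul1n addnS.
rewrite !sCoefD sCoefP mcoeffZ mcoeffX eqxx mulr1 sCoef0.
rewrite (lowM lr ll) ?addr0; last by rewrite addSn -addnS.
rewrite (@lowM _ _ k l.+1) ?addr0 //.
  by move/eqP; rewrite mulf_eq0 (negPf fk) (negPf gl).
move=> u hu; rewrite sCoefP mcoeffZ mcoeffX; case: eqP => [E|]; last by rewrite mulr0.
by move: hu; rewrite -E mdegMn mdeg1 mul1n ltnn.
Qed.

(** Lifts of the two coordinates of the node would be nonzero elements with product zero in the
    domain K[[x]]. As the maps are morphisms only modulo the ideals, each equality is carried out as
    a congruence. *)
Lemma smooth_not_node n n' (S : polyset K n) : n' = 2%N ->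
  analytically_isomorphic S (@axes K 1) ->
  ~ analytically_isomorphic S (@axes K n').
Proof.
move=> -> [phi [_ phiM _ phi_ker _]] [psi [_ psiM _ psi_ker psi_surj]].
have [f0 h0] := psi_surj (series_poly 'X_ord0 : series K 2).
have [f1 h1] := psi_surj (series_poly 'X_ord_max : series K 2).
have nX (i : 'I_2) : ~ fps_ideal (@axes K 2) (series_poly 'X_i : series K 2).
  move/axes_idealP => /(_ isT i); rewrite scompX; last exact: axis_incl_low.
  rewrite /axis_incl eqxx => /(congr1 (fun h : series K 1 => h U_(ord0)%MM)).
  by rewrite sCoefP sCoef0 mcoeffX eqxx => /eqP; rewrite oner_eq0.
have nf i f : fps_ideal (@axes K 2) ((series_poly 'X_i : series K 2) - psi f) -> ~ fps_ideal S f.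
  move=> hf /psi_ker hS; apply: (nX i).
  by apply/(fps_ideal_congr (g := psi f)).
have hprod : fps_ideal S (fps_mul f0 f1).
  apply/psi_ker; apply/(fps_ideal_congr (g := (psi f0 : series K 2) * psi f1)).
    exact: psiM.
  apply/(fps_ideal_congr (g := (series_poly 'X_ord0 : series K 2) * series_poly 'X_ord_max)); last first.
    by rewrite -rmorphM; apply: fps_ideal_gen; exists ord0, ord_max.
  set A : series K 2 := psi f0; set B : series K 2 := psi f1.
  set x : series K 2 := series_poly _; set y : series K 2 := series_poly _.
  have -> : A * B - x * y = - (B * (x - A) + x * (y - B)) by ring.
  by apply: fps_idealN; apply: fps_idealD; apply: fps_idealMl.
have ax1 (f : series K 1) : fps_ideal (@axes K 1) f -> f = 0.
  move/axes_idealP => /(_ isT ord0) <-.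
  rewrite -[LHS]scomp_id; apply: eq_scomp => i.
  by rewrite /axis_incl ord1 eqxx.
have /ax1 h : fps_ideal (@axes K 1) ((phi f0 : series K 1) * phi f1).
  have /phi_ker hp := hprod; apply/(fps_ideal_congr (g := phi (fps_mul f0 f1))) => //.
  by rewrite -opprB; apply: fps_idealN; apply: phiM.
have [/series1_mulf_eq0[E|E]] := h.
  by apply: (nf _ _ h0); apply/phi_ker; rewrite E; apply: fps_ideal0.
by apply: (nf _ _ h1); apply/phi_ker; rewrite E; apply: fps_ideal0.
Qed.

End NotNode.

(** * Closed sets, irreducibility and unions of curves in projective space *)

Section Projective.
Variables (K : numFieldType) (n : nat).
Implicit Types (Y Z : pset K n) (u v w x : 'rV[K]_n) (f : 'cV[K]_n).

(** Closedness with a witness for each outside point. In this form it passes to finite unions by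
    multiplying witnesses, and the witnesses serve to remove unwanted components near a point. *)
Definition separated Y := forall x, x != 0 -> ~ Y x ->
  exists2 g : {mpoly K[n]}, (exists d, g \is d.-homog) &
    vanishing Y g /\ g.@[x 0] != 0.

Lemma separated_zclosed Y : (forall x, Y x -> x != 0) -> separated Y -> zclosed Y.
Proof.
move=> Y0 sY; exists (fun g => (exists d, g \is d.-homog) /\ vanishing Y g).
  by move=> g [].
move=> x; split=> [Yx|[x0 hx]].
  by split; [apply: Y0|move=> g [_]; apply].
apply/not_notP => nYx; have [g hg [vg]] := sY x x0 nYx.
by rewrite hx ?eqxx.
Qed.

Lemma zeros_separated (I : polyset K n) :
  (forall g, I g -> exists d, g \is d.-homog) -> separated (zeros I).
Proof.
move=> hI x x0 nx; apply/not_notP => h; apply: nx; split=> // g Ig.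
apply/eqP/negPn/negP => gx; apply: h; exists g; first exact: hI.
by split=> // y [_]; apply.
Qed.

Lemma separatedU Y Z : separated Y -> separated Z ->
  separated (fun x => Y x \/ Z x).
Proof.
move=> sY sZ x x0 /not_orP[nY nZ].
have [g [d hd] [vg gx]] := sY x x0 nY; have [h [e he] [vh hx]] := sZ x x0 nZ.
exists (g * h); first by exists (d + e)%N; apply: dhomogM.
split=> [y [Yy|Zy]|]; rewrite mevalM ?mulf_neq0 //.
  by rewrite vg ?mul0r.
by rewrite vh ?mulr0.
Qed.

Lemma separated_bigU (T : eqType) (s : seq T) (Z : T -> pset K n) :
  (forall i, separated (Z i)) -> separated (fun x => exists2 i, i \in s & Z i x).
Proof.
move=> sZ; elim: s => [|i s IH].
  move=> x _ _; exists 1; first by exists 0%N; apply: dhomog1.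
  by split=> [y []|] //; rewrite meval1 oner_neq0.
have -> : (fun x => exists2 j, j \in i :: s & Z j x) =
    (fun x => Z i x \/ exists2 j, j \in s & Z j x).
  apply/funext => x; apply/propext; split=> [[j]|[Zx|[j js Zx]]].
  - by rewrite inE => /orP[/eqP->|js] Zx; [left|right; exists j].
  - by exists i => //; rewrite inE eqxx.
  - by exists j => //; rewrite inE js orbT.
exact: separatedU.
Qed.

Lemma lineset_separated u v : separated (lineset u v).
Proof.
move=> x x0 nx; pose A := col_mx u v.
have nxA : ~~ (x <= A)%MS.
  apply/negP => /submxP[D ED]; apply: nx; split=> //.
  exists (lsubmx D 0 0), (rsubmx D 0 0).
  rewrite ED -[D in LHS]hsubmxK mul_row_col.
  by rewrite [lsubmx D in LHS]mx11_scalar [rsubmx D in LHS]mx11_scalar !mul_scalar_mx.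
rewrite submxE in nxA.
have [k hk] : exists k, (x *m cokermx A) 0 k != 0.
  apply/not_notP => h; case/negP: nxA; apply/eqP/rowP => k; rewrite [RHS]mxE.
  by apply/eqP/negPn/negP => hk; apply: h; exists k.
exists (lform (col k (cokermx A))).
  by exists 1%N; apply: lform_homog.
split=> [y [_ [a [b ->]]]|]; last by rewrite lform_meval mulmx_col.
have hA : col_mx (u *m cokermx A) (v *m cokermx A) = 0 by rewrite -mul_col_mx mulmx_coker.
rewrite -col_mx0 in hA; have [hu hv] := eq_col_mx hA.
by rewrite lform_meval !evE !mulmx_col hu hv !mxE !mulr0 addr0.
Qed.

Lemma conicset_separated u v w al be ga f1 f2 f3 :
  (u *m f1) 0 0 = 1 -> (v *m f1) 0 0 = 0 -> (w *m f1) 0 0 = 0 ->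
  (u *m f2) 0 0 = 0 -> (v *m f2) 0 0 = 1 -> (w *m f2) 0 0 = 0 ->
  (u *m f3) 0 0 = 0 -> (v *m f3) 0 0 = 0 -> (w *m f3) 0 0 = 1 ->
  separated (conicset u v w al be ga).
Proof.
move=> u1 v1 w1 u2 v2 w2 u3 v3 w3 x x0 nx.
have ff f a b c : ((a *: u + b *: v + c *: w) *m f) 0 0 =
     a * (u *m f) 0 0 + b * (v *m f) 0 0 + c * (w *m f) 0 0 by rewrite !evE.
have [Ex|Ex] := eqVneq x ((x *m f1) 0 0 *: u + (x *m f2) 0 0 *: v + (x *m f3) 0 0 *: w).
  pose Q : {mpoly K[n]} := al *: (lform f1 * lform f2) + be *: (lform f1 * lform f3)
    + ga *: (lform f2 * lform f3).
  exists Q.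
    exists 2%N; have h f f' : (lform f * lform f' : {mpoly K[n]}) \is 2.-homog.
      by apply: (@dhomogM _ _ _ 1%N _ 1%N); apply: lform_homog.
    by apply: rpredD; first apply: rpredD; apply: rpredZ; apply: h.
  have QE (y : 'rV[K]_n) : Q.@[y 0] = al * (y *m f1) 0 0 * (y *m f2) 0 0 +
     be * (y *m f1) 0 0 * (y *m f3) 0 0 + ga * (y *m f2) 0 0 * (y *m f3) 0 0.
    by rewrite /Q !mevalD !mevalZ !mevalM !lform_meval !mulrA.
  split=> [y [_ [a [b [c [-> q0]]]]]|].
    by rewrite QE !ff u1 v1 w1 u2 v2 w2 u3 v3 w3 -[RHS]q0; ring.
  rewrite QE; apply/eqP => q0; apply: nx; split=> //.
  by exists ((x *m f1) 0 0), ((x *m f2) 0 0), ((x *m f3) 0 0).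
have /existsNP[i hi] : ~ forall i, x 0 i = (x *m f1) 0 0 * u 0 i +
    (x *m f2) 0 0 * v 0 i + (x *m f3) 0 0 * w 0 i.
  have key a b c : (forall i, x 0 i = a * u 0 i + b * v 0 i + c * w 0 i) ->
      x = a *: u + b *: v + c *: w by move=> h; apply/rowP => i; rewrite h !mxE.
  by move/key/eqP; apply/negP.
pose d : 'cV[K]_n := delta_mx i 0 - u 0 i *: f1 - v 0 i *: f2 - w 0 i *: f3.
have dE (y : 'rV[K]_n) : (y *m d) 0 0 = y 0 i - u 0 i * (y *m f1) 0 0 - v 0 i * (y *m f2) 0 0
    - w 0 i * (y *m f3) 0 0.
  by rewrite !evcB !evcZ mulmx_delta.
exists (lform d); first by exists 1%N; apply: lform_homog.
split=> [y [_ [a [b [c [-> _]]]]]|].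
  by rewrite lform_meval ff !dE u1 v1 w1 u2 v2 w2 u3 v3 w3; ring.
rewrite lform_meval dE; apply/eqP => h; apply: hi.
by apply/eqP; rewrite -subr_eq0 -h; apply/eqP; ring.
Qed.

(** Either Y lies in the first member, or irreducibility puts it in the union of the others; then
    induct on the list. *)
Lemma irreducible_cover Y k (Z : 'I_k -> pset K n) :
  irreducible Y -> (forall i, zclosed (Z i)) ->
  (forall i x, Z i x -> x != 0) -> (forall i, separated (Z i)) ->
  (forall x, Y x -> exists i, Z i x) -> exists i, forall x, Y x -> Z i x.
Proof.
move=> [_ [y Yy] nred] cZ Z0 sZ YZ.
have H (s : seq 'I_k) : (forall x, Y x -> exists2 i, i \in s & Z i x) ->
    exists i, forall x, Y x -> Z i x.
  elim: s => [/(_ y Yy)[]//|i s IH hs].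
  have [h|/existsNP[x /not_implyP[Yx nZx]]] := pselect (forall x, Y x -> Z i x).
    by exists i.
  apply: IH => x' Yx'; apply/not_notP => nx'; apply: nred.
  exists (Z i), (fun x => exists2 j, j \in s & Z j x); split=> //.
  - apply: separated_zclosed; last exact: separated_bigU.
    by move=> z [j _]; apply: Z0.
  - move=> z /hs[j]; rewrite inE => /orP[/eqP->|js] Zz; first by left.
    by right; exists j.
  - by exists x.
  - by exists x'.
apply: (H (enum 'I_k)) => x /YZ[i Zi]; exists i => //; exact: mem_enum.
Qed.

Section Line.
Variables (u v : 'rV[K]_n) (f1 f2 : 'cV[K]_n).
Hypotheses (u1 : (u *m f1) 0 0 = 1) (v1 : (v *m f1) 0 0 = 0)
           (u2 : (u *m f2) 0 0 = 0) (v2 : (v *m f2) 0 0 = 1).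

Lemma line_comb_neq0 a b : (a *: u + b *: v == 0) = (a == 0) && (b == 0).
Proof.
apply/eqP/andP => [h|[/eqP-> /eqP->]]; last by rewrite !scale0r addr0.
have := congr1 (fun x => (x *m f1) 0 0) h; have := congr1 (fun x => (x *m f2) 0 0) h.
by rewrite /= !evE u1 v1 u2 v2 !mul0mx !mxE !mulr0 !mulr1 add0r addr0 => -> ->.
Qed.

Lemma lineset_irreducible : irreducible (lineset u v).
Proof.
split.
- by apply: separated_zclosed; [move=> x []|apply: lineset_separated].
- exists u; split; last by exists 1, 0; rewrite scale1r scale0r addr0.
  apply/eqP => u0; move: u1; rewrite u0 mul0mx mxE => /esym/eqP; by rewrite oner_eq0.
move=> [A [B [[IA _ hA] [IB _ hB] AB [x Zx nAx] [y Zy nBy]]]].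
have sep (C : pset K n) IC z : (forall x, C x <-> zeros IC x) -> lineset u v z -> ~ C z ->
    exists2 g, IC g & g.@[z 0] != 0.
  move=> hC [z0 _] nC; apply/not_notP => h; apply: nC; apply/hC; split=> // g Ig.
  by apply/eqP/negPn/negP => gz; apply: h; exists g.
have [f If fx] := sep _ _ _ hA Zx nAx; have [g Ig gy] := sep _ _ _ hB Zy nBy.
pose h : n.-tuple {mpoly K[2]} := [tuple u 0 i *: 'X_ord0 + v 0 i *: 'X_ord_max | i < n].
have hE (F : {mpoly K[n]}) c : (F \mPo h).@[c] = F.@[(c ord0 *: u + c ord_max *: v) 0].
  rewrite comp_mpoly_meval; apply: meval_eq => i.
  by rewrite tnth_mktuple mevalD !mevalZ !mevalXU !mxE mulrC [v 0 i * _]mulrC.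
have nz (F : {mpoly K[n]}) z : lineset u v z -> F.@[z 0] != 0 -> F \mPo h != 0.
  move=> [_ [a [b ->]]]; apply: contra_neq => F0.
  have := hE F (fun i : 'I_2 => if i == ord0 then a else b); by rewrite F0 meval0 /= => <-.
(* The extra factor discards the parameters with first coordinate 0; at all others the combination
   is a nonzero vector and so a point of the line. *)
have /eqP : ('X_ord0 : {mpoly K[2]}) * (f \mPo h) * (g \mPo h) = 0.
  apply: mpoly2_fun_eq0 => c; rewrite !mevalM mevalXU !hE.
  have [->|c0] := eqVneq (c ord0) 0; first by rewrite !mul0r.
  have : lineset u v (c ord0 *: u + c ord_max *: v).
    by split; [rewrite line_comb_neq0 (negPf c0)|exists (c ord0), (c ord_max)].
  case/AB => [/hA[_ /(_ _ If) ->]|/hB[_ /(_ _ Ig) ->]]; by rewrite ?mulr0 ?mul0r.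
rewrite !mulf_eq0 (negPf (nz _ _ Zx fx)) (negPf (nz _ _ Zy gy)) !orbF.
by rewrite -msupp_eq0 msuppX.
Qed.

Lemma lineset_rational : rational_curve (lineset u v).
Proof.
exists [tuple u 0 i *: 'X_ord0 + v 0 i *: 'X_ord_max | i < n].
exists [tuple lform f1; lform f2]; exists 1%N, 1%N.
set F := [tuple _ | i < n]; set G := [tuple _; _].
have FE c : eval_tuple F c = c 0 ord0 *: u + c 0 ord_max *: v.
  apply/rowP => i; rewrite mxE tnth_mktuple mevalD !mevalZ !mevalXU !mxE.
  by rewrite mulrC [v 0 i * _]mulrC.
have GE x : eval_tuple G x = \row_i (if i == ord0 then (x *m f1) 0 0 else (x *m f2) 0 0).
  apply/rowP => i; rewrite mxE [RHS]mxE (tnth_nth 0).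
  by case: i => -[|[|//]] hi /=; rewrite lform_meval.
have GF c : eval_tuple G (eval_tuple F c) = c.
  rewrite GE FE; apply/rowP => i; rewrite mxE !evE u1 v1 u2 v2 !mulr0 !mulr1 addr0 add0r.
  by case: i => -[|[|//]] hi /=; congr (c 0 _); apply: val_inj.
have G0 x : eval_tuple G x 0 ord0 = (x *m f1) 0 0 by rewrite GE mxE.
have G1 x : eval_tuple G x 0 ord_max = (x *m f2) 0 0 by rewrite GE mxE.
have FG z : lineset u v z -> eval_tuple F (eval_tuple G z) = z.
  move=> [_ [a [b ->]]]; rewrite FE G0 G1 !evE u1 v1 u2 v2.
  by rewrite !mulr0 !mulr1 addr0 add0r.
have hX (i : 'I_2) : ('X_i : {mpoly K[2]}) \is 1.-homog by rewrite dhomogX /= mdeg1.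
have Zu : lineset u v u.
  split; last by exists 1, 0; rewrite scale1r scale0r addr0.
  apply/eqP => u0; move: u1; rewrite u0 mul0mx mxE => /esym/eqP; by rewrite oner_eq0.
split.
- split=> i.
    by rewrite tnth_mktuple; apply: rpredD; apply: rpredZ.
  by case: i => -[|[|//]] hi; rewrite (tnth_nth 0); apply: lform_homog.
- move=> c; rewrite FE => c0; split=> //.
  by exists (c 0 ord0), (c 0 ord_max).
- split; last by move=> c; exists 1; rewrite GF scale1r.
  exists (delta_mx 0 ord0); rewrite GF; apply/eqP => /rowP/(_ ord0).
  by rewrite !mxE eqxx => /eqP; rewrite oner_eq0.
split; last by move=> z /FG ->; exists 1; rewrite scale1r.
by exists u => //; rewrite FG //; case: Zu.
Qed.

End Line.

Section Family.
Variables (k : nat) (Z : 'I_k -> pset K n) (I : polyset K n) (N : nat).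
Hypothesis Z0 : forall i x, Z i x -> x != 0.
Hypothesis coneZ : forall i, cone (Z i).
Hypothesis sepZ : forall i, separated (Z i).
Hypothesis IZ : forall f : {mpoly K[n]}, I f -> forall i, vanishing (Z i) f.
Hypothesis ZI : forall f : {mpoly K[n]}, (forall i, vanishing (Z i) f) ->
  forall m, mdeg m = N -> I ('X_[m] * f).

(** [I] lies between the ideal of the union and its products with the monomials of degree [N]. At a
    given point some variable is nonzero, and its [N]-th power does not affect the zeros. *)
Lemma zeros_family x : zeros I x <-> exists i, Z i x.
Proof.
split=> [[x0 hx]|[i Zx]]; last first.
  by split=> [|f If]; [apply: Z0 Zx|apply: IZ If _ _ Zx].
apply/not_notP => nx.
have sU := @separated_bigU _ (enum 'I_k) Z sepZ.
have [g _ [vg gx]] : exists2 g : {mpoly K[n]}, (exists d, g \is d.-homog) &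
    vanishing (fun x => exists2 i, i \in enum 'I_k & Z i x) g /\ g.@[x 0] != 0.
  by apply: sU => //; case=> i _ Zx; apply: nx; exists i.
have [j xj] : exists j, x 0 j != 0.
  apply/not_notP => h; case/eqP: x0; apply/rowP => j; rewrite mxE.
  by apply/eqP/negPn/negP => xj; apply: h; exists j.
have vg' i : vanishing (Z i) g by move=> y Zy; apply: vg; exists i; rewrite ?mem_enum.
have := hx _ (ZI vg' (m := (U_(j) *+ N)%MM) _); rewrite mdegMn mdeg1 mul1n => /(_ erefl).
rewrite -mpolyXn mevalM rmorphXn /= mevalXU => /eqP.
by rewrite mulf_eq0 (negPf gx) orbF expf_eq0 (negPf xj) andbF.
Qed.

(** A form nonzero at p that vanishes on the components missing p, times X_j^N to make up for the
    lack of saturation, brings into [I] every form vanishing on the branches; both factors are units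
    at p. *)
Lemma family_analytically_isomorphic (p : 'rV[K]_n) (j : 'I_n) m (tau : 'I_m -> 'I_k)
    (M : 'I_m -> 'M[K]_n) :
  (0 < m)%N -> p 0 j != 0 -> (forall i, Z i p <-> exists b, tau b = i) ->
  (forall b, smooth_branch (Z (tau b)) p j) ->
  (forall b x, Z (tau b) x -> x *m M b = x) ->
  (forall b b' x, b != b' -> Z (tau b') x -> x *m M b = (x 0 j / p 0 j) *: p) ->
  (forall b i, M b i j = (i == j)%:R) ->
  analytically_isomorphic (germ I p j) (@axes K m).
Proof.
move=> m0 pj Zp hsm hid hpr hM.
apply: (@union_analytically_isomorphic K n I p j m (Z \o tau) M) => //=.
- by move=> b; apply/Zp; exists b.
- by move=> b f If; apply: IZ.
move=> f vf.
have p0 : p != 0 by apply: contra_neq pj => ->; rewrite mxE.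
pose s := [seq i <- enum 'I_k | ~~ [exists b, tau b == i]].
have sU := @separated_bigU _ s Z sepZ.
have [g _ [vg gp]] : exists2 g : {mpoly K[n]}, (exists d, g \is d.-homog) &
    vanishing (fun x => exists2 i, i \in s & Z i x) g /\ g.@[p 0] != 0.
  apply: sU => //; case=> i; rewrite mem_filter => /andP[/negP ni _] /Zp[b hb].
  by apply: ni; apply/existsP; exists b; rewrite hb.
apply: (@germ_local K n I p j f ('X_[(U_(j) *+ N)%MM] * g)); last first.
  by rewrite -mpolyXn mevalM rmorphXn /= mevalXU mulf_neq0 ?expf_neq0.
rewrite -mulrA; apply: ZI; last by rewrite mdegMn mdeg1 mul1n.
move=> i x Zx; rewrite mevalM.
have [/existsP[b /eqP hb]|ni] := boolP [exists b, tau b == i].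
  by rewrite (vf b) ?mulr0 //= hb.
by rewrite (vg x) ?mul0r //; exists i; rewrite // mem_filter ni mem_enum.
Qed.

(* On a single component the identity matrix is the required projection. *)
Lemma family_smooth (p : 'rV[K]_n) (j : 'I_n) i : p 0 j != 0 -> Z i p ->
  (forall i', Z i' p -> i' = i) -> smooth_branch (Z i) p j ->
  analytically_isomorphic (germ I p j) (@axes K 1).
Proof.
move=> pj Zp uniq_i sm.
apply: (@family_analytically_isomorphic p j 1 (fun=> i) (fun=> 1%:M)) => //.
- by move=> i'; split=> [/uniq_i ->|[_ <-]] //; exists ord0.
- by move=> b x _; rewrite mulmx1.
- by move=> b b'; rewrite !ord1 eqxx.
- by move=> b i'; rewrite mxE.
Qed.

End Family.
End Projective.

(** * Restriction of forms to linear spans *)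

Section Restriction.
Variables (A : comRingType) (n : nat).
Implicit Types (F G : {mpoly A[n]}).

(** The pullback of F to the span of the vectors [U k], in the coordinates that they define. *)
Definition rest d (U : 'I_d -> 'rV[A]_n) F : {mpoly A[d]} :=
  F \mPo [tuple \sum_k U k 0 i *: 'X_k | i < n].

HB.instance Definition _ d (U : 'I_d -> 'rV[A]_n) :=
  GRing.RMorphism.copy (rest U) (comp_mpoly [tuple \sum_k U k 0 i *: 'X_k | i < n]).

Lemma restZ d (U : 'I_d -> 'rV[A]_n) a F : rest U (a *: F) = a *: rest U F.
Proof. exact: comp_mpolyZ. Qed.

Lemma rest_meval d (U : 'I_d -> 'rV[A]_n) F c :
  (rest U F).@[c] = F.@[(\sum_k c k *: U k) 0].
Proof.
rewrite /rest comp_mpoly_meval; apply: meval_eq => i.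
rewrite tnth_mktuple raddf_sum summxE; apply: eq_bigr => k _ /=.
by rewrite mevalZ mevalXU mxE mulrC.
Qed.

Lemma rest_lform d (U : 'I_d -> 'rV[A]_n) c :
  rest U (lform c) = \sum_k (U k *m c) 0 0 *: 'X_k.
Proof.
rewrite /lform raddf_sum /=.
under eq_bigr => i _ do rewrite restZ /rest comp_mpolyXU -tnth_nth tnth_mktuple scaler_sumr.
rewrite exchange_big; apply: eq_bigr => k _ /=.
by rewrite mxE scaler_suml; apply: eq_bigr => i _; rewrite scalerA mulrC.
Qed.

(** A factor theorem over any ring: with one tuple the identity and the other eliminating a variable
    modulo [q], it says that F is divisible by [q] as soon as the elimination kills it. *)
Lemma comp_congr k (q : {mpoly A[k]}) (h h' : n.-tuple {mpoly A[k]}) F :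
  (forall i, exists r, tnth h i - tnth h' i = q * r) ->
  exists r, (F \mPo h) - (F \mPo h') = q * r.
Proof.
move=> hr; elim/mpolyind: F => [|c u F _ _ [r IH]].
  by exists 0; rewrite !comp_mpoly0 subrr mulr0.
have cM x x' y y' : (exists r, x - x' = q * r) -> (exists r, y - y' = q * r) ->
    exists r, x * y - x' * y' = q * r.
  move=> [a Ea] [b Eb]; exists (a * y + x' * b).
  by rewrite mulrDr mulrA -Ea mulrCA -Eb; ring.
have [s hs] : exists s, ('X_[u] \mPo h) - ('X_[u] \mPo h') = q * s.
  rewrite !comp_mpolyX; elim/big_ind2: _ => [|x y x' y' hx hy|i _].
  - by exists 0; rewrite subrr mulr0.
  - exact: cM.
  elim: (u i) => [|e IHe]; first by exists 0; rewrite subrr mulr0.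
  by rewrite !exprS; apply: cM.
exists (c *: s + r); rewrite !comp_mpolyD !comp_mpolyZ mulrDr -IH -scalerAr -hs scalerBr.
by ring.
Qed.

Lemma comp_idE F : F \mPo [tuple 'X_i | i < n] = F.
Proof. exact: comp_mpoly_id. Qed.

Definition pair2 (u v : 'rV[A]_n) : 'I_2 -> 'rV[A]_n :=
  fun k => if k == ord0 then u else v.

End Restriction.

Lemma rest_rest (A : comRingType) n d e (U : 'I_d -> 'rV[A]_n) (V : 'I_e -> 'rV[A]_d) (F : {mpoly A[n]}) :
  rest V (rest U F) = rest (fun k => \sum_l V k 0 l *: U l) F.
Proof.
rewrite /rest comp_mpolyA; apply: (congr1 (fun h : n.-tuple {mpoly A[e]} => F \mPo h)).
apply: eq_from_tnth => i; rewrite !tnth_mktuple raddf_sum /=.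
under eq_bigr => l _ do rewrite comp_mpolyZ comp_mpolyXU -tnth_nth tnth_mktuple scaler_sumr.
rewrite exchange_big; apply: eq_bigr => k _ /=.
by rewrite summxE scaler_suml; apply: eq_bigr => l _; rewrite mxE scalerA mulrC.
Qed.


(** * Gluing: lifting forms from the limit to the family *)

Section Node.
Variable A : idomainType.

Definition nodeform (p : A * A) : {mpoly A[2]} := p.2 *: 'X_ord0 - p.1 *: 'X_ord_max.
Definition nodept (p : A * A) : 'I_1 -> 'rV[A]_2 :=
  fun _ => \row_k (if k == ord0 then p.1 else p.2).

(** As p is unimodular, modulo [nodeform p] each variable X_i equals p_i times
    [s = a' X_0 + b' X_1]. Substituting turns G into its restriction to the point p, evaluated at
    [s], which is 0. *)
Lemma nodeform_dvd (p : A * A) a' b' (G : {mpoly A[2]}) :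
  p.1 * a' + p.2 * b' = 1 -> rest (nodept p) G = 0 ->
  exists r, G = nodeform p * r.
Proof.
move=> unim G0; case: p unim G0 => a b /= unim G0.
pose s : {mpoly A[2]} := a' *: 'X_ord0 + b' *: 'X_ord_max.
have := @comp_congr A 2 2 (nodeform (a, b)) [tuple 'X_i | i < 2]
  [tuple (if i == ord0 then a else b) *: s | i < 2] G.
have -> : G \mPo [tuple (if i == ord0 then a else b) *: s | i < 2] =
    rest (nodept (a, b)) G \mPo [tuple s | i < 1].
  rewrite /rest comp_mpolyA; apply: (congr1 (fun h : 2.-tuple {mpoly A[2]} => G \mPo h)).
  apply: eq_from_tnth => i; rewrite !tnth_mktuple big_ord1 comp_mpolyZ comp_mpolyXU.
  by rewrite -tnth_nth tnth_mktuple !mxE.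
rewrite G0 comp_mpoly0 subr0 comp_idE; apply => i; rewrite !tnth_mktuple /nodeform /s /=.
have E0 (x y : {mpoly A[2]}) : x = (a * a' + b * b') *: x by rewrite unim scale1r.
case: i => -[|[|//]] hi /=.
  exists b'%:MP; rewrite (_ : Ordinal hi = ord0); last exact: val_inj.
  rewrite {1}(E0 'X_ord0 0) -!mul_mpolyC !mpolyCD !mpolyCM; ring.
exists (- a'%:MP); rewrite (_ : Ordinal hi = ord_max); last exact: val_inj.
rewrite {1}(E0 'X_ord_max 0) -!mul_mpolyC !mpolyCD !mpolyCM; ring.
Qed.

Lemma nodes_dvd (ns : seq (A * A)) (G : {mpoly A[2]}) :
  (forall p, p \in ns -> exists a' b', p.1 * a' + p.2 * b' = 1) ->
  pairwise (fun p q : A * A => p.1 * q.2 != p.2 * q.1) ns ->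
  (forall p, p \in ns -> rest (nodept p) G = 0) ->
  exists r, G = \prod_(p <- ns) nodeform p * r.
Proof.
elim: ns G => [|p ns IH] G hu hp h0; first by exists G; rewrite big_nil mul1r.
have [a' [b' hab]] := hu p (mem_head _ _).
have [r Er] := nodeform_dvd hab (h0 p (mem_head _ _)).
move: hp; rewrite pairwise_cons => /andP[/allP hp1 hp2].
have [] := IH r _ hp2.
- by move=> q qs; apply: hu; rewrite inE qs orbT.
(* The node form of p is nonzero at a different node, so the quotient still vanishes there. *)
- move=> q qs; have := h0 q; rewrite inE qs orbT Er rmorphM => /(_ isT)/eqP.
  rewrite mulf_eq0 => /orP[|/eqP//].
  rewrite /nodeform raddfB /= !restZ /rest !comp_mpolyXU -!tnth_nth !tnth_mktuple.
  rewrite !big_ord1 !mxE /= !scalerA -scalerBl mscalerI subr_eq0.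
  have -> : ('X_ord0 == 0 :> {mpoly A[1]}) = false by rewrite -msupp_eq0 msuppX.
  by rewrite orbF eq_sym (negPf (hp1 q qs)).
move=> s Es; exists s; by rewrite Er Es big_cons mulrA.
Qed.

End Node.

Section Gluing.
Variables (K : numFieldType) (n : nat).
Local Notation A := {poly K}.
Local Notation at0 := (horner_eval (0 : K)).

(** Choose a right inverse [B] of the matrix at s = 0. The product [T] of the whole matrix with [B]
    has determinant 1 at s = 0, and its adjugate yields dual forms up to the factor det T. Keeping
    track of this factor replaces localization at s = 0. *)
Lemma dual_forms d (U : 'I_d -> 'rV[A]_n) :
  row_free (\matrix_k map_mx at0 (U k)) ->
  exists (c : A) (D : 'I_d -> 'cV[A]_n), c.[0] != 0 /\
    forall k l, (U k *m D l) 0 0 = if k == l then c else 0.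
Proof.
set M0 := \matrix_k _ => /row_freeP[B EB].
pose M : 'M[A]_(d, n) := \matrix_k U k.
pose T := M *m map_mx polyC B.
have T0 : map_mx at0 T = 1%:M.
  rewrite -EB map_mxM -map_mx_comp; congr (_ *m _).
    apply/matrixP => i j; by rewrite !mxE.
  apply/matrixP => i j; by rewrite mxE /= horner_evalE hornerC.
exists (\det T), (fun l => col l (map_mx polyC B *m \adj T)); split.
  by rewrite -horner_evalE -det_map_mx T0 det1 oner_neq0.
move=> k l.
have -> : (U k *m col l (map_mx polyC B *m \adj T)) 0 0 = (T *m \adj T) k l.
  rewrite /T -mulmxA !mxE; apply: eq_bigr => i _; by rewrite !mxE.
by rewrite mul_mx_adj mxE; case: eqP.
Qed.

(** Replace the variables by the dual forms. A monomial acquires the power of [c] given by its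
    degree, so an exponent is carried through the induction to reach a common power. *)
Lemma rest_lift d (U : 'I_d -> 'rV[A]_n) (G : {mpoly A[d]}) :
  row_free (\matrix_k map_mx at0 (U k)) ->
  exists c H, c.[0] != 0 /\ rest U H = c *: G.
Proof.
move=> /dual_forms[c [D [c0 hD]]].
have hl l : rest U (lform (D l)) = c *: 'X_l.
  rewrite rest_lform (bigD1 l) //= hD eqxx big1 ?addr0 // => k kl.
  by rewrite hD (negPf kl) scale0r.
suff [e [H EH]] : exists e H, rest U H = c ^+ e *: G.
  by exists (c ^+ e), H; rewrite horner_exp expf_neq0.
elim/mpolyind: G => [|a u G _ _ [e [H EH]]].
  by exists 0%N, 0; rewrite raddf0 scaler0.
exists (mdeg u + e)%N, (c ^+ e *: (a *: \prod_l lform (D l) ^+ u l) + c ^+ mdeg u *: H).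
rewrite raddfD /= !restZ EH scalerDr !scalerA exprD; congr (_ + _ *: _).
rewrite rmorph_prod mpolyXE_id /=.
under eq_bigr => l _ do rewrite rmorphXn /= hl exprZn.
rewrite scaler_prod -expr_sum -mdegE scalerA; congr (_ *: _); ring.
Qed.

Lemma div_by_s d (G : {mpoly A[d]}) : map_mpoly at0 G = 0 -> exists H, G = 'X *: H.
Proof.
move=> G0; exists (\sum_(m <- msupp G) (G@_m %/ 'X) *: 'X_[m]).
rewrite {1}[G]mpolyE scaler_sumr; apply: eq_bigr => m _; rewrite scalerA; congr (_ *: _).
rewrite mulrC divpK // -['X]subr0 -polyC0 dvdp_XsubCl; apply/rootP.
by have := congr1 (mcoeff m) G0; rewrite mcoeff_map_mpoly mcoeff0.
Qed.

End Gluing.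

(** Divides the available degree: a monomial for the components already glued, and [N2] single
    variables to be spent on the next line. *)
Lemma mdeg_split (R : comRingType) n (m : 'X_{1..n}) N1 N2 : mdeg m = (N1 + N2)%N ->
  exists m1 (s : seq 'I_n), [/\ mdeg m1 = N1, size s = N2 &
    'X_[m] = 'X_[m1] * \prod_(i <- s) 'X_i :> {mpoly R[n]}].
Proof.
elim: N2 m => [|N2 IH] m hm.
  by exists m, [::]; rewrite hm addn0 big_nil mulr1.
have [j uj] : exists j, m j != 0%N.
  apply/existsP; rewrite -negb_forall; apply: contraPN hm => /forallP u0.
  by rewrite mdegE big1 ?addnS // => i _; apply/eqP.
have Em : m = (U_(j) + (m - U_(j)))%MM by rewrite addmC submK // lep1mP.
have [|m1 [s [h1 h2 h3]]] := IH (m - U_(j))%MM.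
  by move: hm; rewrite {1}Em mdegD mdeg1 addnS add1n => -[].
exists m1, (j :: s); split=> //=; first by rewrite h2.
by rewrite Em mpolyXD h3 big_cons mulrCA.
Qed.

Section Glue.
Variables (K : numFieldType) (n k : nat).
Local Notation A := {poly K}.
Local Notation at0 := (horner_eval (0 : K)).
Variables (W : 'I_k -> 'I_2 -> 'rV[A]_n) (Wc : 'I_3 -> 'rV[A]_n) (q : {mpoly A[3]}).

Definition conic_ok (F : {mpoly A[n]}) := exists h, rest Wc F = q * h.
Definition good (i : nat) F := conic_ok F /\ forall j : 'I_k, (j < i)%N -> rest (W j) F = 0.

Lemma goodB i F G : good i F -> good i G -> good i (F - G).
Proof.
move=> [[h Eh] hF] [[h' Eh'] hG]; split=> [|j ji].
  by exists (h - h'); rewrite raddfB /= Eh Eh' mulrBr.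
by rewrite raddfB /= hF ?hG ?subr0.
Qed.

Lemma goodM i F G : good i F -> good i (G * F).
Proof.
move=> [[h Eh] hF]; split=> [|j ji]; last by rewrite rmorphM /= hF ?mulr0.
by exists (rest Wc G * h); rewrite rmorphM /= Eh mulrCA.
Qed.

Lemma goodZ i a F : good i F -> good i (a *: F).
Proof. by rewrite -mul_mpolyC; apply: goodM. Qed.

(* A multiple c E of a form w on the i-th line that vanishes on the components of
   [cov]: the conic if [cov.1], and the lines with index in [cov.2]. *)
Definition factor (i : 'I_k) (cov : bool * seq nat) (w : {mpoly A[2]}) :=
  exists c E, [/\ c.[0] != 0, rest (W i) E = c *: w,
    cov.1 -> rest Wc E = 0 & forall j : 'I_k, nat_of_ord j \in cov.2 -> rest (W j) E = 0].

Lemma factor_nil i : factor i (false, [::]) 1.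
Proof. by exists 1, 1; rewrite hornerC oner_neq0 rmorph1 scale1r. Qed.

Lemma factor_mul i cov1 cov2 w1 w2 : factor i cov1 w1 -> factor i cov2 w2 ->
  factor i (cov1.1 || cov2.1, cov1.2 ++ cov2.2) (w1 * w2).
Proof.
move=> [c1 [E1 [c10 r1 h1 g1]]] [c2 [E2 [c20 r2 h2 g2]]].
exists (c1 * c2), (E1 * E2); split.
- by rewrite hornerM mulf_neq0.
- by rewrite rmorphM /= r1 r2 -!mul_mpolyC mpolyCM; ring.
- by move=> /orP[/h1|/h2] h; rewrite rmorphM /= h ?mul0r ?mulr0.
by move=> j; rewrite mem_cat => /orP[/g1|/g2] h; rewrite rmorphM /= h ?mul0r ?mulr0.
Qed.

(* The nodes of the i-th line with the previous components are [ns]; up to these,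
   any product of N linear forms on the line extends to the ambient space. *)
Definition step (i : 'I_k) := exists (ns : seq (A * A)) (N : nat),
  [/\ forall p, p \in ns -> exists a' b', p.1 * a' + p.2 * b' = 1,
      pairwise (fun p q : A * A => p.1 * q.2 != p.2 * q.1) ns,
      forall p F, p \in ns -> good i F -> rest (nodept p) (rest (W i) F) = 0 &
      forall s : seq 'I_n, size s = N -> exists2 cov,
        factor i cov (\prod_(p <- ns) nodeform p * \prod_(x <- s) rest (W i) 'X_x) &
        cov.1 /\ forall j : 'I_k, (j < i)%N -> nat_of_ord j \in cov.2].

Hypothesis Wc_free : row_free (\matrix_l map_mx at0 (Wc l)).
Hypothesis W_free : forall i, row_free (\matrix_l map_mx at0 (W i l)).
Hypothesis steps : forall i, step i.

Lemma map_rest0 d (U : 'I_d -> 'rV[A]_n) F :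
  map_mpoly at0 (rest U F) = rest (fun l => map_mx at0 (U l)) (map_mpoly at0 F).
Proof.
elim/mpolyind: F => [|a u F _ _ IH]; first by rewrite !raddf0.
rewrite !raddfD /= IH; congr (_ + _).
rewrite restZ !map_mpolyZ map_mpolyX restZ /rest !comp_mpolyX rmorph_prod; congr (_ *: _).
apply: eq_bigr => i _; rewrite rmorphXn /= !tnth_mktuple raddf_sum; congr (_ ^+ _).
by apply: eq_bigr => l _; rewrite /= map_mpolyZ map_mpolyX mxE.
Qed.

Lemma map_polyC_at0 (f : {mpoly K[n]}) : map_mpoly at0 (map_mpoly polyC f) = f.
Proof. by apply/mpolyP => m; rewrite !mcoeff_map_mpoly /= /horner_eval hornerC. Qed.

(** Suppose a lift is correct on the components treated so far. On the next line its restriction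
    vanishes at s = 0 and at the nodes, so it is s times the node forms times some r. It is
    cancelled by s E H, where H restricts to a multiple of r and E, provided by [step], restricts to
    a multiple of the node forms and of the spare variables. As E vanishes on the earlier
    components, nothing is spoilt there. *)
Theorem glue : exists N, forall f : {mpoly K[n]},
  (exists h, rest (fun l => map_mx at0 (Wc l)) f = map_mpoly at0 q * h) ->
  (forall i, rest (fun l => map_mx at0 (W i l)) f = 0) ->
  forall m, mdeg m = N -> exists (c : A) G, c.[0] != 0 /\
    good k (c *: ('X_[m] * map_mpoly polyC f) - 'X *: G).
Proof.
suff H i : (i <= k)%N -> exists N, forall f : {mpoly K[n]},
    (exists h, rest (fun l => map_mx at0 (Wc l)) f = map_mpoly at0 q * h) ->
    (forall i, rest (fun l => map_mx at0 (W i l)) f = 0) ->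
    forall m, mdeg m = N -> exists (c : A) G, c.[0] != 0 /\
      good i (c *: ('X_[m] * map_mpoly polyC f) - 'X *: G) by apply: (H k).
elim: i => [_|i IH lt_ik].
  exists 0%N => f [h Eh] _ m /eqP; rewrite mdeg_eq0 => /eqP ->.
  (* The conic comes first: lifting the quotient at s = 0 coefficientwise leaves an error divisible
     by s, which [rest_lift] absorbs. *)
  have [G EG] : exists G, rest Wc (map_mpoly polyC f) - q * map_mpoly polyC h = 'X *: G.
    apply: div_by_s; rewrite raddfB /= rmorphM /= map_rest0 map_polyC_at0 Eh.
    have -> : map_mpoly at0 (map_mpoly polyC h) = h.
      by apply/mpolyP => m'; rewrite !mcoeff_map_mpoly /= /horner_eval hornerC.
    by rewrite subrr.
  have [c [H [c0 EH]]] := rest_lift G Wc_free.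
  exists c, H; split=> //; split=> // ; exists (c *: map_mpoly polyC h).
  rewrite raddfB /= !restZ mpolyX0 mul1r EH scalerA mulrC -scalerA -EG scalerBr.
  by rewrite opprB addrC subrK -scalerAr.
have [N1 {}IH] := IH (ltnW lt_ik).
pose o := Ordinal lt_ik; have [ns [N2 [unim pw nv hs]]] := steps o.
exists (N1 + N2)%N => f hc hl m hm.
have [m1 [s [hm1 hsz Em]]] := mdeg_split A hm.
have [c1 [G1 [c10 g1]]] := IH f hc hl m1 hm1.
set F := _ - _ in g1.
have [G EG] : exists G, rest (W o) F = 'X *: G.
  apply: div_by_s; rewrite map_rest0 /F raddfB /= !map_mpolyZ rmorphM /= map_polyC_at0.
  rewrite -[X in _ - X *: _]/('X.[0]) hornerX scale0r subr0 restZ rmorphM /= hl.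
  by rewrite mulr0 scaler0.
have X0 : 'X != 0 :> A by rewrite polyX_eq0.
(* Since s is not a zero divisor, the quotient G by s still vanishes at the nodes. *)
have [r Er] : exists r, G = \prod_(p <- ns) nodeform p * r.
  apply: nodes_dvd => // p pns; have := nv p F pns g1.
  rewrite EG restZ => /eqP; by rewrite mscalerI (negPf X0) /= => /eqP.
have [c2 [H [c20 EH]]] := rest_lift r (W_free o).
have [cov [c3 [E [c30 EE covc covl]]] [cc cl]] := hs s hsz.
pose P : {mpoly A[n]} := \prod_(x <- s) 'X_x.
have gE : good i E by split; [exists 0; rewrite covc ?mulr0|move=> j ji; apply/covl/cl].
exists (c2 * c3 * c1), ((c2 * c3) *: (P * G1) + E * H); split.
  by rewrite !hornerM !mulf_neq0.
(* In this form both terms are visibly good on the earlier components, and on the new line they are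
   the same product with opposite signs. *)
have -> : (c2 * c3 * c1) *: ('X_[m] * map_mpoly polyC f) -
    'X *: ((c2 * c3) *: (P * G1) + E * H) = ((c2 * c3) *: P) * F - 'X *: (E * H).
  rewrite Em -/P /F -!mul_mpolyC !mpolyCM; ring.
set F' := _ - _.
have gi : good i F'.
  apply: goodB; first exact: goodM.
  by apply: goodZ; rewrite mulrC; apply: goodM.
have r0 : rest (W o) F' = 0.
  rewrite /F' raddfB /= !restZ !rmorphM /= restZ EG EE EH Er /P rmorph_prod /=.
  rewrite -!mul_mpolyC !mpolyCM; ring.
split; first by case: gi.
move=> j; rewrite ltnS leq_eqVlt => /orP[/eqP ji|]; last by apply: (proj2 gi).
by rewrite (_ : j = o) //; apply: val_inj.
Qed.

(* Dual forms on vectors that are independent at s = 0 provide the factors. *)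
Lemma form_factor (i : 'I_k) (cov : bool * seq nat) d (U : 'I_d -> 'rV[A]_n) (e : 'I_d -> A)
    (x y : A) :
  row_free (\matrix_l map_mx at0 (U l)) ->
  (forall (phi : 'cV[A]_n) c, (forall l, (U l *m phi) 0 0 = c * e l) ->
     [/\ (W i ord0 *m phi) 0 0 = c * x, (W i ord_max *m phi) 0 0 = c * y,
         cov.1 -> forall l, (Wc l *m phi) 0 0 = 0 &
         forall j : 'I_k, nat_of_ord j \in cov.2 -> forall l, (W j l *m phi) 0 0 = 0]) ->
  factor i cov (x *: 'X_ord0 + y *: 'X_ord_max).
Proof.
move=> /dual_forms[c [D [c0 hD]]] h.
pose phi := \sum_l e l *: D l.
have [l|hx hy hc hl] := h phi c.
  rewrite /phi mulmx_sumr summxE (bigD1 l) //= evcZ hD eqxx big1 ?addr0; last first.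
    by move=> l' l'l; rewrite evcZ hD eq_sym (negPf l'l) mulr0.
  by rewrite mulrC.
exists c, (lform phi); split=> //.
- rewrite rest_lform big_ord_recl big_ord1 hx (_ : lift ord0 ord0 = ord_max); last exact: val_inj.
  by rewrite hy scalerDr !scalerA.
- by move=> cc; rewrite rest_lform big1 // => l _; rewrite hc // scale0r.
by move=> j jc; rewrite rest_lform big1 // => l _; rewrite hl // scale0r.
Qed.

End Glue.

Notation i0 := (ord0 : 'I_3).
Notation i1 := (inord 1 : 'I_3).
Notation i2 := (ord_max : 'I_3).

Lemma i1E : i1 = lift ord0 ord0. Proof. by apply: val_inj; rewrite /= inordK. Qed.

Lemma big_ord3 (R : Type) (idx : R) (op : R -> R -> R) (F : 'I_3 -> R) :
  \big[op/idx]_(i < 3) F i = op (F i0) (op (F i1) (op (F i2) idx)).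
Proof.
rewrite !big_ord_recl big_ord0 i1E.
by congr (op _ (op _ (op (F _) _))); apply: val_inj.
Qed.

Lemma ord3P (P : 'I_3 -> Prop) : P i0 -> P i1 -> P i2 -> forall i, P i.
Proof.
move=> h0 h1 h2; case=> -[|[|[|//]]] hi.
- by rewrite (_ : Ordinal hi = i0) //; apply: val_inj.
- by rewrite (_ : Ordinal hi = i1) //; apply: val_inj; rewrite /= inordK.
- by rewrite (_ : Ordinal hi = i2) //; apply: val_inj.
Qed.

(** * Forms vanishing on a conic *)

Section ConicForm.
Variable A : comRingType.

(** The conic of X_t in the coordinates of [conic_rows], with al = t_0 and ga = t_1 - t_0. *)
Definition qform (al ga : A) : {mpoly A[3]} :=
  al *: ('X_i0 * 'X_i1) - 'X_i0 * 'X_i2 + ga *: ('X_i1 * 'X_i2).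
(** The coefficient of x_0 in [qform]; inverting it parametrizes the conic by (x_1 : x_2). *)
Definition cform (al : A) : {mpoly A[3]} := al *: 'X_i1 - 'X_i2.

Definition emb3 (P : {mpoly A[2]}) : {mpoly A[3]} :=
  P \mPo [tuple if i == ord0 then 'X_i1 else 'X_i2 | i < 2].

Lemma emb3_meval P c : (emb3 P).@[c] = P.@[fun i => if i == ord0 then c i1 else c i2].
Proof.
rewrite /emb3 comp_mpoly_meval; apply: meval_eq => i.
by rewrite tnth_mktuple; case: ifP; rewrite mevalXU.
Qed.

(* Modulo the conic, x_0 = - ga x_1 x_2 / (al x_1 - x_2). *)
Lemma conic_normal_form al ga (g : {mpoly A[3]}) : exists D P r,
  cform al ^+ D * g = emb3 P + qform al ga * r.
Proof.
set L := cform al; set q := qform al ga.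
pose L2 : {mpoly A[2]} := al *: 'X_ord0 - 'X_ord_max.
have embX0 : emb3 'X_ord0 = 'X_i1 by rewrite /emb3 comp_mpolyXU -tnth_nth tnth_mktuple.
have embX1 : emb3 'X_ord_max = 'X_i2 by rewrite /emb3 comp_mpolyXU -tnth_nth tnth_mktuple.
have embM : {morph emb3 : x y / x * y} by move=> x y; rewrite /emb3 rmorphM.
have embD : {morph emb3 : x y / x + y} by move=> x y; rewrite /emb3 rmorphD.
have embB : {morph emb3 : x y / x - y} by move=> x y; rewrite /emb3 rmorphB.
have embZ c x : emb3 (c *: x) = c *: emb3 x by rewrite /emb3 comp_mpolyZ.
have emb1 : emb3 1 = 1 by rewrite /emb3 rmorph1.
have embL : emb3 L2 = L by rewrite /L2 embB embZ embX0 embX1.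
have embLn d : emb3 (L2 ^+ d) = L ^+ d.
  by elim: d => [|d IH]; rewrite ?emb1 // !exprS embM embL IH.
pose ok (g : {mpoly A[3]}) := exists D P r, L ^+ D * g = emb3 P + q * r.
have okM x y : ok x -> ok y -> ok (x * y).
  move=> [D [P [r E]]] [D' [P' [r' E']]]; exists (D + D')%N, (P * P').
  exists (emb3 P * r' + r * emb3 P' + q * (r * r')).
  rewrite exprD embM; transitivity ((L ^+ D * x) * (L ^+ D' * y)); first by ring.
  by rewrite E E'; ring.
have ok1 : ok 1 by exists 0%N, 1, 0; rewrite emb1 mulr0 addr0 expr0 mulr1.
have okX : forall i : 'I_3, ok 'X_i.
  apply: ord3P.
  - exists 1%N, (- (ga *: ('X_ord0 * 'X_ord_max))), 1.
    rewrite -scaleN1r embZ embZ embM embX0 embX1 /L /q /cform /qform expr1 -!mul_mpolyC mpolyCN mpolyC1.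
    by ring.
  - by exists 0%N, 'X_ord0, 0; rewrite expr0 mul1r mulr0 addr0 embX0.
  - by exists 0%N, 'X_ord_max, 0; rewrite expr0 mul1r mulr0 addr0 embX1.
elim/mpolyind: g => [|c u g _ _ [D' [P' [r' E']]]].
  by exists 0%N, 0, 0; rewrite /emb3 comp_mpoly0 !mulr0 addr0.
have [D [P [r E]]] : ok 'X_[u].
  rewrite mpolyXE_id; elim/big_ind: _ => // i _.
  by elim: (u i) => // e IHe; rewrite exprS; apply: okM.
exists (D + D')%N, (c *: (L2 ^+ D' * P) + L2 ^+ D * P').
exists (c *: (L ^+ D' * r) + L ^+ D * r').
rewrite embD embZ !embM !embLn exprD -!mul_mpolyC.
transitivity (c%:MP * (L ^+ D' * (L ^+ D * 'X_[u])) + L ^+ D * (L ^+ D' * g)); first by ring.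
by rewrite E E'; ring.
Qed.

End ConicForm.

Section ConicDiv.
Variable A : idomainType.

(* The linear form al x_1 - x_2 does not divide the conic when al ga != 0. *)
Lemma conic_strip (al ga : A) g r D : al != 0 -> ga != 0 ->
  cform al ^+ D * g = qform al ga * r -> exists h, g = qform al ga * h.
Proof.
move=> al0 ga0; elim: D r => [|D IH] r; first by rewrite expr0 mul1r; exists r.
(* [t] restricts to the zeros of [cform al], where [qform] becomes ga al x_1^2 and is not a zero
   divisor. So r restricts to 0 there and one factor [cform] can be cancelled. *)
pose t : 3.-tuple {mpoly A[3]} := [tuple if i == i2 then al *: 'X_i1 else 'X_i | i < 3].
have tE i : tnth t i = if i == i2 then al *: 'X_i1 else 'X_i by rewrite tnth_mktuple.
have t0 : tnth t i0 = 'X_i0 by rewrite tE.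
have i12 : (i1 == i2) = false by apply/negbTE; rewrite -val_eqE /= inordK.
have t1 : tnth t i1 = 'X_i1 by rewrite tE i12.
have t2 : tnth t i2 = al *: 'X_i1 by rewrite tE eqxx.
have L0 : cform al \mPo t = 0.
  by rewrite /cform comp_mpolyB comp_mpolyZ !comp_mpolyXU -!tnth_nth t1 t2 subrr.
have q0 : qform al ga \mPo t = (ga * al) *: ('X_i1 * 'X_i1).
  rewrite /qform comp_mpolyD comp_mpolyB !comp_mpolyZ !rmorphM /= !comp_mpolyXU -!tnth_nth.
  rewrite t0 t1 t2 -!mul_mpolyC mpolyCM; ring.
have X1 : 'X_i1 != 0 :> {mpoly A[3]} by rewrite -msupp_eq0 msuppX.
move=> E; have /(congr1 (comp_mpoly t)) := E.
rewrite !rmorphM rmorphXn /= L0 q0 expr0n mul0r => /esym/eqP.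
rewrite !mulf_eq0 mscalerI mulf_eq0 (negPf ga0) (negPf al0) mulf_eq0 (negPf X1) /= => /eqP r0.
have [|s hs] := @comp_congr A 3 3 (cform al) [tuple 'X_i | i < 3] t r.
  move=> i; rewrite tnth_mktuple tE; case: eqP => [->|_]; last first.
    by exists 0; rewrite subrr mulr0.
  by exists (-1); rewrite /cform mulrN1 opprB.
rewrite comp_idE r0 subr0 in hs.
apply: (IH s); have L1 : cform al != 0.
  apply/eqP => /(congr1 (mcoeff U_(i2)%MM)).
  rewrite mcoeffB mcoeffZ !mcoeffXU eqxx i12 mcoeff0 mulr0 sub0r => /eqP.
  by rewrite oppr_eq0 oner_eq0.
by apply: (mulfI L1); rewrite mulrA -exprS E hs; ring.
Qed.

End ConicDiv.

Notation conic U al ga := (conicset (U i0) (U i1) (U i2) al (-1) ga).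

(** * Vanishing on lines and conics, over the field and in families *)

Section FamilyIdeals.
Variables (K : numFieldType) (n : nat).
Local Notation A := {poly K}.

Lemma poly_cofinite d (e : A) (G : {mpoly A[d]}) : e != 0 ->
  (forall s, e.[s] != 0 -> map_mpoly (horner_eval s) G = 0) -> G = 0.
Proof.
move=> e0 h; apply/mpolyP => m; rewrite mcoeff0; apply: (poly_cofinite_eq0 e0) => s /h.
by move/(congr1 (mcoeff m)); rewrite mcoeff_map_mpoly mcoeff0.
Qed.

Lemma map_comp (R S : comRingType) (f : {rmorphism R -> S}) d k (F : {mpoly R[k]})
    (t : k.-tuple {mpoly R[d]}) : map_mpoly f (F \mPo t) =
  map_mpoly f F \mPo [tuple map_mpoly f (tnth t i) | i < k].
Proof.
elim/mpolyind: F => [|a u F _ _ IH]; first by rewrite comp_mpoly0 !(raddf0 (map_mpoly f)) comp_mpoly0.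
rewrite comp_mpolyD !(raddfD (map_mpoly f)) /= comp_mpolyD IH; congr (_ + _).
rewrite comp_mpolyZ !map_mpolyZ map_mpolyX comp_mpolyZ !comp_mpolyX rmorph_prod; congr (_ *: _).
by apply: eq_bigr => i _; rewrite rmorphXn /= tnth_mktuple.
Qed.

Lemma map_rest s d (U : 'I_d -> 'rV[A]_n) F :
  map_mpoly (horner_eval s) (rest U F) =
  rest (fun l => map_mx (horner_eval s) (U l)) (map_mpoly (horner_eval s) F).
Proof.
rewrite /rest map_comp; apply: (congr1 (fun h : n.-tuple {mpoly K[d]} => _ \mPo h)).
apply: eq_from_tnth => i; rewrite !tnth_mktuple raddf_sum.
by apply: eq_bigr => l _; rewrite /= map_mpolyZ map_mpolyX mxE.
Qed.

Lemma map_qform s (al ga : A) :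
  map_mpoly (horner_eval s) (qform al ga) = qform al.[s] ga.[s].
Proof.
by rewrite /qform raddfD raddfB /= !map_mpolyZ !rmorphM /= !map_mpolyX.
Qed.

Lemma rest_vanish_line (U : 'I_2 -> 'rV[K]_n) f :
  vanishing (lineset (U ord0) (U ord_max)) f -> U ord0 != 0 -> rest U f = 0.
Proof.
move=> vf U0; apply: mpoly2_fun_eq0 => c; rewrite rest_meval.
have Z0 : lineset (U ord0) (U ord_max) (U ord0).
  by split=> //; exists 1, 0; rewrite scale1r scale0r addr0.
have [->|x0] := eqVneq (\sum_k c k *: U k) 0.
  exact: (vanishing_at_0 (@lineset_cone _ _ _ _) Z0 vf).
apply: vf; split=> //; exists (c ord0), (c ord_max).
rewrite big_ord_recl big_ord1 (_ : lift ord0 ord0 = ord_max) //; exact: val_inj.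
Qed.

Lemma rest0_vanish_line (U : 'I_2 -> 'rV[K]_n) f : rest U f = 0 ->
  vanishing (lineset (U ord0) (U ord_max)) f.
Proof.
move=> r0 x [_ [a [b ->]]].
have := rest_meval U f (fun k => if k == ord0 then a else b).
rewrite r0 meval0 big_ord_recl big_ord1 (_ : lift ord0 ord0 = ord_max) //; exact: val_inj.
Qed.

Lemma fam_line (e : A) (U : 'I_2 -> 'rV[A]_n) F : e != 0 ->
  (forall s, e.[s] != 0 -> map_mx (horner_eval s) (U ord0) != 0) ->
  (forall s, e.[s] != 0 -> vanishing (lineset (map_mx (horner_eval s) (U ord0))
     (map_mx (horner_eval s) (U ord_max))) (map_mpoly (horner_eval s) F)) ->
  rest U F = 0.
Proof.
move=> e0 U0 h; apply: (poly_cofinite e0) => s es; rewrite map_rest.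
by apply: rest_vanish_line; [apply: h|apply: U0].
Qed.


Lemma qform_meval (al ga : K) c : (qform al ga).@[c] =
  al * c i0 * c i1 + (-1) * c i0 * c i2 + ga * c i1 * c i2.
Proof. by rewrite /qform mevalD mevalB !mevalZ !mevalM !mevalXU; ring. Qed.

Lemma rest_div_conic (U : 'I_3 -> 'rV[K]_n) al ga f h :
  rest U f = qform al ga * h -> vanishing (conic U al ga) f.
Proof.
move=> E x [_ [a [b [c [-> q0]]]]].
pose d (k : 'I_3) : K := if k == i0 then a else if k == i1 then b else c.
have d0 : d i0 = a by [].
have d1 : d i1 = b by rewrite /d eqxx; case: eqP => // /(congr1 val); rewrite /= inordK.
have d2 : d i2 = c by rewrite /d; case: eqP => // _; case: eqP => // /(congr1 val); rewrite /= inordK.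
have := rest_meval U f d; rewrite E mevalM qform_meval d0 d1 d2 q0 mul0r.
by rewrite big_ord3 d0 d1 d2 addr0 addrA => <-.
Qed.

(** The inverse of the projection of the conic from its point [U i0]. *)
Definition conic_at (U : 'I_3 -> 'rV[K]_n) (al ga : K) (c : 'I_2 -> K) : 'rV[K]_n :=
  let y := c ord0 in let z := c ord_max in
  (- ga * y * z / (al * y - z)) *: U i0 + y *: U i1 + z *: U i2.

(** Vanishing is asked only away from the zeros of [e], since X_t is the closure of the images of
    the smooth points of C_t. *)
Lemma conic_normal_open (U : 'I_3 -> 'rV[K]_n) al ga f D P r (e : {mpoly K[2]}) :
  (forall c, e.@[c] != 0 -> al * c ord0 - c ord_max != 0 -> f.@[conic_at U al ga c 0] = 0) ->
  cform al ^+ D * rest U f = emb3 P + qform al ga * r ->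
  e * (al *: 'X_ord0 - 'X_ord_max) * P = 0.
Proof.
move=> vf E; apply: mpoly2_fun_eq0 => c; rewrite !mevalM mevalB mevalZ !mevalXU.
have [->|ec] := eqVneq e.@[c] 0; first by rewrite !mul0r.
have [->|l0] := eqVneq (al * c ord0 - c ord_max) 0; first by rewrite mulr0 mul0r.
have := vf c ec l0; rewrite /conic_at.
move: l0; set y := c ord0; set z := c ord_max; set l := al * y - z => l0.
pose d (k : 'I_3) : K := if k == i0 then - ga * y * z / l else if k == i1 then y else z.
have d0 : d i0 = - ga * y * z / l by [].
have d1 : d i1 = y by rewrite /d eqxx; case: eqP => // /(congr1 val); rewrite /= inordK.
have d2 : d i2 = z by rewrite /d; case: eqP => // _; case: eqP => // /(congr1 val); rewrite /= inordK.
have q0 : (qform al ga).@[d] = 0 by rewrite qform_meval d0 d1 d2 /l; field.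
have := congr1 (meval d) E; rewrite mevalD !mevalM q0 mul0r addr0 rest_meval.
rewrite emb3_meval d1 d2 big_ord3 addr0 addrA d0 d1 d2 => + f0; rewrite f0 mulr0 => h.
rewrite (_ : P.@[c] = 0) ?mulr0 // [RHS]h.
apply: meval_eq => i; case: i => -[|[|//]] hi /=; congr (c _); exact: val_inj.
Qed.

Lemma conic_at_vanish (U : 'I_3 -> 'rV[K]_n) al ga f c : U i0 != 0 ->
  vanishing (conic U al ga) f -> al * c ord0 - c ord_max != 0 ->
  f.@[conic_at U al ga c 0] = 0.
Proof.
move=> U0 vf l0; have Z0 : conic U al ga (U i0).
  by split=> //; exists 1, 0, 0; rewrite scale1r !scale0r !addr0; split=> //; ring.
have [->|x0] := eqVneq (conic_at U al ga c) 0.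
  exact: (vanishing_at_0 (@conicset_cone _ _ _ _ _ _ _ _) Z0 vf).
apply: vf; split=> //; exists (- ga * c ord0 * c ord_max / (al * c ord0 - c ord_max)),
  (c ord0), (c ord_max); by split=> //; field.
Qed.

Lemma conic_normal_vanish (U : 'I_3 -> 'rV[K]_n) al ga f D P r : U i0 != 0 ->
  vanishing (conic U al ga) f -> cform al ^+ D * rest U f = emb3 P + qform al ga * r ->
  (al *: 'X_ord0 - 'X_ord_max) * P = 0.
Proof.
move=> U0 vf E; rewrite -[RHS](@conic_normal_open U al ga f D P r 1) ?mul1r //.
by move=> c _; apply: conic_at_vanish.
Qed.

Lemma form2_neq0 (R : idomainType) (al : R) : al *: 'X_ord0 - 'X_ord_max != 0 :> {mpoly R[2]}.
Proof.
apply/eqP => /(congr1 (mcoeff U_(ord_max)%MM)).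
rewrite mcoeffB mcoeffZ !mcoeffXU eqxx mcoeff0 mulr0 sub0r => /eqP.
by rewrite oppr_eq0 oner_eq0.
Qed.

Lemma conic_open_dvd (U : 'I_3 -> 'rV[K]_n) al ga f (e : {mpoly K[2]}) :
  al != 0 -> ga != 0 -> e != 0 ->
  (forall c, e.@[c] != 0 -> al * c ord0 - c ord_max != 0 -> f.@[conic_at U al ga c 0] = 0) ->
  exists h, rest U f = qform al ga * h.
Proof.
move=> al0 ga0 e0 vf; have [D [P [r E]]] := conic_normal_form al ga (rest U f).
have /eqP := conic_normal_open vf E.
rewrite !mulf_eq0 (negPf (form2_neq0 al)) (negPf e0) /= => /eqP P0.
by apply: (@conic_strip K al ga _ r D); rewrite // E P0 /emb3 comp_mpoly0 add0r.
Qed.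

Lemma conic_dvd (U : 'I_3 -> 'rV[K]_n) al ga f : U i0 != 0 -> al != 0 -> ga != 0 ->
  vanishing (conic U al ga) f -> exists h, rest U f = qform al ga * h.
Proof.
move=> U0 al0 ga0 vf; apply: (@conic_open_dvd U al ga f 1) => // [|c _].
  exact: oner_neq0.
exact: conic_at_vanish.
Qed.

(** The divisibility holds over K[s] itself, where [al] and [ga] are nonzero but need not be units
    at s = 0. Specializing to s = 0 therefore yields the equation of the limit even when the conic
    degenerates. *)
Lemma fam_conic (e : A) (U : 'I_3 -> 'rV[A]_n) (al ga : A) F : e != 0 ->
  al != 0 -> ga != 0 ->
  (forall s, e.[s] != 0 -> map_mx (horner_eval s) (U i0) != 0) ->
  (forall s, e.[s] != 0 ->
     vanishing (conic (fun l => map_mx (horner_eval s) (U l)) al.[s] ga.[s])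
       (map_mpoly (horner_eval s) F)) ->
  exists h, rest U F = qform al ga * h.
Proof.
move=> e0 al0 ga0 U0 h; have [D [P [r E]]] := conic_normal_form al ga (rest U F).
have P0 : (al *: 'X_ord0 - 'X_ord_max) * P = 0.
  apply: (poly_cofinite e0) => s es.
  rewrite rmorphM rmorphB /= map_mpolyZ !map_mpolyX.
  apply: (conic_normal_vanish (D := D) (r := map_mpoly (horner_eval s) r) (U0 s es) (h s es)).
  have := congr1 (map_mpoly (horner_eval s)) E.
  rewrite (rmorphM (map_mpoly (horner_eval s))) (rmorphD (map_mpoly (horner_eval s))).
  rewrite (rmorphM (map_mpoly (horner_eval s))) (rmorphXn (map_mpoly (horner_eval s))) /=.
  rewrite map_qform map_rest => E'.
  have -> : emb3 (map_mpoly (horner_eval s) P) = map_mpoly (horner_eval s) (emb3 P).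
    rewrite /emb3 map_comp; apply: (congr1 (fun h : 2.-tuple {mpoly K[3]} => _ \mPo h)).
    by apply: eq_from_tnth => i; rewrite !tnth_mktuple; case: ifP; rewrite map_mpolyX.
  rewrite -E' /cform raddfB /= map_mpolyZ !map_mpolyX; by [].
move/eqP: P0; rewrite mulf_eq0 (negPf (form2_neq0 al)) /= => /eqP P0.
by apply: (@conic_strip _ al ga _ r D); rewrite // E P0 /emb3 comp_mpoly0 add0r.
Qed.

(** The conic at t = 1 is x_0 (x_1 - x_2). Vanishing on the first line gives the factor x_0; after
    its cancellation, vanishing on the second gives x_1 - x_2. *)
Lemma line_pair_dvd (U : 'I_3 -> 'rV[K]_n) f : U i0 != 0 -> U i1 != 0 ->
  vanishing (lineset (U i1) (U i2)) f -> vanishing (lineset (U i0) (U i1 + U i2)) f ->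
  exists h, rest U f = qform 1 0 * h.
Proof.
move=> U0 U1 v1 v2.
pose t : 3.-tuple {mpoly K[3]} := [tuple if i == i0 then 0 else 'X_i | i < 3].
pose t' : 3.-tuple {mpoly K[3]} := [tuple if i == i2 then 'X_i1 else 'X_i | i < 3].
have i10 : (i1 == i0) = false by apply/negbTE; rewrite -val_eqE /= inordK.
have i12 : (i1 == i2) = false by apply/negbTE; rewrite -val_eqE /= inordK.
have f0 : f.@[(0 : 'rV[K]_n) 0] = 0.
  apply: (vanishing_at_0 (@lineset_cone _ _ _ _) _ v1 (x := U i1)).
  by split=> //; exists 1, 0; rewrite scale1r scale0r addr0.
have vl (u v : 'rV[K]_n) a b : vanishing (lineset u v) f -> f.@[(a *: u + b *: v) 0] = 0.
  move=> vf; have [->|x0] := eqVneq (a *: u + b *: v) 0; first exact: f0.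
  by apply: vf; split=> //; exists a, b.
have r0 : rest U f \mPo t = 0.
  have -> : rest U f \mPo t = emb3 (rest (pair2 (U i1) (U i2)) f).
    rewrite /rest /emb3 !comp_mpolyA; apply: (congr1 (fun h : n.-tuple {mpoly K[3]} => f \mPo h)).
    apply: eq_from_tnth => i; rewrite !tnth_mktuple !raddf_sum big_ord3 /= big_ord_recl big_ord1.
    rewrite !comp_mpolyZ !comp_mpolyXU -!tnth_nth !tnth_mktuple i10 /= scaler0 add0r addr0.
    by rewrite /pair2 /= i1E.
  rewrite (_ : rest _ f = 0) /emb3 ?comp_mpoly0 //.
  apply: mpoly2_fun_eq0 => c; rewrite rest_meval big_ord_recl big_ord1; exact: vl.
have [|r] := @comp_congr K 3 3 'X_i0 [tuple 'X_i | i < 3] t (rest U f).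
  move=> i; rewrite !tnth_mktuple; case: eqP => [->|_].
    by exists 1; rewrite subr0 mulr1.
  by exists 0; rewrite subrr mulr0.
rewrite comp_idE r0 subr0 => Er.
have X0 : 'X_ord0 != 0 :> {mpoly K[2]} by rewrite -msupp_eq0 msuppX.
pose w : 3.-tuple {mpoly K[2]} := [tuple if i == i0 then 'X_ord0 else 'X_ord_max | i < 3].
have rw : r \mPo w = 0.
  have /eqP : ('X_ord0 : {mpoly K[2]}) * (r \mPo w) = 0; last first.
    by rewrite mulf_eq0 (negPf X0) /= => /eqP.
  have -> : ('X_ord0 : {mpoly K[2]}) * (r \mPo w) = rest U f \mPo w.
    by rewrite Er rmorphM /= comp_mpolyXU -tnth_nth tnth_mktuple.
  apply: mpoly2_fun_eq0 => c; rewrite comp_mpoly_meval.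
  rewrite (rest_meval U f (fun i => (tnth w i).@[c])) big_ord3 !tnth_mktuple i10 /= !mevalXU addr0.
  by rewrite -scalerDr; apply: vl.
have rt' : r \mPo t' = 0.
  have -> : r \mPo t' = (r \mPo w) \mPo [tuple if i == ord0 then 'X_i0 else 'X_i1 | i < 2].
    rewrite comp_mpolyA; apply: (congr1 (fun h : 3.-tuple {mpoly K[3]} => r \mPo h)).
    apply: eq_from_tnth; apply: ord3P; rewrite !tnth_mktuple ?i10 ?i12 /=;
      by rewrite comp_mpolyXU -tnth_nth tnth_mktuple.
  by rewrite rw comp_mpoly0.
have [|s] := @comp_congr K 3 3 (cform 1) [tuple 'X_i | i < 3] t' r.
  move=> i; rewrite !tnth_mktuple; case: eqP => [->|_].
    by exists (-1); rewrite /cform scale1r mulrN1 opprB.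
  by exists 0; rewrite subrr mulr0.
rewrite comp_idE rt' subr0 => Es; exists s.
rewrite Er Es /cform /qform !scale1r scale0r addr0; ring.
Qed.

End FamilyIdeals.

(** * Half spinors and the rows of the Jacobian matrix *)

Section Spinor.
Variable K : fieldType.
Implicit Types (s : exterior K) (l : seq nat) (z : nat -> K).

Definition ins (i : nat) l := [seq j <- iota 1 5 | (j == i) || (j \in l)].
Definition del (i : nat) l := [seq j <- iota 1 5 | (j != i) && (j \in l)].
Definition sgn (i : nat) l : K := (-1) ^+ count (fun j => (j.+1 \in l) && (j < i)%N) (iota 0 5).
Definition xs s l : K := s (index_set l).

(** The Clifford action with index sets as increasing lists and the sum over the five indices
    unrolled, so that it reduces to an expression for [ring] and [field]. Entry i < 5 of [z] belongs
    to the contraction and entry 5 + i to the wedge product with the same basis vector. *)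
Definition clq z (x : seq nat -> K) l : K :=
  foldr (fun i acc => (if i.+1 \in l then z (5 + i)%N * (sgn i l * x (del i.+1 l))
                       else z i * (sgn i l * x (ins i.+1 l))) + acc) 0 (iota 0 5).

Lemma mem_index_set l (i : 'I_5) : (i \in index_set l) = (i.+1 \in l).
Proof. by rewrite inE. Qed.

Lemma wedge_signE (i : 'I_5) l : wedge_sign K i (index_set l) = sgn i l.
Proof.
rewrite /wedge_sign /sgn; congr (_ ^+ _).
rewrite -sum1_card big_mkcond /= !big_ord_recl big_ord0 /= !inE.
by do 5!(case: ifP => _ /=).
Qed.

Lemma iota_ord (j : 'I_5) : j.+1 \in iota 1 5.
Proof. by case: j => -[|[|[|[|[|//]]]]] hj. Qed.

Lemma ins_set (i : 'I_5) l : i |: index_set l = index_set (ins i.+1 l).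
Proof.
apply/setP => j; rewrite !inE mem_filter iota_ord andbT eqSS.
by [].
Qed.

Lemma del_set (i : 'I_5) l : index_set l :\ i = index_set (del i.+1 l).
Proof.
apply/setP => j; rewrite !inE mem_filter iota_ord andbT eqSS.
by [].
Qed.

Lemma cliffordE (u : 'rV[K]_(5 + 5)) s l :
  clifford u s (index_set l) = clq (fun k => u 0 (inord k)) (xs s) l.
Proof.
pose G i := if i.+1 \in l then u 0 (inord (5 + i)%N) * (sgn i l * xs s (del i.+1 l))
   else u 0 (inord i) * (sgn i l * xs s (ins i.+1 l)).
have -> : clq (fun k => u 0 (inord k)) (xs s) l = \sum_(i < 5) G i.
  by rewrite !big_ord_recl big_ord0.
rewrite ffunE; apply: eq_bigr => i _; rewrite !ffunE mem_index_set /G.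
have -> : lshift 5 i = inord i by apply: val_inj; rewrite /= inordK // (leq_trans (ltn_ord i)).
have -> : rshift 5 i = inord (5 + i)%N by apply: val_inj; rewrite /= inordK // (ltn_add2l 5 i 5).
rewrite wedge_signE; case: ifP => _; first by rewrite mulr0 add0r del_set.
by rewrite mulr0 addr0 ins_set.
Qed.

(** The ten quadrics as lists of a coefficient and two indices. A square has equal indices, and the
    two tests in [Jf] then both fire and give the factor 2 of its derivative. *)
Definition mons (t : K * K) : seq (seq (K * nat * nat)) :=
  let t0 := t.1 in let t1 := t.2 in
  [:: [:: (- t0, 1%N, 3%N); (t1, 0%N, 4%N)];
      [:: (- (t0 - t1), 0%N, 3%N); (- t1, 2%N, 3%N); (- (t0 - t1), 3%N, 3%N); (t1, 2%N, 4%N);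
          (t0 - t1, 3%N, 4%N); (- (t0 - t1), 3%N, 6%N)];
      [:: (t0 - t1, 1%N, 3%N); (t1, 2%N, 3%N); (- t1, 2%N, 4%N)];
      [:: (t0, 2%N, 3%N); (- t1, 2%N, 4%N); (- (t0 - t1), 3%N, 4%N); (t0 - t1, 3%N, 5%N)];
      [:: (- t1, 0%N, 2%N); (t1, 1%N, 2%N); (- t1, 2%N, 3%N); (t1, 2%N, 4%N)];
      [:: (1, 2%N, 6%N)];
      [:: (1, 1%N, 5%N)];
      [:: (1, 0%N, 5%N); (1, 3%N, 5%N); (- 1, 4%N, 5%N); (1, 4%N, 6%N)];
      [:: (1, 1%N, 6%N)];
      [:: (1, 3%N, 5%N); (- 1, 4%N, 5%N); (1, 4%N, 6%N)]].

Definition Jf (t : K * K) (p : nat -> K) (b k : nat) : K :=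
  foldr (fun (m : K * nat * nat) acc =>
    m.1.1 * ((if m.1.2 == b then p m.2 else 0) + (if m.2 == b then p m.1.2 else 0)) + acc)
    0 (nth [::] (mons t) k).

Lemma quadric_mons t k : (k < 10)%N -> quadric t k =
  foldr (fun (m : K * nat * nat) acc => m.1.1 *: (y_ K m.1.2 * y_ K m.2) + acc) 0 (nth [::] (mons t) k).
Proof.
case: k => [|[|[|[|[|[|[|[|[|[|//]]]]]]]]]] _; rewrite /quadric /quadrics /mons /=;
  rewrite -?mul_mpolyC ?(mpolyCN, mpolyCB, mpolyC1, expr2); ring.
Qed.

Lemma jacobianE t (p : 'rV[K]_7) b k : (b < 7)%N -> (k < 10)%N ->
  jacobian t p (inord b) (inord k) = Jf t (fun j => p 0 (inord j)) b k.
Proof.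
move=> hb hk; rewrite mxE inordK // quadric_mons // /Jf.
have hm m : m \in nth [::] (mons t) k -> (m.1.2 < 7)%N && (m.2 < 7)%N.
  move: m; apply/allP; move: k hk => [|[|[|[|[|[|[|[|[|[|//]]]]]]]]]] _ //.
elim: (nth _ _ k) hm => [|m ms IH] hm /=; first by rewrite raddf0 meval0.
rewrite mderivD mevalD IH => [|m' hm']; last by apply: hm; rewrite inE hm' orbT.
congr (_ + _); rewrite mderivZ mevalZ mderivM mevalD !mevalM !mevalXU; congr (_ * _).
have /andP[h1 h2] := hm m (mem_head _ _).
have dy a : (a < 7)%N -> ((y_ K a)^`M(inord b)).@[p 0] = (a == b)%:R.
  move=> ha; rewrite mderivX mevalZ mnm1E -val_eqE /= !inordK //.
  case: eqP => [->|_]; last by rewrite mul0r.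
  rewrite (_ : (U_(inord b) - U_(inord b))%MM = 0%MM) ?mpolyX0 ?meval1 ?mulr1 //.
  by apply/mnmP => i; rewrite mnmBE mnm0E subnn.
rewrite !dy //; do 2!case: eqP => _; rewrite ?mul0r ?mul1r ?mulr0 ?mulr1 ?addr0 ?add0r //.
Qed.

Definition row7 (c : seq K) : 'rV[K]_7 := \row_i nth 0 c i.

Lemma row7E c j : (j < 7)%N -> row7 c 0 (inord j) = nth 0 c j.
Proof. by move=> hj; rewrite mxE inordK. Qed.

Lemma JfE t c b k : Jf t (fun j => row7 c 0 (inord j)) b k = Jf t (nth 0 c) b k.
Proof.
rewrite /Jf; have hm m : m \in nth [::] (mons t) k -> (m.1.2 < 7)%N && (m.2 < 7)%N.
  move: m; apply/allP; have [hk|hk] := ltnP k 10; last by rewrite nth_default.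
  by move: k hk => [|[|[|[|[|[|[|[|[|[|//]]]]]]]]]] _.
elim: (nth _ _ k) hm => [|m ms IH] hm //=.
rewrite IH => [|m' hm']; last by apply: hm; rewrite inE hm' orbT.
have /andP[h1 h2] := hm m (mem_head _ _); by rewrite !row7E.
Qed.

Lemma clq_ext z z' x l : (forall k, (k < 10)%N -> z k = z' k) -> clq z x l = clq z' x l.
Proof. by move=> h; rewrite /clq /= !h. Qed.

Lemma half_spinor_eq t c s b l : half_spinor (jacobian t (row7 c)) s -> (b < 7)%N ->
  clq (Jf t (nth 0 c) b) (xs s) l = 0.
Proof.
move=> [_ _ h] hb; have := h (row (inord b) (jacobian t (row7 c))) (row_sub _ _).
move/(congr1 (fun e : exterior K => e (index_set l))); rewrite cliffordE ffunE => {2}<-.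
by apply: clq_ext => k hk; rewrite mxE jacobianE // JfE.
Qed.

Definition row16 (c : seq K) : 'rV[K]_16 := \row_i nth 0 c i.

Definition seqI (I : {set 'I_5}) : seq nat := [seq i <- iota 1 5 | inord i.-1 \in I].
Lemma seqIK I : index_set (seqI I) = I.
Proof.
apply/setP => i; rewrite inE mem_filter iota_ord andbT /=.
by rewrite inord_val.
Qed.

Definition xlist (c : seq K) (l : seq nat) : K := nth 0 c (index l even_indices).
Definition spinor (c : seq K) : exterior K := [ffun I => xlist c (seqI I)].

(** Subsets of the five indices become five booleans, over which a case analysis computes. *)
Lemma all_sets (P : {set 'I_5} -> Prop) :
  (forall b1 b2 b3 b4 b5 : bool, P (index_set (mask [:: b1; b2; b3; b4; b5] (iota 1 5)))) ->
  forall I, P I.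
Proof.
move=> h I; rewrite -(seqIK I) /seqI filter_mask; exact: h.
Qed.

Lemma xs_spinor c l : seqI (index_set l) = l -> xs (spinor c) l = xlist c l.
Proof. by move=> h; rewrite /xs ffunE h. Qed.

Lemma seqI_index_set l : seqI (index_set l) = [seq i <- iota 1 5 | i \in l].
Proof.
rewrite /seqI; apply: eq_in_filter => i; rewrite mem_iota => /andP[i0 i5].
by rewrite inE inordK prednK // -ltnS prednK.
Qed.

Lemma coordinates_spinor c : size c = 16%N -> coordinates (spinor c) = row16 c.
Proof.
move=> hc; apply/rowP => k; rewrite !mxE -/(xs _ _) xs_spinor /xlist; last first.
  by rewrite seqI_index_set; move: k; case=> -[|[|[|[|[|[|[|[|[|[|[|[|[|[|[|[|//]]]]]]]]]]]]]]]] hk.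
by move: k; case=> -[|[|[|[|[|[|[|[|[|[|[|[|[|[|[|[|//]]]]]]]]]]]]]]]] hk.
Qed.

Lemma clq_xspinor z c l : clq z (xs (spinor c)) l = clq z (xlist c) l.
Proof.
rewrite /clq /= /ins /del.
have E (P : pred nat) : xs (spinor c) [seq j <- iota 1 5 | P j] = xlist c [seq j <- iota 1 5 | P j].
  apply: xs_spinor; rewrite seqI_index_set -{2}[iota 1 5]filter_predT.
  apply: eq_in_filter => j hj; by rewrite mem_filter hj andbT.
by rewrite !E.
Qed.

Definition odd_sets : seq (seq nat) :=
  [:: [:: 1]; [:: 2]; [:: 3]; [:: 4]; [:: 5]; [:: 1; 2; 3]; [:: 1; 2; 4]; [:: 1; 2; 5];
      [:: 1; 3; 4]; [:: 1; 3; 5]; [:: 1; 4; 5]; [:: 2; 3; 4]; [:: 2; 3; 5]; [:: 2; 4; 5];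
      [:: 3; 4; 5]; [:: 1; 2; 3; 4; 5]]%N.

(** The Clifford action changes parity. For an odd set [index] returns 16, beyond the end of [c], so
    [xlist] yields the default 0. *)
Lemma clq_even z c (b1 b2 b3 b4 b5 : bool) : size c = 16%N ->
  let l := mask [:: b1; b2; b3; b4; b5] (iota 1 5) in
  l \notin odd_sets -> clq z (xlist c) l = 0.
Proof.
move=> sc; have x0 l : (index l even_indices == 16)%N -> xlist c l = 0.
  by move=> /eqP e; rewrite /xlist nth_default // sc e.
by case: b1 b2 b3 b4 b5 => [] [] [] [] [] l //; rewrite /clq /= !x0 // !mulr0 !addr0.
Qed.

(** Linearity reduces annihilation by the row space to the seven rows, and parity reduces it to the
    sixteen odd index sets. *)
Lemma spinor_half_spinor t c c' : size c' = 16%N -> row16 c' != 0 ->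
  (forall b j, (b < 7)%N -> (j < 16)%N ->
     clq (Jf t (nth 0 c) b) (xlist c') (nth [::] odd_sets j) = 0) ->
  half_spinor (jacobian t (row7 c)) (spinor c').
Proof.
move=> hc' c0 h0.
have h b (b1 b2 b3 b4 b5 : bool) : (b < 7)%N ->
     clq (Jf t (nth 0 c) b) (xlist c') (mask [:: b1; b2; b3; b4; b5] (iota 1 5)) = 0.
  move=> hb; have [hl|hl] := boolP (mask [:: b1; b2; b3; b4; b5] (iota 1 5) \in odd_sets).
    by rewrite -(nth_index [::] hl); apply: h0 => //; rewrite index_mem.
  exact: clq_even.
split.
- apply: contra_neq c0 => /(congr1 (@coordinates K)); rewrite coordinates_spinor // => ->.
  by apply/rowP => k; rewrite !mxE ffunE.
- apply: all_sets => b1 b2 b3 b4 b5; rewrite ffunE seqI_index_set => odd_I.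
  rewrite /xlist nth_default // hc'; move: odd_I.
  have -> : #|index_set (mask [:: b1; b2; b3; b4; b5] (iota 1 5))| = (b1 + b2 + b3 + b4 + b5)%N.
    rewrite -sum1_card big_mkcond /= !big_ord_recl big_ord0 /= !inE.
    by case: b1 b2 b3 b4 b5 => [] [] [] [] [].
  by case: b1 b2 b3 b4 b5 => [] [] [] [] [].
move=> u /submxP[D ->]; apply/ffunP; apply: all_sets => b1 b2 b3 b4 b5.
set l := mask _ _.
have lin z z' a y : clq (fun k => a * z k + z' k) y l = a * clq z y l + clq z' y l.
  rewrite /clq /=; do 5!(case: ifP => _); ring.
have lin0 y : clq (fun=> 0) y l = 0 by rewrite /clq /=; do 5!(case: ifP => _); ring.
rewrite cliffordE ffunE; transitivity (\sum_i D 0 i * clq (Jf t (nth 0 c) i) (xs (spinor c')) l).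
  have -> : clq (fun k => (D *m jacobian t (row7 c)) 0 (inord k)) (xs (spinor c')) l =
     clq (fun k => \sum_i D 0 i * Jf t (nth 0 c) i k) (xs (spinor c')) l.
    apply: clq_ext => k hk; rewrite mxE; apply: eq_bigr => i _; congr (_ * _).
    by rewrite -(inord_val i) jacobianE // JfE inordK.
  elim: (index_enum _) => [|i r IH].
    by rewrite big_nil -[RHS](lin0 (xs (spinor c'))); apply: clq_ext => k _; rewrite big_nil.
  rewrite big_cons -IH -lin; apply: clq_ext => k _; by rewrite big_cons.
by rewrite big1 // => i _; rewrite clq_xspinor h ?mulr0.
Qed.

End Spinor.

(** The combination with coefficients [c] of the seven vectors spanning P_nod, written in the
    sixteen coordinates x_I. *)
Definition wvec (R : comNzRingType) (t0 t1 : R) (c : seq R) : seq R :=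
  let A := nth 0 c 0 in let B := nth 0 c 1 in let C := nth 0 c 2 in
  let D := nth 0 c 3 in let E := nth 0 c 4 in let F := nth 0 c 5 in
  let G := nth 0 c 6 in
  [:: t1 * (t0 - t1) * D; A; A; 0; (t0 - t1) * D; t1 * D + E; B; t1 * D + E; C;
      t0 * D; E; 0; F; 0; G; 0].

(** One linear map in y computes rho on all components of C_t at once, in the basis of P_nod; see
    [rho_unique] and [rho_exists]. *)
Definition rho_coef (R : comNzRingType) (t1 : R) (y : seq R) : seq R :=
  [:: t1 * nth 0 y 2; - t1 * nth 0 y 1; t1 * (nth 0 y 4 - nth 0 y 0 - nth 0 y 3);
      - nth 0 y 3; t1 * (nth 0 y 3 - nth 0 y 4); - nth 0 y 5; nth 0 y 6].

Section Certificate.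
Variables (K : fieldType) (t : K * K).
Local Notation "q @@ b : l" := ((q, b%N), l) (at level 60, b at next level).

Definition clq_comb (c : seq K) (x : seq nat -> K) (m : seq (K * nat * seq nat)) : K :=
  foldr (fun e acc => e.1.1 * clq (Jf t (nth 0 c) e.1.2) x e.2 + acc) 0 m.

(** For each coordinate l, the certificate [m] contains a combination of spinor equations equal to
    x_l - x_i w_l / w_i; hence all coordinates are fixed by the pivot i. A triple holds the
    multiplier, the row of the Jacobian matrix and the odd set of the equation. *)
Lemma spinor_unique c w i (m : seq (seq (K * nat * seq nat))) s :
  all (all (fun e => (e.1.2 < 7)%N)) m ->
  (forall x, [seq clq_comb c x e | e <- m] =
     [seq x l - x i * (xlist w l / xlist w i) | l <- even_indices]) ->
  half_spinor (jacobian t (row7 c)) s ->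
  exists k : K, coordinates s = k *: row16 w.
Proof.
move=> hm h hs; exists (xs s i / xlist w i); apply/rowP => k; rewrite !mxE.
have /(congr1 (fun r => nth 0 r k)) := h (xs s).
have size_m : size m = 16 by move/(congr1 size): (h (xs s)); rewrite !size_map.
rewrite (nth_map [::]) ?size_m // (nth_map [::]) // /xlist index_uniq //.
rewrite -/(xs _ _) => e; apply/eqP; rewrite mulrAC -mulrA -subr_eq0 -e; apply/eqP.
have: all (fun e => (e.1.2 < 7)%N) (nth [::] m k).
  by apply: (allP hm); rewrite mem_nth ?size_m.
elim: (nth [::] m k) => [|q r IH] //= /andP[hq hr].
by rewrite (half_spinor_eq _ hs) // mulr0 add0r IH.
Qed.
End Certificate.
Section Exists.
Variables (K : fieldType) (t0 t1 : K).
Let t := (t0, t1).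

Definition quadric_at (y : nat -> K) k : K :=
  foldr (fun m acc => m.1.1 * (y m.1.2 * y m.2) + acc) 0 (nth [::] (mons t) k).

Definition quadric_coef : seq (seq (seq (K * nat))) :=
  [:: [:: [::]; [::]; [:: (- t1, 3%N)]; [:: (t1, 2%N)]; [::]; [::]; [::]; [::]; [:: (t1, 5%N)]; [::]; [::]; [:: (t1, 6%N)]; [::]; [::]; [:: (t1, 9%N)]; [::]];
   [:: [::]; [:: (- t1, 3%N)]; [::]; [:: (t1, 1%N)]; [::]; [::]; [:: (t1, 5%N)]; [::]; [::]; [::]; [::]; [:: (- t1, 7%N)]; [::]; [:: (t1, 9%N)]; [::]; [::]];
   [:: [:: (t1, 1%N); (t1, 2%N)]; [:: (- t1, 0%N)]; [:: (- t1, 0%N)]; [::]; [::]; [:: (t1, 6%N); (- t1, 7%N)]; [:: (- t1, 8%N)]; [:: (- t1, 9%N)]; [:: (- t1, 8%N)]; [:: (- t1, 9%N)]; [::]; [::]; [::]; [::]; [::]; [::]];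
   [:: [:: (t1 * (t0 - t1), 5%N); (- (t0 - t1), 4%N)]; [:: (t1 * (t0 - t1), 6%N)]; [:: (t1 * (t0 - t1), 7%N); (- (t0 - t1) - t1, 4%N); (- t1, 3%N)]; [:: (t1 * (t0 - t1), 8%N); (t1, 2%N); (t1, 4%N)]; [:: ((t0 - t1), 0%N); ((t0 - t1) + t1, 2%N); (t1 * (t0 - t1), 9%N); (- t1, 3%N)]; [::]; [::]; [:: (- (t0 - t1), 6%N)]; [:: (t1, 5%N)]; [:: ((t0 - t1) + t1, 5%N); (- (t0 - t1), 7%N)]; [:: (- t1, 5%N); (- (t0 - t1), 8%N)]; [:: (t1, 6%N)]; [:: ((t0 - t1) + t1, 6%N)]; [:: (- t1, 6%N)]; [:: (- (t0 - t1) - t1, 8%N); (- t1, 7%N); (t1, 9%N)]; [::]];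
   [:: [::]; [:: (- t1, 2%N); (- t1, 4%N)]; [:: (t1, 1%N); (t1, 3%N)]; [:: (- t1, 2%N); (- t1, 4%N)]; [:: (t1, 1%N); (t1, 3%N)]; [:: (t1, 5%N)]; [::]; [:: (t1, 5%N)]; [:: (- t1, 5%N)]; [::]; [:: (t1, 5%N)]; [:: (- t1, 6%N); (t1, 8%N)]; [:: (- t1, 7%N); (t1, 9%N)]; [:: (t1, 6%N); (- t1, 8%N)]; [:: (t1, 7%N); (- t1, 9%N)]; [::]];
   [:: [::]; [::]; [::]; [::]; [::]; [:: (- 1, 4%N)]; [::]; [:: (1, 2%N)]; [::]; [:: (- 1, 1%N)]; [::]; [::]; [:: (1, 0%N)]; [::]; [::]; [:: (- 1, 8%N)]];
   [:: [::]; [::]; [::]; [::]; [::]; [::]; [::]; [::]; [:: (1, 4%N)]; [:: (- 1, 3%N)]; [:: (1, 2%N)]; [::]; [::]; [::]; [:: (- 1, 0%N)]; [:: (1, 6%N)]]].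

(** An identity valid for all y: each spinor equation at the claimed vector is the combination of
    quadrics tabulated in [quadric_coef]. On C_t all quadrics vanish, which proves that the spinor
    exists. *)
Lemma clq_quadric c b j : (b < 7)%N -> (j < 16)%N ->
  clq (Jf t (nth 0 c) b) (xlist (wvec t0 t1 (rho_coef t1 c))) (nth [::] odd_sets j) =
  foldr (fun m acc => m.1 * quadric_at (nth 0 c) m.2 + acc) 0
    (nth [::] (nth [::] quadric_coef b) j).
Proof.
do 7?[case: b => [|b]] => //; do 16?[case: j => [|j]] => // _ _;
  rewrite /clq /ins /del /sgn /Jf /xlist /quadric_at /=; ring.
Qed.

Lemma spinor_rho c : let w := wvec t0 t1 (rho_coef t1 c) in row16 w != 0 ->
  (forall k, (k < 10)%N -> quadric_at (nth 0 c) k = 0) ->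
  half_spinor (jacobian t (row7 c)) (spinor w).
Proof.
move=> w w0 h; apply: spinor_half_spinor => // b j hb hj; rewrite clq_quadric //.
have: all (fun m => m.2 < 10)%N (nth [::] (nth [::] quadric_coef b) j).
  by do 7?[case: b hb => [|b] hb] => //; do 16?[case: j hj => [|j] hj].
by elim: (nth _ _ j) => [|m ms IH] //= /andP[hm hms]; rewrite h // mulr0 add0r IH.
Qed.
End Exists.

(** * Certificates of uniqueness of the spinor, component by component *)

Section Generic.
Variables (K : fieldType) (t0 t1 : K).
Hypotheses (t00 : t0 != 0) (t10 : t1 != 0) (t01 : t0 - t1 != 0).
Ltac certificate h := rewrite /clq_comb /clq /ins /del /sgn /Jf /xlist /=;
  do ![apply: (congr2 cons); idtac | by [] | field; rewrite ?oppr_eq0 ?t00 ?t10 ?t01 ?h].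
(** A line is covered by its points with a != 0 and the one point with a = 0, each with its own
    pivot. On this chart the pivot x_34 takes the value - t_1 a. *)
Lemma unique_v0_a (a b : K) s : a != 0 ->
  half_spinor (jacobian (t0, t1) (row7 [:: a; 0; 0; 0; 0; 0; b])) s ->
  exists k : K, coordinates s = k *: row16 (wvec t0 t1 (rho_coef t1 [:: a; 0; 0; 0; 0; 0; b])).
Proof.
move=> h; apply: (@spinor_unique _ _ _ _ [:: 3; 4] [:: [:: ((1) / (a), 5%N, [:: 3]%N)]; [:: ((1) / (a * t1), 4%N, [:: 2]%N)]; [:: ((1) / (a * t1), 4%N, [:: 3]%N); ((- b) / (a * a * t1), 5%N, [:: 3]%N)]; [:: ((1) / (a * t1), 4%N, [:: 4]%N)]; [:: ((- 1) / (a), 5%N, [:: 1; 3; 5]%N)]; [:: ((- 1) / (a * (t0 - t1)), 3%N, [:: 3]%N); ((- 1) / (a), 1%N, [:: 2; 3; 4]%N)]; [:: ((- 1) / (a), 5%N, [:: 2; 3; 4]%N)]; [:: ((1) / (a * t1), 2%N, [:: 2]%N)]; [::]; [:: ((1) / (a * t1), 2%N, [:: 3]%N)]; [:: ((1) / (a * t1), 2%N, [:: 4]%N)]; [:: ((1) / (a * t1), 4%N, [:: 2; 3; 4]%N); ((- b) / (a * a * t1), 5%N, [:: 2; 3; 4]%N)]; [:: ((1) / (a * t1), 2%N, [:: 1; 2; 3]%N); ((b) / (a * a * t1 * (t0 - t1)), 3%N, [:: 3]%N); ((b) / (a * a * t1), 1%N, [:: 2; 3; 4]%N)]; [:: ((1)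 / (a), 5%N, [:: 1; 2; 3; 4; 5]%N)]; [:: ((1) / (a * t1), 2%N, [:: 1; 3; 4]%N)]; [:: ((1) / (a * t1), 2%N, [:: 2; 3; 4]%N)]]) => // x.
by certificate h.
Qed.


Lemma unique_v0_b (b : K) s : b != 0 ->
  half_spinor (jacobian (t0, t1) (row7 [:: 0; 0; 0; 0; 0; 0; b])) s ->
  exists k : K, coordinates s = k *: row16 (wvec t0 t1 (rho_coef t1 [:: 0; 0; 0; 0; 0; 0; b])).
Proof.
move=> h; apply: (@spinor_unique _ _ _ _ [:: 1; 3; 4; 5] [:: [:: ((1) / (b), 1%N, [:: 4]%N)]; [:: ((1) / (b), 1%N, [:: 1; 2; 4]%N)]; [:: ((1) / (b), 1%N, [:: 1; 3; 4]%N)]; [:: ((- 1) / (b), 4%N, [:: 1; 3; 4]%N)]; [:: ((- 1) / (b), 1%N, [:: 1; 4; 5]%N)]; [:: ((1) / (b), 1%N, [:: 2; 3; 4]%N)]; [:: ((1) / (b), 2%N, [:: 1; 2; 4]%N)]; [:: ((- 1) / (b), 1%N, [:: 2; 4; 5]%N)]; [:: ((1) / (b), 2%N, [:: 1; 3; 4]%N)]; [:: ((- 1) / (b), 1%N, [:: 3; 4; 5]%N)]; [:: ((1) / (b), 2%N, [:: 1; 4; 5]%N)]; [:: ((1) / (b * (t0 - t1)), 3%N, [:: 1; 3; 4]%N)]; [:: ((- 1) / (b), 1%N, [:: 1; 2; 3; 4; 5]%N)]; [:: ((1) / (b * (t0 - t1)), 3%N, [:: 1; 4; 5]%N)]; [::];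 [:: ((1) / (b), 2%N, [:: 1; 2; 3; 4; 5]%N)]]) => // x.
by certificate h.
Qed.


Lemma unique_v1_a (a b : K) s : a != 0 ->
  half_spinor (jacobian (t0, t1) (row7 [:: a; b; 0; 0; 0; 0; 0])) s ->
  exists k : K, coordinates s = k *: row16 (wvec t0 t1 (rho_coef t1 [:: a; b; 0; 0; 0; 0; 0])).
Proof.
move=> h; apply: (@spinor_unique _ _ _ _ [:: 3; 4] [:: [:: ((1) / (a), 5%N, [:: 3]%N)]; [:: ((1) / (a * t1), 4%N, [:: 2]%N)]; [:: ((1) / (a * t1), 4%N, [:: 3]%N)]; [:: ((1) / (a * t1), 4%N, [:: 4]%N)]; [:: ((1) / (a * t1), 4%N, [:: 5]%N)]; [:: ((- 1) / (a * (t0 - t1)), 3%N, [:: 3]%N); ((- b * (t0 - t1) - b * t1) / (a * a * t1 * (t0 - t1)), 4%N, [:: 3]%N)]; [:: ((- 1) / (a), 5%N, [:: 2; 3; 4]%N)]; [:: ((- 1) / (a), 5%N, [:: 2; 3; 5]%N); ((- b) / (a * a), 6%N, [:: 3; 4; 5]%N); ((b) / (a * a * t1), 2%N, [:: 3]%N)]; [::]; [:: ((- 1) / (a), 6%N, [:: 3; 4; 5]%N); ((1) / (a * t1), 2%N, [:: 3]%N)]; [:: ((1) / (a), 5%N, [:: 3; 4; 5]%N)]; [:: ((1) / (a * (t0 - t1)), 3%N, [:: 1; 3; 4]%N)]; [:: ((1) / (a * (t0 - t1)), 3%N, [:: 1; 3; 5]%N)]; [:: ((1) / (a * t1), 4%N,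 [:: 2; 4; 5]%N)]; [:: ((1) / (a * t1), 4%N, [:: 3; 4; 5]%N)]; [:: ((- 1) / (a * (t0 - t1)), 3%N, [:: 3; 4; 5]%N); ((- b * (t0 - t1) - b * t1) / (a * a * t1 * (t0 - t1)), 4%N, [:: 3; 4; 5]%N)]]) => // x.
by certificate h.
Qed.


Lemma unique_v1_b (b : K) s : b != 0 ->
  half_spinor (jacobian (t0, t1) (row7 [:: 0; b; 0; 0; 0; 0; 0])) s ->
  exists k : K, coordinates s = k *: row16 (wvec t0 t1 (rho_coef t1 [:: 0; b; 0; 0; 0; 0; 0])).
Proof.
move=> h; apply: (@spinor_unique _ _ _ _ [:: 2; 4] [:: [:: ((1) / (b), 5%N, [:: 2]%N)]; [:: ((1) / (b), 6%N, [:: 1; 2; 4]%N)]; [:: ((- 1) / (b * (t0 - t1)), 3%N, [:: 1]%N)]; [:: ((- 1) / (b), 5%N, [:: 1; 2; 4]%N)]; [:: ((- 1) / (b * t1), 2%N, [:: 1]%N)]; [:: ((1) / (b), 6%N, [:: 2; 3; 4]%N)]; [::]; [:: ((- 1) / (b * t1), 2%N, [:: 2]%N)]; [:: ((1) / (b), 5%N, [:: 2; 3; 4]%N)]; [:: ((- 1) / (b * t1), 2%N, [:: 3]%N)]; [:: ((- 1) / (b * t1), 2%N, [:: 4]%N)]; [:: ((1) / (b * (t0 - t1)), 3%N, [:: 1; 2; 4]%N)]; [:: ((- 1) / (b * t1), 2%N, [:: 1; 2; 3]%N)]; [:: ((- 1) / (b * t1), 2%N, [:: 1; 2; 4]%N)];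 [:: ((- 1) / (b * t1), 2%N, [:: 1; 3; 4]%N)]; [:: ((- 1) / (b * t1), 2%N, [:: 2; 3; 4]%N)]]) => // x.
by certificate h.
Qed.


Lemma unique_v2_a (a b : K) s : a != 0 ->
  half_spinor (jacobian (t0, t1) (row7 [:: a; a; b; 0; 0; 0; 0])) s ->
  exists k : K, coordinates s = k *: row16 (wvec t0 t1 (rho_coef t1 [:: a; a; b; 0; 0; 0; 0])).
Proof.
move=> h; apply: (@spinor_unique _ _ _ _ [:: 2; 4] [:: [:: ((1) / (a), 5%N, [:: 2]%N)]; [:: ((1) / (a), 6%N, [:: 1; 2; 4]%N)]; [:: ((- 1) / (a), 5%N, [:: 1; 2; 3]%N); ((1) / (a), 6%N, [:: 1; 2; 4]%N)]; [:: ((- 1) / (a), 5%N, [:: 1; 2; 4]%N)]; [:: ((- 1) / (a), 5%N, [:: 1; 2; 5]%N)]; [:: ((1) / (a), 6%N, [:: 2; 3; 4]%N)]; [::]; [:: ((- 1) / (a), 6%N, [:: 2; 4; 5]%N)]; [:: ((1) / (a), 5%N, [:: 2; 3; 4]%N)]; [:: ((- 1) / (a), 6%N, [:: 3; 4; 5]%N)]; [:: ((1) / (a), 5%N, [:: 2; 4; 5]%N)]; [:: ((1) / (a * t1), 4%N, [:: 2; 3; 4]%N); ((- b) / (a * a * (t0 - t1)), 3%N, [:: 2; 4; 5]%N); ((- b * (t0 - t1) - b * t1) / (a * a * t1 * (t0 - t1)), 4%N, [:: 2; 4; 5]%N); ((b) / (a * a * t1), 0%N, [:: 2; 3; 4]%N)];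 [:: ((1) / (a * t1), 4%N, [:: 2; 3; 5]%N); ((- b) / (a * a * (t0 - t1)), 3%N, [:: 2; 4; 5]%N); ((- b * (t0 - t1) - b * t1) / (a * a * t1 * (t0 - t1)), 4%N, [:: 2; 4; 5]%N); ((b) / (a * a * t1), 0%N, [:: 2; 3; 4]%N)]; [:: ((b * (t0 - t1) + b * t1 + a * (t0 - t1)) / (a * a * t1 * (t0 - t1)), 4%N, [:: 2; 4; 5]%N); ((b) / (a * a * (t0 - t1)), 3%N, [:: 2; 4; 5]%N); ((- b) / (a * a * t1), 0%N, [:: 2; 3; 4]%N)]; [:: ((1) / (a * t1), 4%N, [:: 3; 4; 5]%N); ((b) / (a * a * (t0 - t1)), 3%N, [:: 2; 4; 5]%N); ((b * (t0 - t1) + b * t1) / (a * a * t1 * (t0 - t1)), 4%N, [:: 2; 4; 5]%N); ((- b) / (a * a * t1), 0%N, [:: 2; 3; 4]%N)]; [:: ((- 1) / (a * (t0 - t1)), 3%N, [:: 2; 4; 5]%N); ((- (t0 - t1) - t1) / (a * t1 * (t0 - t1)), 4%N, [:: 2; 4; 5]%N); ((1) / (a * t1), 0%N, [:: 2; 3; 4]%N)]]) => // x.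
by certificate h.
Qed.


Lemma unique_v2_b (b : K) s : b != 0 ->
  half_spinor (jacobian (t0, t1) (row7 [:: 0; 0; b; 0; 0; 0; 0])) s ->
  exists k : K, coordinates s = k *: row16 (wvec t0 t1 (rho_coef t1 [:: 0; 0; b; 0; 0; 0; 0])).
Proof.
move=> h; apply: (@spinor_unique _ _ _ _ [:: 1; 2] [:: [:: ((1) / (b), 6%N, [:: 1]%N)]; [::]; [:: (((t0 - t1) + t1) / (b * t1 * (t0 - t1)), 4%N, [:: 1]%N); ((1) / (b * t1), 0%N, [:: 1]%N); ((1) / (b * (t0 - t1)), 3%N, [:: 1]%N)]; [:: ((- 1) / (b * (t0 - t1)), 3%N, [:: 1]%N); ((- 1) / (b * (t0 - t1)), 4%N, [:: 1]%N)]; [:: ((1) / (b * t1), 0%N, [:: 1]%N)]; [:: ((1) / (b), 6%N, [:: 1; 2; 3]%N)]; [:: ((1) / (b), 6%N, [:: 1; 2; 4]%N)]; [:: ((1) / (b * t1), 0%N, [:: 2]%N)]; [:: ((1) / (b), 6%N, [:: 1; 3; 4]%N)]; [:: ((1) / (b * t1), 0%N, [:: 3]%N)]; [:: ((1) / (b * t1), 0%N, [:: 4]%N)]; [:: ((1) / (b * t1), 3%N, [:: 1; 2; 4]%N); ((- 1) / (b * t1), 0%N, [:: 1; 2; 4]%N)]; [:: ((1) / (b * t1), 0%N, [:: 1; 2; 3]%N)]; [:: ((1) / (b * t1), 0%N, [:: 1; 2; 4]%N)]; [:: ((1) / (b * t1), 0%N, [:: 1; 3; 4]%N)]; [:: ((1)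 / (b * t1), 0%N, [:: 2; 3; 4]%N)]]) => // x.
by certificate h.
Qed.


Lemma unique_v5_a (a b : K) s : a != 0 ->
  half_spinor (jacobian (t0, t1) (row7 [:: 0; 0; a; b; b; b - a; 0])) s ->
  exists k : K, coordinates s = k *: row16 (wvec t0 t1 (rho_coef t1 [:: 0; 0; a; b; b; b - a; 0])).
Proof.
move=> h; apply: (@spinor_unique _ _ _ _ [:: 1; 2] [:: [:: ((1) / (a), 6%N, [:: 1]%N)]; [::]; [:: ((- 1) / (a * t1), 3%N, [:: 1]%N); ((1) / (a * t1), 0%N, [:: 1]%N); ((1) / (a * (t0 - t1)), 2%N, [:: 1]%N); ((- 1) / (a), 0%N, [:: 1; 3; 4]%N); ((- 1) / (a), 1%N, [:: 1; 3; 4]%N); ((b * (t0 - t1)) / (a * a * t1), 3%N, [:: 1; 2; 4]%N); ((- b * (t0 - t1)) / (a * a * t1), 0%N, [:: 1; 2; 4]%N)]; [:: ((- 1) / (a * (t0 - t1)), 2%N, [:: 1]%N); ((1) / (a), 0%N, [:: 1; 3; 4]%N); ((1) / (a), 1%N, [:: 1; 3; 4]%N); ((- b * (t0 - t1)) / (a * a * t1), 3%N, [:: 1; 2; 4]%N); ((b * (t0 - t1)) / (a * a * t1), 0%N, [:: 1; 2; 4]%N)]; [:: ((1) / (a * t1), 0%N, [:: 1]%N)]; [:: ((1) / (a), 6%N, [:: 1; 2; 3]%N)]; [:: ((1) / (a), 6%N, [:: 1; 2; 4]%N)]; [:: ((1) / (a * t1), 0%N, [:: 2]%N)]; [:: ((1)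 / (a * t1), 3%N, [:: 4]%N); ((1) / (a), 6%N, [:: 1; 2; 4]%N); ((- 1) / (a * t1), 0%N, [:: 4]%N); ((- b) / (a * a * (t0 - t1)), 2%N, [:: 1]%N); ((b) / (a * a), 0%N, [:: 1; 3; 4]%N); ((b) / (a * a), 1%N, [:: 1; 3; 4]%N); ((- b * b * (t0 - t1)) / (a * a * a * t1), 3%N, [:: 1; 2; 4]%N); ((b * b * (t0 - t1)) / (a * a * a * t1), 0%N, [:: 1; 2; 4]%N)]; [:: ((- 1) / (a * t1), 1%N, [:: 3]%N); ((b * (t0 - t1) + b * t1) / (a * a * t1 * t1), 3%N, [:: 1]%N); ((- b * (t0 - t1) - b * t1) / (a * a * t1 * t1), 0%N, [:: 1]%N); ((- b * (t0 - t1) - b * t1) / (a * a * t1 * (t0 - t1)), 2%N, [:: 1]%N); ((b * (t0 - t1) + b * t1) / (a * a * t1), 0%N, [:: 1; 3; 4]%N); ((b * (t0 - t1) + b * t1) / (a * a * t1), 1%N, [:: 1; 3; 4]%N); ((- b * b * (t0 - t1) * (t0 - t1) - b * b * t1 * (t0 - t1)) / (a * a * a * t1 * t1), 3%N, [:: 1; 2; 4]%N); ((b * b * (t0 - t1) * (t0 - t1) + b * b * t1 * (t0 - t1)) / (a * a * a * t1 * t1), 0%N, [:: 1; 2; 4]%N)]; [:: ((1) / (a * t1), 0%N, [:: 4]%N); ((b * (t0 - t1)) / (a * a * t1), 6%N, [:: 1; 2; 4]%N); ((b) / (a * a * (t0 - t1)), 2%N, [:: 1]%N); ((- b) / (a *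 a), 0%N, [:: 1; 3; 4]%N); ((- b) / (a * a), 1%N, [:: 1; 3; 4]%N); ((b * b * (t0 - t1)) / (a * a * a * t1), 3%N, [:: 1; 2; 4]%N); ((- b * b * (t0 - t1)) / (a * a * a * t1), 0%N, [:: 1; 2; 4]%N)]; [:: ((1) / (a * t1), 3%N, [:: 1; 2; 4]%N); ((- 1) / (a * t1), 0%N, [:: 1; 2; 4]%N)]; [:: ((1) / (a * t1), 0%N, [:: 1; 2; 3]%N)]; [:: ((1) / (a * t1), 0%N, [:: 1; 2; 4]%N)]; [:: ((- 1) / (a * t1), 1%N, [:: 1; 3; 4]%N)]; [:: ((1) / (a), 6%N, [:: 1; 2; 3; 4; 5]%N); ((- b) / (a * a * t1), 3%N, [:: 1; 2; 4]%N)]]) => // x.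
by certificate h.
Qed.


(** The literal [b - 0] is what [line_point v5 0 b] unfolds to. *)
Lemma unique_v5_b (b : K) s : b != 0 ->
  half_spinor (jacobian (t0, t1) (row7 [:: 0; 0; 0; b; b; b - 0; 0])) s ->
  exists k : K, coordinates s = k *: row16 (wvec t0 t1 (rho_coef t1 [:: 0; 0; 0; b; b; b - 0; 0])).
Proof.
move=> h; apply: (@spinor_unique _ _ _ _ [::] [:: [::]; [:: ((1) / (b * (t0 - t1)), 0%N, [:: 1]%N)]; [:: ((- 1) / (b * (t0 - t1)), 1%N, [:: 1]%N)]; [:: ((- 1) / (b * (t0 - t1)), 2%N, [:: 1]%N)]; [:: ((1) / (b * t1), 0%N, [:: 5]%N); ((- 1) / (b * t1), 3%N, [:: 5]%N)]; [:: ((- 1) / (b * (t0 - t1)), 3%N, [:: 3]%N)]; [:: ((- 1) / (b * (t0 - t1)), 2%N, [:: 2]%N)]; [:: ((- 1) / (b * (t0 - t1)), 3%N, [:: 5]%N)]; [:: ((- 1) / (b * (t0 - t1)), 2%N, [:: 3]%N)]; [:: ((1) / (b * (t0 - t1)), 1%N, [:: 5]%N); (((t0 - t1) + t1) / (b * t1 * (t0 - t1)), 0%N, [:: 5]%N); ((- (t0 - t1) - t1) / (b * t1 * (t0 - t1)), 3%N, [:: 5]%N)]; [:: ((1) / (b * (t0 - t1)), 2%N, [:: 5]%N)]; [:: ((- 1) / (b * (t0 - t1)), 2%N, [:: 1; 2; 3]%N)]; [:: ((1) / (b * t1), 0%N, [:: 2; 3; 5]%N); ((- 1) / (b * t1 *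 (t0 - t1)), 3%N, [:: 5]%N)]; [:: ((1) / (b * (t0 - t1)), 0%N, [:: 1; 4; 5]%N)]; [:: ((- 1) / (b * (t0 - t1)), 1%N, [:: 1; 4; 5]%N)]; [:: ((1) / (b * (t0 - t1)), 2%N, [:: 2; 3; 5]%N)]]) => // x.
by certificate h.
Qed.


Lemma unique_v6_a (a b : K) s : a != 0 ->
  half_spinor (jacobian (t0, t1) (row7 [:: 0; 0; 0; a; a + b; a + b; b])) s ->
  exists k : K, coordinates s = k *: row16 (wvec t0 t1 (rho_coef t1 [:: 0; 0; 0; a; a + b; a + b; b])).
Proof.
move=> h; apply: (@spinor_unique _ _ _ _ [::] [:: [::]; [:: ((1) / (a * (t0 - t1)), 0%N, [:: 1]%N)]; [:: ((- 1) / (a * (t0 - t1)), 1%N, [:: 1]%N)]; [:: ((- 1) / (a * (t0 - t1)), 5%N, [:: 1]%N)]; [:: ((- 1) / (a * t1), 3%N, [:: 5]%N); ((1) / (a * t1), 0%N, [:: 5]%N); ((1) / (a * t1), 2%N, [:: 1]%N); ((b) / (a * a * (t0 - t1)), 0%N, [:: 1]%N); ((b) / (a * a * (t0 - t1)), 1%N, [:: 1]%N); ((b * t1 - a * (t0 - t1)) / (a * a * t1 * (t0 - t1)), 5%N, [:: 1]%N)]; [:: ((- 1) / (a * (t0 - t1)), 3%N, [:: 3]%N)]; [:: ((- 1) / (a * (t0 - t1)), 3%N, [:: 4]%N)]; [:: ((b) / (a * a * (t0 - t1)), 0%N, [:: 5]%N); ((- b - a) / (a * a * (t0 - t1)), 3%N,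 [:: 5]%N); ((b + a) / (a * a * (t0 - t1)), 2%N, [:: 1]%N); ((b * b * t1 + a * b * t1) / (a * a * a * (t0 - t1) * (t0 - t1)), 0%N, [:: 1]%N); ((b * b * t1 + a * b * t1) / (a * a * a * (t0 - t1) * (t0 - t1)), 1%N, [:: 1]%N); ((b * b * t1 - a * b * (t0 - t1) + a * b * t1 - a * a * (t0 - t1)) / (a * a * a * (t0 - t1) * (t0 - t1)), 5%N, [:: 1]%N)]; [:: ((- 1) / (a * (t0 - t1)), 5%N, [:: 3]%N)]; [:: ((1) / (a * (t0 - t1)), 1%N, [:: 5]%N); ((- (t0 - t1) - t1) / (a * t1 * (t0 - t1)), 3%N, [:: 5]%N); (((t0 - t1) + t1) / (a * t1 * (t0 - t1)), 0%N, [:: 5]%N); (((t0 - t1) + t1) / (a * t1 * (t0 - t1)), 2%N, [:: 1]%N); ((b * (t0 - t1) + b * t1) / (a * a * (t0 - t1) * (t0 - t1)), 0%N, [:: 1]%N); ((b * (t0 - t1) + b * t1) / (a * a * (t0 - t1) * (t0 - t1)), 1%N, [:: 1]%N); ((b * t1 * (t0 - t1) + b * t1 * t1 - a * (t0 - t1) * (t0 - t1) - a * t1 * (t0 - t1)) / (a * a * t1 * (t0 - t1) * (t0 - t1)), 5%N, [:: 1]%N)]; [:: ((1) / (a * (t0 - t1)), 5%N, [:: 5]%N)]; [:: ((1) / (a * (t0 - t1)), 4%N, [:: 1; 2; 3]%N); ((1) / (a * (t0 - t1) * (t0 - t1)), 0%N, [:: 1]%N)]; [:: ((1) / (a * (t0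 - t1)), 0%N, [:: 1; 3; 5]%N); ((- b - a) / (a * a * t1 * (t0 - t1)), 3%N, [:: 5]%N); ((b + a) / (a * a * t1 * (t0 - t1)), 0%N, [:: 5]%N); ((b + a) / (a * a * t1 * (t0 - t1)), 2%N, [:: 1]%N); ((b * b + a * b) / (a * a * a * (t0 - t1) * (t0 - t1)), 0%N, [:: 1]%N); ((b * b + a * b) / (a * a * a * (t0 - t1) * (t0 - t1)), 1%N, [:: 1]%N); ((b * b * t1 - a * b * (t0 - t1) + a * b * t1 - a * a * (t0 - t1)) / (a * a * a * t1 * (t0 - t1) * (t0 - t1)), 5%N, [:: 1]%N)]; [:: ((1) / (a * (t0 - t1)), 0%N, [:: 1; 4; 5]%N)]; [:: ((- 1) / (a * (t0 - t1)), 1%N, [:: 1; 4; 5]%N); ((b) / (a * a * t1 * (t0 - t1)), 3%N, [:: 5]%N); ((- b) / (a * a * t1 * (t0 - t1)), 0%N, [:: 5]%N); ((- b) / (a * a * t1 * (t0 - t1)), 2%N, [:: 1]%N); ((- b * b) / (a * a * a * (t0 - t1) * (t0 - t1)), 0%N, [:: 1]%N); ((- b * b) / (a * a * a * (t0 - t1) * (t0 - t1)), 1%N, [:: 1]%N); ((- b * b * t1 + a * b * (t0 - t1)) / (a * a * a * t1 * (t0 - t1) * (t0 - t1)), 5%N, [:: 1]%N)]; [:: ((1) / (a * (t0 - t1)), 4%N, [:: 3; 4; 5]%N); ((- 1) / (a * (t0 - t1) * (t0 - t1)), 5%N, [:: 3]%N); ((1) / (a * (t0 - t1) * (t0 - t1)),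 5%N, [:: 5]%N)]]) => // x.
by certificate h.
Qed.


Lemma unique_v6_b (b : K) s : b != 0 ->
  half_spinor (jacobian (t0, t1) (row7 [:: 0; 0; 0; 0; 0 + b; 0 + b; b])) s ->
  exists k : K, coordinates s = k *: row16 (wvec t0 t1 (rho_coef t1 [:: 0; 0; 0; 0; 0 + b; 0 + b; b])).
Proof.
move=> h; apply: (@spinor_unique _ _ _ _ [:: 2; 3] [:: [:: ((1) / (b), 1%N, [:: 2]%N)]; [:: ((1) / (b * t1), 0%N, [:: 2]%N)]; [:: ((- 1) / (b), 1%N, [:: 1; 2; 3]%N)]; [:: ((1) / (b * t1), 0%N, [:: 4]%N)]; [:: ((1) / (b * t1), 0%N, [:: 5]%N)]; [::]; [:: ((- 1) / (b), 3%N, [:: 2; 3; 4]%N)]; [:: ((- 1) / (b), 3%N, [:: 2; 3; 5]%N)]; [:: ((1) / (b), 1%N, [:: 2; 3; 4]%N)]; [:: ((1) / (b), 1%N, [:: 2; 3; 5]%N)]; [:: ((1) / (b), 1%N, [:: 2; 4; 5]%N); ((- 1) / (b), 3%N, [:: 2; 3; 5]%N)]; [:: ((1) / (b * t1), 0%N, [:: 2; 3; 4]%N); ((- 1) / (b * t1), 3%N, [:: 2; 3; 4]%N)]; [:: ((1) / (b * t1), 0%N, [:: 2; 3; 5]%N); ((- 1) / (b * t1), 3%N, [:: 2; 3; 5]%N)]; [:: ((1) / (b * t1), 0%N, [:: 2; 4; 5]%N)]; [:: ((1) / (b * t1), 0%N, [:: 3; 4; 5]%N); ((- 1) / (b * t1),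 1%N, [:: 2; 4; 5]%N); ((1) / (b * t1), 3%N, [:: 2; 3; 5]%N)]; [:: ((- 1) / (b * t1), 2%N, [:: 2; 3; 4]%N)]]) => // x.
by certificate h.
Qed.


Lemma unique_v7_a (a b : K) s : a != 0 ->
  half_spinor (jacobian (t0, t1) (row7 [:: 0; 0; 0; 0; a; b; b])) s ->
  exists k : K, coordinates s = k *: row16 (wvec t0 t1 (rho_coef t1 [:: 0; 0; 0; 0; a; b; b])).
Proof.
move=> h; apply: (@spinor_unique _ _ _ _ [:: 2; 3] [:: [:: ((- 1) / (a), 5%N, [:: 3]%N)]; [:: ((1) / (a * t1), 0%N, [:: 2]%N)]; [:: ((1) / (a * t1), 0%N, [:: 3]%N); ((b) / (a * a * t1), 5%N, [:: 3]%N)]; [:: ((1) / (a * t1), 0%N, [:: 4]%N)]; [:: ((1) / (a * t1), 0%N, [:: 5]%N)]; [::]; [:: ((1) / (a), 5%N, [:: 2; 3; 4]%N)]; [:: ((1) / (a), 5%N, [:: 2; 3; 5]%N)]; [:: ((1) / (a * (t0 - t1)), 3%N, [:: 3]%N); ((b) / (a * a * (t0 - t1)), 5%N, [:: 3]%N); ((1) / (a), 1%N, [:: 2; 3; 4]%N)]; [:: ((1) / (a * (t0 - t1)), 3%N, [:: 3]%N); ((b) / (a * a * (t0 - t1)), 5%N, [:: 3]%N); ((- 1) / (a * t1), 2%N, [:: 3]%N); ((1) / (a), 1%N, [:: 2; 3; 4]%N)]; [:: ((- 1) / (a), 5%N, [:: 3; 4; 5]%N); ((- 1) / (a * (t0 -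 t1)), 3%N, [:: 3]%N); ((- b) / (a * a * (t0 - t1)), 5%N, [:: 3]%N); ((- 1) / (a), 1%N, [:: 2; 3; 4]%N)]; [:: ((1) / (a * t1), 0%N, [:: 2; 3; 4]%N); ((b) / (a * a * t1), 5%N, [:: 2; 3; 4]%N)]; [:: ((1) / (a * t1), 0%N, [:: 2; 3; 5]%N); ((b) / (a * a * t1), 5%N, [:: 2; 3; 5]%N)]; [:: ((1) / (a * t1), 0%N, [:: 2; 4; 5]%N)]; [:: ((1) / (a * t1), 0%N, [:: 3; 4; 5]%N); ((b) / (a * a * t1), 5%N, [:: 3; 4; 5]%N); ((b) / (a * a * t1 * (t0 - t1)), 3%N, [:: 3]%N); ((b * b) / (a * a * a * t1 * (t0 - t1)), 5%N, [:: 3]%N); ((b) / (a * a * t1), 1%N, [:: 2; 3; 4]%N)]; [:: ((- 1) / (a * t1), 2%N, [:: 2; 3; 4]%N)]]) => // x.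
by certificate h.
Qed.


Lemma unique_v7_b (b : K) s : b != 0 ->
  half_spinor (jacobian (t0, t1) (row7 [:: 0; 0; 0; 0; 0; b; b])) s ->
  exists k : K, coordinates s = k *: row16 (wvec t0 t1 (rho_coef t1 [:: 0; 0; 0; 0; 0; b; b])).
Proof.
move=> h; apply: (@spinor_unique _ _ _ _ [:: 1; 2; 3; 5] [:: [:: ((1) / (b), 0%N, [:: 3]%N)]; [:: ((1) / (b), 0%N, [:: 1; 2; 3]%N)]; [:: ((- 1) / (b), 1%N, [:: 1; 2; 3]%N)]; [:: ((- 1) / (b), 0%N, [:: 1; 3; 4]%N)]; [:: ((- 1) / (b), 0%N, [:: 1; 3; 5]%N)]; [:: ((1) / (b), 2%N, [:: 1; 2; 3]%N)]; [:: ((- 1) / (b), 0%N, [:: 2; 3; 4]%N)]; [:: ((- 1) / (b), 0%N, [:: 2; 3; 5]%N)]; [:: ((1) / (b), 2%N, [:: 1; 3; 4]%N)]; [:: ((1) / (b), 1%N, [:: 2; 3; 5]%N)]; [:: ((1) / (b), 0%N, [:: 3; 4; 5]%N)]; [:: ((- 1) / (b * (t0 - t1)), 3%N, [:: 1; 2; 3]%N); ((1) / (b * (t0 - t1)), 0%N, [:: 1; 2; 3]%N)]; [::]; [:: ((1) / (b), 0%N, [:: 1; 2; 3; 4; 5]%N)]; [:: ((- 1) / (b), 1%N, [:: 1; 2; 3; 4; 5]%N)]; [:: ((1) / (b), 2%N, [:: 1; 2; 3; 4; 5]%N)]]) => // x.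
by certificate h.
Qed.


Lemma unique_v8_a (a b : K) s : a != 0 ->
  half_spinor (jacobian (t0, t1) (row7 [:: 0; 0; 0; 0; 0; a; b])) s ->
  exists k : K, coordinates s = k *: row16 (wvec t0 t1 (rho_coef t1 [:: 0; 0; 0; 0; 0; a; b])).
Proof.
move=> h; apply: (@spinor_unique _ _ _ _ [:: 1; 2; 3; 5] [:: [:: ((1) / (a), 0%N, [:: 3]%N)]; [:: ((1) / (a), 0%N, [:: 1; 2; 3]%N)]; [:: ((- 1) / (a), 1%N, [:: 1; 2; 3]%N)]; [:: ((- 1) / (a), 0%N, [:: 1; 3; 4]%N)]; [:: ((- 1) / (a), 0%N, [:: 1; 3; 5]%N)]; [:: ((- 1) / (a), 4%N, [:: 2; 3; 5]%N); ((b - a) / (a * a), 0%N, [:: 2; 3; 5]%N); ((1) / (a), 2%N, [:: 1; 2; 3]%N)]; [:: ((- 1) / (a), 0%N, [:: 2; 3; 4]%N)]; [:: ((- 1) / (a), 0%N, [:: 2; 3; 5]%N)]; [:: ((1) / (a), 1%N, [:: 2; 3; 4]%N); ((b) / (a * a), 4%N, [:: 2; 3; 5]%N); ((- b * b + a * b) / (a * a * a), 0%N, [:: 2; 3; 5]%N); ((- b) / (a * a), 2%N, [:: 1; 2; 3]%N)]; [:: ((1) / (a), 1%N, [:: 2; 3; 5]%N)]; [:: ((1) / (a), 0%N, [:: 3; 4; 5]%N)]; [:: ((- 1) / (a * (t0 - t1)), 3%N, [:: 1; 2; 3]%N); ((1) / (a * (t0 - t1)), 0%N, [:: 1; 2;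 3]%N)]; [::]; [:: ((1) / (a), 0%N, [:: 1; 2; 3; 4; 5]%N)]; [:: ((- 1) / (a), 1%N, [:: 1; 2; 3; 4; 5]%N)]; [:: ((1) / (a * (t0 - t1)), 3%N, [:: 2; 3; 5]%N); ((- b) / (a * a * (t0 - t1)), 0%N, [:: 2; 3; 5]%N); ((1) / (a * (t0 - t1)), 4%N, [:: 2; 3; 5]%N); ((- 1) / (a * (t0 - t1)), 2%N, [:: 1; 2; 3]%N)]]) => // x.
by certificate h.
Qed.


Lemma unique_v8_b (b : K) s : b != 0 ->
  half_spinor (jacobian (t0, t1) (row7 [:: 0; 0; 0; 0; 0; 0; b])) s ->
  exists k : K, coordinates s = k *: row16 (wvec t0 t1 (rho_coef t1 [:: 0; 0; 0; 0; 0; 0; b])).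
Proof.
move=> h; apply: (@spinor_unique _ _ _ _ [:: 1; 3; 4; 5] [:: [:: ((1) / (b), 1%N, [:: 4]%N)]; [:: ((1) / (b), 1%N, [:: 1; 2; 4]%N)]; [:: ((1) / (b), 1%N, [:: 1; 3; 4]%N)]; [:: ((- 1) / (b), 4%N, [:: 1; 3; 4]%N)]; [:: ((- 1) / (b), 1%N, [:: 1; 4; 5]%N)]; [:: ((1) / (b), 1%N, [:: 2; 3; 4]%N)]; [:: ((1) / (b), 2%N, [:: 1; 2; 4]%N)]; [:: ((- 1) / (b), 1%N, [:: 2; 4; 5]%N)]; [:: ((1) / (b), 2%N, [:: 1; 3; 4]%N)]; [:: ((- 1) / (b), 1%N, [:: 3; 4; 5]%N)]; [:: ((1) / (b), 2%N, [:: 1; 4; 5]%N)]; [:: ((1) / (b * (t0 - t1)), 3%N, [:: 1; 3; 4]%N)]; [:: ((- 1) / (b), 1%N, [:: 1; 2; 3; 4; 5]%N)]; [:: ((1) / (b * (t0 - t1)), 3%N, [:: 1; 4; 5]%N)]; [::]; [:: ((1) / (b), 2%N, [:: 1; 2; 3; 4; 5]%N)]]) => // x.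
by certificate h.
Qed.


Lemma unique_v9_a (a b : K) s : a != 0 ->
  half_spinor (jacobian (t0, t1) (row7 [:: - a - b; 0; 0; a; 0; 0; b])) s ->
  exists k : K, coordinates s = k *: row16 (wvec t0 t1 (rho_coef t1 [:: - a - b; 0; 0; a; 0; 0; b])).
Proof.
move=> h; apply: (@spinor_unique _ _ _ _ [::] [:: [::]; [:: ((1) / (a * (t0 - t1)), 0%N, [:: 1]%N)]; [:: ((- 1) / (a * (t0 - t1)), 1%N, [:: 1]%N)]; [:: ((- 1) / (a * (t0 - t1)), 5%N, [:: 1]%N)]; [:: ((- 1) / (a * t1), 4%N, [:: 5]%N); ((- 1) / (a * t1), 0%N, [:: 5]%N); ((b - a) / (a * a * t1), 5%N, [:: 5]%N); ((- (t0 - t1)) / (a * t1), 2%N, [:: 1; 4; 5]%N); ((1) / (a), 0%N, [:: 1; 4; 5]%N); ((1) / (a), 1%N, [:: 1; 4; 5]%N)]; [:: ((- 1) / (a * (t0 - t1)), 0%N, [:: 3]%N)]; [:: ((- 1) / (a * (t0 - t1)), 0%N, [:: 4]%N)]; [:: ((- 1) / (a * (t0 - t1)), 0%N, [:: 5]%N)]; [:: ((- 1) / (a * (t0 - t1)), 5%N, [:: 3]%N)]; [:: ((1) / (a * (t0 - t1)), 1%N, [:: 5]%N); ((- (t0 - t1) - t1) / (a * t1 * (t0 - t1)), 4%N, [:: 5]%N); ((- (t0 - t1) - t1) / (a * t1 * (t0 - t1)), 0%N, [:: 5]%N); ((b * (t0 - t1) + b * t1 - a * (t0 - t1) - a * t1)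 / (a * a * t1 * (t0 - t1)), 5%N, [:: 5]%N); ((- (t0 - t1) - t1) / (a * t1), 2%N, [:: 1; 4; 5]%N); (((t0 - t1) + t1) / (a * (t0 - t1)), 0%N, [:: 1; 4; 5]%N); (((t0 - t1) + t1) / (a * (t0 - t1)), 1%N, [:: 1; 4; 5]%N)]; [:: ((1) / (a * (t0 - t1)), 5%N, [:: 5]%N)]; [:: ((1) / (a * (t0 - t1)), 0%N, [:: 1; 3; 4]%N)]; [:: ((1) / (a * (t0 - t1)), 0%N, [:: 1; 3; 5]%N)]; [:: ((1) / (a * (t0 - t1)), 0%N, [:: 1; 4; 5]%N)]; [:: ((- b - a) / (a * a * (t0 - t1)), 1%N, [:: 1; 4; 5]%N); ((b) / (a * a * t1 * (t0 - t1)), 4%N, [:: 5]%N); ((b) / (a * a * t1 * (t0 - t1)), 0%N, [:: 5]%N); ((- b * b + a * b) / (a * a * a * t1 * (t0 - t1)), 5%N, [:: 5]%N); ((b) / (a * a * t1), 2%N, [:: 1; 4; 5]%N); ((- b) / (a * a * (t0 - t1)), 0%N, [:: 1; 4; 5]%N)]; [:: ((- 1) / (a * (t0 - t1)), 0%N, [:: 3; 4; 5]%N)]]) => // x.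
by certificate h.
Qed.


Lemma unique_v9_b (b : K) s : b != 0 ->
  half_spinor (jacobian (t0, t1) (row7 [:: - 0 - b; 0; 0; 0; 0; 0; b])) s ->
  exists k : K, coordinates s = k *: row16 (wvec t0 t1 (rho_coef t1 [:: - 0 - b; 0; 0; 0; 0; 0; b])).
Proof.
move=> h; apply: (@spinor_unique _ _ _ _ [:: 3; 4] [:: [:: ((1) / (b), 1%N, [:: 4]%N)]; [:: ((1) / (b), 1%N, [:: 1; 2; 4]%N)]; [:: ((1) / (b), 1%N, [:: 1; 3; 4]%N)]; [:: ((- 1) / (b * t1), 4%N, [:: 4]%N)]; [:: ((- 1) / (b), 1%N, [:: 1; 4; 5]%N)]; [:: ((1) / (b), 1%N, [:: 2; 3; 4]%N)]; [:: ((1) / (b), 5%N, [:: 2; 3; 4]%N)]; [:: ((- 1) / (b), 1%N, [:: 2; 4; 5]%N)]; [::]; [:: ((- 1) / (b), 1%N, [:: 3; 4; 5]%N)]; [:: ((- 1) / (b * t1), 2%N, [:: 4]%N)]; [:: ((- 1) / (b * t1), 4%N, [:: 2; 3; 4]%N); ((- 1) / (b * t1), 5%N, [:: 2; 3; 4]%N)]; [:: ((- 1) / (b), 1%N, [:: 1; 2; 3; 4; 5]%N)]; [:: ((- 1) / (b), 5%N, [:: 1; 2; 3; 4; 5]%N)]; [:: ((- 1) / (b * t1), 2%N, [:: 1; 3; 4]%N)]; [:: ((- 1) / (b * t1), 2%N, [:: 2; 3; 4]%N)]]) => // x.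
by certificate h.
Qed.


Lemma unique_v10_a (a b : K) s : a != 0 ->
  half_spinor (jacobian (t0, t1) (row7 [:: 0; a; 0; 0; b; 0; 0])) s ->
  exists k : K, coordinates s = k *: row16 (wvec t0 t1 (rho_coef t1 [:: 0; a; 0; 0; b; 0; 0])).
Proof.
move=> h; apply: (@spinor_unique _ _ _ _ [:: 2; 4] [:: [:: ((1) / (a), 5%N, [:: 2]%N)]; [:: ((1) / (a), 6%N, [:: 1; 2; 4]%N)]; [:: ((- 1) / (a), 5%N, [:: 1; 2; 3]%N); ((- b) / (a * a), 6%N, [:: 1; 2; 4]%N)]; [:: ((- 1) / (a), 5%N, [:: 1; 2; 4]%N)]; [:: ((- 1) / (a), 5%N, [:: 1; 2; 5]%N); ((- b) / (a * a), 6%N, [:: 1; 2; 4]%N)]; [:: ((1) / (a), 6%N, [:: 2; 3; 4]%N)]; [::]; [:: ((- 1) / (a), 6%N, [:: 2; 4; 5]%N)]; [:: ((1) / (a), 5%N, [:: 2; 3; 4]%N)]; [:: ((- 1) / (a), 6%N, [:: 3; 4; 5]%N); ((b) / (a * a), 5%N, [:: 2; 3; 4]%N); ((b) / (a * a), 5%N, [:: 2; 4; 5]%N)]; [:: ((1) / (a), 5%N, [:: 2; 4; 5]%N)]; [:: ((1) / (a * (t0 - t1)), 3%N, [:: 1; 2; 4]%N)]; [:: ((1) / (a * (t0 - t1)), 3%N, [:: 1; 2; 5]%N); ((- b) / (a * a * t1), 2%N, [:: 1; 2; 4]%N); ((- b * b) / (a * a * a * (t0 - t1)), 3%N, [:: 1;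 2; 4]%N); ((- b) / (a * a * t1), 0%N, [:: 2; 4; 5]%N)]; [:: ((- 1) / (a * t1), 2%N, [:: 1; 2; 4]%N); ((- b) / (a * a * (t0 - t1)), 3%N, [:: 1; 2; 4]%N); ((- 1) / (a * t1), 0%N, [:: 2; 4; 5]%N)]; [:: ((- 1) / (a * (t0 - t1)), 3%N, [:: 1; 4; 5]%N); ((b) / (a * a * t1), 2%N, [:: 1; 2; 4]%N); ((b * b) / (a * a * a * (t0 - t1)), 3%N, [:: 1; 2; 4]%N); ((b) / (a * a * t1), 0%N, [:: 2; 4; 5]%N)]; [:: ((- 1) / (a * (t0 - t1)), 3%N, [:: 2; 4; 5]%N); (((t0 - t1) + t1) / (a * t1 * (t0 - t1)), 2%N, [:: 1; 2; 4]%N); ((b * (t0 - t1) + b * t1) / (a * a * (t0 - t1) * (t0 - t1)), 3%N, [:: 1; 2; 4]%N); (((t0 - t1) + t1) / (a * t1 * (t0 - t1)), 0%N, [:: 2; 4; 5]%N)]]) => // x.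
by certificate h.
Qed.


Lemma unique_v10_b (b : K) s : b != 0 ->
  half_spinor (jacobian (t0, t1) (row7 [:: 0; 0; 0; 0; b; 0; 0])) s ->
  exists k : K, coordinates s = k *: row16 (wvec t0 t1 (rho_coef t1 [:: 0; 0; 0; 0; b; 0; 0])).
Proof.
move=> h; apply: (@spinor_unique _ _ _ _ [:: 2; 3] [:: [:: ((- 1) / (b), 5%N, [:: 3]%N)]; [:: ((1) / (b * t1), 0%N, [:: 2]%N)]; [:: ((1) / (b * t1), 0%N, [:: 3]%N)]; [:: ((1) / (b * t1), 0%N, [:: 4]%N)]; [:: ((1) / (b * t1), 0%N, [:: 5]%N)]; [::]; [:: ((1) / (b * (t0 - t1)), 3%N, [:: 2]%N)]; [:: ((- 1) / (b * (t0 - t1)), 3%N, [:: 3]%N); ((1) / (b * (t0 - t1)), 3%N, [:: 5]%N); ((- 1) / (b), 5%N, [:: 3; 4; 5]%N)]; [:: ((1) / (b * (t0 - t1)), 3%N, [:: 3]%N)]; [:: ((- 1) / (b * t1), 2%N, [:: 3]%N); ((1) / (b * (t0 - t1)), 3%N, [:: 3]%N)]; [:: ((- 1) / (b * (t0 - t1)), 3%N, [:: 3]%N); ((- 1) / (b), 5%N, [:: 3; 4; 5]%N)]; [:: ((1) / (b * t1), 0%N, [:: 2; 3; 4]%N)]; [:: ((1) / (b * t1), 0%N, [:: 2; 3; 5]%N)]; [:: ((1) / (b * t1), 0%N, [:: 2; 4; 5]%N)]; [:: ((1) / (b * t1), 0%N, [:: 3; 4; 5]%N)]; [:: ((- 1)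 / (b * t1), 2%N, [:: 2; 3; 4]%N)]]) => // x.
by certificate h.
Qed.


Lemma unique_v11_a (a b : K) s : a != 0 ->
  half_spinor (jacobian (t0, t1) (row7 [:: 0; 0; a; 0; 0; b; 0])) s ->
  exists k : K, coordinates s = k *: row16 (wvec t0 t1 (rho_coef t1 [:: 0; 0; a; 0; 0; b; 0])).
Proof.
move=> h; apply: (@spinor_unique _ _ _ _ [:: 1; 2] [:: [:: ((1) / (a), 6%N, [:: 1]%N)]; [::]; [:: (((t0 - t1) + t1) / (a * t1 * (t0 - t1)), 4%N, [:: 1]%N); ((1) / (a * t1), 0%N, [:: 1]%N); ((1) / (a * (t0 - t1)), 3%N, [:: 1]%N); ((- 1) / (a), 0%N, [:: 1; 3; 4]%N); ((- 1) / (a), 1%N, [:: 1; 3; 4]%N)]; [:: ((- 1) / (a * (t0 - t1)), 3%N, [:: 1]%N); ((- 1) / (a * (t0 - t1)), 4%N, [:: 1]%N); ((1) / (a), 0%N, [:: 1; 3; 4]%N); ((1) / (a), 1%N, [:: 1; 3; 4]%N)]; [:: ((1) / (a * t1), 0%N, [:: 1]%N)]; [:: ((1) / (a), 6%N, [:: 1; 2; 3]%N)]; [:: ((1) / (a), 6%N, [:: 1; 2; 4]%N)]; [:: ((1) / (a * t1), 0%N, [:: 2]%N)]; [:: ((1) / (a), 6%N, [:: 1; 3; 4]%N)]; [:: ((- 1) / (a * t1), 1%N, [:: 3]%N)]; [:: ((1) / (a * t1), 0%N, [:: 4]%N)]; [:: ((1) / (a * t1), 3%N, [:: 1; 2; 4]%N);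 ((- 1) / (a * t1), 0%N, [:: 1; 2; 4]%N)]; [:: ((1) / (a * t1), 0%N, [:: 1; 2; 3]%N)]; [:: ((1) / (a * t1), 0%N, [:: 1; 2; 4]%N)]; [:: ((- 1) / (a * t1), 1%N, [:: 1; 3; 4]%N)]; [:: ((1) / (a), 6%N, [:: 1; 2; 3; 4; 5]%N)]]) => // x.
by certificate h.
Qed.


Lemma unique_v11_b (b : K) s : b != 0 ->
  half_spinor (jacobian (t0, t1) (row7 [:: 0; 0; 0; 0; 0; b; 0])) s ->
  exists k : K, coordinates s = k *: row16 (wvec t0 t1 (rho_coef t1 [:: 0; 0; 0; 0; 0; b; 0])).
Proof.
move=> h; apply: (@spinor_unique _ _ _ _ [:: 1; 2; 3; 5] [:: [:: ((1) / (b), 0%N, [:: 3]%N)]; [:: ((1) / (b), 0%N, [:: 1; 2; 3]%N)]; [:: ((- 1) / (b), 1%N, [:: 1; 2; 3]%N)]; [:: ((- 1) / (b), 0%N, [:: 1; 3; 4]%N)]; [:: ((- 1) / (b), 0%N, [:: 1; 3; 5]%N)]; [:: ((- 1) / (b), 4%N, [:: 2; 3; 5]%N); ((- 1) / (b), 0%N, [:: 2; 3; 5]%N)]; [:: ((- 1) / (b), 0%N, [:: 2; 3; 4]%N)]; [:: ((- 1) / (b), 0%N, [:: 2; 3; 5]%N)]; [:: ((1) / (b), 1%N, [:: 2; 3; 4]%N)]; [:: ((1) / (b), 1%N, [:: 2; 3; 5]%N)]; [:: ((1) / (b), 0%N, [:: 3; 4; 5]%N)]; [:: ((- 1) / (b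 * (t0 - t1)), 3%N, [:: 1; 2; 3]%N); ((1) / (b * (t0 - t1)), 0%N, [:: 1; 2; 3]%N)]; [::]; [:: ((1) / (b), 0%N, [:: 1; 2; 3; 4; 5]%N)]; [:: ((- 1) / (b), 1%N, [:: 1; 2; 3; 4; 5]%N)]; [:: ((1) / (b * (t0 - t1)), 3%N, [:: 2; 3; 5]%N); ((1) / (b * (t0 - t1)), 4%N, [:: 2; 3; 5]%N)]]) => // x.
by certificate h.
Qed.


(** Here y4 is solved from the equation of the conic, with [q] its coefficient. The three points of
    the conic with y2 y3 = 0 lie on lines and are covered by their certificates. *)
Lemma unique_v34_a (y2 y3 q : K) s : y2 != 0 -> y3 != 0 -> q != 0 ->
  t1 * y2 + (t0 - t1) * y3 = q ->
  let c := [:: y2 - y3; y2 - t0 * y2 * y3 / q; y2; y3; t0 * y2 * y3 / q; 0; 0] in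
  half_spinor (jacobian (t0, t1) (row7 c)) s ->
  exists k : K, coordinates s = k *: row16 (wvec t0 t1 (rho_coef t1 c)).
Proof.
move=> h2 h3 hq eq_q; move: hq; rewrite -eq_q => hq c; pose d := t0 - t1; pose y4 := t0 * y2 * y3 / (t1 * y2 + (t0 - t1) * y3).
apply: (@spinor_unique _ _ _ _ [:: 1; 2]%N
 [:: [:: (y2^-1, 6%N, [:: 1]%N)]; [::];
     [:: (- (d * y3)^-1, 1%N, [:: 1]%N); (- (d * y3)^-1, 0%N, [:: 1]%N)];
     [:: (- (d * y3)^-1, 5%N, [:: 1]%N)];
     [:: ((t1 * y2)^-1, 0%N, [:: 1]%N)];
     [:: (- (d * y3)^-1, 1%N, [:: 2]%N); (- (d * y3)^-1, 0%N, [:: 2]%N)];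
     [:: (y2^-1, 6%N, [:: 1; 2; 4]%N)];
     [:: ((t1 * y2)^-1, 0%N, [:: 2]%N)];
     [:: ((d * y3)^-1, 1%N, [:: 4]%N); ((d * y3)^-1, 0%N, [:: 4]%N);
         ((t1 * y4 - t0 * y3) / (d * y3) / (d * y3), 5%N, [:: 1]%N);
         (y2^-1, 6%N, [:: 1; 2; 4]%N)];
     [:: (- (t1 * y2)^-1, 1%N, [:: 3]%N);
         (t0 / (d * t1 * y2), 1%N, [:: 1]%N); (t0 / (d * t1 * y2), 0%N, [:: 1]%N)];
     [:: ((t1 * y2)^-1, 0%N, [:: 4]%N); (y4 / (y2 * d * y3), 5%N, [:: 1]%N);
         (d * y3 / (t1 * y2 * y2), 6%N, [:: 1; 2; 4]%N)];
     [:: ((d * y3)^-1, 0%N, [:: 1; 3; 4]%N);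
         (t1 * y2 / (t0 * d * y3 * y3), 1%N, [:: 3; 4; 5]%N)];
     [:: ((d * y3)^-1, 0%N, [:: 1; 3; 5]%N)];
     [:: ((d * y3)^-1, 0%N, [:: 1; 4; 5]%N)];
     [:: (- (t0 * y3)^-1, 1%N, [:: 3; 4; 5]%N)];
     [:: (- (d * y3)^-1, 0%N, [:: 3; 4; 5]%N);
         (- (t1 * y4) / (t0 * d * y3 * y3), 1%N, [:: 3; 4; 5]%N)]]) => // x.
rewrite /clq_comb /clq /ins /del /sgn /Jf /xlist /y4 /d /=.
by do ![apply: (congr2 cons) | by [] | field; rewrite ?t00 ?t10 ?t01 ?h2 ?h3 ?hq].
Qed.
End Generic.

(** * The curve C_t and its smooth points *)

Definition line_point (R : comNzRingType) (v : component) (a b : R) : seq R :=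
  match v with
  | v0 => [:: a; 0; 0; 0; 0; 0; b]
  | v1 => [:: a; b; 0; 0; 0; 0; 0]
  | v2 => [:: a; a; b; 0; 0; 0; 0]
  | v5 => [:: 0; 0; a; b; b; b - a; 0]
  | v6 => [:: 0; 0; 0; a; a + b; a + b; b]
  | v7 => [:: 0; 0; 0; 0; a; b; b]
  | v8 => [:: 0; 0; 0; 0; 0; a; b]
  | v9 => [:: - a - b; 0; 0; a; 0; 0; b]
  | v10 => [:: 0; a; 0; 0; b; 0; 0]
  | v11 => [:: 0; 0; a; 0; 0; b; 0]
  | v34 => [:: 0; 0; 0; 0; 0; 0; 0]
  end.

Definition is_line (v : component) : bool := if v is v34 then false else true.

Definition line_coord (v : component) : nat * nat :=
  match v with
  | v0 => (0, 6) | v1 => (0, 1) | v2 => (0, 2) | v5 => (2, 3) | v6 => (3, 6)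
  | v7 => (4, 5) | v8 => (5, 6) | v9 => (3, 6) | v10 => (1, 4) | v11 => (2, 5)
  | v34 => (0, 0)
  end%N.

Definition conic_point (R : comNzRingType) (y2 y3 y4 : R) : seq R :=
  [:: y2 - y3; y2 - y4; y2; y3; y4; 0; 0].

(** Closes an equality that follows from one hypothesis with sign, or from the difference of two
    hypotheses. *)
Ltac by_equations :=
  match goal with
  | |- ?u = ?v => ring
  | e : ?E = 0 |- ?u = ?v => transitivity (v + E); [ring|by rewrite e addr0]
  | e : ?E = 0 |- ?u = ?v => transitivity (v - E); [ring|by rewrite e subr0]
  | e : ?E = 0, e' : ?E' = 0 |- ?u = ?v =>
      transitivity (v + E - E'); [ring|by rewrite e e' addr0 subr0]
  end.

Section Curve.
Variables (K : numFieldType) (t0 t1 : K).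
Let t := (t0, t1).

Definition C_values v (y : nat -> K) : seq K :=
  match v with
  | v0 => [:: y 5; y 4; y 3; y 2; y 1]
  | v1 => [:: y 6; y 5; y 4; y 3; y 2]
  | v2 => [:: y 6; y 5; y 4; y 3; y 0 - y 1]
  | v34 => [:: t0 * (y 2 * y 3) - t1 * (y 2 * y 4) + (- t0 + t1) * (y 3 * y 4);
               y 6; y 5; y 1 - y 2 + y 4; y 0 - y 2 + y 3]
  | v5 => [:: y 6; y 3 - y 4; y 2 - y 4 + y 5; y 1; y 0]
  | v6 => [:: y 4 - y 5; y 3 - y 5 + y 6; y 2; y 1; y 0]
  | v7 => [:: y 5 - y 6; y 3; y 2; y 1; y 0]
  | v8 => [:: y 4; y 3; y 2; y 1; y 0]
  | v9 => [:: y 5; y 4; y 2; y 1; y 0 + y 3 + y 6]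
  | v10 => [:: y 6; y 5; y 3; y 2; y 0]
  | v11 => [:: y 6; y 4; y 3; y 1; y 0]
  end.

Lemma C_compE v x : C_comp t v x <->
  x != 0 /\ all (fun e => e == 0) (C_values v (fun k => x 0 (inord k))).
Proof.
have yE k : (y_ K k).@[x 0] = x 0 (inord k) by rewrite mevalXU.
have -> : C_values v (fun k => x 0 (inord k)) = [seq f.@[x 0] | f <- C_equations t v].
  by case: v => /=; rewrite ?(mevalD, mevalB, mevalN, mevalZ, mevalM) ?yE.
split=> -[x0 h]; split=> //.
  by rewrite all_map; apply/allP => f /h /= ->.
by move=> f hf; apply/eqP; move: h; rewrite all_map => /allP/(_ f hf).
Qed.

Lemma row7_eta (x : 'rV[K]_7) (c : seq K) :
  (forall k, (k < 7)%N -> x 0 (inord k) = nth 0 c k) -> x = row7 c.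
Proof. by move=> h; apply/rowP => k; rewrite -(inord_val k) h // row7E. Qed.

Lemma C_lineE v x : is_line v -> C_comp t v x <->
  x != 0 /\ exists a b, x = row7 (line_point v a b).
Proof.
move=> nv; rewrite C_compE; split=> -[x0 h]; split=> //; last first.
  case: h x0 => a [b ->] _; case: v nv => //= _; rewrite !row7E //=;
    do ?[by []|apply/andP; split|apply/eqP; ring].
exists (x 0 (inord (line_coord v).1)), (x 0 (inord (line_coord v).2)).
apply: row7_eta => k; move: nv h; case: v => //= _ /and5P[/eqP e0 /eqP e1 /eqP e2 /eqP e3];
  rewrite andbT => /eqP e4; do 7?[case: k => [|k]] => // _ /=; by_equations.
Qed.

Lemma C_conicE x : C_comp t v34 x <-> x != 0 /\ exists y2 y3 y4 : K,
  t0 * y2 * y3 - t1 * y2 * y4 + (t1 - t0) * y3 * y4 = 0 /\ x = row7 (conic_point y2 y3 y4).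
Proof.
rewrite C_compE; split=> -[x0 h]; split=> //; last first.
  case: h x0 => y2 [y3 [y4 [q0 ->]]] _; rewrite /= !row7E //=.
  by apply/and5P; split; rewrite ?andbT //; apply/eqP; [rewrite -q0| |]; ring.
exists (x 0 (inord 2)), (x 0 (inord 3)), (x 0 (inord 4)).
move: h => /and5P[/eqP e0 /eqP e1 /eqP e2 /eqP e3]; rewrite andbT => /eqP e4.
split; first by rewrite -e0; ring.
by apply: row7_eta => k; do 7?[case: k => [|k]] => // _ /=; by_equations.
Qed.

Lemma line_pointE v (a b : K) : row7 (line_point v a b) =
  a *: row7 (line_point v 1 0) + b *: row7 (line_point v 0 1).
Proof.
apply/rowP => k; rewrite !mxE; case: k => k hk; case: v => /=;
  do 7?[case: k hk => [|k] hk] => //=; ring.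
Qed.

Lemma C_lineset v : is_line v ->
  C_comp t v = lineset (row7 (line_point v 1 0)) (row7 (line_point v 0 1)).
Proof.
move=> nv; apply/funext => x; apply/propext; rewrite C_lineE //.
by split=> -[x0 [a [b xE]]]; split=> //; exists a, b; rewrite xE -line_pointE.
Qed.

Lemma conic_pointE (y2 y3 y4 : K) : row7 (conic_point y2 y3 y4) =
  y2 *: row7 (conic_point 1 0 0) + y3 *: row7 (conic_point 0 1 0) +
  y4 *: row7 (conic_point 0 0 1).
Proof.
apply/rowP => k; rewrite !mxE; case: k => k hk.
by do 7?[case: k hk => [|k] hk] => //=; ring.
Qed.

Lemma C_conicset : C_comp t v34 = conicset (row7 (conic_point 1 0 0))
  (row7 (conic_point 0 1 0)) (row7 (conic_point 0 0 1)) t0 (- t1) (t1 - t0).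
Proof.
apply/funext => x; apply/propext; rewrite C_conicE.
split=> -[x0 [a [b [c []]]]] => [q xE|xE q]; split=> //; exists a, b, c;
  by rewrite xE -conic_pointE; split=> //; rewrite -q; ring.
Qed.

Definition component_of (i : 'I_11) : component :=
  nth v0 [:: v0; v1; v2; v34; v5; v6; v7; v8; v9; v10; v11] i.

Lemma component_ofP v : exists i, component_of i = v.
Proof.
pose k := match v with v0 => 0 | v1 => 1 | v2 => 2 | v34 => 3 | v5 => 4 | v6 => 5
  | v7 => 6 | v8 => 7 | v9 => 8 | v10 => 9 | v11 => 10 end%N.
by exists (inord k); rewrite /component_of inordK /k; case: v {k}.
Qed.

Lemma component_of_inj : injective component_of.
Proof.
move=> i j; rewrite /component_of => e; apply: val_inj; move: i j e => [i hi] [j hj] /=.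
by do 11?[case: i hi => [|i] hi] => //; do 11?[case: j hj => [|j] hj].
Qed.

Lemma C_equations_homog v f : f \in C_equations t v -> exists d, f \is d.-homog.
Proof.
have hy k : y_ K k \is 1.-homog by rewrite dhomogX /= mdeg1.
have hyy k l : y_ K k * y_ K l \is 2.-homog by apply: (@dhomogM _ _ _ 1%N _ 1%N).
by case: v => /=; rewrite !inE => /or4P[|||/orP[]] /eqP ->;
  solve [by exists 1%N; do ?[exact: hy|apply: rpredB|apply: rpredD]
        |by exists 2%N; do ?[exact: hyy|apply: rpredZ|apply: rpredB|apply: rpredD]].
Qed.

(** C_t is a union of eleven curves whose ideal is the full vanishing ideal, so the results on
    families apply with [N = 0]. *)
Lemma C_smooth v (p : 'rV[K]_7) (j : 'I_7) : p 0 j != 0 -> C_comp t v p -> smooth_branch (C_comp t v) p j ->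
  (forall v', C_comp t v' p -> v' = v) -> smooth_point (vanishing (C t)) p.
Proof.
move=> pj Cp sm uniq_v; have p0 : p != 0 by case: Cp.
split; first by split=> // f; apply; exists v.
exists j => //; have [i Ei] := component_ofP v.
apply: (@family_smooth _ _ 11 (fun i => C_comp t (component_of i)) _ 0%N _ _ _ _ p j i) => //;
  rewrite ?Ei //.
- by move=> i'; case: (boolP (is_line (component_of i'))) => [/C_lineset ->|];
    [apply: lineset_cone|case: (component_of i') => // _; rewrite C_conicset; apply: conicset_cone].
- by move=> i'; apply: zeros_separated => f; apply: C_equations_homog.
- by move=> f If i' x Cx; apply: If; exists (component_of i').
- move=> f h m; move/eqP; rewrite mdeg_eq0 => /eqP ->; rewrite mpolyX0 mul1r => x [v' Cx].
  by have [i' Ei'] := component_ofP v'; apply: (h i'); rewrite Ei'.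
- by move=> i' Ci'; apply: component_of_inj; rewrite Ei; apply: uniq_v.
Qed.

Lemma line_point_coord v (a b : K) : is_line v ->
  row7 (line_point v a b) 0 (inord (line_coord v).1) = a /\
  row7 (line_point v a b) 0 (inord (line_coord v).2) = b.
Proof. by case: v => // _; rewrite !row7E. Qed.

Lemma lineset_general n (u v : 'rV[K]_n) a b : a != 0 ->
  lineset (a *: u + b *: v) v = lineset u v.
Proof.
move=> a0; apply/funext => x; apply/propext; split=> -[x0 [c [d xE]]]; split=> //.
  exists (c * a), (c * b + d); rewrite xE scalerDr !scalerA -addrA; congr (_ + _).
  by rewrite -scalerDl.
exists (c / a), (d - c / a * b); rewrite xE scalerDr !scalerA divfK // -addrA; congr (_ + _).
by rewrite -scalerDl; congr (_ *: _); ring.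
Qed.

(** In the chosen parametrizations a line meets the other components only where a : b is 0, 1, -1 or
    infinite. *)
Lemma line_smooth v (a b : K) : is_line v -> a * b * ((a + b) * (a - b)) != 0 ->
  let p := row7 (line_point v a b) in C_comp t v p /\ smooth_point (vanishing (C t)) p.
Proof.
move=> nv; rewrite !mulf_eq0 !negb_or -!andbA => /and4P[a0 b0 ab amb] p.
have [pa pb] := line_point_coord a b nv.
have [va vb] := line_point_coord 0 1 nv.
have p0 : p != 0 by apply: contra_neq a0 => p0; rewrite -pa -/p p0 mxE.
have Cp : C_comp t v p by rewrite C_lineE //; split=> //; exists a, b.
split=> //; apply: (@C_smooth v p (inord (line_coord v).1)) => //; first by rewrite pa.
  rewrite C_lineset // -(lineset_general _ _ b a0) -line_pointE -/p.
  apply: (@smooth_branch_line _ _ _ _ _ (delta_mx (inord (line_coord v).2) 0 -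
    (b / a) *: delta_mx (inord (line_coord v).1) 0)); first by rewrite pa.
    by rewrite evcB evcZ !mulmx_delta pa pb divfK // subrr.
  by rewrite evcB evcZ !mulmx_delta va vb mulr0 subr0.
move=> v'; rewrite C_compE => -[_]; rewrite /p.
have nz (c : K) : c != 0 -> c = 0 -> False by move=> /eqP.
have na := nz _ a0; have nb := nz _ b0; have nab := nz _ ab; have namb := nz _ amb.
case: v' v nv {p p0 Cp pa pb va vb} => [] [] //= _; rewrite !row7E //= =>
  /and5P[/eqP e0 /eqP e1 /eqP e2 /eqP e3]; rewrite andbT => /eqP e4; exfalso;
  solve [apply: na; by_equations|apply: nb; by_equations
        |apply: nab; by_equations|apply: namb; by_equations].
Qed.

(** The conic meets [v9] and [v10] where y2 = 0, [v2] where y4 = 0, and [v5] where y2 = y3. *)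
Lemma conic_smooth (y2 y3 y4 : K) : t0 != 0 -> t1 != 0 -> t1 - t0 != 0 ->
  y2 != 0 -> y4 != 0 -> y2 - y3 != 0 ->
  t0 * y2 * y3 - t1 * y2 * y4 + (t1 - t0) * y3 * y4 = 0 ->
  let p := row7 (conic_point y2 y3 y4) in C_comp t v34 p /\ smooth_point (vanishing (C t)) p.
Proof.
move=> t00 t10 t01 h2 h4 h23 q0 p.
have p2 : p 0 (inord 2) = y2 by rewrite row7E.
have p0 : p != 0 by apply: contra_neq h2 => p0; rewrite -p2 p0 mxE.
have Cp : C_comp t v34 p by rewrite C_conicE; split=> //; exists y2, y3, y4.
split=> //; apply: (@C_smooth v34 p (inord 2)) => //; first by rewrite p2.
  rewrite C_conicset /p conic_pointE.
  apply: (@smooth_branch_conic _ _ _ _ _ _ _ _ _ _ _ _ (delta_mx (inord 3) 0)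
    (delta_mx (inord 4) 0)) => //; rewrite ?mulmx_delta ?row7E ?oppr_eq0 ?oner_neq0 //=.
  by rewrite -q0; ring.
move=> v'; rewrite C_compE => -[_]; rewrite /p {p p2 p0 Cp}.
have nz (c : K) : c != 0 -> c = 0 -> False by move=> /eqP.
have n2 := nz _ h2; have n4 := nz _ h4; have n23 := nz _ h23.
case: v' => //=; rewrite !row7E //= =>
  /and5P[/eqP e0 /eqP e1 /eqP e2 /eqP e3]; rewrite andbT => /eqP e4; exfalso;
  solve [apply: n2; by_equations|apply: n4; by_equations|apply: n23; by_equations].
Qed.
End Curve.

(** * The image of rho: ten lines and a conic in P_nod *)

Definition pvec (R : comNzRingType) (t0 t1 : R) (c : seq R) : 'rV[R]_16 :=
  \row_i nth 0 (wvec t0 t1 c) i.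

(** Spanning vectors of the image lines in the basis of P_nod. The images of the two parametrizing
    points are rescaled so that these vectors stay independent at t_1 = 0. *)
Definition line_rows (R : comNzRingType) (t1 : R) (v : component) : seq R * seq R :=
  match v with
  | v0 => ([:: 0; 0; 1; 0; 0; 0; 0], [:: 0; 0; 0; 0; 0; 0; 1])
  | v1 => ([:: 0; 0; 1; 0; 0; 0; 0], [:: 0; 1; 0; 0; 0; 0; 0])
  | v2 => ([:: 0; 1; 1; 0; 0; 0; 0], [:: 1; 0; 0; 0; 0; 0; 0])
  | v5 => ([:: t1; 0; 0; 0; 0; 1; 0], [:: 0; 0; 0; 1; 0; 1; 0])
  | v6 => ([:: 0; 0; 0; 1; 0; 1; 0], [:: 0; 0; t1; 0; - t1; -1; 1])
  | v7 => ([:: 0; 0; 1; 0; -1; 0; 0], [:: 0; 0; 0; 0; 0; -1; 1])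
  | v8 => ([:: 0; 0; 0; 0; 0; 1; 0], [:: 0; 0; 0; 0; 0; 0; 1])
  | v9 => ([:: 0; 0; 0; -1; t1; 0; 0], [:: 0; 0; t1; 0; 0; 0; 1])
  | v10 => ([:: 0; 1; 0; 0; 0; 0; 0], [:: 0; 0; 1; 0; -1; 0; 0])
  | v11 => ([:: 1; 0; 0; 0; 0; 0; 0], [:: 0; 0; 0; 0; 0; 1; 0])
  | v34 => ([::], [::])
  end.

(** Writing y_3 = t_1 z makes a factor t_1 split off both from the image vector and from the
    equation of the conic. What remains is t_0 y_2 z - y_2 y_4 + (t_1 - t_0) z y_4, which is smooth
    also at t_1 = 0. *)
Definition conic_rows (R : comNzRingType) (t1 : R) : seq (seq R) :=
  [:: [:: 1; -1; -1; 0; 0; 0; 0]; [:: 0; 0; 0; -1; t1; 0; 0]; [:: 0; 1; 1; 0; -1; 0; 0]].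

Section Rho.
Variables (K : numFieldType) (t0 t1 : K).
Let t := (t0, t1).
Hypotheses (t00 : t0 != 0) (t10 : t1 != 0) (t01 : t0 - t1 != 0).

Definition rho_vec (p : 'rV[K]_7) : 'rV[K]_16 :=
  pvec t0 t1 (rho_coef t1 (mkseq (fun k => p 0 (inord k)) 7)).

Lemma rho_vecE c : rho_vec (row7 c) = pvec t0 t1 (rho_coef t1 c).
Proof. by rewrite /rho_vec /mkseq /= !row7E. Qed.

Lemma pvec_eq0 c : pvec t0 t1 c = 0 -> forall k, (k < 7)%N -> nth 0 c k = 0.
Proof.
move=> /rowP h; have e k : (k < 16)%N -> nth 0 (wvec t0 t1 c) k = 0.
  by move=> hk; have := h (inord k); rewrite !mxE inordK.
do 7?[case=> [|]] => // _; first exact: (e 1%N).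
- exact: (e 6%N).
- exact: (e 8%N).
- by apply: (mulfI t00); rewrite mulr0; apply: (e 9%N).
- exact: (e 10%N).
- exact: (e 12%N).
exact: (e 14%N).
Qed.

(** [rho_coef] is injective because t_1 != 0, and [pvec] because t_0 != 0. *)
Lemma rho_vec_neq0 c : row7 c != 0 -> rho_vec (row7 c) != 0.
Proof.
apply: contra_neq; rewrite rho_vecE => /pvec_eq0 h.
have h0 k : (k < 7)%N -> nth 0 (rho_coef t1 c) k = 0 by apply: h.
have m0 x : t1 * x = 0 -> x = 0 by move/eqP; rewrite mulf_eq0 (negPf t10) => /eqP.
have y2 : nth 0 c 2 = 0 by apply: m0; apply: (h0 0%N).
have y1 : nth 0 c 1 = 0 by apply/eqP; rewrite -oppr_eq0; apply/eqP/m0; rewrite mulrN -mulNr; apply: (h0 1%N).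
have y3 : nth 0 c 3 = 0 by apply/eqP; rewrite -oppr_eq0; apply/eqP; apply: (h0 3%N).
have y5 : nth 0 c 5 = 0 by apply/eqP; rewrite -oppr_eq0; apply/eqP; apply: (h0 5%N).
have y6 : nth 0 c 6 = 0 by apply: (h0 6%N).
have y4 : nth 0 c 4 = 0.
  by have /m0/eqP := h0 4%N isT; rewrite y3 sub0r oppr_eq0 => /eqP.
have y0 : nth 0 c 0 = 0.
  by have /m0/eqP := h0 2%N isT; rewrite y3 y4 subr0 sub0r oppr_eq0 => /eqP.
apply/rowP => k; rewrite !mxE; case: k => k hk /=.
by do 7?[case: k hk => [|k] hk].
Qed.

Lemma rho_unique v p x : C_comp t v p -> rho t p x ->
  exists2 k : K, k != 0 & x = k *: rho_vec p.
Proof.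
move=> Cp [s hs ->].
have key : exists k : K, coordinates s = k *: rho_vec p.
  have line v' (a b : K) : is_line v' -> row7 (line_point v' a b) != 0 ->
      half_spinor (jacobian t (row7 (line_point v' a b))) s ->
      exists k : K, coordinates s = k *: rho_vec (row7 (line_point v' a b)).
    rewrite rho_vecE; have [->|a0] := eqVneq a 0; last first.
      by case: v' => // _ _; [exact: unique_v0_a|exact: unique_v1_a|exact: unique_v2_a
        |exact: unique_v5_a|exact: unique_v6_a|exact: unique_v7_a|exact: unique_v8_a
        |exact: unique_v9_a|exact: unique_v10_a|exact: unique_v11_a].
    have [->|b0] := eqVneq b 0.
      by rewrite line_pointE !scale0r addr0 eqxx.
    by case: v' => // _ _; [exact: unique_v0_b|exact: unique_v1_b|exact: unique_v2_b
        |exact: unique_v5_b|exact: unique_v6_b|exact: unique_v7_b|exact: unique_v8_b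
        |exact: unique_v9_b|exact: unique_v10_b|exact: unique_v11_b].
  case: (boolP (is_line v)) => nv.
    by move: Cp hs; rewrite C_lineE // => -[p0 [a [b E]]]; rewrite E in p0 *; apply: line.
  have Ev : v = v34 by case: (v) nv.
  move: Cp hs; rewrite Ev C_conicE => -[p0 [y2 [y3 [y4 [q0 E]]]]]; rewrite {p}E in p0 *.
  (* The points with y2 = 0 or y3 = 0 are the nodes with [v10], [v9] and [v2]; rewriting them as
     points of these lines makes the line certificates available. *)
  have [y20|y20] := eqVneq y2 0.
    have /eqP : (t1 - t0) * y3 * y4 = 0 by rewrite -q0 y20; ring.
    rewrite !mulf_eq0 -[t1 - t0]opprB oppr_eq0 (negPf t01) /= => /orP[] /eqP y30.
      have E : conic_point y2 y3 y4 = line_point v10 (- y4) y4.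
        by rewrite /conic_point /line_point y20 y30 subrr sub0r.
      by rewrite E in p0 *; apply: line.
    have E : conic_point y2 y3 y4 = line_point v9 y3 0.
      by rewrite /conic_point /line_point y20 y30 subrr sub0r subr0.
    by rewrite E in p0 *; apply: line.
  have [y30|y30] := eqVneq y3 0.
    have /eqP : - t1 * y2 * y4 = 0 by rewrite -q0 y30; ring.
    rewrite !mulf_eq0 oppr_eq0 (negPf t10) (negPf y20) /= => /eqP y40.
    have E : conic_point y2 y3 y4 = line_point v2 y2 y2.
      by rewrite /conic_point /line_point y30 y40 !subr0.
    by rewrite E in p0 *; apply: line.
  have Eq : (t1 * y2 + (t0 - t1) * y3) * y4 = t0 * y2 * y3 by rewrite -[RHS]subr0 -q0; ring.
  have q1 : t1 * y2 + (t0 - t1) * y3 != 0.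
    by apply/eqP => q1; move/eqP: Eq; rewrite q1 mul0r eq_sym !mulf_eq0 (negPf t00) (negPf y20) (negPf y30).
  have -> : y4 = t0 * y2 * y3 / (t1 * y2 + (t0 - t1) * y3) by rewrite -Eq mulrC mulKf.
  by rewrite rho_vecE; apply: (unique_v34_a t00 t10 t01 y20 y30 q1).
(* If k were 0, all even coordinates of the spinor would vanish; the odd ones vanish anyway,
   contradicting s != 0. *)
case: key => k E; exists k => //; apply/eqP => k0; case: hs => + + _ => /eqP s0 odd_s; apply: s0.
apply/ffunP => I; rewrite [RHS]ffunE; have [/odd_s //|] := boolP (odd #|I|).
move: E; rewrite k0 scale0r => /rowP E; move: I; apply: all_sets => b1 b2 b3 b4 b5 even_I.
have xs0 l : l \in even_indices -> s (index_set l) = 0.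
  move=> hl; have := E (inord (index l even_indices)); rewrite !mxE inordK ?nth_index //.
  by rewrite -[16%N]/(size even_indices) index_mem.
apply: xs0; move: even_I.
have -> : #|index_set (mask [:: b1; b2; b3; b4; b5] (iota 1 5))| = (b1 + b2 + b3 + b4 + b5)%N.
  rewrite -sum1_card big_mkcond /= !big_ord_recl big_ord0 /= !inE.
  by case: b1 b2 b3 b4 b5 => [] [] [] [] [].
by case: b1 b2 b3 b4 b5 => [] [] [] [] [].
Qed.

Lemma quadric_on_line v (a b : K) k : is_line v -> (k < 10)%N ->
  quadric_at t0 t1 (nth 0 (line_point v a b)) k = 0.
Proof.
move=> + hk; case: v => // _; rewrite /quadric_at;
  do 10?[case: k hk => [|k] hk] => //=; ring.
Qed.

Lemma quadric_on_conic (y2 y3 y4 : K) k : (k < 10)%N ->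
  t0 * y2 * y3 - t1 * y2 * y4 + (t1 - t0) * y3 * y4 = 0 ->
  quadric_at t0 t1 (nth 0 (conic_point y2 y3 y4)) k = 0.
Proof.
move=> hk q0; rewrite /quadric_at.
by do 10?[case: k hk => [|k] hk] => //=; by_equations.
Qed.

Lemma rho_exists c : row7 c != 0 -> (forall k, (k < 10)%N -> quadric_at t0 t1 (nth 0 c) k = 0) ->
  rho t (row7 c) (rho_vec (row7 c)).
Proof.
move=> c0 hq; exists (spinor (wvec t0 t1 (rho_coef t1 c))).
  by apply: spinor_rho hq; have := rho_vec_neq0 c0; rewrite rho_vecE.
by rewrite coordinates_spinor // rho_vecE.
Qed.

Lemma rho_line_point v : is_line v -> exists x y : K, [/\ x != 0, y != 0 &
  forall a b, rho_vec (row7 (line_point v a b)) =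
    (a * x) *: pvec t0 t1 (line_rows t1 v).1 + (b * y) *: pvec t0 t1 (line_rows t1 v).2].
Proof.
have n1 : -1 != 0 :> K by rewrite oppr_eq0 oner_eq0.
have nt : - t1 != 0 by rewrite oppr_eq0.
have o1 := @oner_neq0 K.
have solve v' (x y : K) : is_line v' -> x != 0 -> y != 0 ->
    (forall a b k, (k < 7)%N -> nth 0 (rho_coef t1 (line_point v' a b)) k =
       a * x * nth 0 (line_rows t1 v').1 k + b * y * nth 0 (line_rows t1 v').2 k) ->
    exists x y : K, [/\ x != 0, y != 0 &
      forall a b, rho_vec (row7 (line_point v' a b)) =
      (a * x) *: pvec t0 t1 (line_rows t1 v').1 + (b * y) *: pvec t0 t1 (line_rows t1 v').2].
  move=> nv x0 y0 h; exists x, y; split=> // a b; rewrite rho_vecE; apply/rowP => k.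
  rewrite !mxE /wvec !h //; case: k => k hk.
  by do 16?[case: k hk => [|k] hk] => //=; ring.
case: v => // _; [apply: (solve v0 (- t1) 1)|apply: (solve v1 (- t1) (- t1))
  |apply: (solve v2 (- t1) t1)|apply: (solve v5 1 (- 1))|apply: (solve v6 (- 1) 1)
  |apply: (solve v7 t1 1)|apply: (solve v8 (- 1) 1)|apply: (solve v9 1 1)
  |apply: (solve v10 (- t1) t1)|apply: (solve v11 t1 (- 1))] => // a b k hk;
  do 7?[case: k hk => [|k] hk] => //=; ring.
Qed.

Lemma rho_conic_point y2 z y4 : rho_vec (row7 (conic_point y2 (t1 * z) y4)) =
  t1 *: (y2 *: pvec t0 t1 (nth [::] (conic_rows t1) 0) + z *: pvec t0 t1 (nth [::] (conic_rows t1) 1)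
         + y4 *: pvec t0 t1 (nth [::] (conic_rows t1) 2)).
Proof.
rewrite rho_vecE; apply/rowP => k; rewrite !mxE; case: k => k hk.
by do 16?[case: k hk => [|k] hk] => //=; ring.
Qed.

Definition conic_basis (R : comNzRingType) (a b : R) (l : 'I_3) : 'rV[R]_16 :=
  pvec a b (nth [::] (conic_rows b) l).

Definition line_basis (R : comNzRingType) (a b : R) (v : component) : 'I_2 -> 'rV[R]_16 :=
  pair2 (pvec a b (line_rows b v).1) (pvec a b (line_rows b v).2).

Lemma vanishing_zclosure n (S : pset K n) f : (forall x, S x -> x != 0) ->
  vanishing (zclosure S) f <-> vanishing S f.
Proof.
move=> S0; split=> h x Sx; last by case: Sx => _; apply.
by apply: h; split=> [|g]; [apply: S0|apply].
Qed.

Lemma X_comp_vanishing v f : vanishing (X_comp t v) f <->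
  forall p, C_comp t v p -> smooth_point (vanishing (C t)) p ->
    forall k, k != 0 -> rho t p (k *: rho_vec p) -> f.@[(k *: rho_vec p) 0] = 0.
Proof.
rewrite /X_comp vanishing_zclosure; last first.
  move=> x [p [Cp _ /(rho_unique Cp)[k k0 ->]]]; rewrite scaler_eq0 negb_or k0 /=.
  have Ep : p = row7 (mkseq (fun k => p 0 (inord k)) 7).
    by apply: row7_eta => j hj; rewrite nth_mkseq.
  by rewrite Ep; apply: rho_vec_neq0; rewrite -Ep; case: Cp.
split=> [h p Cp sp k k0 hr|h x [p [Cp sp hr]]]; first by apply: h; exists p.
by have [k k0 E] := rho_unique Cp hr; rewrite E; apply: h; rewrite // -E.
Qed.

Lemma X_line v f : is_line v -> vanishing (X_comp t v) f <->
  vanishing (lineset (line_basis t0 t1 v ord0) (line_basis t0 t1 v ord_max)) f.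
Proof.
move=> nv; rewrite X_comp_vanishing; have [x [y [x0 y0 E]]] := rho_line_point nv.
rewrite /line_basis /pair2 /=; set r1 := pvec _ _ _ in E *; set r2 := pvec _ _ _ in E *.
split=> h; last first.
  move=> p Cp _ k k0 _; move: (Cp); rewrite C_lineE // => -[p0 [a [b Ep]]].
  apply: h; split; last by rewrite Ep E scalerDr !scalerA; eexists; eexists.
  by rewrite scaler_eq0 negb_or k0 Ep; apply: rho_vec_neq0; rewrite -Ep.
suff P0 : rest (pair2 r1 r2) f = 0 by apply: (rest0_vanish_line P0).
(* [g] vanishes at the parameters where nodes may occur. Elsewhere the point is smooth and has a
   spinor, so [g] times the restriction of f vanishes identically, and [g] can be cancelled. *)
pose g : {mpoly K[2]} := 'X_ord0 * 'X_ord_max *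
  ((y *: 'X_ord0 + x *: 'X_ord_max) * (y *: 'X_ord0 - x *: 'X_ord_max)).
have gE c : g.@[c] = c ord0 * c ord_max * ((y * c ord0 + x * c ord_max) * (y * c ord0 - x * c ord_max)).
  by rewrite /g !mevalM mevalB mevalD !mevalZ !mevalXU.
have g0 : g != 0.
  (* At (2 x, y) the value of [g] is 6 x^3 y^3. *)
  apply/eqP => g0; pose c (i : 'I_2) := if i == ord0 then 2%:R * x else y.
  have /eqP : (2%:R * 3%:R) * (x * x * x * (y * y * y)) = 0.
    by transitivity g.@[c]; [rewrite gE /c /=; ring|rewrite g0 meval0].
  by rewrite !mulf_eq0 !pnatr_eq0 (negPf x0) (negPf y0).
have /eqP : g * rest (pair2 r1 r2) f = 0; last by rewrite mulf_eq0 (negPf g0) => /eqP.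
apply: mpoly2_fun_eq0 => c; rewrite mevalM rest_meval.
have [->|gc] := eqVneq g.@[c] 0; first by rewrite mul0r.
rewrite gE in gc.
have gab : c ord0 / x * (c ord_max / y) * ((c ord0 / x + c ord_max / y) * (c ord0 / x - c ord_max / y)) != 0.
  have -> : c ord0 / x * (c ord_max / y) * ((c ord0 / x + c ord_max / y) * (c ord0 / x - c ord_max / y)) =
    c ord0 * c ord_max * ((y * c ord0 + x * c ord_max) * (y * c ord0 - x * c ord_max)) / (x * y) ^+ 3.
    by field; rewrite x0 y0.
  by apply: mulf_neq0 => //; rewrite invr_eq0 expf_neq0 // mulf_neq0.
have [Cp sp] := line_smooth t0 t1 nv gab.
have hr : rho t (row7 (line_point v (c ord0 / x) (c ord_max / y)))
    (rho_vec (row7 (line_point v (c ord0 / x) (c ord_max / y)))).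
  by apply: rho_exists => [|k]; [case: Cp|apply: quadric_on_line].
have := h _ Cp sp 1 (oner_neq0 _); rewrite scale1r => /(_ hr); rewrite E !divfK //.
have -> : \sum_k c k *: pair2 r1 r2 k = c ord0 *: r1 + c ord_max *: r2.
  by rewrite big_ord_recl big_ord1 (_ : lift ord0 ord0 = ord_max) //; apply: val_inj.
by move=> ->; rewrite mulr0.
Qed.

Lemma X_conic f : vanishing (X_comp t v34) f <->
  vanishing (conic (conic_basis t0 t1) t0 (t1 - t0)) f.
Proof.
have t10' : t1 - t0 != 0 by rewrite -opprB oppr_eq0.
have i1v : nat_of_ord i1 = 1%N by rewrite inordK.
rewrite X_comp_vanishing; split=> h; last first.
  move=> p Cp _ k k0 _; move: (Cp); rewrite C_conicE => -[p0 [y2 [y3 [y4 [q0 Ep]]]]].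
  apply: h; split.
    by rewrite scaler_eq0 negb_or k0 Ep; apply: rho_vec_neq0; rewrite -Ep.
  have E3 : y3 = t1 * (y3 / t1) by rewrite mulrC divfK.
  rewrite {1}Ep E3 rho_conic_point; exists (k * t1 * y2), (k * t1 * (y3 / t1)), (k * t1 * y4).
  rewrite /conic_basis i1v /= !scalerDr !scalerA !mulrA; split=> //.
  transitivity (k ^+ 2 * t1 * (t0 * y2 * y3 - t1 * y2 * y4 + (t1 - t0) * y3 * y4)).
    by field.
  by rewrite q0 mulr0.
(* The factors exclude the parameters for which the hypotheses of [conic_smooth] fail; the last one
   corresponds to y2 = y3. *)
pose g : {mpoly K[2]} := (t1 - t0) *: ('X_ord0 * 'X_ord_max) *
   'X_ord0 * ((t1 - t0) *: 'X_ord_max + t1 *: (t0 *: 'X_ord0 - 'X_ord_max)).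
have gE c : g.@[c] = (t1 - t0) * (c ord0 * c ord_max) * c ord0 *
   ((t1 - t0) * c ord_max + t1 * (t0 * c ord0 - c ord_max)).
  by rewrite /g !mevalM mevalD !mevalZ mevalB mevalZ !mevalM !mevalXU.
have g0 : g != 0.
  apply/eqP => g0; pose c (i : 'I_2) := if i == ord0 then 2%:R else t1.
  have /eqP : (t1 - t0) * 2%:R * t1 * 2%:R * (t0 * t1) = 0.
    by transitivity g.@[c]; [rewrite gE /c /=; ring|rewrite g0 meval0].
  by rewrite !mulf_eq0 !pnatr_eq0 (negPf t00) (negPf t10) (negPf t10').
have [|r E] := @conic_open_dvd K 16 (conic_basis t0 t1) t0 (t1 - t0) f g t00 t10' g0; last first.
  exact: rest_div_conic E.
move=> c; rewrite gE; set y := c ord0; set z := c ord_max => gc l0.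
pose a := - (t1 - t0) * y * z / (t0 * y - z).
have y0 : y != 0 by apply: contra_neq gc => ->; ring.
have z0 : z != 0 by apply: contra_neq gc => ->; ring.
have a0 : a / t1 != 0 by rewrite !mulf_neq0 ?invr_eq0 ?oppr_eq0.
have ay : a / t1 - y != 0.
  apply: contra_neq gc => ay; have {}ay : a = t1 * y.
    by rewrite -(subr0_eq ay) mulrC divfK.
  have {}ay : - (t1 - t0) * y * z = t1 * y * (t0 * y - z) by rewrite -ay /a divfK.
  transitivity ((t1 - t0) * (y * z) * (t1 * y * (t0 * y - z) - - (t1 - t0) * y * z)); first by ring.
  by rewrite ay subrr mulr0.
have q0 : t0 * (a / t1) * y - t1 * (a / t1) * (z / t1) + (t1 - t0) * y * (z / t1) = 0.
  by rewrite /a; field; rewrite l0 t10.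
have [Cp sp] := conic_smooth t00 t10 t10' a0 (mulf_neq0 z0 (invr_neq0 t10)) ay q0.
have hr : rho t (row7 (conic_point (a / t1) y (z / t1)))
    (rho_vec (row7 (conic_point (a / t1) y (z / t1)))).
  by apply: rho_exists => [|k hk]; [case: Cp|apply: quadric_on_conic].
have := h _ Cp sp 1 (oner_neq0 _); rewrite scale1r => /(_ hr).
suff -> : rho_vec (row7 (conic_point (a / t1) y (z / t1))) = conic_at (conic_basis t0 t1) t0 (t1 - t0) c by [].
have Ey : y = t1 * (y / t1) by rewrite mulrC divfK.
rewrite {1}Ey rho_conic_point /conic_at /conic_basis i1v /= -/y -/z -/a.
by rewrite !scalerDr !scalerA ![t1 * _]mulrC !divfK.
Qed.
End Rho.

(** * Linear algebra over the integers and tables of vectors *)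

Fixpoint lc (R : pzRingType) (x : seq R) (M : seq (seq R)) (k : nat) : R :=
  if x is c :: x' then if M is r :: M' then c * r`_k + lc x' M' k else 0 else 0.

Fixpoint dot (R : pzRingType) (x e : seq R) : R :=
  if x is c :: x' then if e is r :: e' then c * r + dot x' e' else 0 else 0.

Definition elim_row (r : seq int) (k : nat) (r' : seq int) : seq int :=
  mkseq (fun j => r`_k * r'`_j - r'`_k * r`_j) 7.

(** Fraction-free Gaussian elimination on seven columns, with pivot at the first nonzero entry of
    the first row. [n] is fuel and must exceed the number of rows, so 8 suffices for every
    independent list. *)
Fixpoint freeZ (n : nat) (M : seq (seq int)) : bool :=
  if n is n'.+1 then
    if M is r :: M' then
      let k := find (fun c => c != 0) (take 7 r) in
      (k < size (take 7 r))%N &&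
        freeZ n' [seq elim_row r k r' | r' <- M']
    else true
  else false.

Lemma lc_cons (R : pzRingType) c (x : seq R) r M k :
  lc (c :: x) (r :: M) k = c * r`_k + lc x M k.
Proof. by []. Qed.

(** Elimination keeps the coefficients of a relation among the remaining rows, so these vanish by
    induction; the pivot column then gives the first one. A nonzero integer pivot stays nonzero in
    characteristic 0. *)
Lemma freeZP (K : numFieldType) n (M : seq (seq int)) (x : seq K) : freeZ n M ->
  size x = size M ->
  (forall k, (k < 7)%N -> lc x [seq [seq c%:~R | c <- r] | r <- M] k = 0) ->
  forall l, x`_l = 0.
Proof.
elim: n M x => [|n IH] // [|r M] [|c x] //=; first by move=> _ _ _ l; rewrite nth_nil.
set k := find _ _ => /andP[hk hM] [sx] h.
have hk7 : (k < 7)%N by apply: leq_trans hk _; rewrite size_take; case: ltnP.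
have rk : r`_k != 0.
  by have := nth_find 0 (a := fun c : int => c != 0) (s := take 7 r); rewrite has_find hk -/k nth_take // => ->.
have nE (q : seq int) i : [seq c%:~R | c <- q]`_i = (q`_i)%:~R :> K.
  have [hi|hi] := ltnP i (size q); first by rewrite (nth_map 0).
  by rewrite !nth_default ?size_map.
have lcE (y : seq K) (N : seq (seq int)) j : (j < 7)%N ->
    lc y [seq [seq c%:~R | c <- r'] | r' <- [seq elim_row r k r' | r' <- N]] j =
    (r`_k)%:~R * lc y [seq [seq c%:~R | c <- r] | r <- N] j -
    lc y [seq [seq c%:~R | c <- r] | r <- N] k * (r`_j)%:~R.
  move=> hj; elim: y N => [|d y IHy] [|r' N]; try by rewrite /= mul0r mulr0 subr0.
  have eE : (elim_row r k r')`_j = r`_k * r'`_j - r'`_k * r`_j by rewrite nth_mkseq.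
  by rewrite !lc_cons IHy !nE eE rmorphB !rmorphM /=; ring.
have hx : forall l, x`_l = 0.
  apply: (IH _ _ hM); first by rewrite size_map.
  move=> j hj; rewrite lcE //.
  have /eqP := h j hj; have /eqP := h k hk7; rewrite !nE !addr_eq0 => /eqP ck /eqP cj.
  by rewrite -[lc x _ j]opprK -[lc x _ k]opprK -cj -ck; ring.
have c0 : c = 0.
  have := h k hk7; rewrite nE.
  have -> : lc x [seq [seq c%:~R | c <- r] | r <- M] k = 0.
    elim: x {h sx} hx (M) => [|d x IHx] hx [|r' N] //=.
    have d0 : d = 0 by exact: (hx 0%N).
    by rewrite d0 mul0r add0r IHx // => l; apply: (hx l.+1).
  by move=> /eqP; rewrite addr0 mulf_eq0 intr_eq0 (negPf rk) orbF => /eqP.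
by case.
Qed.

Definition component_rows (R : comNzRingType) (t1 : R) (v : component) : seq (seq R) :=
  if v is v34 then conic_rows t1 else [:: (line_rows t1 v).1; (line_rows t1 v).2].

(** A table written over an arbitrary ring. Over [int] it can be computed with, over [{poly K}] it
    spans the family; naturality in ring morphisms links the two through the value at s = 0. *)
Definition row_data := forall R : comNzRingType, R -> seq (seq R).

Definition natural (T : row_data) := forall (R S : comNzRingType) (f : {rmorphism R -> S}) x,
  [seq map f r | r <- T R x] = T S (f x).

Lemma component_rows_natural v : natural (fun R x => component_rows x v).
Proof. by move=> R S f x; case: v; rewrite /= ?rmorphN ?rmorph1 ?rmorph0. Qed.

Lemma cat_natural T T' : natural T -> natural T' -> natural (fun R x => T R x ++ T' R x).
Proof. by move=> h h' R S f x; rewrite map_cat h h'. Qed.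

Lemma pvec_lc (R : comNzRingType) (a b : R) (x : seq R) M : size x = size M ->
  \sum_(l < size M) x`_l *: pvec a b (nth [::] M l) = pvec a b (mkseq (lc x M) 7).
Proof.
elim: x M => [|c x IH] [|r M] //= => [_|[sx]].
  by rewrite big_ord0; apply/rowP => k; rewrite !mxE; case: k => k hk;
    do 16?[case: k hk => [|k] hk] => //=; ring.
rewrite big_ord_recl /= IH //; apply/rowP => k; rewrite !mxE; case: k => k hk.
by do 16?[case: k hk => [|k] hk] => //=; ring.
Qed.

Lemma map_pvec (R S : comNzRingType) (f : {rmorphism R -> S}) a b c :
  map_mx f (pvec a b c) = pvec (f a) (f b) (map f c).
Proof.
have nE k : (map f c)`_k = f c`_k.
  have [hk|hk] := ltnP k (size c); first by rewrite (nth_map 0).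
  by rewrite !nth_default ?size_map ?rmorph0.
apply/rowP => k; rewrite !mxE /wvec !nE; case: k => k hk.
by do 16?[case: k hk => [|k] hk] => //=; rewrite ?(rmorph0 f, rmorphM f, rmorphB f, rmorphD f).
Qed.

Lemma lc_cat (R : pzRingType) (x y : seq R) M N k : size x = size M ->
  lc (x ++ y) (M ++ N) k = lc x M k + lc y N k.
Proof.
by elim: x M => [|c x IH] [|r M] //= => [_|[/IH ->]]; rewrite ?add0r ?addrA.
Qed.

Lemma dot_cat (R : pzRingType) (x y e e' : seq R) : size x = size e ->
  dot (x ++ y) (e ++ e') = dot x e + dot y e'.
Proof.
by elim: x e => [|c x IH] [|r e] //= => [_|[/IH ->]]; rewrite ?add0r ?addrA.
Qed.

Lemma dot0 (R : pzRingType) (x : seq R) n : dot x (nseq n 0) = 0.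
Proof. by elim: x n => [|c x IH] [|n] //=; rewrite IH mulr0 addr0. Qed.

Lemma lc0 (R : pzRingType) n (M : seq (seq R)) k : lc (nseq n 0) M k = 0.
Proof. by elim: n M => [|n IH] [|r M] //=; rewrite IH mul0r addr0. Qed.

(** The conic precedes this list. [v0], [v11] and [v7] are disjoint from it and from one another at
    both limits, and every later line has at most three nodes with its predecessors. *)
Definition gluing_order (i : nat) : component :=
  nth v0 [:: v0; v11; v7; v1; v2; v10; v5; v6; v8; v9] i.

(** * The gluing steps, for both limits at once *)

Section GlueData.
Variables (K : numFieldType) (a b : {poly K}) (tau : int).
Local Notation A := {poly K}.
Local Notation at0 := (horner_eval (0 : K)).
Hypotheses (a0 : a.[0] = 1) (b0 : b.[0] = tau%:~R).

Let W (i : 'I_10) : 'I_2 -> 'rV[A]_16 := line_basis a b (gluing_order i).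
Let Wc : 'I_3 -> 'rV[A]_16 := conic_basis a b.
Let q : {mpoly A[3]} := qform a (b - a).
Local Notation row1 i := (line_rows b (gluing_order i)).1.
Local Notation row2 i := (line_rows b (gluing_order i)).2.

(** At s = 0 the table takes its value at t_1 = tau, which is the image in K of the integer table on
    which [freeZ] has been run. *)
Lemma natural_free (T : row_data) n d : natural T -> freeZ n (T int tau) ->
  size (T A b) = d ->
  row_free (\matrix_(l < d) map_mx at0 (pvec a b (nth [::] (T A b) l))).
Proof.
move=> nT fT sT.
have eZ : [seq [seq (c%:~R : K) | c <- r] | r <- T int tau] = T K b.[0].
  by rewrite b0; apply: (nT int K intr tau).
have eA : [seq map at0 r | r <- T A b] = T K b.[0] by exact: nT.
have sZ : size (T int tau) = d by rewrite -sT -(size_map (map at0)) eA -eZ size_map.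
apply: inj_row_free => v; rewrite mulmx_sum_row => v0.
pose x := [seq v 0 l | l <- enum 'I_d].
have sx : size x = d by rewrite size_map size_enum_ord.
have xE (l : 'I_d) : x`_l = v 0 l by rewrite (nth_map l) ?size_enum_ord // nth_ord_enum.
have hx : forall l, x`_l = 0.
  apply: (freeZP fT); first by rewrite sx sZ.
  rewrite eZ -eA => k hk.
  set M := map _ _; have sM : size x = size M by rewrite sx size_map.
  have E : pvec 1 (at0 b) (mkseq (lc x M) 7) = 0.
    rewrite -pvec_lc // -[RHS]v0 (_ : size M = d); last by rewrite -sM.
    apply: eq_bigr => l _; rewrite xE rowK map_pvec (nth_map [::]) ?sT //.
    by rewrite /= /horner_eval a0.
  by have := pvec_eq0 (oner_neq0 K) E hk; rewrite nth_mkseq.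
by apply/rowP => l; rewrite -xE hx mxE.
Qed.

(** [e] prescribes a linear functional on the rows [U]; a row [cs] of their span then receives the
    value [v]. *)
Definition spans (U : seq (seq A)) (e cs : seq A) (v : A) :=
  exists zs, [/\ size zs = size U, forall k, (k < 7)%N -> lc zs U k = cs`_k & dot zs e = v].

Lemma pvec_ext (c c' : seq A) : (forall k, (k < 7)%N -> c`_k = c'`_k) -> pvec a b c = pvec a b c'.
Proof. by move=> h; apply/rowP => k; rewrite !mxE /wvec !h. Qed.

Lemma spans_eval (U : seq (seq A)) e cs v c (phi : 'cV[A]_16) :
  (forall l : 'I_(size U), (pvec a b (nth [::] U l) *m phi) 0 0 = c * e`_l) ->
  size e = size U -> spans U e cs v -> (pvec a b cs *m phi) 0 0 = c * v.
Proof.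
move=> h se [zs [sz hz <-]].
rewrite -(@pvec_ext (mkseq (lc zs U) 7)) => [|k hk]; last by rewrite nth_mkseq ?hz.
rewrite -pvec_lc // mulmx_suml summxE.
transitivity (\sum_(l < size U) c * (zs`_l * e`_l)).
  by apply: eq_bigr => l _; rewrite -scalemxAl mxE h mulrCA.
rewrite -mulr_sumr; congr (_ * _); clear h hz.
elim: U zs e sz se => [|r U IH] [|z zs] [|x e] //=; first by rewrite big_ord0.
by move=> [sz] [se]; rewrite big_ord_recl /= IH.
Qed.

Lemma group_factor (i : 'I_10) (cov : bool * seq nat) (T : row_data) n e x y :
  natural T -> freeZ n (T int tau) -> size e = size (T A b) ->
  spans (T A b) e (row1 i) x -> spans (T A b) e (row2 i) y ->
  (cov.1 -> forall l : 'I_3, spans (T A b) e (nth [::] (conic_rows b) l) 0) ->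
  (forall j : 'I_10, nat_of_ord j \in cov.2 ->
     spans (T A b) e (row1 j) 0 /\ spans (T A b) e (row2 j) 0) ->
  factor W Wc i cov (x *: 'X_ord0 + y *: 'X_ord_max).
Proof.
move=> nT fT se s1 s2 hc hl.
apply: (@form_factor K 16 10 W Wc i cov (size (T A b))
  (fun l => pvec a b (nth [::] (T A b) l)) (fun l => e`_l) x y).
  exact: (natural_free nT fT).
move=> phi c h; have ev cs v := @spans_eval (T A b) e cs v c phi h se.
split.
- exact: ev s1.
- exact: ev s2.
- by move=> /hc hc' l; rewrite /Wc /conic_basis (ev _ _ (hc' l)) mulr0.
move=> j /hl[hl1 hl2] l; rewrite /W /line_basis /pair2.
by case: ifP => _; rewrite (ev _ _ hl1, ev _ _ hl2) mulr0.
Qed.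

Definition inspan (T : seq (seq A)) (cs : seq A) :=
  exists zs, size zs = size T /\ forall k, (k < 7)%N -> lc zs T k = cs`_k.

Lemma inspan_spans T rs vs cs : size rs = size vs -> inspan T cs ->
  spans (T ++ rs) (nseq (size T) 0 ++ vs) cs 0.
Proof.
move=> srs [zs [sz h]]; exists (zs ++ nseq (size rs) 0).
split; first by rewrite !size_cat sz size_nseq.
  by move=> k hk; rewrite lc_cat // h // lc0 addr0.
by rewrite dot_cat ?size_nseq // dot0 add0r srs; elim: vs {srs} => //= v vs ->; rewrite mul0r addr0.
Qed.

Lemma nth_inspan T l : (l < size T)%N -> inspan T (nth [::] T l).
Proof.
elim: T l => [|r T IH] [|l] //= => [_|/IH[zs [sz h]]].
  by exists (1 :: nseq (size T) 0); split=> [|k _] /=; rewrite ?size_nseq // lc0 mul1r addr0.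
by exists (0 :: zs); split=> [|k hk] /=; rewrite ?sz // h // mul0r add0r.
Qed.

Lemma last_spans T r v : spans (T ++ [:: r]) (nseq (size T) 0 ++ [:: v]) r v.
Proof.
exists (nseq (size T) 0 ++ [:: 1]); split; first by rewrite !size_cat size_nseq.
  by move=> k hk; rewrite lc_cat ?size_nseq // lc0 /= mul1r add0r addr0.
by rewrite dot_cat ?size_nseq // dot0 /= mul1r add0r addr0.
Qed.

Lemma row_natural (fst_row : bool) v : natural (fun R x =>
  [:: if fst_row then (line_rows x v).1 else (line_rows x v).2]).
Proof. by move=> R S f x; case: fst_row; case: v; rewrite /= ?rmorphN ?rmorph1 ?rmorph0. Qed.

Section NodeFactor.
Variables (i : 'I_10) (cov : bool * seq nat) (T : row_data) (n : nat).
Hypotheses (nT : natural T)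
  (conic_in : cov.1 -> forall l : 'I_3, inspan (@T A b) (nth [::] (conic_rows b) l))
  (lines_in : forall j : 'I_10, nat_of_ord j \in cov.2 ->
     inspan (@T A b) (row1 j) /\ inspan (@T A b) (row2 j)).

(** The functional is 0 on [T], which contains the covered components and the node row1 + y row2,
    and is -1 on row2. It is therefore y on row1 and restricts to the node form. *)
Lemma node_factor1 y :
  freeZ n (@T int tau ++ [:: (line_rows tau (gluing_order i)).2]) ->
  inspan (@T A b) (mkseq (fun k => (row1 i)`_k + y * (row2 i)`_k) 7) ->
  factor W Wc i cov (nodeform (1, y)).
Proof.
move=> fT [zs [sz hz]]; rewrite /nodeform /= -scaleNr.
apply: (@group_factor i cov (fun R x => @T R x ++ [:: (line_rows x (gluing_order i)).2]) n
  (nseq (size (@T A b)) 0 ++ [:: -1])) => //.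
- exact: (cat_natural nT (row_natural false _)).
- by rewrite !size_cat size_nseq.
- exists (zs ++ [:: - y]); split; first by rewrite !size_cat sz.
    by move=> k hk; rewrite lc_cat // hz // nth_mkseq //=; ring.
  by rewrite dot_cat ?size_nseq // dot0 /=; ring.
- exact: last_spans.
- by move=> hc l; apply: inspan_spans => //; apply: conic_in.
by move=> j /lines_in[h1 h2]; split; apply: inspan_spans.
Qed.

Lemma node_factor2 x :
  freeZ n (@T int tau ++ [:: (line_rows tau (gluing_order i)).1]) ->
  inspan (@T A b) (mkseq (fun k => x * (row1 i)`_k + (row2 i)`_k) 7) ->
  factor W Wc i cov (nodeform (x, 1)).
Proof.
move=> fT [zs [sz hz]]; rewrite /nodeform /= -scaleNr.
apply: (@group_factor i cov (fun R x => @T R x ++ [:: (line_rows x (gluing_order i)).1]) n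
  (nseq (size (@T A b)) 0 ++ [:: 1])) => //.
- exact: (cat_natural nT (row_natural true _)).
- by rewrite !size_cat size_nseq.
- exact: last_spans.
- exists (zs ++ [:: - x]); split; first by rewrite !size_cat sz.
    by move=> k hk; rewrite lc_cat // hz // nth_mkseq //=; ring.
  by rewrite dot_cat ?size_nseq // dot0 /=; ring.
- by move=> hc l; apply: inspan_spans => //; apply: conic_in.
by move=> j /lines_in[h1 h2]; split; apply: inspan_spans.
Qed.
End NodeFactor.

(* The component [None] is the conic. *)
Definition glued (j : option nat) : component := if j is Some j then gluing_order j else v34.
Definition cover_of (j : option nat) : bool * seq nat := if j is Some j then (false, [:: j]) else (true, [::]).

(** When two components have independent spans at s = 0, arbitrary values on the one can be combined
    with zero on the other. *)
Lemma disjoint_factor (i : 'I_10) (j : option nat) n (x y : A) :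
  freeZ n (component_rows tau (glued j) ++ component_rows tau (gluing_order i)) ->
  factor W Wc i (cover_of j) (x *: 'X_ord0 + y *: 'X_ord_max).
Proof.
move=> fT; pose U (R : comNzRingType) (t : R) :=
  component_rows t (glued j) ++ component_rows t (gluing_order i).
have row_i k : (k < 10)%N -> component_rows b (gluing_order k) = [:: row1 k; row2 k].
  by do 10?[case: k => [|k]].
pose m := size (component_rows b (glued j)).
have UE : U A b = component_rows b (glued j) ++ [:: row1 i; row2 i] by rewrite /U row_i.
have earlier l : (l < m)%N ->
    spans (U A b) (nseq m 0 ++ [:: x; y]) (nth [::] (component_rows b (glued j)) l) 0.
  by move=> hl; rewrite UE; apply: inspan_spans => //; apply: nth_inspan.
apply: (@group_factor i (cover_of j) U n (nseq m 0 ++ [:: x; y])) => //.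
- by apply: cat_natural; apply: component_rows_natural.
- by rewrite UE !size_cat size_nseq.
- exists (nseq m 0 ++ [:: 1; 0]); rewrite UE; split; first by rewrite !size_cat size_nseq.
    by move=> k _; rewrite lc_cat ?size_nseq // lc0 /=; ring.
  by rewrite dot_cat ?size_nseq // dot0 /=; ring.
- exists (nseq m 0 ++ [:: 0; 1]); rewrite UE; split; first by rewrite !size_cat size_nseq.
    by move=> k _; rewrite lc_cat ?size_nseq // lc0 /=; ring.
  by rewrite dot_cat ?size_nseq // dot0 /=; ring.
- move: earlier; rewrite /m; case: (j) => [j'|] //= earlier _ l.
  by apply: (earlier l); apply: ltn_ord.
move=> j'; move: earlier; rewrite /m; case: (j) => [j''|] //= earlier.
rewrite inE => /eqP ej; move: earlier; rewrite -ej row_i //= => earlier.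
by split; [apply: (earlier 0%N)|apply: (earlier 1%N)].
Qed.

Definition on_earlier (i : 'I_10) (p : A * A) :=
  (exists (j : 'I_10) z1 z2, (j < i)%N /\ forall k, (k < 7)%N ->
     p.1 * (row1 i)`_k + p.2 * (row2 i)`_k = z1 * (row1 j)`_k + z2 * (row2 j)`_k) \/
  (exists z0 z1 z2, a * z0 * z1 - z0 * z2 + (b - a) * z1 * z2 = 0 /\ forall k, (k < 7)%N ->
     p.1 * (row1 i)`_k + p.2 * (row2 i)`_k = lc [:: z0; z1; z2] (conic_rows b) k).

Lemma rest1 d (U : 'I_d -> 'rV[A]_16) (V : 'I_1 -> 'rV[A]_d) d' (U' : 'I_d' -> 'rV[A]_16)
    (V' : 'I_1 -> 'rV[A]_d') F :
  \sum_l V ord0 0 l *: U l = \sum_l V' ord0 0 l *: U' l ->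
  rest V (rest U F) = rest V' (rest U' F).
Proof.
move=> h; rewrite !rest_rest /rest.
apply: (congr1 (fun t : 16.-tuple {mpoly A[1]} => F \mPo t)).
by apply: eq_from_tnth => k; rewrite !tnth_mktuple !big_ord1 h.
Qed.

(** The node is also a point of an earlier component, where F restricts to 0 or to a multiple of the
    conic equation, and the latter vanishes at the node. *)
Lemma on_earlier_rest (i : 'I_10) p F : on_earlier i p -> good W Wc q i F ->
  rest (nodept p) (rest (W i) F) = 0.
Proof.
have sumW (k : 'I_10) (V : 'I_1 -> 'rV[A]_2) : \sum_l V ord0 0 l *: W k l =
    pvec a b (mkseq (lc [:: V ord0 0 ord0; V ord0 0 ord_max] [:: row1 k; row2 k]) 7).
  rewrite -pvec_lc // !big_ord_recl !big_ord0 /= /W /line_basis /pair2 /=.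
  by rewrite (_ : lift ord0 ord0 = ord_max :> 'I_2) //; apply: val_inj.
move=> h [[r hr] hF]; case: h => [[j [z1 [z2 [ji h]]]]|[z0 [z1 [z2 [q0 h]]]]].
  rewrite (@rest1 _ _ _ _ (W j) (nodept (z1, z2))) ?hF ?raddf0 //.
  rewrite !sumW; apply: pvec_ext => k hk; rewrite !nth_mkseq //= !mxE /= addr0 addr0.
  exact: h.
pose V (_ : 'I_1) : 'rV[A]_3 := \row_k [:: z0; z1; z2]`_k.
rewrite (@rest1 _ _ _ _ Wc V) ?hr.
  have VX l : rest V 'X_l = [:: z0; z1; z2]`_l *: 'X_ord0.
    by rewrite /rest comp_mpolyXU -tnth_nth tnth_mktuple big_ord1 mxE.
  have z1E : [:: z0; z1; z2]`_i1 = z1 by rewrite inordK.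
  rewrite rmorphM /= (_ : rest V q = 0) ?mul0r // /q /qform raddfD raddfB /= !restZ !rmorphM /= !VX z1E /=.
  rewrite -[RHS](mul0r ('X_ord0 * 'X_ord0)) -(mpolyC0 1) -q0 !mpolyCD !mpolyCM mpolyCN -!mul_mpolyC.
  ring.
rewrite sumW big_ord3 /Wc /conic_basis /= !mxE inordK //=.
rewrite (@pvec_ext _ (mkseq (lc [:: z0; z1; z2] (conic_rows b)) 7)).
  by rewrite -pvec_lc // !big_ord_recl big_ord0.
move=> k hk; rewrite !nth_mkseq // -h //= addr0; congr (_ * _ + _ * _); rewrite ?mxE //.
Qed.

(** Each node form takes care of the components listed with it. Each disjoint component in [D] is
    killed by extending one of the spare linear forms, so the number of spare forms is [size D]. *)
Lemma step_intro (i : 'I_10) (nodes : seq ((A * A) * (bool * seq nat))) (D : seq (bool * seq nat)) :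
  (forall p, p \in nodes -> p.1.1 = 1 \/ p.1.2 = 1) ->
  pairwise (fun p q : A * A => p.1 * q.2 != p.2 * q.1) [seq p.1 | p <- nodes] ->
  (forall p, p \in nodes -> on_earlier i p.1) ->
  (forall p, p \in nodes -> factor W Wc i p.2 (nodeform p.1)) ->
  (forall c x y, c \in D -> factor W Wc i c (x *: 'X_ord0 + y *: 'X_ord_max)) ->
  has (fun c => c.1) ([seq p.2 | p <- nodes] ++ D) &&
    all (fun j => j \in flatten [seq c.2 | c <- [seq p.2 | p <- nodes] ++ D]) (iota 0 i) ->
  step W Wc q i.
Proof.
move=> h1 h2 h3 h4 h5 /andP[hc hl]; exists [seq p.1 | p <- nodes], (size D); split=> //.
- move=> p /mapP[nd hnd ->]; case: (h1 _ hnd) => ->; [exists 1, 0|exists 0, 1]; ring.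
- by move=> p F /mapP[nd hnd ->]; apply: on_earlier_rest; apply: h3.
have lin x : exists u v, rest (W i) 'X_x = u *: 'X_ord0 + v *: 'X_ord_max.
  exists (W i ord0 0 x), (W i ord_max 0 x).
  rewrite /rest comp_mpolyXU -tnth_nth tnth_mktuple big_ord_recl big_ord1.
  by rewrite (_ : lift ord0 ord0 = ord_max) //; apply: val_inj.
have fD : forall s : seq 'I_16, size s = size D -> exists2 cov,
    factor W Wc i cov (\prod_(x <- s) rest (W i) 'X_x) &
    cov.1 = has (fun c => c.1) D /\ cov.2 = flatten [seq c.2 | c <- D].
  elim: D h5 {hc hl} => [|c D IH] h5 [|x s] //=.
    by exists (false, [::]); rewrite ?big_nil //; apply: factor_nil.
  move=> [/IH[c' x' y' hc'|cov fcov [e1 e2]]]; first by apply: h5; rewrite inE hc' orbT.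
  exists (c.1 || cov.1, c.2 ++ cov.2); last by rewrite /= e1 e2.
  rewrite big_cons; apply: factor_mul => //; have [u [v ->]] := lin x.
  by apply: h5; rewrite inE eqxx.
move=> s /fD[covD fcovD [eD1 eD2]].
have [covN fcovN [eN1 eN2]] : exists2 cov,
    factor W Wc i cov (\prod_(p <- [seq p.1 | p <- nodes]) nodeform p) &
    cov.1 = has (fun c => c.1) [seq p.2 | p <- nodes] /\
    cov.2 = flatten [seq c.2 | c <- [seq p.2 | p <- nodes]].
  elim: nodes h4 {h1 h2 h3 hc hl} => [|nd nodes IH] h4 /=.
    by exists (false, [::]); rewrite ?big_nil //; apply: factor_nil.
  case: IH => [p hp|cov fcov [e1 e2]]; first by apply: h4; rewrite inE hp orbT.
  exists (nd.2.1 || cov.1, nd.2.2 ++ cov.2); last by rewrite /= e1 e2.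
  by rewrite big_cons; apply: factor_mul => //; apply: h4; rewrite inE eqxx.
exists (covN.1 || covD.1, covN.2 ++ covD.2); first exact: factor_mul.
rewrite /= eN1 eN2 eD1 eD2 -has_cat; split=> // j ji.
move/allP: hl => /(_ j); rewrite mem_iota ji => /(_ isT).
by rewrite map_cat flatten_cat.
Qed.

Definition node_ok (i : 'I_10) (nd : (A * A) * (bool * seq nat)) :=
  [/\ nd.1.1 = 1 \/ nd.1.2 = 1, on_earlier i nd.1 & factor W Wc i nd.2 (nodeform nd.1)].

Lemma step_nodes (i : 'I_10) (nodes : seq ((A * A) * (bool * seq nat))) (D : seq (option nat)) n :
  (forall nd, nd \in nodes -> node_ok i nd) ->
  pairwise (fun p q : A * A => p.1 * q.2 != p.2 * q.1) [seq nd.1 | nd <- nodes] ->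
  all (fun j => freeZ n (component_rows tau (glued j) ++ component_rows tau (gluing_order i))) D ->
  has (fun c => c.1) ([seq nd.2 | nd <- nodes] ++ map cover_of D) &&
    all (fun j => j \in flatten [seq c.2 | c <- [seq nd.2 | nd <- nodes] ++ map cover_of D]) (iota 0 i) ->
  step W Wc q i.
Proof.
move=> hn hp hD; apply: step_intro hp _ _ _ => [nd /hn[]|nd /hn[]|nd /hn[]|] // c x y.
by move=> /mapP[j jD ->]; apply: disjoint_factor (allP hD j jD).
Qed.

Lemma component_rowsE (R : comNzRingType) (t : R) k : (k < 10)%N ->
  component_rows t (gluing_order k) =
  [:: (line_rows t (gluing_order k)).1; (line_rows t (gluing_order k)).2].
Proof. by do 10?[case: k => [|k]]. Qed.

Lemma line_inspan (j j' : 'I_10) : nat_of_ord j' \in [:: nat_of_ord j] ->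
  inspan (component_rows b (gluing_order j)) (row1 j') /\
  inspan (component_rows b (gluing_order j)) (row2 j').
Proof.
rewrite inE => /eqP/val_inj ->; rewrite component_rowsE //.
by split; [apply: (@nth_inspan _ 0)|apply: (@nth_inspan _ 1)].
Qed.

Lemma line_node1 (i j : 'I_10) n y z1 z2 : (j < i)%N ->
  freeZ n (component_rows tau (gluing_order j) ++ [:: (line_rows tau (gluing_order i)).2]) ->
  (forall k, (k < 7)%N ->
     1 * (row1 i)`_k + y * (row2 i)`_k = z1 * (row1 j)`_k + z2 * (row2 j)`_k) ->
  node_ok i ((1, y), (false, [:: nat_of_ord j])).
Proof.
move=> ji fT h; split; [by left|by left; exists j, z1, z2|].
apply: (@node_factor1 i (false, [:: nat_of_ord j])
  (fun R t => component_rows t (gluing_order j)) n) => //.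
- exact: component_rows_natural.
- by move=> j'; apply: line_inspan.
exists [:: z1; z2]; rewrite component_rowsE //; split=> // k hk.
by rewrite nth_mkseq //= addr0 -h // mul1r.
Qed.

Lemma line_node2 (i j : 'I_10) n x z1 z2 : (j < i)%N ->
  freeZ n (component_rows tau (gluing_order j) ++ [:: (line_rows tau (gluing_order i)).1]) ->
  (forall k, (k < 7)%N ->
     x * (row1 i)`_k + 1 * (row2 i)`_k = z1 * (row1 j)`_k + z2 * (row2 j)`_k) ->
  node_ok i ((x, 1), (false, [:: nat_of_ord j])).
Proof.
move=> ji fT h; split; [by right|by left; exists j, z1, z2|].
apply: (@node_factor2 i (false, [:: nat_of_ord j])
  (fun R t => component_rows t (gluing_order j)) n) => //.
- exact: component_rows_natural.
- by move=> j'; apply: line_inspan.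
exists [:: z1; z2]; rewrite component_rowsE //; split=> // k hk.
by rewrite nth_mkseq //= addr0 -h // mul1r.
Qed.

Lemma conic_inspan (l : 'I_3) : inspan (conic_rows b) (nth [::] (conic_rows b) l).
Proof. by apply: nth_inspan; apply: ltn_ord. Qed.

Lemma conic_node1 (i : 'I_10) n y z0 z1 z2 :
  a * z0 * z1 - z0 * z2 + (b - a) * z1 * z2 = 0 ->
  freeZ n (conic_rows tau ++ [:: (line_rows tau (gluing_order i)).2]) ->
  (forall k, (k < 7)%N ->
     1 * (row1 i)`_k + y * (row2 i)`_k = lc [:: z0; z1; z2] (conic_rows b) k) ->
  node_ok i ((1, y), (true, [::])).
Proof.
move=> q0 fT h; split; [by left|by right; exists z0, z1, z2|].
apply: (@node_factor1 i (true, [::]) (fun R t => conic_rows t) n) => //.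
- exact: (component_rows_natural v34).
- by move=> _; apply: conic_inspan.
by exists [:: z0; z1; z2]; split=> // k hk; rewrite nth_mkseq // -h // mul1r.
Qed.

Lemma conic_node2 (i : 'I_10) n x z0 z1 z2 :
  a * z0 * z1 - z0 * z2 + (b - a) * z1 * z2 = 0 ->
  freeZ n (conic_rows tau ++ [:: (line_rows tau (gluing_order i)).1]) ->
  (forall k, (k < 7)%N ->
     x * (row1 i)`_k + 1 * (row2 i)`_k = lc [:: z0; z1; z2] (conic_rows b) k) ->
  node_ok i ((x, 1), (true, [::])).
Proof.
move=> q0 fT h; split; [by right|by right; exists z0, z1, z2|].
apply: (@node_factor2 i (true, [::]) (fun R t => conic_rows t) n) => //.
- exact: (component_rows_natural v34).
- by move=> _; apply: conic_inspan.
by exists [:: z0; z1; z2]; split=> // k hk; rewrite nth_mkseq // -h // mul1r.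
Qed.

Lemma forall7 (P : nat -> Prop) : P 0%N -> P 1%N -> P 2%N -> P 3%N -> P 4%N -> P 5%N -> P 6%N ->
  forall k, (k < 7)%N -> P k.
Proof. by move=> p0 p1 p2 p3 p4 p5 p6; do 7?[case=> [|]] => // k. Qed.

Hypothesis tau01 : tau = 0 \/ tau = 1.

Ltac free := first [by case: tau01 => ->; vm_compute|by vm_compute].
Ltac coords := apply: forall7; rewrite /=; ring.
Ltac line_at j z1 z2 := first
  [apply: (@line_node1 _ (@Ordinal 10 j isT) 8 _ z1 z2); [by []|free|coords]
  |apply: (@line_node2 _ (@Ordinal 10 j isT) 8 _ z1 z2); [by []|free|coords]].
Ltac conic_at z0 z1 z2 := first
  [apply: (@conic_node1 _ 8 _ z0 z1 z2); [ring|free|coords]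
  |apply: (@conic_node2 _ 8 _ z0 z1 z2); [ring|free|coords]].
Ltac distinct := rewrite /= ?(mul0r, mulr0, mul1r, mulr1, mulN1r, mulrN1, opprK)
  ?oppr_eq0 ?oner_eq0 ?[0 == _]eq_sym ?oppr_eq0 ?oner_eq0 ?andbT //.

Lemma step0 h : step W Wc q (@Ordinal 10 0 h).
Proof. by apply: (@step_nodes _ [::] [:: None] 8); [by []|by []|free|by []]. Qed.
Lemma step1 h : step W Wc q (@Ordinal 10 1 h).
Proof. by apply: (@step_nodes _ [::] [:: None; Some 0%N] 8); [by []|by []|free|by []]. Qed.
Lemma step2 h : step W Wc q (@Ordinal 10 2 h).
Proof. by apply: (@step_nodes _ [::] [:: None; Some 0; Some 1]%N 8); [by []|by []|free|by []]. Qed.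
Lemma step3 h : step W Wc q (@Ordinal 10 3 h).
Proof.
apply: (@step_nodes _ [:: ((1, 0), (false, [:: 0%N]))] [:: None; Some 1; Some 2]%N 8); [|by distinct|free|by []].
by move=> nd; rewrite inE => /eqP ->; line_at 0%N (1 : A) (0 : A).
Qed.
Lemma step4 h : step W Wc q (@Ordinal 10 4 h).
Proof.
(* The nodes of [v2] with [v1], [v11] and the conic, in coordinates on the line. The second list
   names the earlier components disjoint from it at both limits. *)
apply: (@step_nodes _ [:: ((1, 0), (false, [:: 3%N])); ((0, 1), (false, [:: 1%N])); ((-1, 1), (true, [::]))]
  [:: Some 0; Some 2]%N 8); [|by distinct|free|by []].
move=> nd; rewrite !inE => /or3P[] /eqP ->.
- by line_at 3%N (1 : A) (1 : A).
- by line_at 1%N (1 : A) (0 : A).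
by conic_at (1 : A) (0 : A) (0 : A).
Qed.
Lemma step5 h : step W Wc q (@Ordinal 10 5 h).
Proof.
apply: (@step_nodes _ [:: ((1, 0), (false, [:: 3%N])); ((0, 1), (false, [:: 2%N])); ((1, 1), (true, [::]))]
  [:: Some 0; Some 1; Some 4]%N 8); [|by distinct|free|by []].
move=> nd; rewrite !inE => /or3P[] /eqP ->.
- by line_at 3%N (0 : A) (1 : A).
- by line_at 2%N (1 : A) (0 : A).
by conic_at (0 : A) (0 : A) (1 : A).
Qed.
Lemma step6 h : step W Wc q (@Ordinal 10 6 h).
Proof.
apply: (@step_nodes _ [:: ((1, 0), (false, [:: 1%N])); ((1, -1), (true, [::]))]
  [:: Some 0; Some 2; Some 3; Some 4; Some 5]%N 8); [|by distinct|free|by []].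
move=> nd; rewrite !inE => /orP[] /eqP ->.
- by line_at 1%N b (1 : A).
by conic_at b (1 : A) b.
Qed.
Lemma step7 h : step W Wc q (@Ordinal 10 7 h).
Proof.
apply: (@step_nodes _ [:: ((1, 0), (false, [:: 6%N])); ((0, 1), (false, [:: 2%N]))]
  [:: None; Some 0; Some 1; Some 3; Some 4; Some 5]%N 8); [|by distinct|free|by []].
move=> nd; rewrite !inE => /orP[] /eqP ->.
- by line_at 6%N (0 : A) (1 : A).
by line_at 2%N b (1 : A).
Qed.

Ltac in_span zs := exists zs; split; [by []|coords].

Lemma step8 h : step W Wc q (@Ordinal 10 8 h).
Proof.
pose T1 (R : comNzRingType) (_ : R) : seq (seq R) :=
  [:: [:: 1; 0; 0; 0; 0; 0; 0]; [:: 0; 0; 0; 0; 0; 1; 0]; [:: 0; 0; 0; 1; 0; 0; 0]].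
pose T2 (R : comNzRingType) (_ : R) : seq (seq R) :=
  [:: [:: 0; 0; 1; 0; -1; 0; 0]; [:: 0; 0; 0; 0; 0; -1; 1]; [:: 0; 0; 0; 1; 0; 1; 0]].
have n1 : natural T1 by move=> R S f x; rewrite /= ?rmorphN ?rmorph1 ?rmorph0.
have n2 : natural T2 by move=> R S f x; rewrite /= ?rmorphN ?rmorph1 ?rmorph0.
apply: (@step_nodes _ [:: ((0, 1), (false, [:: 0%N])); ((1, 0), (false, [:: 1; 6]%N));
    ((-1, 1), (false, [:: 2; 7]%N))]
  [:: None; Some 3; Some 4; Some 5]%N 8); [|by distinct|free|by []].
move=> nd; rewrite !inE => /or3P[] /eqP ->.
- by line_at 0%N (0 : A) (1 : A).
- split; [by left|left; exists (@Ordinal 10 1 isT), 0, 1; split; [by []|coords]|].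
  apply: (@node_factor1 _ _ T1 8 n1); [by []| |free|].
  + move=> [j hj]; rewrite /= !inE => /orP[] /eqP ej; subst j; split.
    * by in_span [:: 1; 0; 0 : A].
    * by in_span [:: 0; 1; 0 : A].
    * by in_span [:: b; 1; 0 : A].
    * by in_span [:: 0; 1; 1 : A].
  by in_span [:: 0; 1; 0 : A].
split; [by right|left; exists (@Ordinal 10 2 isT), 0, 1; split; [by []|coords]|].
apply: (@node_factor2 _ _ T2 8 n2); [by []| |free|].
- move=> [j hj]; rewrite /= !inE => /orP[] /eqP ej; subst j; split.
  + by in_span [:: 1; 0; 0 : A].
  + by in_span [:: 0; 1; 0 : A].
  + by in_span [:: 0; 0; 1 : A].
  + by in_span [:: b; 1; 0 : A].
by in_span [:: 0; 1; 0 : A].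
Qed.

(** At t_1 = 0 the line [v9] also meets [v8] in its node with [v0], and [v5] in its node with the
    conic. [T1] contains [v0] and [v8], and [T2] contains the conic and [v5]. *)
Lemma step9 h : step W Wc q (@Ordinal 10 9 h).
Proof.
pose T1 (R : comNzRingType) (_ : R) : seq (seq R) :=
  [:: [:: 0; 0; 1; 0; 0; 0; 0]; [:: 0; 0; 0; 0; 0; 0; 1]; [:: 0; 0; 0; 0; 0; 1; 0]].
pose T2 (R : comNzRingType) (t : R) : seq (seq R) :=
  conic_rows t ++ [:: [:: 0; 0; 0; 1; 0; 1; 0]].
have n1 : natural T1 by move=> R S f x; rewrite /= ?rmorphN ?rmorph1 ?rmorph0.
have n2 : natural T2 by move=> R S f x; rewrite /= ?rmorphN ?rmorph1 ?rmorph0.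
apply: (@step_nodes _ [:: ((0, 1), (false, [:: 0; 8]%N)); ((1, 0), (true, [:: 6%N]));
    ((1, -1), (false, [:: 7%N]))]
  [:: Some 1; Some 2; Some 3; Some 4; Some 5]%N 8); [|by distinct|free|by []].
move=> nd; rewrite !inE => /or3P[] /eqP ->.
- split; [by right|left; exists (@Ordinal 10 0 isT), b, 1; split; [by []|coords]|].
  apply: (@node_factor2 _ _ T1 8 n1); [by []| |free|].
  + move=> [j hj]; rewrite /= !inE => /orP[] /eqP ej; subst j; split.
    * by in_span [:: 1; 0; 0 : A].
    * by in_span [:: 0; 1; 0 : A].
    * by in_span [:: 0; 0; 1 : A].
    * by in_span [:: 0; 1; 0 : A].
  by in_span [:: b; 1; 0 : A].
- split; [by left|right; exists 0, 1, 0; split; [ring|coords]|].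
  apply: (@node_factor1 _ _ T2 8 n2); [| |free|].
  + move=> _ l; have [zs [sz hz]] := conic_inspan l; exists (zs ++ [:: 0]).
    split; first by rewrite !size_cat sz.
    by move=> k hk; rewrite lc_cat // hz //= mul0r !addr0.
  + move=> [j hj]; rewrite /= !inE => /eqP ej; subst j; split.
    * by in_span [:: b; 1; b; 1 : A].
    * by in_span [:: 0; 0; 0; 1 : A].
  by in_span [:: 0; 1; 0; 0 : A].
by line_at 7%N (-1 : A) (-1 : A).
Qed.

Lemma steps i : step W Wc q i.
Proof.
case: i; do 10?[case=> [|]] => // h; [exact: step0|exact: step1|exact: step2|exact: step3
  |exact: step4|exact: step5|exact: step6|exact: step7|exact: step8|exact: step9].
Qed.

Lemma lines_free i : row_free (\matrix_l map_mx at0 (W i l)).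
Proof.
have E l : W i l = pvec a b (nth [::] (component_rows b (gluing_order i)) l).
  by rewrite component_rowsE // /W /line_basis /pair2; case: l => -[|[|//]] hl.
rewrite (_ : (\matrix_l _) = \matrix_(l < 2) map_mx at0
   (pvec a b (nth [::] (component_rows b (gluing_order i)) l))); last first.
  by apply/matrixP => l k; rewrite !mxE E !mxE.
apply: (@natural_free (fun R t => component_rows t (gluing_order i)) 8).
- exact: component_rows_natural.
- have /allP h : all (fun k => freeZ 8 (component_rows tau (gluing_order k))) (iota 0 10) by free.
  by apply: h; rewrite mem_iota ltn_ord.
by rewrite component_rowsE.
Qed.

Lemma conic_free : row_free (\matrix_l map_mx at0 (Wc l)).
Proof.
by apply: (@natural_free (fun R t => conic_rows t) 8);
  [exact: (component_rows_natural v34)|free|].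
Qed.

Theorem limit_lift : exists N, forall f : {mpoly K[16]},
  (exists h, rest (conic_basis 1 tau%:~R) f = qform 1 (tau%:~R - 1) * h) ->
  (forall v, is_line v -> rest (line_basis 1 tau%:~R v) f = 0) ->
  forall m, mdeg m = N -> exists (c : A) (G : {mpoly A[16]}), c.[0] != 0 /\
    let F := c *: ('X_[m] * map_mpoly polyC f) - 'X *: G in
    (exists h, rest (conic_basis a b) F = qform a (b - a) * h) /\
    forall v, is_line v -> rest (line_basis a b v) F = 0.
Proof.
have [N hN] := @glue K 16 10 W Wc q conic_free lines_free steps; exists N => f hc hl m hm.
have pE (r : seq A) r0 : map at0 r = r0 -> map_mx at0 (pvec a b r) = pvec 1 tau%:~R r0.
  by move=> <-; rewrite map_pvec /= /horner_eval a0 b0.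
have at0b : at0 b = tau%:~R by rewrite /= /horner_eval b0.
have [||c [G [c0 [gc gl]]]] := hN f _ _ m hm.
- have [r hr] := hc; exists r; rewrite /q map_qform hornerD hornerN a0 b0 -hr.
  apply: (congr1 (fun U : 'I_3 -> 'rV[K]_16 => rest U f)); apply/funext => l.
  rewrite /Wc /conic_basis; apply: pE; rewrite -at0b.
  have e : [seq map at0 r | r <- conic_rows b] = conic_rows (at0 b) := component_rows_natural v34 at0 b.
  by rewrite -e (nth_map [::]).
- move=> i; rewrite -[RHS](hl (gluing_order i)); last by case: i; do 10?[case=> [|]].
  apply: (congr1 (fun U : 'I_2 -> 'rV[K]_16 => rest U f)); apply/funext => l.
  rewrite /W /line_basis /pair2; case: ifP => _; apply: pE; rewrite -at0b.
    by have [] := row_natural true (gluing_order i) at0 b.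
  by have [] := row_natural false (gluing_order i) at0 b.
exists c, G; split=> //; split=> // v nv.
suff [i Ei] : exists i : 'I_10, gluing_order i = v by rewrite -Ei; apply: gl.
case: v nv => // _; [exists (@Ordinal 10 0 isT)|exists (@Ordinal 10 3 isT)
  |exists (@Ordinal 10 4 isT)|exists (@Ordinal 10 6 isT)|exists (@Ordinal 10 7 isT)
  |exists (@Ordinal 10 2 isT)|exists (@Ordinal 10 8 isT)|exists (@Ordinal 10 9 isT)
  |exists (@Ordinal 10 5 isT)|exists (@Ordinal 10 1 isT)] => //.
Qed.
End GlueData.

Lemma monomial_split n (m : 'X_{1..n}) N k : mdeg m = (N + k)%N ->
  exists m1 m2, [/\ mdeg m1 = N, mdeg m2 = k & m = (m1 + m2)%MM].
Proof.
elim: k m => [|k IH] m hm; first by exists m, 0%MM; rewrite mdeg0 hm addn0 addm0.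
have [j uj] : exists j, m j != 0%N.
  apply/existsP; rewrite -negb_forall; apply: contraPN hm => /forallP u0.
  by rewrite mdegE big1 ?addnS // => i _; apply/eqP.
have Em : m = (U_(j) + (m - U_(j)))%MM by rewrite addmC submK // lep1mP.
have [|m1 [m2 [h1 h2 e]]] := IH (m - U_(j))%MM.
  by move: hm; rewrite {1}Em mdegD mdeg1 addnS => -[].
exists m1, (U_(j) + m2)%MM; split; rewrite // ?mdegD ?mdeg1 ?h2 //.
by rewrite {1}Em e !addmA [(U_(j) + m1)%MM]addmC.
Qed.

(** * The ideal of the flat limit *)

Section Limit.
Variables (K : numFieldType) (a b : {poly K}) (tau : int).
Local Notation A := {poly K}.
Local Notation be := (tau%:~R : K).
Hypotheses (a0 : a.[0] = 1) (b0 : b.[0] = be) (tau01 : tau = 0 \/ tau = 1).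
Hypotheses (ab : a != b) (bn0 : b != 0).

Let e : A := a * b * (a - b).

Lemma a_neq0 : a != 0.
Proof. by apply/eqP => h; move/eqP: a0; rewrite h horner0 eq_sym oner_eq0. Qed.

Lemma e_neq0 : e != 0.
Proof. by rewrite /e !mulf_neq0 ?subr_eq0 ?a_neq0. Qed.

Lemma genericE s : generic (a.[s], b.[s]) <-> e.[s] != 0.
Proof.
rewrite /e !hornerM hornerD hornerN !mulf_eq0 !negb_or subr_eq0 -andbA.
by split=> [[h1 h2 h3]|/and3P[]] //; apply/and3P.
Qed.

Lemma generic_neq0 s : e.[s] != 0 -> [/\ a.[s] != 0, b.[s] != 0 & a.[s] - b.[s] != 0].
Proof. by move/genericE => [h1 h2 h3]; rewrite subr_eq0. Qed.

(** Vanishing on the limits of all components. For the conic it is stated as divisibility, which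
    also covers the case where the limit equation is reducible. *)
Definition limit_ideal (f : {mpoly K[16]}) :=
  (exists h, rest (conic_basis 1 be) f = qform 1 (be - 1) * h) /\
  forall v, is_line v -> rest (line_basis 1 be v) f = 0.

Lemma map_line_basis s v l : map_mx (horner_eval s) (line_basis a b v l) =
  line_basis a.[s] b.[s] v l.
Proof.
rewrite /line_basis /pair2; case: ifP => _; rewrite map_pvec; congr (pvec _ _ _).
  by have [] := row_natural true v (horner_eval s) b.
by have [] := row_natural false v (horner_eval s) b.
Qed.

Lemma map_conic_basis s l : map_mx (horner_eval s) (conic_basis a b l) =
  conic_basis a.[s] b.[s] l.
Proof.
rewrite /conic_basis map_pvec; congr (pvec _ _ _).
have E : [seq map (horner_eval s) r | r <- conic_rows b] = conic_rows b.[s] :=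
  component_rows_natural v34 (horner_eval s) b.
by rewrite -E (nth_map [::]).
Qed.

Lemma line_basis_neq0 (t0 t1 : K) v : t0 != 0 -> is_line v -> line_basis t0 t1 v ord0 != 0.
Proof.
move=> t00 nv; apply/eqP => /(pvec_eq0 t00) h.
have [k [hk hr]] : exists k, (k < 7)%N /\
    ((line_rows t1 v).1`_k = 1 \/ (line_rows t1 v).1`_k = -1).
  case: v nv {h} => // _; [exists 2|exists 2|exists 1%N|exists 5|exists 3|exists 2|exists 5|exists 3
    |exists 1%N|exists 0%N]; by split=> //=; auto.
have /eqP := h k hk; case: hr => ->; by rewrite ?oppr_eq0 oner_eq0.
Qed.

Lemma conic_basis_neq0 (t0 t1 : K) : t0 != 0 -> conic_basis t0 t1 i0 != 0.
Proof.
move=> t00; apply/eqP; rewrite /conic_basis => /(pvec_eq0 t00)/(_ 0%N isT)/eqP.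
by rewrite /= oner_eq0.
Qed.

Lemma limit_X_union f : limit_X a b f -> union_ideal (limit_X_comp a b) f.
Proof.
by move=> [F hF ->] v; exists F => // s gs x Xx; apply: hF => //; exists v.
Qed.

Lemma union_limit_ideal f : union_ideal (limit_X_comp a b) f -> limit_ideal f.
Proof.
move=> h; split=> [|v nv].
  have [F hF ->] := h v34.
  have [||s es|s es|r hr] := @fam_conic K 16 e (conic_basis a b) a (b - a) F e_neq0.
  - exact: a_neq0.
  - by rewrite subr_eq0 eq_sym.
  - by rewrite map_conic_basis; apply: conic_basis_neq0; case: (generic_neq0 es).
  - have [h1 h2 h3] := generic_neq0 es; have /genericE gs := es.
    have := hF s gs; rewrite (X_conic h1 h2 h3) hornerD hornerN.
    by rewrite !map_conic_basis.
  exists (map_mpoly (horner_eval 0) r).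
  have := congr1 (map_mpoly (horner_eval 0)) hr; rewrite map_rest rmorphM /= map_qform.
  rewrite hornerD hornerN a0 b0 => <-.
  apply: (congr1 (fun U : 'I_3 -> 'rV[K]_16 => rest U _)); apply/funext => l.
  by rewrite map_conic_basis a0 b0.
have [F hF ->] := h v.
have hr : rest (line_basis a b v) F = 0.
  apply: (fam_line e_neq0) => s es.
    by rewrite map_line_basis; apply: line_basis_neq0 => //; case: (generic_neq0 es).
  have [h1 h2 h3] := generic_neq0 es; have /genericE gs := es.
  by rewrite !map_line_basis -X_line //; apply: hF.
have := congr1 (map_mpoly (horner_eval 0)) hr; rewrite map_rest raddf0 => <-.
apply: (congr1 (fun U : 'I_2 -> 'rV[K]_16 => rest U _)); apply/funext => l.
by rewrite map_line_basis a0 b0.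
Qed.

Lemma limit_ideal_lift : exists N, forall f, limit_ideal f ->
  forall m, mdeg m = N -> limit_X a b ('X_[m] * f).
Proof.
have [N hN] := limit_lift a0 b0 tau01; exists N => f [hc hl] m hm.
have [c [G [c0 [[r hr] hv]]]] := hN f hc hl m hm.
(* At s = 0 the lift equals c(0) X^m f, whence the normalizing constant. *)
set F := _ - _ in hr hv; exists ((c.[0])^-1%:P *: F).
  move=> s /genericE es x [v Xx].
  have [h1 h2 h3] := generic_neq0 es.
  rewrite map_mpolyZ mevalZ (_ : (_).@[x 0] = 0) ?mulr0 //.
  case: (boolP (is_line v)) => nv.
    have /(X_line h1 h2 h3 _ nv) : vanishing (lineset (line_basis a.[s] b.[s] v ord0)
        (line_basis a.[s] b.[s] v ord_max)) (map_mpoly (horner_eval s) F).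
      apply: rest0_vanish_line.
      have := congr1 (map_mpoly (horner_eval s)) (hv v nv); rewrite map_rest raddf0 => <-.
      by apply: (congr1 (fun U : 'I_2 -> 'rV[K]_16 => rest U _)); apply/funext => l;
        rewrite map_line_basis.
    by apply.
  have Ev : v = v34 by case: (v) nv.
  rewrite Ev in Xx.
  have /(X_conic h1 h2 h3) : vanishing (conic (conic_basis a.[s] b.[s]) a.[s] (b.[s] - a.[s]))
      (map_mpoly (horner_eval s) F).
    apply: (@rest_div_conic _ _ _ _ _ _ (map_mpoly (horner_eval s) r)).
    have := congr1 (map_mpoly (horner_eval s)) hr; rewrite map_rest rmorphM /= map_qform.
    rewrite hornerD hornerN => <-.
    by apply: (congr1 (fun U : 'I_3 -> 'rV[K]_16 => rest U _)); apply/funext => l;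
      rewrite map_conic_basis.
  by apply.
rewrite map_mpolyZ /F raddfB /= !map_mpolyZ rmorphM /= map_mpolyX map_polyC_at0.
rewrite /horner_eval hornerX hornerC scale0r subr0 scalerA mulVf ?scale1r //.
Qed.

(** The ideal of the union lies in [limit_ideal], whose products with all monomials of degree [N]
    lie in the ideal of the limit; so the saturations agree. *)
Lemma limit_same : same_subscheme (limit_X a b) (union_ideal (limit_X_comp a b)).
Proof.
move=> f; split=> -[k h]; first by exists k => m hm; apply: limit_X_union; apply: h.
have [N hN] := limit_ideal_lift; exists (N + k)%N => m hm.
have [m1 [m2 [h1 h2 ->]]] := monomial_split hm.
by rewrite mpolyXD -mulrA; apply: hN => //; apply: union_limit_ideal; apply: h.
Qed.
End Limit.

(** * Incidence data of a configuration of lines and conics *)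

Definition dz (d r : seq int) : int :=
  d`_0 * r`_0 + d`_1 * r`_1 + d`_2 * r`_2 + d`_3 * r`_3 + d`_4 * r`_4 + d`_5 * r`_5 + d`_6 * r`_6.

(* A branch at a point p of the component with index [comp]: the component lies
   in the span of p, v and w, and [vform], [wform] are the coordinates along v
   and w; [mat] expresses p and v in the two rows of a line. *)
Definition branch : Type := nat * seq int * (seq int * seq int) * (seq int * seq int).
Definition comp (b : branch) : nat := b.1.1.1.
Definition mat (b : branch) : seq int := b.1.1.2.
Definition bv (b : branch) : seq int := b.1.2.1.
Definition vform (b : branch) : seq int := b.1.2.2.
Definition bw (b : branch) : seq int := b.2.1.
Definition wform (b : branch) : seq int := b.2.2.

Definition point : Type := seq int * nat * seq branch.
Definition pt (P : point) : seq int := P.1.1.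
Definition chart (P : point) : nat := P.1.2.
Definition branches (P : point) : seq branch := P.2.

HB.instance Definition _ := Equality.on branch.
HB.instance Definition _ := Equality.on point.

Definition comps_of (P : point) : seq nat := map comp (branches P).

Definition combZ (c : seq int) (M : seq (seq int)) : seq int := mkseq (lc c M) 7.

(** The expansion (r_j / p_j) p + vform(r) v + wform(r) w in the chart j of the point. Since
    [point_ok] demands p_j = 1 or -1, the product r_j p_j replaces the quotient. *)
Definition normal_form (P : point) (b : branch) (r : seq int) : seq int :=
  mkseq (fun k => r`_(chart P) * (pt P)`_(chart P) * (pt P)`_k + dz (vform b) r * (bv b)`_k
    + dz (wform b) r * (bw b)`_k) 7.

Definition line_branch_ok (rows : seq (seq int)) (P : point) (b : branch) : bool :=
  [&& size rows == 2%N, bw b == [::], wform b == [::], dz (vform b) (bv b) == 1,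
      combZ (take 2 (mat b)) rows == pt P & combZ (take 2 (drop 2 (mat b))) rows == bv b].

Definition conic_branch_ok (rows : seq (seq int)) (P : point) (b : branch) : bool :=
  [&& size rows == 3%N, dz (vform b) (bv b) == 1, dz (vform b) (bw b) == 0,
      dz (wform b) (bv b) == 0, dz (wform b) (bw b) == 1 &
      [|| rows == [:: pt P; bv b; bw b], rows == [:: bv b; pt P; bw b] |
          rows == [:: bw b; bv b; pt P]]].

(** These checks make [projb] a matrix as in [union_analytically_isomorphic]: the normal form fixes
    the rows of the branch, and the forms of the branch vanish on the rows of the other branches
    through the point. *)
Definition branch_ok (comps : seq (seq (seq int))) (P : point) (b : branch) : bool :=
  let rows := nth [::] comps (comp b) in
  [&& (comp b < size comps)%N, line_branch_ok rows P b || conic_branch_ok rows P b,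
      all (fun r => normal_form P b r == r) rows,
      (bv b)`_(chart P) == 0, (bw b)`_(chart P) == 0,
      dz (vform b) (pt P) == 0, dz (wform b) (pt P) == 0 &
      all (fun b' => (comp b' == comp b) || all (fun r => (dz (vform b) r == 0) && (dz (wform b) r == 0))
        (nth [::] comps (comp b'))) (branches P)].

(** The last clause certifies that the point lies on no component other than those listed. *)
Definition point_ok (comps : seq (seq (seq int))) (P : point) : bool :=
  [&& (chart P < 7)%N, (pt P)`_(chart P) * (pt P)`_(chart P) == 1, (0 < size (branches P))%N,
      uniq (comps_of P), all (branch_ok comps P) (branches P) &
      all (fun i => (i \in comps_of P) || freeZ 8 (pt P :: nth [::] comps i)) (iota 0 (size comps))].

(** Independent rows make two components disjoint. Otherwise a listed point is common to both, and
    by [meet_components] it is the only one. *)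
Definition pairs_ok (comps : seq (seq (seq int))) (pts : seq point) : bool :=
  all (fun i => all (fun i' => [|| i == i',
      freeZ 8 (nth [::] comps i ++ nth [::] comps i') |
      has (fun P => (i \in comps_of P) && (i' \in comps_of P)) pts])
    (iota 0 (size comps))) (iota 0 (size comps)).

Definition dual_ok (rows duals : seq (seq int)) : bool :=
  all (fun l => all (fun m => dz (nth [::] duals l) (nth [::] rows m) == (l == m)%:R)
    (iota 0 (size rows))) (iota 0 (size rows)).

(** A coordinate nonzero at one spanning point of the conic and zero at the other two, as
    [smooth_branch_conic] requires of its chart. *)
Definition chart_ok (rows : seq (seq int)) (l : nat) : bool :=
  has (fun j => all (fun m => ((nth [::] rows m)`_j != 0) == (m == l)) (iota 0 3)) (iota 0 7).

Definition comp_ok (rows duals : seq (seq int)) : bool :=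
  ((size rows == 2%N) || (size rows == 3%N) && all (chart_ok rows) (iota 0 3)) && dual_ok rows duals.

Section Config.
Variables (K : numFieldType) (tau : int).
Local Notation be := (tau%:~R : K).

Definition rowK (r : seq int) : seq K := [seq c%:~R | c <- r].
Definition pz (r : seq int) : 'rV[K]_16 := pvec 1 be (rowK r).
(** At t_0 = 1 each of the seven coefficients of a vector of P_nod appears alone at one coordinate
    of [wvec]; these positions, shared with [jx], transport [d] to a linear form on the ambient
    space. *)
Definition form (d : seq int) : 'cV[K]_16 := \col_i
  ([:: 0; d`_0; 0; 0; 0; 0; d`_1; 0; d`_2; d`_3; d`_4; 0; d`_5; 0; d`_6; 0]`_i)%:~R.
Definition jx (k : nat) : 'I_16 := inord (nth 0%N [:: 1; 6; 8; 9; 10; 12; 14]%N k).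

Lemma rowK_nth r k : (rowK r)`_k = (r`_k)%:~R.
Proof.
have [hk|hk] := ltnP k (size r); first by rewrite (nth_map 0).
by rewrite !nth_default ?size_map.
Qed.

Lemma formE r d : (pz r *m form d) 0 0 = (dz d r)%:~R.
Proof.
rewrite mxE !big_ord_recl big_ord0 !mxE /= !rowK_nth /dz !rmorphD !rmorphM /=; ring.
Qed.

Lemma pz_chart r k : (k < 7)%N -> pz r 0 (jx k) = (r`_k)%:~R.
Proof.
move=> hk; rewrite mxE /wvec !rowK_nth; move: k hk.
by apply: forall7; rewrite inordK //= mul1r.
Qed.

Lemma pz_lin3 c1 c2 c3 r1 r2 r3 : pz (mkseq (fun k => c1 * r1`_k + c2 * r2`_k + c3 * r3`_k) 7) =
  c1%:~R *: pz r1 + c2%:~R *: pz r2 + c3%:~R *: pz r3.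
Proof.
apply/rowP => k; rewrite !mxE /wvec !rowK_nth; case: k => k hk.
by do 16?[case: k hk => [|k] hk] => //=; rewrite ?rmorphD ?rmorphM /=; ring.
Qed.

Lemma pz0 : pz [::] = 0.
Proof.
apply/rowP => k; rewrite !mxE /wvec !rowK_nth; case: k => k hk.
by do 16?[case: k hk => [|k] hk] => //=; ring.
Qed.

Lemma pz_comb2 c r1 r2 : pz (combZ (take 2 c) [:: r1; r2]) = (c`_0)%:~R *: pz r1 + (c`_1)%:~R *: pz r2.
Proof.
have lcE k : lc (take 2 c) [:: r1; r2] k = c`_0 * r1`_k + c`_1 * r2`_k.
  by case: c => [|c0 [|c1 c]]; rewrite /= ?take0 /=; ring.
apply/rowP => k; rewrite !mxE /wvec !rowK_nth /combZ !nth_mkseq // !lcE.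
by case: k => k hk; do 16?[case: k hk => [|k] hk] => //=; rewrite ?rmorphD ?rmorphM /=; ring.
Qed.

Definition curve (rows : seq (seq int)) : pset K 16 :=
  match rows with
  | [:: u; v] => lineset (pz u) (pz v)
  | [:: u; v; w] => conicset (pz u) (pz v) (pz w) 1 (-1) (-1)
  | _ => fun=> False
  end.

Lemma curve_span rows x : curve rows x -> x != 0 /\
  exists c : seq K, size c = size rows /\ x = \sum_(l < size rows) c`_l *: pz (nth [::] rows l).
Proof.
case: rows => [|u [|v [|w [|? ?]]]] //= [x0].
  by move=> [c1 [c2 xE]]; split=> //; exists [:: c1; c2]; rewrite xE !big_ord_recl big_ord0 addr0.
move=> [c1 [c2 [c3 [xE _]]]]; split=> //; exists [:: c1; c2; c3].
by rewrite xE !big_ord_recl big_ord0 addr0 addrA.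
Qed.

Lemma sum_zip (c : seq K) rows : size c = size rows ->
  \sum_(l < size rows) c`_l *: pz (nth [::] rows l) = \sum_(z <- zip c rows) z.1 *: pz z.2.
Proof.
elim: c rows => [|z c IH] [|r rows] //= => [_|[sc]]; first by rewrite big_ord0 big_nil.
by rewrite big_ord_recl big_cons /= IH.
Qed.

Lemma curve_linear rows x (M N : 'M[K]_16) : (forall r, r \in rows -> pz r *m M = pz r *m N) ->
  curve rows x -> x *m M = x *m N.
Proof.
move=> h /curve_span[_ [c [_ ->]]]; rewrite !mulmx_suml; apply: eq_bigr => l _.
by rewrite -!scalemxAl h // mem_nth.
Qed.

Lemma curve_form rows x d : (forall r, r \in rows -> dz d r = 0) -> curve rows x ->
  (x *m form d) 0 0 = 0.
Proof.
move=> h /curve_span[_ [c [_ ->]]]; rewrite mulmx_suml summxE big1 // => l _.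
by rewrite -scalemxAl mxE formE h ?mulr0 // mem_nth.
Qed.

Lemma free_pz n rows (c : seq K) : freeZ n rows -> size c = size rows ->
  \sum_(l < size rows) c`_l *: pz (nth [::] rows l) = 0 -> forall l, c`_l = 0.
Proof.
move=> fr sc h; apply: (freeZP fr sc) => k hk.
have sM : size (map rowK rows) = size rows by rewrite size_map.
have E : pvec 1 be (mkseq (lc c (map rowK rows)) 7) = 0.
  rewrite -pvec_lc ?sM // -[RHS]h; apply: eq_bigr => l _; rewrite (nth_map [::]) //.
by have := pvec_eq0 (oner_neq0 K) E hk; rewrite nth_mkseq.
Qed.

Variables (comps : seq (seq (seq int))) (pts : seq point).
Hypotheses (pts_ok : all (point_ok comps) pts) (comps_pairs : pairs_ok comps pts).
Let k := size comps.
Let Z (i : 'I_k) : pset K 16 := curve (nth [::] comps i).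

Lemma Z_neq0 i x : Z i x -> x != 0.
Proof. by move/curve_span=> []. Qed.

Lemma curve_cone rows : cone (curve rows).
Proof.
case: rows => [|u [|v [|w [|? ?]]]] //=; [exact: lineset_cone|exact: conicset_cone].
Qed.

Section Point.
Variable P : point.
Hypothesis PP : P \in pts.
Let p := pz (pt P).
Let j := jx (chart P).

Lemma chart_lt : (chart P < 7)%N.
Proof. by move/allP: pts_ok => /(_ P PP)/and5P[]. Qed.

Lemma chart_sqr : ((pt P)`_(chart P))%:~R * ((pt P)`_(chart P))%:~R = 1 :> K.
Proof. by move/allP: pts_ok => /(_ P PP)/and5P[_ /eqP h _ _ _]; rewrite -rmorphM /= h. Qed.

Lemma pjE : p 0 j = ((pt P)`_(chart P))%:~R.
Proof. by rewrite /p /j pz_chart // chart_lt. Qed.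

Lemma pj_neq0 : p 0 j != 0.
Proof. by apply/eqP => h; move: chart_sqr; rewrite -pjE h mul0r => /esym/eqP; rewrite oner_eq0. Qed.

Lemma p_neq0 : p != 0.
Proof. by apply: contra_neq pj_neq0 => ->; rewrite mxE. Qed.

(* x |-> (x_j / p_j) p *)
Definition proj0 : 'M[K]_16 := (delta_mx j 0 : 'cV_16) *m ((p 0 j)^-1 *: p).

Lemma proj0E (x : 'rV[K]_16) : x *m proj0 = (x 0 j / p 0 j) *: p.
Proof.
rewrite /proj0 mulmxA [x *m _](_ : _ = (x 0 j)%:M); last first.
  by apply/matrixP => a b; rewrite !ord1 mulmx_delta mxE.
by rewrite mul_scalar_mx scalerA.
Qed.

Definition projb (b : branch) : 'M[K]_16 :=
  proj0 + form (vform b) *m pz (bv b) + form (wform b) *m pz (bw b).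

Lemma projbE b (x : 'rV[K]_16) : x *m projb b = (x 0 j / p 0 j) *: p +
  (x *m form (vform b)) 0 0 *: pz (bv b) + (x *m form (wform b)) 0 0 *: pz (bw b).
Proof.
have E (f : 'cV[K]_16) (w : 'rV[K]_16) : x *m (f *m w) = (x *m f) 0 0 *: w.
  by rewrite mulmxA {1}[x *m f]mx11_scalar mul_scalar_mx.
by rewrite /projb !mulmxDr proj0E !E.
Qed.

Lemma branchP b : b \in branches P -> [/\ (comp b < k)%N,
   line_branch_ok (nth [::] comps (comp b)) P b || conic_branch_ok (nth [::] comps (comp b)) P b &
   [/\ forall r, r \in nth [::] comps (comp b) -> normal_form P b r = r,
      (bv b)`_(chart P) = 0, (bw b)`_(chart P) = 0,
      dz (vform b) (pt P) = 0 & dz (wform b) (pt P) = 0]].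
Proof.
move=> hb; move/allP: pts_ok => /(_ P PP)/and5P[_ _ _ _ /andP[/allP/(_ b hb)]].
rewrite /branch_ok => /and5P[h1 h2 /allP h3 /eqP h4 /and4P[/eqP h5 /eqP h6 /eqP h7 _]] _.
by split=> //; split=> // r /h3/eqP.
Qed.

Lemma branch_other b b' r : b \in branches P -> b' \in branches P -> comp b' != comp b ->
  r \in nth [::] comps (comp b') -> dz (vform b) r = 0 /\ dz (wform b) r = 0.
Proof.
move=> hb hb' nb hr; move/allP: pts_ok => /(_ P PP)/and5P[_ _ _ _ /andP[/allP/(_ b hb)]].
rewrite /branch_ok => /and5P[_ _ _ _ /and4P[_ _ _ /allP/(_ b' hb')]].
by rewrite (negPf nb) /= => /allP/(_ r hr)/andP[/eqP -> /eqP ->].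
Qed.

Lemma proj_branch b x : b \in branches P -> curve (nth [::] comps (comp b)) x -> x *m projb b = x.
Proof.
move=> hb Zx; rewrite -[RHS]mulmx1; apply: curve_linear Zx => r hr.
have [_ _ [/(_ r hr) h _ _ _ _]] := branchP hb.
rewrite mulmx1 projbE !formE -[RHS](congr1 pz h) /normal_form.
rewrite pz_lin3 rmorphM /=; congr (_ *: _ + _ + _).
rewrite /j pz_chart ?chart_lt // -/j pjE; apply: (mulIf (_ : ((pt P)`_(chart P))%:~R != 0)).
  by rewrite -pjE pj_neq0.
by rewrite divfK -?pjE ?pj_neq0 // -mulrA pjE chart_sqr mulr1.
Qed.

Lemma proj_other b b' x : b \in branches P -> b' \in branches P -> comp b' != comp b ->
  curve (nth [::] comps (comp b')) x -> x *m projb b = (x 0 j / p 0 j) *: p.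
Proof.
move=> hb hb' nb Zx; rewrite projbE.
rewrite (curve_form (fun r hr => (branch_other hb hb' nb hr).1) Zx).
by rewrite (curve_form (fun r hr => (branch_other hb hb' nb hr).2) Zx) !scale0r !addr0.
Qed.

Lemma smooth_at b c : b \in branches P -> c != 0 ->
  smooth_branch (curve (nth [::] comps (comp b))) (c *: p) j.
Proof.
move=> hb c0; have [_ ok [_ vj wj pv pw]] := branchP hb.
have pb x := @proj_branch b x hb.
have cpj : (c *: p) 0 j != 0 by rewrite mxE mulf_neq0 ?pj_neq0.
move: ok pb; set rows := nth [::] comps (comp b) => /orP[].
  case: rows => [|r1 [|r2 [|? ?]]]; rewrite /line_branch_ok ?andbF //=.
  case/and5P=> /eqP bw0 /eqP wf0 /eqP v1 /eqP pE /eqP vE pb.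
  have pD : p = _ := etrans (congr1 pz (esym pE)) (pz_comb2 (mat b) r1 r2).
  have vD : pz (bv b) = _ := etrans (congr1 pz (esym vE)) (pz_comb2 (drop 2 (mat b)) r1 r2).
  have -> : lineset (pz r1) (pz r2) = lineset (c *: p) (pz (bv b)).
    apply/funext => x; apply/propext; split=> [Zx|[x0 [u [v xE]]]].
      case: (Zx) => x0 _; split=> //.
      exists (x 0 j / p 0 j / c), ((x *m form (vform b)) 0 0).
      rewrite scalerA divfK // -{1}(pb x Zx) projbE bw0.
      by rewrite (_ : pz [::] = 0) ?scaler0 ?addr0 // pz0.
    split=> //; rewrite xE pD vD !scalerDr !scalerA addrACA -!scalerDl.
    by eexists; eexists.
  apply: (@smooth_branch_line _ _ _ _ _ (form (vform b))) => //.
    by rewrite -scalemxAl mxE formE pv mulr0.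
  by rewrite formE v1.
rewrite /conic_branch_ok => /and5P[/eqP _ /eqP v1 /eqP v2 /eqP w1 /andP[/eqP w2 E]] _.
have bvj : pz (bv b) 0 j = 0 by rewrite /j pz_chart ?chart_lt // vj.
have bwj : pz (bw b) 0 j = 0 by rewrite /j pz_chart ?chart_lt // wj.
have key al be' ga : al != 0 -> be' != 0 -> ga != 0 ->
    smooth_branch (conicset p (pz (bv b)) (pz (bw b)) al be' ga) (c *: p) j.
  move=> al0 be0 ga0; have := @smooth_branch_conic K 16 p (pz (bv b)) (pz (bw b)) al be' ga c 0 0 j
    (form (vform b)) (form (wform b)) al0 be0 ga0 c0.
  rewrite !scale0r !addr0 !mulr0 !addr0; apply=> //; rewrite ?pj_neq0 ?formE //.
  - by rewrite pv.
  - by rewrite v1.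
  - by rewrite v2.
  - by rewrite pw.
  - by rewrite w1.
  by rewrite w2.
have n1 : -1 != 0 :> K by rewrite oppr_eq0 oner_eq0.
have o1 := oner_neq0 K.
case/or3P: E => /eqP -> /=; first exact: key.
  by rewrite conicset_swap12; apply: key.
by rewrite conicset_swap13; apply: key.
Qed.

Lemma branch_nth i : i \in comps_of P -> exists2 b, b \in branches P & comp b = i.
Proof. by case/mapP=> b hb ->; exists b. Qed.

Lemma p_on_branch b c : b \in branches P -> c != 0 -> curve (nth [::] comps (comp b)) (c *: p).
Proof.
move=> hb c0; apply: curve_cone => //; have [_ ok _] := branchP hb.
move: ok; set rows := nth [::] comps (comp b) => /orP[].
  case: rows => [|r1 [|r2 [|? ?]]]; rewrite /line_branch_ok ?andbF //=.
  case/and5P=> _ _ _ /eqP pE _.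
  split; first exact: p_neq0.
  by exists ((mat b)`_0)%:~R, ((mat b)`_1)%:~R; rewrite -pz_comb2 pE.
rewrite /conic_branch_ok => /and5P[_ _ _ _ /andP[_ E]].
case/or3P: E => /eqP -> /=; split; rewrite ?p_neq0 //.
- by exists 1, 0, 0; rewrite scale1r !scale0r !addr0; split=> //; ring.
- by exists 0, 1, 0; rewrite scale1r !scale0r addr0 add0r; split=> //; ring.
by exists 0, 0, 1; rewrite scale1r !scale0r !add0r; split=> //; ring.
Qed.

Lemma p_incidence (i : 'I_k) c : c != 0 -> Z i (c *: p) <-> nat_of_ord i \in comps_of P.
Proof.
move=> c0; split=> [Zp|/branch_nth[b hb E]]; last by rewrite /Z -E; apply: p_on_branch.
apply/negP => /negP ni; move/allP: pts_ok => /(_ P PP)/and5P[_ _ _ _ /andP[_ /allP/(_ i)]].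
rewrite mem_iota ltn_ord => /(_ isT); rewrite (negPf ni) orFb => fr.
have [_ [cs [sc E]]] := curve_span Zp.
have := @free_pz _ _ (- c :: cs) fr; rewrite /= sc => /(_ erefl).
rewrite big_ord_recl /= -/p -E scaleNr addNr => /(_ erefl 0%N)/eqP.
by rewrite oppr_eq0 (negPf c0).
Qed.
End Point.

(** For components sharing a listed point p, the projection of the first branch fixes a common point
    x, but also collapses it to the line of p as a point of the second branch. *)
Lemma meet_components (i i' : 'I_k) : i != i' ->
  (forall x, Z i x -> ~ Z i' x) \/
  exists2 P, P \in pts & (nat_of_ord i \in comps_of P) && (nat_of_ord i' \in comps_of P) /\
    forall x, Z i x -> Z i' x -> exists2 c : K, c != 0 & x = c *: pz (pt P).
Proof.
move=> ni; move/allP: comps_pairs => /(_ i); rewrite mem_iota ltn_ord => /(_ isT)/allP/(_ i').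
rewrite mem_iota ltn_ord => /(_ isT)/or3P[/eqP/val_inj ei|fr|/hasP[P PP /andP[hi hi']]].
- by rewrite ei eqxx in ni.
- left=> x Zx Zx'.
  have [x0 [cs [sc E]]] := curve_span Zx; have [_ [cs' [sc' E']]] := curve_span Zx'.
  have hs : size (cs ++ map -%R cs') = size (nth [::] comps i ++ nth [::] comps i').
    by rewrite !size_cat size_map sc sc'.
  have /(free_pz fr hs) c0 : \sum_(l < size (nth [::] comps i ++ nth [::] comps i'))
      (cs ++ map -%R cs')`_l *: pz (nth [::] (nth [::] comps i ++ nth [::] comps i') l) = 0.
    rewrite sum_zip // zip_cat // big_cat /= -sum_zip // -E E' sum_zip //.
    elim: (cs') (nth [::] comps i') {sc' E' hs fr Zx'} => [|z zs IH] [|r rs]; rewrite ?big_nil ?addr0 //.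
    by rewrite /= !big_cons /= scaleNr addrACA subrr add0r IH.
  case/negP: x0; rewrite E big1 // => l _.
  by have := c0 l; rewrite nth_cat sc ltn_ord => ->; rewrite scale0r.
right; exists P => //; split=> [|x Zx Zx']; first by rewrite hi hi'.
exists (x 0 (jx (chart P)) / pz (pt P) 0 (jx (chart P))).
  apply: contraTneq (Z_neq0 Zx) => c0.
  have [b hb eb] := branch_nth hi; have [b' hb' eb'] := branch_nth hi'.
  have := @proj_other P PP b b' x hb hb'; rewrite eb eb' c0 scale0r eq_sym => /(_ ni Zx').
  by rewrite proj_branch ?eb // => ->; rewrite eqxx.
have [b hb eb] := branch_nth hi; have [b' hb' eb'] := branch_nth hi'.
rewrite -(@proj_other P PP b b' x hb hb') ?eb ?eb' //; first by rewrite proj_branch // eb.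
by rewrite eq_sym.
Qed.

Lemma two_components (i i' : 'I_k) x : Z i x -> Z i' x -> i != i' ->
  exists P c, [/\ P \in pts, c != 0 & x = c *: pz (pt P)].
Proof.
move=> Zx Zx' /meet_components[h|[P PP [_ h]]]; first by case: (h x Zx).
by have [c c0 xE] := h x Zx Zx'; exists P, c.
Qed.

Variables (duals : seq (seq (seq int))) (I : polyset K 16) (N : nat).
Hypothesis comps_ok : all (fun i => comp_ok (nth [::] comps i) (nth [::] duals i)) (iota 0 k).
Hypothesis IZ : forall f, I f -> forall i : 'I_k, vanishing (Z i) f.
Hypothesis ZI : forall f, (forall i : 'I_k, vanishing (Z i) f) ->
  forall m, mdeg m = N -> I ('X_[m] * f).

Lemma comp_okP (i : 'I_k) : comp_ok (nth [::] comps i) (nth [::] duals i).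
Proof. by move/allP: comps_ok; apply; rewrite mem_iota ltn_ord. Qed.

Lemma dualE rows ds l m : dual_ok rows ds -> (l < size rows)%N -> (m < size rows)%N ->
  (pz (nth [::] rows m) *m form (nth [::] ds l)) 0 0 = (l == m)%:R.
Proof.
move=> /allP h hl hm; rewrite formE; have /h/allP h' : l \in iota 0 (size rows) by rewrite mem_iota.
have /h'/eqP -> : m \in iota 0 (size rows) by rewrite mem_iota.
by case: (l == m).
Qed.

Lemma curve_lineP (i : 'I_k) : size (nth [::] comps i) = 2%N ->
  exists (u v : 'rV[K]_16) (f1 f2 : 'cV[K]_16),
  Z i = lineset u v /\ [/\ u = pz (nth [::] (nth [::] comps i) 0), v = pz (nth [::] (nth [::] comps i) 1) &
  ((u *m f1) 0 0 = 1 /\ (v *m f1) 0 0 = 0) /\ ((u *m f2) 0 0 = 0 /\ (v *m f2) 0 0 = 1)].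
Proof.
move=> s2; have /andP[_ hd] := comp_okP i.
have d l m hl hm := @dualE _ _ l m hd hl hm; rewrite s2 in d.
exists (pz (nth [::] (nth [::] comps i) 0)), (pz (nth [::] (nth [::] comps i) 1)),
  (form (nth [::] (nth [::] duals i) 0)), (form (nth [::] (nth [::] duals i) 1)).
split; last by split=> //; rewrite !d.
by rewrite /Z; case: (nth [::] comps i) s2 => [|r1 [|r2 [|? ?]]].
Qed.

Lemma sepZ i : separated (Z i).
Proof.
have /andP[/orP[/eqP s2|/andP[/eqP s3 _]] hd] := comp_okP i.
  by have [u [v [f1 [f2 [-> _]]]]] := curve_lineP s2; apply: lineset_separated.
have d l m hl hm := @dualE _ _ l m hd hl hm; rewrite s3 in d; move: d.
rewrite /Z; case: (nth [::] comps i) s3 => [|u [|v [|w [|? ?]]]] //= _ d.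
apply: (@conicset_separated _ _ _ _ _ _ _ _ (form (nth [::] (nth [::] duals i) 0))
  (form (nth [::] (nth [::] duals i) 1)) (form (nth [::] (nth [::] duals i) 2)));
  by [exact: (d 0%N 0%N)|exact: (d 0%N 1%N)|exact: (d 0%N 2)|exact: (d 1%N 0%N)|exact: (d 1%N 1%N)
     |exact: (d 1%N 2)|exact: (d 2 0%N)|exact: (d 2 1%N)|exact: (d 2 2)].
Qed.

Lemma zerosE x : zeros I x <-> exists i, Z i x.
Proof. exact: (zeros_family Z_neq0 sepZ IZ ZI). Qed.

Lemma axes_at P c : P \in pts -> c != 0 -> axes_point (size (branches P)) I (c *: pz (pt P)).
Proof.
move=> PP c0; have /allP/(_ P PP)/and5P[_ _ b_gt0 uniq_b _] := pts_ok.
pose b0 : branch := (0%N, [::], ([::], [::]), ([::], [::])).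
pose br (b : 'I_(size (branches P))) := nth b0 (branches P) b.
have brP b : br b \in branches P by apply: mem_nth.
pose tau' b : 'I_k := Ordinal (let: And3 h _ _ := branchP PP (brP b) in h).
have tau'E b : tau' b = comp (br b) :> nat by [].
split.
  apply/zerosE; exists (tau' (Ordinal b_gt0)); apply: (p_on_branch PP (brP _) c0).
exists (jx (chart P)); first by rewrite mxE mulf_neq0 // pj_neq0.
apply: (@family_analytically_isomorphic _ _ _ Z I N (fun i => @curve_cone _) sepZ IZ ZI _ _ _
  tau' (fun b => projb P (br b))) => //.
- by rewrite mxE mulf_neq0 // pj_neq0.
- move=> i; rewrite p_incidence //; split=> [hi|[b <-]]; last by apply: map_f; apply: brP.
  have hb : (index (nat_of_ord i) (comps_of P) < size (branches P))%N.
    by rewrite -(size_map comp) index_mem.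
  exists (Ordinal hb); apply: val_inj; change (comp (br (Ordinal hb)) = i).
  by rewrite /br -(nth_map b0 0%N) // nth_index.
- by move=> b; apply: (smooth_at PP (brP b) c0).
- by move=> b x; apply: (proj_branch PP (brP b)).
- move=> b b' x nb Zx; rewrite (proj_other PP (brP b) (brP b') _ Zx).
    have -> : (c *: pz (pt P)) 0 (jx (chart P)) = c * pz (pt P) 0 (jx (chart P)) by rewrite [LHS]mxE.
    rewrite scalerA; congr (_ *: _); field.
    by rewrite c0 pj_neq0.
  apply: contra nb => /eqP e; apply/eqP/val_inj/eqP.
  have := nth_uniq 0%N _ _ uniq_b; rewrite size_map => /(_ b' b (ltn_ord _) (ltn_ord _)).
  by rewrite !(nth_map b0) // -/(br b) -/(br b') e eqxx eq_sym => <-.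
move=> b i; have [_ _ [_ vj wj _ _]] := branchP PP (brP b).
have jl := chart_lt PP.
have ent (u v w : 'rV[K]_16) z1 z2 z3 j :
    (z1 *: u + z2 *: v + z3 *: w) 0 j = z1 * u 0 j + z2 * v 0 j + z3 * w 0 j by rewrite !mxE.
have -> : projb P (br b) i (jx (chart P)) =
    ((delta_mx 0 i : 'rV_16) *m projb P (br b)) 0 (jx (chart P)).
  by rewrite -rowE [RHS]mxE.
rewrite projbE ent [pz (bv _) _ _]pz_chart // [pz (bw _) _ _]pz_chart // vj wj !mulr0 !addr0.
by rewrite divfK ?pj_neq0 // mxE eqxx eq_sym.
Qed.

Lemma smooth_branch_on_line (i : 'I_k) x (j : 'I_16) : size (nth [::] comps i) = 2%N ->
  Z i x -> x 0 j != 0 -> smooth_branch (Z i) x j.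
Proof.
move=> s2 Zx xj; have x0 := Z_neq0 Zx.
have [u [v [f1 [f2 [Ei [_ _ [[u1 v1] [u2 v2]]]]]]]] := curve_lineP s2.
move: (Zx); rewrite Ei => -[_ [c1 [c2 xE]]].
have [c10|c10] := eqVneq c1 0; last first.
  rewrite -(@lineset_general _ _ u v c1 c2) // -xE.
  apply: (@smooth_branch_line _ _ _ _ _ (f2 - (c2 / c1) *: f1)) => //.
    by rewrite xE !evcB !evcZ !evE u1 v1 u2 v2; field.
  by rewrite evcB evcZ v1 v2; ring.
have c20 : c2 != 0 by apply: contra_neq x0 => c20; rewrite xE c10 c20 !scale0r addr0.
have -> : lineset u v = lineset v u.
  by apply/funext => y; apply/propext; split=> -[y0 [z1 [z2 yE]]]; split=> //;
    exists z2, z1; rewrite yE addrC.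
have xE' : x = c2 *: v + 0 *: u by rewrite xE c10 !scale0r add0r addr0.
rewrite -(@lineset_general _ _ v u c2 0) // -xE'.
apply: (@smooth_branch_line _ _ _ _ _ f1) => //.
by rewrite xE' !evE v1; ring.
Qed.

Lemma line_smooth_at (i : 'I_k) x (j : 'I_16) : size (nth [::] comps i) = 2%N ->
  Z i x -> (forall i', Z i' x -> i' = i) -> x 0 j != 0 ->
  analytically_isomorphic (germ I x j) (@axes K 1).
Proof.
move=> s2 Zx uniq_i xj.
apply: (family_smooth (fun i => @curve_cone _) sepZ IZ ZI xj Zx uniq_i).
exact: smooth_branch_on_line.
Qed.

Lemma smooth_elsewhere (i : 'I_k) x : Z i x -> (forall i', Z i' x -> i' = i) -> smooth_point I x.
Proof.
move=> Zx uniq_i; have x0 := Z_neq0 Zx.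
suff [j xj sm] : exists2 j, x 0 j != 0 & smooth_branch (Z i) x j.
  split; first by apply/zerosE; exists i.
  by exists j => //; apply: (family_smooth (fun i => @curve_cone _) sepZ IZ ZI xj Zx uniq_i sm).
have /andP[/orP[/eqP s2|/andP[/eqP s3 hch]] hd] := comp_okP i.
  have [j xj] : exists j, x 0 j != 0.
    apply/existsP; rewrite -negb_forall; apply: contra x0 => /forallP h.
    by apply/eqP/rowP => j; rewrite mxE; apply/eqP.
  by exists j => //; apply: smooth_branch_on_line.
have d l m hl hm := @dualE _ _ l m hd hl hm; rewrite s3 in d.
have chart_l l : (l < 3)%N -> exists j, forall m, (m < 3)%N ->
    (pz (nth [::] (nth [::] comps i) m) 0 j != 0) = (m == l).
  move=> hl; have hl3 : l \in iota 0 3 by rewrite mem_iota.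
  have /hasP[j hj /allP h] := allP hch l hl3; rewrite mem_iota in hj; exists (jx j) => m hm; rewrite pz_chart // intr_eq0.
  by have := h m; rewrite mem_iota => /(_ hm)/eqP.
move: Zx d chart_l; rewrite /Z; case: (nth [::] comps i) s3 => [|u [|v [|w [|? ?]]]] //= _.
move=> [_ [c1 [c2 [c3 [xE q0]]]]] d chart_l.
set f := fun l => form (nth [::] (nth [::] duals i) l) in d.
have n1 : -1 != 0 :> K by rewrite oppr_eq0 oner_eq0.
have o1 := oner_neq0 K.
have nz (y : K) : (y != 0) = false -> y = 0 by move/negbFE/eqP.
have ent (p q r : 'rV[K]_16) z1 z2 z3 j :
    (z1 *: p + z2 *: q + z3 *: r) 0 j = z1 * p 0 j + z2 * q 0 j + z3 * r 0 j by rewrite !mxE.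
have [c10|c10] := eqVneq c1 0; last first.
  have [j hj] := chart_l 0%N isT; have uj := hj 0%N isT.
  have vj := nz _ (hj 1%N isT); have wj := nz _ (hj 2 isT); rewrite [nth _ _ _]/= in uj vj wj.
  exists j; first by rewrite xE ent vj wj !mulr0 !addr0 mulf_neq0.
  by rewrite xE; apply: (@smooth_branch_conic _ _ _ _ _ _ _ _ _ _ _ _ (f 1%N) (f 2)) => //;
    [exact: (d 1%N 0%N)|exact: (d 1%N 1%N)|exact: (d 1%N 2)|exact: (d 2 0%N)
    |exact: (d 2 1%N)|exact: (d 2 2)].
have /eqP : c2 * c3 = 0 by rewrite -[RHS]oppr0 -q0 c10; ring.
rewrite mulf_eq0; have [c20 _|c20] := eqVneq c2 0.
  have c30 : c3 != 0 by apply: contra_neq x0 => c30; rewrite xE c10 c20 c30 !scale0r !addr0.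
  have [j hj] := chart_l 2 isT; have wj := hj 2 isT.
  have vj := nz _ (hj 1%N isT); have uj := nz _ (hj 0%N isT); rewrite [nth _ _ _]/= in uj vj wj.
  have xE' : x = c3 *: pz w + 0 *: pz v + 0 *: pz u by rewrite xE c10 c20 !scale0r !addr0 !add0r.
  exists j; first by rewrite xE' ent uj vj !mulr0 !addr0 mulf_neq0.
  rewrite xE' conicset_swap13.
  apply: (@smooth_branch_conic _ _ _ _ _ _ _ _ _ _ _ _ (f 1%N) (f 0%N)) => //;
    [ring|exact: (d 1%N 2)|exact: (d 1%N 1%N)|exact: (d 1%N 0%N)|exact: (d 0%N 2)
    |exact: (d 0%N 1%N)|exact: (d 0%N 0%N)].
rewrite orFb => /eqP c30.
have [j hj] := chart_l 1%N isT; have vj := hj 1%N isT.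
have wj := nz _ (hj 2 isT); have uj := nz _ (hj 0%N isT); rewrite [nth _ _ _]/= in uj vj wj.
have xE' : x = c2 *: pz v + 0 *: pz u + 0 *: pz w by rewrite xE c10 c30 !scale0r !addr0 !add0r.
exists j; first by rewrite xE' ent uj wj !mulr0 !addr0 mulf_neq0.
rewrite xE' conicset_swap12.
apply: (@smooth_branch_conic _ _ _ _ _ _ _ _ _ _ _ _ (f 0%N) (f 2)) => //;
  [ring|exact: (d 0%N 1%N)|exact: (d 0%N 0%N)|exact: (d 0%N 2)|exact: (d 2 1%N)
  |exact: (d 2 0%N)|exact: (d 2 2)].
Qed.

Lemma classify x : zeros I x -> smooth_point I x \/
  exists P c, [/\ P \in pts, c != 0 & x = c *: pz (pt P)].
Proof.
move=> /zerosE[i Zx]; have [[i' [Zx' ni]]|h] := pselect (exists i', Z i' x /\ i != i').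
  by right; have [P [c [PP c0 xE]]] := two_components Zx Zx' ni; exists P, c.
left; apply: (smooth_elsewhere Zx) => i' Zx'; apply/eqP/negPn/negP => ni.
by apply: h; exists i'; rewrite eq_sym.
Qed.
End Config.

(** * The limit configurations at t = 1 and at infinity *)

Definition comps1 : seq (seq (seq int)) :=
  [:: [:: [:: 0; 0; 1; 0; 0; 0; 0]; [:: 0; 0; 0; 0; 0; 0; 1]];
      [:: [:: 0; 0; 1; 0; 0; 0; 0]; [:: 0; 1; 0; 0; 0; 0; 0]];
      [:: [:: 0; 1; 1; 0; 0; 0; 0]; [:: 1; 0; 0; 0; 0; 0; 0]];
      [:: [:: 0; 0; 0; -1; 1; 0; 0]; [:: 0; 1; 1; 0; -1; 0; 0]];
      [:: [:: 1; -1; -1; 0; 0; 0; 0]; [:: 0; 1; 1; -1; 0; 0; 0]];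
      [:: [:: 1; 0; 0; 0; 0; 1; 0]; [:: 0; 0; 0; 1; 0; 1; 0]];
      [:: [:: 0; 0; 0; 1; 0; 1; 0]; [:: 0; 0; 1; 0; -1; -1; 1]];
      [:: [:: 0; 0; 1; 0; -1; 0; 0]; [:: 0; 0; 0; 0; 0; -1; 1]];
      [:: [:: 0; 0; 0; 0; 0; 1; 0]; [:: 0; 0; 0; 0; 0; 0; 1]];
      [:: [:: 0; 0; 0; -1; 1; 0; 0]; [:: 0; 0; 1; 0; 0; 0; 1]];
      [:: [:: 0; 1; 0; 0; 0; 0; 0]; [:: 0; 0; 1; 0; -1; 0; 0]];
      [:: [:: 1; 0; 0; 0; 0; 0; 0]; [:: 0; 0; 0; 0; 0; 1; 0]]].
Definition duals1 : seq (seq (seq int)) :=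
  [:: [:: [:: 0; 0; 1; 0; 0; 0; 0]; [:: 0; 0; 0; 0; 0; 0; 1]];
      [:: [:: 0; 0; 1; 0; 0; 0; 0]; [:: 0; 1; 0; 0; 0; 0; 0]];
      [:: [:: 0; 0; 1; 0; 0; 0; 0]; [:: 1; 0; 0; 0; 0; 0; 0]];
      [:: [:: 0; 0; 0; -1; 0; 0; 0]; [:: 0; 0; 1; 0; 0; 0; 0]];
      [:: [:: 1; 0; 0; 0; 0; 0; 0]; [:: 0; 0; 0; -1; 0; 0; 0]];
      [:: [:: 1; 0; 0; 0; 0; 0; 0]; [:: 0; 0; 0; 1; 0; 0; 0]];
      [:: [:: 0; 0; 0; 1; 0; 0; 0]; [:: 0; 0; 0; 0; -1; 0; 0]];
      [:: [:: 0; 0; 0; 0; -1; 0; 0]; [:: 0; 0; 0; 0; 0; -1; 0]];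
      [:: [:: 0; 0; 0; 0; 0; 1; 0]; [:: 0; 0; 0; 0; 0; 0; 1]];
      [:: [:: 0; 0; 0; -1; 0; 0; 0]; [:: 0; 0; 0; 0; 0; 0; 1]];
      [:: [:: 0; 1; 0; 0; 0; 0; 0]; [:: 0; 0; 0; 0; -1; 0; 0]];
      [:: [:: 1; 0; 0; 0; 0; 0; 0]; [:: 0; 0; 0; 0; 0; 1; 0]]].
(** Listed in the order of [G1_edges]. Components 3 and 4 are the two lines of the split conic. *)
Definition points1 : seq point :=
  [:: ([:: 0; 0; 1; 0; 0; 0; 0], 2%N,
       [:: (0%N, [:: 1; 0; 0; 1], ([:: 0; 0; 0; 0; 0; 0; 1], [:: 0; 0; 0; 0; 0; 0; 1]), ([::], [::]));
           (1%N, [:: 1; 0; 0; 1], ([:: 0; 1; 0; 0; 0; 0; 0], [:: 0; 1; 0; 0; 0; 0; 0]), ([::], [::]))]);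
      ([:: 0; 0; 0; 0; 0; 0; 1], 6%N,
       [:: (0%N, [:: 0; 1; 1; 0], ([:: 0; 0; 1; 0; 0; 0; 0], [:: 0; 0; 1; 0; 0; 0; 0]), ([::], [::]));
           (8%N, [:: 0; 1; 1; 0], ([:: 0; 0; 0; 0; 0; 1; 0], [:: 0; 0; 0; 0; 0; 1; 0]), ([::], [::]))]);
      ([:: 0; 0; 1; 0; 0; 0; 1], 2%N,
       [:: (0%N, [:: 1; 1; 0; -1], ([:: 0; 0; 0; 0; 0; 0; -1], [:: 0; 0; 1; 0; 0; 0; -1]), ([::], [::]));
           (9%N, [:: 0; 1; 1; 0], ([:: 0; 0; 0; -1; 1; 0; 0], [:: 0; 0; 0; -1; 0; 0; 0]), ([::], [::]))]);
      ([:: 0; 1; 1; 0; 0; 0; 0], 1%N,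
       [:: (1%N, [:: 1; 1; 1; 0], ([:: 0; 0; 1; 0; 0; 0; 0], [:: 0; -1; 1; 0; 0; 0; 0]), ([::], [::]));
           (2%N, [:: 1; 0; 0; 1], ([:: 1; 0; 0; 0; 0; 0; 0], [:: 1; 0; 0; 0; 0; 0; 0]), ([::], [::]))]);
      ([:: 0; 1; 0; 0; 0; 0; 0], 1%N,
       [:: (1%N, [:: 0; 1; 1; 0], ([:: 0; 0; 1; 0; 0; 0; 0], [:: 0; 0; 1; 0; 1; 0; 0]), ([::], [::]));
           (10%N, [:: 1; 0; 0; 1], ([:: 0; 0; 1; 0; -1; 0; 0], [:: 0; 0; 0; 0; -1; 0; 0]), ([::], [::]))]);
      ([:: 1; -1; -1; 0; 0; 0; 0], 0%N,
       [:: (2%N, [:: -1; 1; 1; 0], ([:: 0; 1; 1; 0; 0; 0; 0], [:: 1; 0; 1; 1; 0; 0; 0]), ([::], [::]));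
           (4%N, [:: 1; 0; 0; 1], ([:: 0; 1; 1; -1; 0; 0; 0], [:: 0; 0; 0; -1; 0; 0; 0]), ([::], [::]))]);
      ([:: 1; 0; 0; 0; 0; 0; 0], 0%N,
       [:: (2%N, [:: 0; 1; 1; 0], ([:: 0; 1; 1; 0; 0; 0; 0], [:: 0; 0; 1; 0; 0; 0; 0]), ([::], [::]));
           (11%N, [:: 1; 0; 0; 1], ([:: 0; 0; 0; 0; 0; 1; 0], [:: 0; 0; 0; 0; 0; 1; 0]), ([::], [::]))]);
      ([:: 0; 1; 1; -1; 0; 0; 0], 1%N,
       [:: (3%N, [:: 1; 1; 1; 0], ([:: 0; 0; 0; -1; 1; 0; 0], [:: 0; 0; 0; 0; 1; 0; 0]), ([::], [::]));
           (4%N, [:: 0; 1; 1; 1], ([:: 1; 0; 0; -1; 0; 0; 0], [:: 1; 0; 0; 0; 0; 0; 0]), ([::], [::]))]);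
      ([:: 0; 0; 0; -1; 1; 0; 0], 3%N,
       [:: (3%N, [:: 1; 0; 0; 1], ([:: 0; 1; 1; 0; -1; 0; 0], [:: 0; 1; 0; 0; 0; 0; 0]), ([::], [::]));
           (9%N, [:: 1; 0; 0; 1], ([:: 0; 0; 1; 0; 0; 0; 1], [:: 0; 0; 0; 0; 0; 0; 1]), ([::], [::]))]);
      ([:: 0; 1; 1; 0; -1; 0; 0], 1%N,
       [:: (3%N, [:: 0; 1; 1; 0], ([:: 0; 0; 0; -1; 1; 0; 0], [:: 0; 0; 0; -1; 0; 0; 0]), ([::], [::]));
           (10%N, [:: 1; 1; 0; -1], ([:: 0; 0; -1; 0; 1; 0; 0], [:: 0; 1; -1; 0; 0; 0; 0]), ([::], [::]))]);
      ([:: 1; 0; 0; -1; 0; 0; 0], 0%N,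
       [:: (4%N, [:: 1; 1; 0; -1], ([:: 0; -1; -1; 1; 0; 0; 0], [:: 0; -1; 0; 0; 0; 0; 0]), ([::], [::]));
           (5%N, [:: 1; -1; 0; 1], ([:: 0; 0; 0; 1; 0; 1; 0], [:: 0; 0; 0; 0; 0; 1; 0]), ([::], [::]))]);
      ([:: 0; 0; 0; 1; 0; 1; 0], 3%N,
       [:: (5%N, [:: 0; 1; 1; 0], ([:: 1; 0; 0; 0; 0; 1; 0], [:: 1; 0; 0; 0; 0; 0; 0]), ([::], [::]));
           (6%N, [:: 1; 0; 0; 1], ([:: 0; 0; 1; 0; -1; -1; 1], [:: 0; 0; 0; 0; -1; 0; 0]), ([::], [::]))]);
      ([:: 1; 0; 0; 0; 0; 1; 0], 0%N,
       [:: (5%N, [:: 1; 0; 0; 1], ([:: 0; 0; 0; 1; 0; 1; 0], [:: 0; 0; 0; 1; 0; 0; 0]), ([::], [::]));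
           (11%N, [:: 1; 1; 0; -1], ([:: 0; 0; 0; 0; 0; -1; 0], [:: 1; 0; 0; 1; 0; -1; 0]), ([::], [::]))]);
      ([:: 0; 0; 1; 0; -1; -1; 1], 2%N,
       [:: (6%N, [:: 0; 1; 1; 0], ([:: 0; 0; 0; 1; 0; 1; 0], [:: 0; 0; 0; 1; 0; 0; 0]), ([::], [::]));
           (7%N, [:: 1; 1; 0; -1], ([:: 0; 0; 0; 0; 0; 1; -1], [:: 0; 0; 0; 0; -1; 0; -1]), ([::], [::]))]);
      ([:: 0; 0; -1; -1; 1; 0; -1], 2%N,
       [:: (6%N, [:: -1; -1; 1; 0], ([:: 0; 0; 0; 1; 0; 1; 0], [:: 0; 0; 0; 0; 0; 1; 0]), ([::], [::]));
           (9%N, [:: 1; -1; 1; 0], ([:: 0; 0; 0; -1; 1; 0; 0], [:: 0; 0; 0; 0; 1; 0; 1]), ([::], [::]))]);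
      ([:: 0; 0; 0; 0; 0; -1; 1], 5%N,
       [:: (7%N, [:: 0; 1; 1; 0], ([:: 0; 0; 1; 0; -1; 0; 0], [:: 0; 0; 0; 0; -1; 0; 0]), ([::], [::]));
           (8%N, [:: -1; 1; 0; 1], ([:: 0; 0; 0; 0; 0; 0; 1], [:: 0; 0; 0; 0; 0; 1; 1]), ([::], [::]))]);
      ([:: 0; 0; 1; 0; -1; 0; 0], 2%N,
       [:: (7%N, [:: 1; 0; 0; 1], ([:: 0; 0; 0; 0; 0; -1; 1], [:: 0; 0; 0; 0; 0; -1; 0]), ([::], [::]));
           (10%N, [:: 0; 1; 1; 0], ([:: 0; 1; 0; 0; 0; 0; 0], [:: 0; 1; 0; 0; 0; 0; 0]), ([::], [::]))]);
      ([:: 0; 0; 0; 0; 0; 1; 0], 5%N,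
       [:: (8%N, [:: 1; 0; 0; 1], ([:: 0; 0; 0; 0; 0; 0; 1], [:: 0; 0; 0; 0; 0; 0; 1]), ([::], [::]));
           (11%N, [:: 0; 1; 1; 0], ([:: 1; 0; 0; 0; 0; 0; 0], [:: 1; 0; 0; 0; 0; 0; 0]), ([::], [::]))])].

Definition comps0 : seq (seq (seq int)) :=
  [:: [:: [:: 0; 0; 1; 0; 0; 0; 0]; [:: 0; 0; 0; 0; 0; 0; 1]];
      [:: [:: 0; 0; 1; 0; 0; 0; 0]; [:: 0; 1; 0; 0; 0; 0; 0]];
      [:: [:: 0; 1; 1; 0; 0; 0; 0]; [:: 1; 0; 0; 0; 0; 0; 0]];
      [:: [:: 1; -1; -1; 0; 0; 0; 0]; [:: 0; 0; 0; -1; 0; 0; 0]; [:: 0; 1; 1; 0; -1; 0; 0]];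
      [:: [:: 0; 0; 0; 0; 0; 1; 0]; [:: 0; 0; 0; 1; 0; 1; 0]];
      [:: [:: 0; 0; 0; 1; 0; 1; 0]; [:: 0; 0; 0; 0; 0; -1; 1]];
      [:: [:: 0; 0; 1; 0; -1; 0; 0]; [:: 0; 0; 0; 0; 0; -1; 1]];
      [:: [:: 0; 0; 0; 0; 0; 1; 0]; [:: 0; 0; 0; 0; 0; 0; 1]];
      [:: [:: 0; 0; 0; -1; 0; 0; 0]; [:: 0; 0; 0; 0; 0; 0; 1]];
      [:: [:: 0; 1; 0; 0; 0; 0; 0]; [:: 0; 0; 1; 0; -1; 0; 0]];
      [:: [:: 1; 0; 0; 0; 0; 0; 0]; [:: 0; 0; 0; 0; 0; 1; 0]]].
Definition duals0 : seq (seq (seq int)) :=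
  [:: [:: [:: 0; 0; 1; 0; 0; 0; 0]; [:: 0; 0; 0; 0; 0; 0; 1]];
      [:: [:: 0; 0; 1; 0; 0; 0; 0]; [:: 0; 1; 0; 0; 0; 0; 0]];
      [:: [:: 0; 0; 1; 0; 0; 0; 0]; [:: 1; 0; 0; 0; 0; 0; 0]];
      [:: [:: 1; 0; 0; 0; 0; 0; 0]; [:: 0; 0; 0; -1; 0; 0; 0]; [:: 0; 0; 0; 0; -1; 0; 0]];
      [:: [:: 0; 0; 0; -1; 0; 1; 0]; [:: 0; 0; 0; 1; 0; 0; 0]];
      [:: [:: 0; 0; 0; 1; 0; 0; 0]; [:: 0; 0; 0; 0; 0; 0; 1]];
      [:: [:: 0; 0; 0; 0; -1; 0; 0]; [:: 0; 0; 0; 0; 0; -1; 0]];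
      [:: [:: 0; 0; 0; 0; 0; 1; 0]; [:: 0; 0; 0; 0; 0; 0; 1]];
      [:: [:: 0; 0; 0; -1; 0; 0; 0]; [:: 0; 0; 0; 0; 0; 0; 1]];
      [:: [:: 0; 1; 0; 0; 0; 0; 0]; [:: 0; 0; 0; 0; -1; 0; 0]];
      [:: [:: 1; 0; 0; 0; 0; 0; 0]; [:: 0; 0; 0; 0; 0; 1; 0]]].
(** The first four points lie on three components and the other nine on two. Each triple point
    absorbs two of the 17 nodes of X_t. *)
Definition points0 : seq point :=
  [:: ([:: 0; 0; 0; 0; 0; 0; 1], 6%N,
       [:: (0%N, [:: 0; 1; 1; 0], ([:: 0; 0; 1; 0; 0; 0; 0], [:: 0; 0; 1; 0; 0; 0; 0]), ([::], [::]));
           (7%N, [:: 0; 1; 1; 0], ([:: 0; 0; 0; 0; 0; 1; 0], [:: 0; 0; 0; 0; 0; 1; 0]), ([::], [::]));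
           (8%N, [:: 0; 1; 1; 0], ([:: 0; 0; 0; -1; 0; 0; 0], [:: 0; 0; 0; -1; 0; 0; 0]), ([::], [::]))]);
      ([:: 0; 0; 0; 0; 0; 1; 0], 5%N,
       [:: (4%N, [:: 1; 0; -1; 1], ([:: 0; 0; 0; 1; 0; 0; 0], [:: 0; 0; 0; 1; 0; 0; 0]), ([::], [::]));
           (7%N, [:: 1; 0; 0; 1], ([:: 0; 0; 0; 0; 0; 0; 1], [:: 0; 0; 0; 0; 0; 0; 1]), ([::], [::]));
           (10%N, [:: 0; 1; 1; 0], ([:: 1; 0; 0; 0; 0; 0; 0], [:: 1; 0; 0; 0; 0; 0; 0]), ([::], [::]))]);
      ([:: 0; 0; 0; -1; 0; 0; 0], 3%N,
       [:: (3%N, [::], ([:: 1; -1; -1; 0; 0; 0; 0], [:: 1; 0; 0; 0; 0; 0; 0]), ([:: 0; 1; 1; 0; -1; 0; 0], [:: 0; 0; 0; 0; -1; 0; 0]));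
           (4%N, [:: 1; -1; 1; 0], ([:: 0; 0; 0; 0; 0; 1; 0], [:: 0; 0; 0; 0; 0; 1; 0]), ([::], [::]));
           (8%N, [:: 1; 0; 0; 1], ([:: 0; 0; 0; 0; 0; 0; 1], [:: 0; 0; 0; 0; 0; 0; 1]), ([::], [::]))]);
      ([:: 0; 0; 0; 0; 0; -1; 1], 5%N,
       [:: (5%N, [:: 0; 1; 1; 1], ([:: 0; 0; 0; 1; 0; 0; 1], [:: 0; 0; 0; 1; 0; 0; 0]), ([::], [::]));
           (6%N, [:: 0; 1; 1; 0], ([:: 0; 0; 1; 0; -1; 0; 0], [:: 0; 0; 0; 0; -1; 0; 0]), ([::], [::]));
           (7%N, [:: -1; 1; 0; 1], ([:: 0; 0; 0; 0; 0; 0; 1], [:: 0; 0; 0; -1; 0; 1; 1]), ([::], [::]))]);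
      ([:: 0; 0; 1; 0; 0; 0; 0], 2%N,
       [:: (0%N, [:: 1; 0; 0; 1], ([:: 0; 0; 0; 0; 0; 0; 1], [:: 0; 0; 0; 0; 0; 0; 1]), ([::], [::]));
           (1%N, [:: 1; 0; 0; 1], ([:: 0; 1; 0; 0; 0; 0; 0], [:: 0; 1; 0; 0; 0; 0; 0]), ([::], [::]))]);
      ([:: 0; 1; 1; 0; 0; 0; 0], 1%N,
       [:: (1%N, [:: 1; 1; 1; 0], ([:: 0; 0; 1; 0; 0; 0; 0], [:: 0; -1; 1; 0; 0; 0; 0]), ([::], [::]));
           (2%N, [:: 1; 0; 0; 1], ([:: 1; 0; 0; 0; 0; 0; 0], [:: 1; 0; 0; 0; 0; 0; 0]), ([::], [::]))]);
      ([:: 0; 1; 0; 0; 0; 0; 0], 1%N,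
       [:: (1%N, [:: 0; 1; 1; 0], ([:: 0; 0; 1; 0; 0; 0; 0], [:: 0; 0; 1; 0; 1; 0; 0]), ([::], [::]));
           (9%N, [:: 1; 0; 0; 1], ([:: 0; 0; 1; 0; -1; 0; 0], [:: 0; 0; 0; 0; -1; 0; 0]), ([::], [::]))]);
      ([:: 1; -1; -1; 0; 0; 0; 0], 0%N,
       [:: (2%N, [:: -1; 1; 1; 0], ([:: 0; 1; 1; 0; 0; 0; 0], [:: 1; 0; 1; 0; 1; 0; 0]), ([::], [::]));
           (3%N, [::], ([:: 0; 0; 0; -1; 0; 0; 0], [:: 0; 0; 0; -1; 0; 0; 0]), ([:: 0; 1; 1; 0; -1; 0; 0], [:: 0; 0; 0; 0; -1; 0; 0]))]);
      ([:: 1; 0; 0; 0; 0; 0; 0], 0%N,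
       [:: (2%N, [:: 0; 1; 1; 0], ([:: 0; 1; 1; 0; 0; 0; 0], [:: 0; 0; 1; 0; 0; 0; 0]), ([::], [::]));
           (10%N, [:: 1; 0; 0; 1], ([:: 0; 0; 0; 0; 0; 1; 0], [:: 0; 0; 0; 0; 0; 1; 0]), ([::], [::]))]);
      ([:: 0; 1; 1; 0; -1; 0; 0], 4%N,
       [:: (3%N, [::], ([:: 0; 0; 0; -1; 0; 0; 0], [:: 0; 0; 0; -1; 0; 0; 0]), ([:: 1; -1; -1; 0; 0; 0; 0], [:: 1; 0; 0; 0; 0; 0; 0]));
           (9%N, [:: 1; 1; 1; 0], ([:: 0; 1; 0; 0; 0; 0; 0], [:: 0; 1; -1; 0; 0; 0; 0]), ([::], [::]))]);
      ([:: 0; 0; 1; 0; -1; 0; 0], 2%N,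
       [:: (6%N, [:: 1; 0; 0; 1], ([:: 0; 0; 0; 0; 0; -1; 1], [:: 0; 0; 0; 0; 0; -1; 0]), ([::], [::]));
           (9%N, [:: 0; 1; 1; 0], ([:: 0; 1; 0; 0; 0; 0; 0], [:: 0; 1; 0; 0; 0; 0; 0]), ([::], [::]))]);
      ([:: 0; 0; 0; 1; 0; 1; 0], 3%N,
       [:: (4%N, [:: 0; 1; 1; 0], ([:: 0; 0; 0; 0; 0; 1; 0], [:: 0; 0; 0; -1; 0; 1; 1]), ([::], [::]));
           (5%N, [:: 1; 0; 0; 1], ([:: 0; 0; 0; 0; 0; -1; 1], [:: 0; 0; 0; 0; 0; 0; 1]), ([::], [::]))]);
      ([:: 0; 0; 0; 1; 0; 0; 1], 3%N,
       [:: (5%N, [:: 1; 1; 0; -1], ([:: 0; 0; 0; 0; 0; 1; -1], [:: 0; 0; 0; 0; 0; 1; 0]), ([::], [::]));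
           (8%N, [:: -1; 1; 0; 1], ([:: 0; 0; 0; 0; 0; 0; 1], [:: 0; 0; 0; -1; 0; 1; 1]), ([::], [::]))])].

Section Limits.
Variable K : numFieldType.

Lemma points1_ok : all (point_ok comps1) points1. Proof. by vm_compute. Qed.
Lemma pairs1_ok : pairs_ok comps1 points1. Proof. by vm_compute. Qed.
Lemma comps1_ok : all (fun i => comp_ok (nth [::] comps1 i) (nth [::] duals1 i)) (iota 0 (size comps1)).
Proof. by vm_compute. Qed.
Lemma points0_ok : all (point_ok comps0) points0. Proof. by vm_compute. Qed.
Lemma pairs0_ok : pairs_ok comps0 points0. Proof. by vm_compute. Qed.
Lemma comps0_ok : all (fun i => comp_ok (nth [::] comps0 i) (nth [::] duals0 i)) (iota 0 (size comps0)).
Proof. by vm_compute. Qed.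
Section Basis.
Variable tau : int.
Local Notation be := (tau%:~R : K).

Lemma line_basis_pz v l : line_basis 1 be v l =
  pz K tau (if l == ord0 then (line_rows tau v).1 else (line_rows tau v).2).
Proof.
rewrite /line_basis /pair2 /pz; case: ifP => _; congr (pvec _ _ _); symmetry.
  by have [] := row_natural true v (intr : int -> K) tau.
by have [] := row_natural false v (intr : int -> K) tau.
Qed.

Lemma conic_basis_pz l : conic_basis 1 be l = pz K tau (nth [::] (conic_rows tau) l).
Proof.
rewrite /conic_basis /pz; congr (pvec _ _ _); symmetry.
have E : [seq map (intr : int -> K) r | r <- conic_rows tau] = conic_rows be :=
  component_rows_natural v34 (intr : int -> K) tau.
by rewrite -E (nth_map [::]).
Qed.

Lemma line_curve v : is_line v ->
  lineset (line_basis 1 be v ord0) (line_basis 1 be v ord_max) = @curve K tau (component_rows tau v).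
Proof. by rewrite !line_basis_pz /=; case: v. Qed.

Lemma conic_curve : conic (conic_basis 1 be) 1 (-1) = @curve K tau (conic_rows tau).
Proof. by rewrite !conic_basis_pz /= inordK. Qed.

Lemma not_on_curve rows r : freeZ 8 (r :: rows) -> ~ @curve K tau rows (pz K tau r).
Proof.
move=> fr /curve_span[_ [cs [sc E]]].
have := @free_pz K tau _ _ (-1 :: cs) fr; rewrite /= sc => /(_ erefl).
rewrite big_ord_recl /= -E scaleN1r addNr => /(_ erefl 0%N)/eqP.
by rewrite oppr_eq0 oner_eq0.
Qed.

Lemma nod_entry (e0 e12 e13 e15 e23 e24 e25 e34 e35 e45 e1235 e1345 : 'rV[K]_16) j b0 b12 b13 b15 b23 b24 b25 b34 b35 b45 b1235 b1345 :
  e0 0 j = b0 -> e12 0 j = b12 -> e13 0 j = b13 -> e15 0 j = b15 -> e23 0 j = b23 -> e24 0 j = b24 -> e25 0 j = b25 -> e34 0 j = b34 -> e35 0 j = b35 -> e45 0 j = b45 -> e1235 0 j = b1235 -> e1345 0 j = b1345 ->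
  forall z1 z2 z3 z4 z5 z6 z7 q1 q2 q3 q4 q5 : K,
  (z1 *: (e12 + e13) + (z2 *: e24 + (z3 *: e34 +
    (z4 *: (q1 *: e0 + q2 *: e15 + q3 *: e23 + q4 *: e25 + q5 *: e35) +
    (z5 *: (e23 + e25 + e45) + (z6 *: e1235 + (z7 *: e1345 + 0))))))) 0 j =
  z1 * (b12 + b13) + (z2 * b24 + (z3 * b34 +
    (z4 * (q1 * b0 + q2 * b15 + q3 * b23 + q4 * b25 + q5 * b35) +
    (z5 * (b23 + b25 + b45) + (z6 * b1235 + z7 * b1345))))).
Proof.
move=> <- <- <- <- <- <- <- <- <- <- <- <- z1 z2 z3 z4 z5 z6 z7 q1 q2 q3 q4 q5.
by rewrite !mxE addr0.
Qed.

Lemma nod_point r : pz K tau r != 0 -> P_nod (1, be) (pz K tau r).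
Proof.
move=> x0; split=> //; apply/submxP; exists (\row_k (r`_k)%:~R).
have entE l (j : 'I_16) : (index l even_indices < 16)%N ->
    e_ K l 0 j = (nat_of_ord j == index l even_indices)%:R.
  by move=> hl; rewrite /e_ mxE eqxx /= -val_eqE /= inordK.
have entr (k : 'I_7) : (\row_k ((r`_k)%:~R : K)) 0 k = (r`_k)%:~R by rewrite mxE.
rewrite mulmx_sum_row !big_ord_recl big_ord0 !entr !matrix.rowK /=.
apply/rowP => j; rewrite [RHS](nod_entry (entE [::] j isT) (entE [:: 1; 2]%N j isT) (entE [:: 1; 3]%N j isT) (entE [:: 1; 5]%N j isT) (entE [:: 2; 3]%N j isT) (entE [:: 2; 4]%N j isT) (entE [:: 2; 5]%N j isT) (entE [:: 3; 4]%N j isT) (entE [:: 3; 5]%N j isT) (entE [:: 4; 5]%N j isT) (entE [:: 1; 2; 3; 5]%N j isT) (entE [:: 1; 3; 4; 5]%N j isT)).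
rewrite [LHS]mxE /wvec !rowK_nth.
by case: j => j hj; do 16?[case: j hj => [|j] hj] => //=; ring.
Qed.

End Basis.
End Limits.

(** * Conclusion at the two limits *)

Section Final.
Variable K : numFieldType.

Lemma OG_values (x : 'rV[K]_16) (p0 p12 p13 p14 p15 p23 p24 p25 p34 p35 p45 p1234 p1235 p1245 p1345 p2345 : {mpoly K[16]}) v0 v12 v13 v14 v15 v23 v24 v25 v34 v35 v45 v1234 v1235 v1245 v1345 v2345 :
  p0.@[x 0] = v0 -> p12.@[x 0] = v12 -> p13.@[x 0] = v13 -> p14.@[x 0] = v14 -> p15.@[x 0] = v15 -> p23.@[x 0] = v23 -> p24.@[x 0] = v24 -> p25.@[x 0] = v25 -> p34.@[x 0] = v34 -> p35.@[x 0] = v35 -> p45.@[x 0] = v45 -> p1234.@[x 0] = v1234 -> p1235.@[x 0] = v1235 -> p1245.@[x 0] = v1245 -> p1345.@[x 0] = v1345 -> p2345.@[x 0] = v2345 ->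
  [seq f.@[x 0] | f <- [:: p0 * p2345 - p23 * p45 + p24 * p35 - p25 * p34;
      p12 * p1345 - p13 * p1245 + p14 * p1235 - p15 * p1234;
      p0 * p1345 - p13 * p45 + p14 * p35 - p15 * p34;
      p12 * p2345 - p23 * p1245 + p24 * p1235 - p25 * p1234;
      p0 * p1245 - p12 * p45 + p14 * p25 - p15 * p24;
      p13 * p2345 - p23 * p1345 + p34 * p1235 - p35 * p1234;
      p0 * p1235 - p12 * p35 + p13 * p25 - p15 * p23;
      p14 * p2345 - p24 * p1345 + p34 * p1245 - p45 * p1234;
      p0 * p1234 - p12 * p34 + p13 * p24 - p14 * p23;
      p15 * p2345 - p25 * p1345 + p35 * p1245 - p45 * p1235]] =
  [:: v0 * v2345 - v23 * v45 + v24 * v35 - v25 * v34;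
      v12 * v1345 - v13 * v1245 + v14 * v1235 - v15 * v1234;
      v0 * v1345 - v13 * v45 + v14 * v35 - v15 * v34;
      v12 * v2345 - v23 * v1245 + v24 * v1235 - v25 * v1234;
      v0 * v1245 - v12 * v45 + v14 * v25 - v15 * v24;
      v13 * v2345 - v23 * v1345 + v34 * v1235 - v35 * v1234;
      v0 * v1235 - v12 * v35 + v13 * v25 - v15 * v23;
      v14 * v2345 - v24 * v1345 + v34 * v1245 - v45 * v1234;
      v0 * v1234 - v12 * v34 + v13 * v24 - v14 * v23;
      v15 * v2345 - v25 * v1345 + v35 * v1245 - v45 * v1235].
Proof. by move=> <- <- <- <- <- <- <- <- <- <- <- <- <- <- <- <-; rewrite /= !(mevalD, mevalN, mevalM). Qed.

Lemma OG_intro tau r : pz K tau r != 0 ->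
  let v := nth 0 (wvec 1 (tau%:~R : K) (rowK K r)) in
  all (fun y => y == 0) [:: v 0%N * v 15 - v 5 * v 10 + v 6 * v 9 - v 7 * v 8;
      v 1%N * v 14 - v 2 * v 13 + v 3 * v 12 - v 4 * v 11;
      v 0%N * v 14 - v 2 * v 10 + v 3 * v 9 - v 4 * v 8;
      v 1%N * v 15 - v 5 * v 13 + v 6 * v 12 - v 7 * v 11;
      v 0%N * v 13 - v 1%N * v 10 + v 3 * v 7 - v 4 * v 6;
      v 2 * v 15 - v 5 * v 14 + v 8 * v 12 - v 9 * v 11;
      v 0%N * v 12 - v 1%N * v 9 + v 2 * v 7 - v 4 * v 5;
      v 3 * v 15 - v 6 * v 14 + v 8 * v 13 - v 10 * v 11;
      v 0%N * v 11 - v 1%N * v 8 + v 2 * v 6 - v 3 * v 5;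
      v 4 * v 15 - v 7 * v 14 + v 9 * v 13 - v 10 * v 12] -> OG (pz K tau r).
Proof.
move=> nx v h; split=> // f hf; apply/eqP.
have xE l : (index l even_indices < 16)%N -> (x_ K l).@[pz K tau r 0] = v (index l even_indices).
  by move=> hl; rewrite mevalXU mxE inordK.
have E := OG_values (xE [::] isT) (xE [:: 1; 2]%N isT) (xE [:: 1; 3]%N isT) (xE [:: 1; 4]%N isT) (xE [:: 1; 5]%N isT) (xE [:: 2; 3]%N isT) (xE [:: 2; 4]%N isT) (xE [:: 2; 5]%N isT) (xE [:: 3; 4]%N isT) (xE [:: 3; 5]%N isT) (xE [:: 4; 5]%N isT) (xE [:: 1; 2; 3; 4]%N isT) (xE [:: 1; 2; 3; 5]%N isT) (xE [:: 1; 2; 4; 5]%N isT) (xE [:: 1; 3; 4; 5]%N isT) (xE [:: 2; 3; 4; 5]%N isT).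
have : all (fun y => y == 0) [seq f.@[pz K tau r 0] | f <- OG_equations K].
  by rewrite [X in all _ X]E.
by rewrite all_map => /allP/(_ f hf).
Qed.

Lemma pz_neq0 tau r k : (k < 7)%N -> r`_k != 0 -> pz K tau r != 0.
Proof.
move=> hk; apply: contra_neq => /(pvec_eq0 (oner_neq0 K))/(_ k hk)/eqP.
by rewrite rowK_nth intr_eq0 => /eqP.
Qed.

Ltac on_OG := rewrite /rowK /=;
  do ?[apply/andP; split] => //; apply/eqP; ring.

(** At t = 1, on the span of the second to fifth vectors of P_nod, with coefficients b, c, d, e,
    only the first relation of OG survives: b d = (d + e)(c + e). The intersection thus contains a
    quadric surface, and the point is c = d = e = 1, b = 4. *)
Lemma OG_point1 : OG (pz K 1 [:: 0; 4; 1; 1; 1; 0; 0]).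
Proof. by apply: OG_intro; [apply: (@pz_neq0 _ _ 3)|on_OG]. Qed.

(** At infinity the plane spanned by e_15 + e_35, e_1235 and e_1345 lies in OG, as no relation
    multiplies two of the coordinates that are nonzero on it. The limits of [v5], [v6], [v8], [v9]
    are lines in this plane, and the sum of the three vectors is on none of them. *)
Lemma OG_point0 : OG (pz K 0 [:: 0; 0; 0; 1; 0; 1; 1]).
Proof. by apply: OG_intro; [apply: (@pz_neq0 _ _ 3)|on_OG]. Qed.

Section One.
Variables a b : {poly K}.
Hypotheses (a0 : a.[0] = 1) (b0 : b.[0] = 1) (ab : a != b).
Local Notation I := (limit_X a b).
Local Notation k := (size comps1).
Let Z (i : 'I_k) : pset K 16 := @curve K 1 (nth [::] comps1 i).

Lemma b0' : b.[0] = 1%:~R. Proof. by rewrite b0. Qed.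
Lemma b_neq0 : b != 0.
Proof. by apply/eqP => h; move/eqP: b0; rewrite h horner0 eq_sym oner_eq0. Qed.

(** At t = 1 the conic equation is x_0 (x_1 - x_2): component 3 is the line x_0 = 0 and component 4
    the line x_1 = x_2. *)
Lemma limit_ideal1 f : limit_ideal 1 f <-> forall i : 'I_k, vanishing (Z i) f.
Proof.
have Ub l : conic_basis 1 (1%:~R : K) l = pz K 1 (nth [::] (conic_rows 1) l) := @conic_basis_pz K 1 l.
have qE : qform 1 ((1%:~R : K) - 1) = qform 1 0 by rewrite subrr.
have U0 : conic_basis 1 (1%:~R : K) i0 != 0 by apply: conic_basis_neq0; exact: oner_neq0.
have i1v : nat_of_ord i1 = 1%N by rewrite inordK.
have sum12 : pz K 1 [:: 0; 1; 1; -1; 0; 0; 0] = conic_basis 1 (1%:~R : K) i1 + conic_basis 1 (1%:~R : K) i2.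
  rewrite !Ub i1v /=; apply/rowP => j; rewrite [RHS]mxE ![pz _ _ _ _ _]mxE /wvec !rowK_nth.
  by case: j => j hj; do 16?[case: j hj => [|j] hj] => //=; ring.
split=> [[[r hr] hl]|h].
  have L v : is_line v -> vanishing (@curve K 1 (component_rows 1 v)) f.
    by move=> nv; rewrite -line_curve //; apply: rest0_vanish_line; apply: hl.
  have Q := rest_div_conic (etrans hr (congr1 (fun q => q * r) qE)).
  have L3 : vanishing (@curve K 1 (nth [::] comps1 3)) f.
    move=> x [x0 [z1 [z2 xE]]]; apply: Q; split=> //; exists 0, z1, z2.
    by rewrite !Ub i1v scale0r add0r xE; split=> //; ring.
  have L4 : vanishing (@curve K 1 (nth [::] comps1 4)) f.
    move=> x [x0 [z1 [z2 xE]]]; apply: Q; split=> //; exists z1, z2, z2.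
    split; last by ring.
    by rewrite xE /= sum12 scalerDr addrA Ub.
  case=> -[|[|[|[|[|[|[|[|[|[|[|[|//]]]]]]]]]]]] hi; [exact: (L v0 isT)|exact: (L v1 isT)|exact: (L v2 isT)
    |exact: L3|exact: L4|exact: (L v5 isT)|exact: (L v6 isT)|exact: (L v7 isT)|exact: (L v8 isT)
    |exact: (L v9 isT)|exact: (L v10 isT)|exact: (L v11 isT)].
have H i : (i < k)%N -> vanishing (@curve K 1 (nth [::] comps1 i)) f.
  by move=> hi; apply: (h (Ordinal hi)).
split.
  rewrite qE; apply: line_pair_dvd => //.
  - by apply/eqP; rewrite Ub i1v => /(pvec_eq0 (oner_neq0 K))/(_ 3 isT)/eqP; rewrite rowK_nth /= oppr_eq0 oner_eq0.
  - have := H 3 isT; rewrite !Ub i1v; exact.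
  by have := H 4 isT; rewrite -sum12 Ub; exact.
move=> v nv; apply: rest_vanish_line; last by apply: line_basis_neq0 => //; exact: oner_neq0.
rewrite line_curve //; case: v nv => // _; [exact: (H 0%N isT)|exact: (H 1%N isT)|exact: (H 2 isT)
  |exact: (H 5 isT)|exact: (H 6 isT)|exact: (H 7 isT)|exact: (H 8 isT)|exact: (H 9 isT)
  |exact: (H 10 isT)|exact: (H 11 isT)].
Qed.

Lemma family1 : exists N, (forall f, I f -> forall i : 'I_k, vanishing (Z i) f) /\
  (forall f, (forall i : 'I_k, vanishing (Z i) f) -> forall m, mdeg m = N -> I ('X_[m] * f)).
Proof.
have [N hN] := limit_ideal_lift a0 b0' (or_intror erefl); exists N.
split=> f h; last by move=> m hm; apply: hN => //; apply/limit_ideal1.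
by apply/limit_ideal1; apply: (union_limit_ideal a0 b0' ab b_neq0); apply: limit_X_union.
Qed.

Lemma lines1 (i : 'I_k) : size (nth [::] comps1 i) = 2%N.
Proof.
have /allP h : all (fun i => size (nth [::] comps1 i) == 2%N) (iota 0 k) by vm_compute.
by apply/eqP/h; rewrite mem_iota ltn_ord.
Qed.

Lemma irreducible1 (i : 'I_k) : irreducible (Z i) /\ rational_curve (Z i).
Proof.
have [u [v [f1 [f2 [Ei [_ _ [[u1 v1] [u2 v2]]]]]]]] := @curve_lineP K 1 _ _ comps1_ok i (lines1 i).
rewrite /Z [curve _ _]Ei; split; [exact: (lineset_irreducible u1 v1 u2 v2)|exact: (lineset_rational u1 v1 u2 v2)].
Qed.

(** Different components share at most one point, while a line carries the independent points u and
    v. *)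
Lemma nested1 (i i' : 'I_k) : (forall x, Z i x -> Z i' x) -> i = i'.
Proof.
move=> h; apply/eqP/negPn/negP => ni.
have [u [v [f1 [f2 [Ei [_ _ [[u1 v1] [u2 v2]]]]]]]] := @curve_lineP K 1 _ _ comps1_ok i (lines1 i).
have nz (w : 'rV[K]_16) f : (w *m f) 0 0 = 1 -> w != 0.
  by move=> e; apply/eqP => w0; move/eqP: e; rewrite w0 mul0mx mxE eq_sym oner_eq0.
have Zu : Z i u.
  by rewrite /Z [curve _ _]Ei; split; [apply: nz u1|exists 1, 0; rewrite scale1r scale0r addr0].
have Zv : Z i v.
  by rewrite /Z [curve _ _]Ei; split; [apply: nz v2|exists 0, 1; rewrite scale1r scale0r add0r].
have [hd|[P PP [_ hP]]] := @meet_components K 1 _ _ points1_ok pairs1_ok i i' ni.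
  by apply: (hd u Zu); apply: h.
have [c c0 uE] := hP u Zu (h u Zu); have [c' c'0 vE] := hP v Zv (h v Zv).
move/eqP: v1; rewrite vE -scalemxAl mxE mulf_eq0 (negPf c'0) /= => /eqP p1.
by move/eqP: u1; rewrite uE -scalemxAl mxE p1 mulr0 eq_sym oner_eq0.
Qed.

Let P0 : point := ([::], 0%N, [::]).
Let Pk (e : nat) : point := nth P0 points1 e.

Lemma Pk_mem e : (e < 18)%N -> Pk e \in points1.
Proof. by move=> he; apply: mem_nth. Qed.

Lemma comps_Pk e : (e < 18)%N ->
  comps_of (Pk e) = [:: (nth (0, 0)%N G1_edges e).1; (nth (0, 0)%N G1_edges e).2].
Proof.
move=> he; have /allP h : all (fun e => comps_of (Pk e) ==
    [:: (nth (0, 0)%N G1_edges e).1; (nth (0, 0)%N G1_edges e).2]) (iota 0 18) by vm_compute.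
by apply/eqP/h; rewrite mem_iota.
Qed.

Lemma size_Pk e : (e < 18)%N -> size (branches (Pk e)) = 2%N.
Proof. by move=> he; rewrite -(size_map comp) -/(comps_of _) comps_Pk. Qed.

(** G_1 has no multiple edges, so a node is determined by the components through it. *)
Lemma edges_distinct (e e' : nat) : (e < 18)%N -> (e' < 18)%N ->
  (forall i, (i < k)%N -> (i \in comps_of (Pk e)) = (i \in comps_of (Pk e'))) -> e = e'.
Proof.
move=> he he' h; have /allP hall : all (fun e => all (fun e' => (e == e') ||
    has (fun i => (i \in comps_of (Pk e)) != (i \in comps_of (Pk e'))) (iota 0 k))
    (iota 0 18)) (iota 0 18) by vm_compute.
have he18 : e \in iota 0 18 by rewrite mem_iota.
have he18' : e' \in iota 0 18 by rewrite mem_iota.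
have /allP hall' := hall e he18.
have /orP[/eqP -> //|/hasP[i hi]] := hall' e' he18'.
by move: hi; rewrite mem_iota => hi; rewrite h ?eqxx.
Qed.

Theorem limit1 : [/\ same_subscheme I (union_ideal (limit_X_comp a b)),
  graph_curve I, has_dual_graph I 12 G1_edges &
  ~ (forall x, zeros I x <-> P_nod (1, 1) x /\ OG x)].
Proof.
have [N [IZ ZI]] := family1.
have zE x : zeros I x <-> exists i, Z i x := zerosE comps1_ok IZ ZI x.
have nodeP P c : P \in points1 -> c != 0 -> node I (c *: pz K 1 (pt P)).
  move=> PP c0; have := axes_at points1_ok comps1_ok IZ ZI PP c0.
  by rewrite -(nth_index P0 PP) size_Pk // -[18%N]/(size points1) index_mem.
have sep i : separated (Z i) := @sepZ K 1 _ _ comps1_ok i.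
have Z0 i x : Z i x -> x != 0 := @Z_neq0 K 1 comps1 i x.
have zc i : zclosed (Z i) by apply: separated_zclosed; [apply: Z0|apply: sep].
have cover Y : irreducible Y -> (forall x, Y x -> zeros I x) -> exists i, forall x, Y x -> Z i x.
  by move=> irrY YI; apply: (irreducible_cover irrY zc Z0 sep) => x /YI/zE.
have compZ i : irreducible_component I (Z i).
  split=> [|x Zx|Y irrY ZY YI x Yx]; first by have [] := irreducible1 i.
    by apply/zE; exists i.
  have [i' hi'] := cover Y irrY YI.
  by rewrite (nested1 (fun y Zy => hi' y (ZY y Zy))); apply: hi'.
have compE Y : irreducible_component I Y -> exists i, forall x, Y x <-> Z i x.
  move=> [irrY YI maxY]; have [i hi] := cover Y irrY YI; exists i => x; split; first exact: hi.
  by apply: (maxY (Z i)) => // [|y Zy]; [have [] := irreducible1 i|apply/zE; exists i].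
split.
- exact: (limit_same a0 b0' (or_intror erefl) ab b_neq0).
- split=> [p /(classify points1_ok pairs1_ok comps1_ok IZ ZI)[|[P [c [PP c0 ->]]]]|Y /compE[i Yi]].
  + by left.
  + by right; apply: nodeP.
  have -> : Y = Z i by apply/funext => x; apply/propext.
  by have [] := irreducible1 i.
- exists Z, (fun e => pz K 1 (pt (Pk e))).
  have inc (e : 'I_18) c i : c != 0 -> Z i (c *: pz K 1 (pt (Pk e))) <-> nat_of_ord i \in comps_of (Pk e).
    by move=> c0; apply: (p_incidence 1 points1_ok (Pk_mem (ltn_ord e)) i c0).
  split=> //.
  + by split=> // i j h; apply: nested1 => x /h.
  + split=> [e|e e' [c c0 E]]; first by rewrite -[pz _ _ _]scale1r; apply: nodeP; [apply: Pk_mem|apply: oner_neq0].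
    apply: val_inj; apply: (edges_distinct (ltn_ord e) (ltn_ord e')) => i hi.
    have h1 := inc e c (Ordinal hi) c0; have h2 := inc e' 1 (Ordinal hi) (oner_neq0 _).
    rewrite scale1r E in h2; apply/idP/idP => /=.
      by move/h1/h2.
    by move/h2/h1.
  (* A node on only one component would be a smooth point in the same chart j, against
     [smooth_not_node]. So it lies on two components and is a listed point. *)
  + move=> p [pz_ [j pj iso]]; have [i Zi] := (zE p).1 pz_.
    have [[i' [Zi' ni]]|h] := pselect (exists i', Z i' p /\ i != i'); last first.
      case: (@smooth_not_node _ _ 2 _ erefl _ iso).
      apply: (line_smooth_at comps1_ok IZ ZI (lines1 i) Zi) => // i' Zi'.
      by apply/eqP/negPn/negP => ni; apply: h; exists i'; rewrite eq_sym.
    have [P [c [PP c0 pE]]] := two_components points1_ok pairs1_ok Zi Zi' ni.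
    have hP : (index P points1 < 18)%N by rewrite -[18%N]/(size points1) index_mem.
    exists (Ordinal hP); exists c^-1; first by rewrite invr_eq0.
    by rewrite pE scalerA mulVf // scale1r /Pk nth_index.
  move=> e i; rewrite -[pz _ _ _]scale1r inc ?oner_neq0 // comps_Pk // !inE.
  by split=> [/orP[]/eqP ->|[] ->]; rewrite ?eqxx ?orbT; auto.
move=> h; have x0 : pz K 1 [:: 0; 4; 1; 1; 1; 0; 0] != 0 by apply: (@pz_neq0 _ _ 3).
have [i Zi] : exists i, Z i (pz K 1 [:: 0; 4; 1; 1; 1; 0; 0]).
  by apply/zE/h; split; [exact: (nod_point x0)|exact: OG_point1].
move: Zi; apply: not_on_curve.
have /allP hall : all (fun i => freeZ 8 ([:: 0; 4; 1; 1; 1; 0; 0] :: nth [::] comps1 i)) (iota 0 k) by vm_compute.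
by apply: hall; rewrite mem_iota ltn_ord.
Qed.
End One.

Section Zero.
Variables a b : {poly K}.
Hypotheses (a0 : a.[0] = 1) (b0 : b.[0] = 0) (bn0 : b != 0).
Local Notation I := (limit_X a b).
Local Notation k := (size comps0).
Let Z (i : 'I_k) : pset K 16 := @curve K 0 (nth [::] comps0 i).

Lemma b0z : b.[0] = 0%:~R. Proof. by rewrite b0. Qed.
Lemma ab_neq : a != b.
Proof. by apply/eqP => h; move/eqP: a0; rewrite h b0 eq_sym oner_eq0. Qed.

Lemma limit_ideal0 f : limit_ideal 0 f <-> forall i : 'I_k, vanishing (Z i) f.
Proof.
have qE : qform 1 ((0%:~R : K) - 1) = qform 1 (-1) by rewrite sub0r.
have U0 : conic_basis 1 (0%:~R : K) i0 != 0 by apply: conic_basis_neq0; exact: oner_neq0.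
have n1 : -1 != 0 :> K by rewrite oppr_eq0 oner_eq0.
split=> [[[r hr] hl]|h].
  have L v : is_line v -> vanishing (@curve K 0 (component_rows 0 v)) f.
    by move=> nv; rewrite -line_curve //; apply: rest0_vanish_line; apply: hl.
  have Q := rest_div_conic (etrans hr (congr1 (fun q => q * r) qE)); rewrite conic_curve in Q.
  case=> -[|[|[|[|[|[|[|[|[|[|[|//]]]]]]]]]]] hi; [exact: (L v0 isT)|exact: (L v1 isT)|exact: (L v2 isT)
    |exact: Q|exact: (L v5 isT)|exact: (L v6 isT)|exact: (L v7 isT)|exact: (L v8 isT)
    |exact: (L v9 isT)|exact: (L v10 isT)|exact: (L v11 isT)].
have H i : (i < k)%N -> vanishing (@curve K 0 (nth [::] comps0 i)) f.
  by move=> hi; apply: (h (Ordinal hi)).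
split.
  rewrite qE; apply: conic_dvd => //; first exact: oner_neq0.
  by rewrite conic_curve; exact: (H 3 isT).
move=> v nv; apply: rest_vanish_line; last by apply: line_basis_neq0 => //; exact: oner_neq0.
rewrite line_curve //; case: v nv => // _; [exact: (H 0%N isT)|exact: (H 1%N isT)|exact: (H 2 isT)
  |exact: (H 4 isT)|exact: (H 5 isT)|exact: (H 6 isT)|exact: (H 7 isT)|exact: (H 8 isT)
  |exact: (H 9 isT)|exact: (H 10 isT)].
Qed.

Lemma family0 : exists N, (forall f, I f -> forall i : 'I_k, vanishing (Z i) f) /\
  (forall f, (forall i : 'I_k, vanishing (Z i) f) -> forall m, mdeg m = N -> I ('X_[m] * f)).
Proof.
have [N hN] := limit_ideal_lift a0 b0z (or_introl erefl); exists N.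
split=> f h; last by move=> m hm; apply: hN => //; apply/limit_ideal0.
by apply/limit_ideal0; apply: (union_limit_ideal a0 b0z ab_neq bn0); apply: limit_X_union.
Qed.

Theorem limit0 : [/\ same_subscheme I (union_ideal (limit_X_comp a b)),
  reducible (zeros I),
  forall p, zeros I p -> [\/ smooth_point I p, node I p | spatial_triple_point I p],
  (exists p, node I p) /\ (exists p, spatial_triple_point I p) &
  ~ (forall x, zeros I x <-> P_nod (1, 0) x /\ OG x)].
Proof.
have [N [IZ ZI]] := family0.
have zE x : zeros I x <-> exists i, Z i x := zerosE comps0_ok IZ ZI x.
have sep i : separated (Z i) := @sepZ K 0 _ _ comps0_ok i.
have Z0 i x : Z i x -> x != 0 := @Z_neq0 K 0 comps0 i x.
have axes_P P c : P \in points0 -> c != 0 -> axes_point (size (branches P)) I (c *: pz K 0 (pt P)).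
  by move=> PP c0; apply: (axes_at points0_ok comps0_ok IZ ZI PP c0).
have off r (P : pred nat) : r != [::] ->
    all (fun i => P i ==> freeZ 8 (r :: nth [::] comps0 i)) (iota 0 k) ->
    forall i : 'I_k, P i -> ~ Z i (pz K 0 r).
  move=> _ /allP h i Pi; apply: not_on_curve; have := h i.
  by rewrite mem_iota ltn_ord Pi => /(_ isT).
split.
- exact: (limit_same a0 b0z (or_introl erefl) ab_neq bn0).
(* The line [v0] against all other components. The witnesses are a point of [v2] off [v0] and a
   point of [v0] on no other component. *)
- exists (Z ord0), (fun x => exists2 i, i \in [seq i <- enum 'I_k | i != ord0] & Z i x); split.
  + by apply: separated_zclosed; [apply: Z0|apply: sep].
  + by apply: separated_zclosed => [x [i _]|]; [apply: Z0|apply: separated_bigU].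
  + move=> x /zE[i Zx]; have [<-|ni] := eqVneq i ord0; first by left.
    by right; exists i; rewrite // mem_filter ni mem_enum.
  + exists (pz K 0 [:: 1; 0; 0; 0; 0; 0; 0]).
      apply/zE; exists (@Ordinal k 2 isT); split; first by apply: (@pz_neq0 _ _ 0).
      by exists 0, 1; rewrite scale0r scale1r add0r.
    by apply: (@off _ (fun i => i == 0%N)) => //; vm_compute.
  exists (pz K 0 [:: 0; 0; 1; 0; 0; 0; 1]).
    apply/zE; exists (@Ordinal k 0 isT); split; first by apply: (@pz_neq0 _ _ 2).
    exists 1, 1; rewrite !scale1r; apply/rowP => j; rewrite [RHS]mxE ![pz _ _ _ _ _]mxE /wvec !rowK_nth.
    by case: j => j hj; do 16?[case: j hj => [|j] hj] => //=; ring.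
  move=> [i +]; rewrite mem_filter => /andP[ni _].
  apply: (@off _ (fun i => i != 0%N)) => //; by vm_compute.
- move=> p /(classify points0_ok pairs0_ok comps0_ok IZ ZI)[|[P [c [PP c0 ->]]]]; first by constructor 1.
  have /allP/(_ P PP) : all (fun P => (size (branches P) == 2%N) || (size (branches P) == 3%N)) points0.
    by vm_compute.
  have := axes_P P c PP c0.
  by move=> h /orP[] /eqP e; rewrite e in h; [constructor 2|constructor 3].
- split; [exists (1 *: pz K 0 [:: 0; 0; 1; 0; 0; 0; 0])|exists (1 *: pz K 0 [:: 0; 0; 0; 0; 0; 0; 1])].
    have P4 : nth ([::], 0%N, [::]) points0 4 \in points0 by apply: mem_nth.
    exact: (axes_P _ 1 P4 (oner_neq0 _)).
  have P4 : nth ([::], 0%N, [::]) points0 0 \in points0 by apply: mem_nth.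
  exact: (axes_P _ 1 P4 (oner_neq0 _)).
move=> h; have x0 : pz K 0 [:: 0; 0; 0; 1; 0; 1; 1] != 0 by apply: (@pz_neq0 _ _ 3).
have [i Zi] : exists i, Z i (pz K 0 [:: 0; 0; 0; 1; 0; 1; 1]).
  by apply/zE/h; split; [exact: (nod_point x0)|exact: OG_point0].
move: Zi; apply: (@off _ xpredT) => //; by vm_compute.
Qed.
End Zero.
End Final.

Theorem proposition5p2 (R : realType) :
  (forall a b : {poly R[i]}, a.[0] = 1 -> b.[0] = 1 -> a != b ->
    [/\ same_subscheme (limit_X a b) (union_ideal (limit_X_comp a b)),
        graph_curve (limit_X a b),
        has_dual_graph (limit_X a b) 12 G1_edges &
        ~ (forall x, zeros (limit_X a b) x <-> P_nod (1, 1) x /\ OG x)])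
  /\
  (forall a b : {poly R[i]}, a.[0] = 1 -> b.[0] = 0 -> b != 0 ->
    [/\ same_subscheme (limit_X a b) (union_ideal (limit_X_comp a b)),
        reducible (zeros (limit_X a b)),
        forall p, zeros (limit_X a b) p ->
          [\/ smooth_point (limit_X a b) p, node (limit_X a b) p |
              spatial_triple_point (limit_X a b) p],
        (exists p, node (limit_X a b) p) /\
          (exists p, spatial_triple_point (limit_X a b) p) &
        ~ (forall x, zeros (limit_X a b) x <-> P_nod (1, 0) x /\ OG x)]).
Proof. by split=> a b a0 b0 ab; [apply: limit1|apply: limit0]. Qed.
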